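(* Let $\Omega\subseteq\mathbb{R}^n$ be open. Then (i) $\iota(\mathcal D'(\Omega))\subseteq\hat{\mathcal E}_m(\Omega)$; (ii) $\sigma(C^\infty(\Omega))\subseteq\hat{\mathcal E}_m(\Omega)$; (iii) $(\iota-\sigma)(C^\infty(\Omega))\subseteq\hat{\mathcal N}(\Omega)$; (iv) $\iota(\mathcal D'(\Omega))\cap\hat{\mathcal N}(\Omega)=\{0\}$.
   Context: Notation. $I=(0,1]$. $\mathcal D(\Omega)$ and $\mathcal D'(\Omega)$ are the test functions and distributions on an open set $\Omega\subseteq\mathbb{R}^n$; $C^\infty(\Omega)\subseteq\mathcal D'(\Omega)$ via $\langle f,\varphi\rangle=\int_\Omega f\varphi$. $A\subset\subset B$ means that $A$ is compact and contained in the interior of $B$. $B_r(x)$ is the open Euclidean ball. Smoothness of maps on or into locally convex spaces is in the sense of convenient calculus (Kriegl–Michor). $f(\varepsilon)=O(g(\varepsilon))$ means: there are $\varepsilon_0>0$, $C>0$ with $|f(\varepsilon)|\le Cg(\varepsilon)$ for all $\varepsilon\le\varepsilon_0$. $\partial_{x+y}^\alpha=(\partial_x+\partial_y)^\alpha$ (expanded by the binomial theorem). Smoothing kernels. $\widetilde{\mathcal A}_q(\Omega)$ ($q\in\mathbb{N}_0$) is the set of all $\tilde\phi\in C^\infty(I\times\Omega,\mathcal D(\Omega))$, $(\varepsilon,x)\mapsto[y\mapsto\tilde\phi_{\varepsilon,x}(y)]$, such that (LSK1) $\forall K\subset\subset\Omega$ $\exists\varepsilon_0,C>0$ $\forall x\in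 K$ $\forall\varepsilon<\varepsilon_0$: $\operatorname{supp}\tilde\phi_{\varepsilon,x}\subseteq B_{C\varepsilon}(x)$; (LSK2) $\forall K\subset\subset\Omega$ $\forall\alpha,\beta\in\mathbb{N}_0^n$: $(\partial_{x+y}^\alpha\partial_y^\beta\tilde\phi)_{\varepsilon,x}(y)=O(\varepsilon^{-n-|\beta|})$ uniformly for $x\in K$, $y\in\Omega$; (LSK3) $\forall K\subset\subset\Omega$ $\forall\alpha\in\mathbb{N}_0^n$ $\forall f\in C^\infty(\Omega)$: $\int_\Omega f(y)(\partial_x^\alpha\tilde\phi)_{\varepsilon,x}(y)\,dy=(\partial^\alpha f)(x)+O(\varepsilon^{q+1})$ uniformly for $x\in K$. Basic space: $\hat{\mathcal E}(\Omega)=C^\infty(\mathcal D(\Omega)\times\Omega)$, the smooth (scalar-valued) functions $R\colon(\varphi,x)\mapsto R(\varphi,x)$. Embeddings: $\iota\colon\mathcal D'(\Omega)\to\hat{\mathcal E}(\Omega)$, $(\iota u)(\varphi,x)=\langle u,\varphi\rangle$, and $\sigma\colon C^\infty(\Omega)\to\hat{\mathcal E}(\Omega)$, $(\sigma f)(\varphi,x)=f(x)$. Moderateness: $\hat{\mathcal E}_m(\Omega)$ is the set of $R\in\hat{\mathcal E}(\Omega)$ such that $\forall K\subset\subset\Omega$ $\forall\alpha\in\mathbb{N}_0^n$ $\exists q\in\mathbb{N}_0$ $\exists N\in\mathbb{N}$ $\forall\tilde\phi\in\widetilde{\mathcal A}_q(\Omega)$: $\sup_{x\in K}|\partial_x^\alpha(R(\tilde\phi_{\varepsilon,x},x))|=O(\varepsilon^{-N})$.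 Negligibility: $\hat{\mathcal N}(\Omega)$ is the set of $R\in\hat{\mathcal E}(\Omega)$ such that $\forall K\subset\subset\Omega$ $\forall\alpha\in\mathbb{N}_0^n$ $\forall m\in\mathbb{N}$ $\exists q\in\mathbb{N}_0$ $\forall\tilde\phi\in\widetilde{\mathcal A}_q(\Omega)$: $\sup_{x\in K}|\partial_x^\alpha(R(\tilde\phi_{\varepsilon,x},x))|=O(\varepsilon^m)$. *)

(* Defs.v *)
From HB Require Import structures.
From mathcomp Require Import all_boot all_order all_algebra.
From mathcomp Require Import complex.
From mathcomp Require Import all_classical all_reals all_analysis.
Set Implicit Arguments.
Unset Strict Implicit.
Unset Printing Implicit Defensive.
Import Order.TTheory GRing.Theory Num.Theory.
Import numFieldNormedType.Exports.
Local Open Scope classical_set_scope.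
Local Open Scope ring_scope.

Variant scalar_kind := RealScalars | ComplexScalars.

Definition scal (k : scalar_kind) (R : realType) : fieldType :=
  match k with RealScalars => R | ComplexScalars => R[i] end.

Section Scalars.
Context {k : scalar_kind} {R : realType}.
Local Notation K := (scal k R).

Definition sre : K -> R :=
  match k return scal k R -> R with
  | RealScalars => fun z => z
  | ComplexScalars => fun z => complex.Re z
  end.

Definition sim : K -> R :=
  match k return scal k R -> R with
  | RealScalars => fun=> 0
  | ComplexScalars => fun z => complex.Im z
  end.

(* The imaginary part [b] is ignored when the scalars are real. *)
Definition mkscalar (a b : R) : K :=
  match k return scal k R with
  | RealScalars => a
  | ComplexScalars => Complex a b
  end.

Definition modulus (z : K) : R := Num.sqrt (sre z ^+ 2 + sim z ^+ 2).

Lemma sreD (z w : K) : sre (z + w) = sre z + sre w.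
Proof. by rewrite /sre; move: z w; case: k => // -[a b] [c d]. Qed.

Lemma simD (z w : K) : sim (z + w) = sim z + sim w.
Proof. by rewrite /sim; move: z w; case: k => /= [_ _|[a b] [c d]//]; rewrite addr0. Qed.

Lemma sreM (z w : K) : sre (z * w) = sre z * sre w - sim z * sim w.
Proof.
by rewrite /sre /sim; move: z w; case: k => /= [z w|[a b] [c d]//]; rewrite mul0r subr0.
Qed.

Lemma simM (z w : K) : sim (z * w) = sre z * sim w + sim z * sre w.
Proof.
rewrite /sre /sim; move: z w; case: k => /= [z w|[a b] [c d]//].
by rewrite mulr0 mul0r addr0.
Qed.

Lemma sre0 : sre 0 = 0. Proof. by rewrite /sre; case: k. Qed.
Lemma sim0 : sim 0 = 0. Proof. by rewrite /sim; case: k. Qed.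

Lemma mkscalarK (z : K) : mkscalar (sre z) (sim z) = z.
Proof. by rewrite /mkscalar /sre /sim; move: z; case: k => // -[]. Qed.

Lemma sre_mk a b : sre (mkscalar a b) = a.
Proof. by rewrite /mkscalar /sre; case: k. Qed.

Lemma scalar_eq (z w : K) : sre z = sre w -> sim z = sim w -> z = w.
Proof. by move=> er ei; rewrite -[z]mkscalarK -[w]mkscalarK er ei. Qed.

End Scalars.

Section Calculus.
Context {k : scalar_kind} {R : realType} {n : nat}.
Local Notation K := (scal k R).
Local Notation E := 'rV[R]_n.

Definition partial (i : 'I_n) (f : E -> K) : E -> K := fun x =>
  mkscalar ('D_(delta_mx 0 i) (sre \o f) x) ('D_(delta_mx 0 i) (sim \o f) x).

Definition partials (s : seq 'I_n) (f : E -> K) : E -> K := foldr partial f s.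

(* All iterated partial derivatives exist and are continuous on [U]; only meant
   for [U] open, so that they do not depend on the values of [f] outside [U]. *)
Definition smooth_on (U : set E) (f : E -> K) : Prop :=
  forall (s : seq 'I_n) (x : E), U x ->
    [/\ {for x, continuous (sre \o partials s f)},
        {for x, continuous (sim \o partials s f)} &
        forall i : 'I_n, derivable (sre \o partials s f) x (delta_mx 0 i) /\
                         derivable (sim \o partials s f) x (delta_mx 0 i)].

Definition supp (f : E -> K) : set E := closure [set y | f y <> 0].

Definition enorm (x : E) : R := Num.sqrt (\sum_(i < n) x 0 i ^+ 2).

Definition eball (r : R) (x : E) : set E := [set y | enorm (y - x) < r].

(* A \subset\subset B *)
Definition cpt_in (A B : set E) : Prop := compact A /\ A `<=` B°.

Definition multi_index := 'I_n -> nat.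
Definition morder (alpha : multi_index) : nat := \sum_(i < n) alpha i.

(* [mpow D alpha] is the operator D_0^(alpha 0) ... D_(n-1)^(alpha (n-1)). *)
Definition mpow (T : Type) (D : 'I_n -> T -> T) (alpha : multi_index) (f : T) : T :=
  foldr (fun i => iter (alpha i) (D i)) f (enum 'I_n).

Definition partialx (i : 'I_n) (g : E -> E -> K) : E -> E -> K :=
  fun x y => partial i (fun x' => g x' y) x.
Definition partialy (i : 'I_n) (g : E -> E -> K) : E -> E -> K :=
  fun x y => partial i (g x) y.
Definition partialxy (i : 'I_n) (g : E -> E -> K) : E -> E -> K :=
  fun x y => partialx i g x y + partialy i g x y.

End Calculus.
Arguments multi_index : clear implicits.

(* Lebesgue integral over R^n, written as an iterated one-dimensional integral;
   it is only applied to continuous functions with compact support, for which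
   the two agree by Fubini's theorem. *)
Fixpoint rintegral (R : realType) (n : nat) : ('rV[R]_n -> R) -> R :=
  match n with
  | 0 => fun f => f 0
  | m.+1 => fun f => Rintegral (@lebesgue_measure R) setT (fun t : R =>
      rintegral (fun v : 'rV[R]_m => f (row_mx (const_mx t : 'rV[R]_1) v)))
  end.

Definition integral_Rn (k : scalar_kind) (R : realType) (n : nat)
    (f : 'rV[R]_n -> scal k R) : scal k R :=
  mkscalar (rintegral (sre \o f)) (rintegral (sim \o f)).

Section TestFunctions.
Context {k : scalar_kind} {R : realType} {n : nat}.
Local Notation K := (scal k R).
Local Notation E := 'rV[R]_n.
Variable Omega : set E.

Lemma sre_partial i (f : E -> K) x :
  sre (partial i f x) = 'D_(delta_mx 0 i) (sre \o f) x.
Proof. exact: sre_mk. Qed.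

Lemma sim_partial i (f : E -> K) x :
  sim (partial i f x) = 'D_(delta_mx 0 i) (sim \o f) x.
Proof.
rewrite /partial /mkscalar /sim; case: k f => //= f.
by rewrite (_ : _ \o f = cst 0) ?derive_cst.
Qed.

Let derivable_comb (F G H : E -> R) (a b : R) x v :
  derivable F x v -> derivable G x v -> derivable H x v ->
  derivable (fun y => a * F y + b * G y + H y) x v /\
  'D_v (fun y => a * F y + b * G y + H y) x = a * 'D_v F x + b * 'D_v G x + 'D_v H x.
Proof.
move=> dF dG dH.
have iF := derivableP dF; have iG := derivableP dG; have iH := derivableP dH.
have i1 := is_deriveD (is_deriveD (is_deriveZ a iF) (is_deriveZ b iG)) iH.
by have [d1 e1] := i1; split; [exact: d1|exact: e1].
Qed.

Let continuous_comb (F G H : E -> R) (a b : R) (x : E) :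
  {for x, continuous F} -> {for x, continuous G} -> {for x, continuous H} ->
  {for x, continuous (fun y => a * F y + b * G y + H y)}.
Proof.
move=> cF cG cH.
have cc (d : R) : {for x, continuous (fun=> d : R)} by exact: cst_continuous.
have aF := continuousM (cc a) cF; have bG := continuousM (cc b) cG.
exact: (continuousD (continuousD aF bG) cH).
Qed.

Let sre_comb (a : K) (f g : E -> K) :
  sre \o (fun x => a * f x + g x) =
  fun y => sre a * (sre \o f) y + (- sim a) * (sim \o f) y + (sre \o g) y.
Proof. by apply/funext => y /=; rewrite sreD sreM mulNr. Qed.

Let sim_comb (a : K) (f g : E -> K) :
  sim \o (fun x => a * f x + g x) =
  fun y => sre a * (sim \o f) y + sim a * (sre \o f) y + (sim \o g) y.
Proof. by apply/funext => y /=; rewrite simD simM. Qed.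

Lemma partialsZD (a : K) (f g : E -> K) s :
  smooth_on setT f -> smooth_on setT g ->
  partials s (fun x => a * f x + g x) = fun x => a * partials s f x + partials s g x.
Proof.
move=> sf sg; elim: s => [//|i s IH]; rewrite [LHS]/= -/(partials s _) IH.
apply/funext => x.
have [_ _ /(_ i)[fr fi]] := sf s x I.
have [_ _ /(_ i)[gr gi]] := sg s x I.
apply: scalar_eq.
- have [_ e] := derivable_comb (sre a) (- sim a) fr fi gr.
  rewrite sre_partial sre_comb e sreD sreM mulNr.
  by rewrite !sre_partial sim_partial.
- have [_ e] := derivable_comb (sre a) (sim a) fi fr gi.
  rewrite sim_partial sim_comb e simD simM.
  by rewrite !sim_partial sre_partial.
Qed.

Lemma smooth_onZD (a : K) (f g : E -> K) :
  smooth_on setT f -> smooth_on setT g ->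
  smooth_on setT (fun x => a * f x + g x).
Proof.
move=> sf sg s x _; rewrite partialsZD//.
have [cfr cfi df] := sf s x I.
have [cgr cgi dg] := sg s x I.
rewrite sre_comb sim_comb; split.
- exact: continuous_comb.
- exact: continuous_comb.
move=> i; have [fr fi] := df i; have [gr gi] := dg i; split.
- by have [] := derivable_comb (sre a) (- sim a) fr fi gr.
- by have [] := derivable_comb (sre a) (sim a) fi fr gi.
Qed.

(* Test functions on Omega are extended by zero to the whole space. *)
Definition is_test : set (E -> (scal k R)^o) := [set f |
  [/\ smooth_on setT f, compact (supp f) & supp f `<=` Omega]].

Definition test_pred : {pred E -> (scal k R)^o} := mem is_test.

Lemma test_submod_closed : submod_closed test_pred.
Proof.
split.
- rewrite inE; have e0 : supp (0 : E -> K^o) = set0.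
    rewrite /supp (_ : [set _ | _] = set0) ?closure0//.
    by apply/seteqP; split.
  rewrite /is_test /= e0; split; [|exact: compact0|by []].
  have p0 s : partials s (0 : E -> K) = 0.
    elim: s => //= i s ->; apply/funext => x; apply: scalar_eq.
    + rewrite sre_partial (_ : _ \o _ = cst 0) ?derive_cst ?sre0//.
      by apply/funext => y /=; rewrite sre0.
    + rewrite sim_partial (_ : _ \o _ = cst 0) ?derive_cst ?sim0//.
      by apply/funext => y /=; rewrite sim0.
  move=> s x _; rewrite p0.
  have -> : sre \o (0 : E -> K) = cst 0.
    by apply/funext => y /=; rewrite sre0.
  have -> : sim \o (0 : E -> K) = cst 0.
    by apply/funext => y /=; rewrite sim0.
  split; [exact: cst_continuous|exact: cst_continuous|].
  by move=> i; split; exact: derivable_cst.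
- move=> a f g; rewrite !inE => -[sf cf fO] [sg cg gO].
  have sub : supp (a *: f + g) `<=` supp f `|` supp g.
    rewrite /supp -closureU; apply: closureS => y /= nz.
    apply: contrapT => /not_orP[/contrapT fy /contrapT gy]; apply: nz.
    by rewrite [LHS](_ : _ = a * f y + g y :> K)// fy gy mulr0 add0r.
  split.
  + exact: smooth_onZD.
  + apply: subclosed_compact sub; first exact: closed_closure.
    exact: compactU.
  + by move=> x /sub[/fO|/gO].
Qed.

HB.instance Definition _ :=
  GRing.isSubmodClosed.Build _ _ test_pred test_submod_closed.

Record testfun := TestFun {
  test_val :> E -> (scal k R)^o ;
  testP : test_val \in test_pred }.

HB.instance Definition _ := [isSub for test_val].
HB.instance Definition _ := [Choice of testfun by <:].
HB.instance Definition _ := [SubChoice_isSubLmodule of testfun by <:].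

Definition Cnorm (m : nat) (phi : testfun) : R :=
  sup [set r | exists (alpha : multi_index n) (x : E),
    (morder alpha <= m)%N /\ r = modulus (mpow partial alpha phi x)].

Definition seminorm (p : testfun -> R) : Prop :=
  [/\ forall phi, 0 <= p phi,
      forall phi psi, p (phi + psi) <= p phi + p psi &
      forall (a : K) phi, p (a *: phi) = modulus a * p phi].

(* D(Omega) carries the locally convex inductive limit topology of its subspaces
   D_L(Omega), L compact; a seminorm is continuous for it iff its restriction to
   every D_L(Omega) is. *)
Definition continuous_seminorm (p : testfun -> R) : Prop :=
  seminorm p /\
  forall L : set E, cpt_in L Omega -> exists (m : nat) (C : R),
    forall phi : testfun, supp phi `<=` L -> p phi <= C * Cnorm m phi.

Definition distributions : set (testfun -> K) := [set u |
  [/\ forall phi psi, u (phi + psi) = u phi + u psi,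
      forall (a : K) phi, u (a *: phi) = a * u phi &
      continuous_seminorm (fun phi => modulus (u phi))]].

(* [d] is the derivative of the curve [c] in D(Omega). *)
Definition test_curve_derivative (c d : R -> testfun) : Prop :=
  forall (p : testfun -> R) (t : R), continuous_seminorm p ->
    (fun h : R => p (mkscalar h^-1 0 *: (c (h + t) - c t) - d t))
      @ 0^' --> (0 : R).

Definition smooth_test_curve (c : R -> testfun) : Prop :=
  exists d : nat -> R -> testfun,
    d 0%N = c /\ forall m, test_curve_derivative (d m) (d m.+1).

End TestFunctions.
Arguments testfun k {R n} Omega.

Definition smooth_curve (R : realType) (V : normedModType R) (c : R -> V) : Prop :=
  forall (m : nat) (t : R), derivable (derive1n m c) t 1.

Section Spaces.
Context {k : scalar_kind} {R : realType} {n : nat}.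
Local Notation K := (scal k R).
Local Notation E := 'rV[R]_n.
Variable Omega : set E.
Local Notation D := (testfun k Omega).

Definition I01 : set R := [set e | 0 < e <= 1].

Definition smooth_fun : set (Omega -> K) :=
  [set f | smooth_on Omega ('valL_0 f)].

(* Smoothness of maps in the sense of convenient calculus: smooth curves are
   mapped to smooth curves.  This is also the meaning of smoothness on the
   domain I x Omega, which is not open. *)
Definition smooth_kernel (phi : I01 -> Omega -> D) : Prop :=
  forall (e : R -> I01) (c : R -> Omega),
    smooth_curve (V := R^o) (fun t => val (e t)) ->
    smooth_curve (V := E) (fun t => val (c t)) ->
    smooth_test_curve (fun t => phi (e t) (c t)).

Definition basic_space : set (D -> Omega -> K) := [set F |
  forall (c : R -> D) (x : R -> Omega),
    smooth_test_curve c -> smooth_curve (V := E) (fun t => val (x t)) ->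
    smooth_curve (V := R^o) (fun t => sre (F (c t) (x t))) /\
    smooth_curve (V := R^o) (fun t => sim (F (c t) (x t)))].

(* [F e x = O(g e)] as [e -> 0], uniformly for [x] in [X]. *)
Definition unif_bigO (T : Type) (X : set T) (F : I01 -> T -> K) (g : R -> R) : Prop :=
  exists e0 C : R, [/\ 0 < e0, 0 < C &
    forall (e : I01) (x : T), val e <= e0 -> X x ->
      modulus (F e x) <= C * g (val e)].

Definition kernel_fun (phi : I01 -> Omega -> D) (e : I01) : E -> E -> K :=
  'valL_0 (fun x : Omega => test_val (phi e x)).

Definition LSK1 (phi : I01 -> Omega -> D) : Prop :=
  forall L : set E, cpt_in L Omega -> exists e0 C : R, [/\ 0 < e0, 0 < C &
    forall (x : Omega) (e : I01), L (val x) -> val e < e0 ->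
      supp (phi e x) `<=` eball (C * val e) (val x)].

Definition LSK2 (phi : I01 -> Omega -> D) : Prop :=
  forall L : set E, cpt_in L Omega -> forall alpha beta : multi_index n,
    unif_bigO (L `*` Omega)
      (fun e z => mpow partialxy alpha
        (mpow partialy beta (kernel_fun phi e)) z.1 z.2)
      (fun e => e ^- (n + morder beta)).

Definition LSK3 (q : nat) (phi : I01 -> Omega -> D) : Prop :=
  forall L : set E, cpt_in L Omega -> forall (alpha : multi_index n) (f : Omega -> K),
    smooth_fun f ->
    unif_bigO L
      (fun e x =>
        integral_Rn (fun y => 'valL_0 f y * mpow partialx alpha (kernel_fun phi e) x y)
        - mpow partial alpha ('valL_0 f) x)
      (fun e => e ^+ q.+1).

Definition smoothing_kernels (q : nat) : set (I01 -> Omega -> D) :=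
  [set phi | [/\ smooth_kernel phi, LSK1 phi, LSK2 phi & LSK3 q phi]].

Definition iota_emb (u : D -> K) : D -> Omega -> K := fun phi _ => u phi.

Definition sigma_emb (f : Omega -> K) : D -> Omega -> K := fun _ x => f x.

Definition distr_of (f : Omega -> K) : D -> K :=
  fun phi => integral_Rn (fun y => 'valL_0 f y * phi y).

(* x |-> d_x^alpha (F(phi_{e,x}, x)) *)
Definition test_derivative (F : D -> Omega -> K) (phi : I01 -> Omega -> D)
    (alpha : multi_index n) (e : I01) : E -> K :=
  mpow partial alpha ('valL_0 (fun x : Omega => F (phi e x) x)).

Definition moderate_space : set (D -> Omega -> K) := [set F | basic_space F /\
  forall L : set E, cpt_in L Omega -> forall alpha : multi_index n,
  exists q N : nat, forall phi, smoothing_kernels q phi ->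
    unif_bigO L (test_derivative F phi alpha) (fun e => e ^- N)].

Definition negligible_space : set (D -> Omega -> K) := [set F | basic_space F /\
  forall L : set E, cpt_in L Omega -> forall (alpha : multi_index n) (m : nat),
  exists q : nat, forall phi, smoothing_kernels q phi ->
    unif_bigO L (test_derivative F phi alpha) (fun e => e ^+ m)].

End Spaces.
Arguments iota_emb {k R n Omega} u phi _.
Arguments sigma_emb {k R n Omega} f _ x.
Arguments distr_of {k R n Omega} f phi.
Arguments distributions k {R n} Omega.
Arguments smooth_fun k {R n} Omega.
Arguments moderate_space k {R n} Omega.
Arguments negligible_space k {R n} Omega.

(* Main.v *)
(** Embedded distributions are moderate because [x |-> phi_(e,x)] is, by Boman's
    theorem for maps into D(Omega), a smooth family of test functions: hence
    [d_x ^ alpha (u phi_(e,x)) = u (d_x ^ alpha phi_(e,x))], the continuity of [u]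
    bounds this by derivatives of the kernel, and [d_x = d_(x+y) - d_y] reduces
    these to (LSK2).  In the same way the derivatives of [(iota f - sigma f)] are
    exactly the quantities estimated in (LSK3), so [q = m] suffices.

    Conversely let [iota u] be negligible and [psi] a test function.  Mollifiers
    [Xi] with vanishing moments, which are tensor powers of [H (t + 1) - H t] for a
    transition function [H] improved by Richardson extrapolation, give smoothing
    kernels [cut e y * (1 + w y - w x) * e ^- n Xi ((y - x) / e)].  Taking [w = psi]
    and [w = 0] shows that [u] is [O(e)] on [psi y * e ^- n Xi ((y - x) / e)],
    uniformly in [x].  The integer translates of [Xi] form a partition of unity,
    so [psi] is [e ^ n] times a sum of [O(e ^- n)] of these functions; thus
    [u psi = O(e)], and [u psi = 0]. *)
From HB Require Import structures.
Require Import Defs.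
From mathcomp Require Import all_boot all_order all_algebra.
From mathcomp Require Import complex ring lra.
From mathcomp Require Import all_classical all_reals all_analysis.
Set Implicit Arguments.
Unset Strict Implicit.
Unset Printing Implicit Defensive.
Import Order.TTheory GRing.Theory Num.Theory.
Import numFieldNormedType.Exports.
Local Open Scope classical_set_scope.
Local Open Scope ring_scope.

(** * Smooth scalar functions *)

(** A smoothing kernel is only known to map smooth curves to smooth curves, so before any
    [d_x ^ alpha] can be handled its partial derivatives must be shown to exist as limits in
    D(Omega). This space carries no norm: the calculus is done one continuous seminorm at a time,
    and mixed derivatives are assembled from derivatives along lines. For the last statement the
    natural argument, [u psi] as the limit of the integral of [psi x * u phi_(e,x)], would exchange
    [u] with an integral of test functions; an exact finite sum over a grid uses only the linearity
    of [u]. It asks for profiles whose integer translates sum to one and whose moments vanish. Jumps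
    of transition functions provide both: their translates telescope, and correcting a moment
    replaces the transition function by another one. Negligibility can be tested on admissible
    kernels only, and multiplying a mollifier by [psi y] would violate (LSK3). The factor
    [1 + psi y - psi x] is 1 on the diagonal and preserves (LSK3); subtracting [1 - psi x] times the
    kernel for [w = 0] leaves the factor [psi y]. *)

Section ScalarFacts.
Context {k : scalar_kind} {R : realType}.
Local Notation K := (scal k R).

Definition rscal (a : R) : K := mkscalar a 0.

Lemma sre_rscal a : sre (rscal a) = a.
Proof. exact: sre_mk. Qed.

Lemma sim_rscal a : sim (rscal a) = 0.
Proof. by rewrite /rscal /mkscalar /sim; case: k. Qed.

Lemma sreN (z : K) : sre (- z) = - sre z.
Proof. by rewrite /sre; move: z; case: k => // -[]. Qed.

Lemma simN (z : K) : sim (- z) = - sim z.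
Proof. by rewrite /sim; move: z; case: k => //= [_|[]//]; rewrite oppr0. Qed.

Lemma sre1 : sre (1 : K) = 1. Proof. by rewrite /sre; case: k. Qed.
Lemma sim1 : sim (1 : K) = 0. Proof. by rewrite /sim; case: k. Qed.

Lemma rscalD a b : rscal (a + b) = rscal a + rscal b.
Proof. by apply: scalar_eq; rewrite ?sreD ?simD ?sre_rscal ?sim_rscal ?addr0. Qed.

Lemma rscalN a : rscal (- a) = - rscal a.
Proof. by apply: scalar_eq; rewrite ?sreN ?simN ?sre_rscal ?sim_rscal ?oppr0. Qed.

Lemma rscalM a b : rscal (a * b) = rscal a * rscal b.
Proof.
by apply: scalar_eq; rewrite ?sreM ?simM ?sre_rscal ?sim_rscal ?(mulr0, mul0r) ?subr0 ?addr0.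
Qed.

Lemma rscal0 : rscal 0 = 0.
Proof. by apply: scalar_eq; rewrite ?sre_rscal ?sim_rscal ?sre0 ?sim0. Qed.

Lemma rscal1 : rscal 1 = 1.
Proof. by apply: scalar_eq; rewrite ?sre_rscal ?sim_rscal ?sre1 ?sim1. Qed.

Lemma sre_sum (I : Type) (r : seq I) (F : I -> K) :
  sre (\sum_(i <- r) F i) = \sum_(i <- r) sre (F i).
Proof. by elim: r => [|i r IH]; rewrite ?big_nil ?sre0// !big_cons sreD IH. Qed.

Lemma sim_sum (I : Type) (r : seq I) (F : I -> K) :
  sim (\sum_(i <- r) F i) = \sum_(i <- r) sim (F i).
Proof. by elim: r => [|i r IH]; rewrite ?big_nil ?sim0// !big_cons simD IH. Qed.

Lemma modulus_ge0 (z : K) : 0 <= modulus z.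
Proof. exact: sqrtr_ge0. Qed.

Lemma modulus_sqr (z : K) : modulus z ^+ 2 = sre z ^+ 2 + sim z ^+ 2.
Proof. by rewrite sqr_sqrtr// addr_ge0 ?sqr_ge0. Qed.

Lemma modulusM (z w : K) : modulus (z * w) = modulus z * modulus w.
Proof.
rewrite /modulus -sqrtrM ?addr_ge0 ?sqr_ge0//; congr Num.sqrt.
by rewrite sreM simM; ring.
Qed.

Lemma modulus_rscal a : modulus (rscal a) = `|a|.
Proof. by rewrite /modulus sre_rscal sim_rscal expr0n /= addr0 sqrtr_sqr. Qed.

Lemma modulus0 : modulus (0 : K) = 0.
Proof. by rewrite -rscal0 modulus_rscal normr0. Qed.

Lemma modulus1 : modulus (1 : K) = 1.
Proof. by rewrite -rscal1 modulus_rscal normr1. Qed.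

Lemma modulusN (z : K) : modulus (- z) = modulus z.
Proof. by rewrite /modulus sreN simN !sqrrN. Qed.

(** Cauchy-Schwarz through Lagrange's identity: [sre z * sre w + sim z * sim w] is at most
    [modulus (z * w)], because the squares differ by the square of
    [sim z * sre w - sre z * sim w]. *)
Lemma modulusD (z w : K) : modulus (z + w) <= modulus z + modulus w.
Proof.
rewrite -(@ler_pXn2r _ 2)// ?nnegrE ?modulus_ge0 ?addr_ge0 ?modulus_ge0//.
rewrite sqrrD !modulus_sqr sreD simD.
suff : sre z * sre w + sim z * sim w <= modulus z * modulus w by nra.
rewrite -modulusM (le_trans (ler_norm _))//.
rewrite -sqrtr_sqr ler_sqrt ?addr_ge0 ?sqr_ge0// sreM simM.
rewrite -subr_ge0 (_ : _ - _ = (sim z * sre w - sre z * sim w) ^+ 2 +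
  (sre z * sre w - sim z * sim w + sre z * sre w + sim z * sim w) * 0
  + (sre z * sim w + sim z * sre w) ^+ 2 + (sre z * sre w - sim z * sim w) ^+ 2
  - (sre z * sre w + sim z * sim w) ^+ 2 - (sim z * sre w - sre z * sim w) ^+ 2); last by ring.
rewrite (_ : _ - _ = (sim z * sre w + sre z * sim w) ^+ 2 - (4 * sre z * sre w * sim z * sim w)); last by ring.
have : 0 <= (sim z * sre w - sre z * sim w) ^+ 2 by exact: sqr_ge0.
by nra.
Qed.

Lemma modulus_sum (I : Type) (r : seq I) (F : I -> K) :
  modulus (\sum_(i <- r) F i) <= \sum_(i <- r) modulus (F i).
Proof.
elim: r => [|i r IH]; rewrite ?big_nil ?modulus0// !big_cons.
by rewrite (le_trans (modulusD _ _))// lerD2l.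
Qed.

Lemma sre_le_modulus (z : K) : `|sre z| <= modulus z.
Proof.
by rewrite -sqrtr_sqr ler_sqrt ?addr_ge0 ?sqr_ge0// lerDl sqr_ge0.
Qed.

Lemma sim_le_modulus (z : K) : `|sim z| <= modulus z.
Proof.
by rewrite -sqrtr_sqr ler_sqrt ?addr_ge0 ?sqr_ge0// lerDr sqr_ge0.
Qed.

Lemma modulus_le (z : K) : modulus z <= `|sre z| + `|sim z|.
Proof.
rewrite -(@ler_pXn2r _ 2)// ?nnegrE ?modulus_ge0 ?addr_ge0//.
rewrite modulus_sqr sqrrD !real_normK ?num_real// -addrA lerD2l lerDr.
by rewrite pmulrn_lge0// mulr_ge0.
Qed.

Lemma modulus_eq0 (z : K) : modulus z = 0 -> z = 0.
Proof.
move=> z0; apply: scalar_eq; apply/eqP; rewrite ?sre0 ?sim0 -normr_le0 -z0.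
- exact: sre_le_modulus.
- exact: sim_le_modulus.
Qed.

End ScalarFacts.

Section SmoothClass.
Context {k : scalar_kind} {R : realType} {V : normedModType R}.
Local Notation K := (scal k R).
Implicit Types (f g : V -> K) (x v : V).

Definition kcont x f : Prop :=
  {for x, continuous (sre \o f)} /\ {for x, continuous (sim \o f)}.

Definition kderive x v f (df : K) : Prop :=
  is_derive x v (sre \o f) (sre df) /\ is_derive x v (sim \o f) (sim df).

Lemma kderive_unique x v f a b : kderive x v f a -> kderive x v f b -> a = b.
Proof.
move=> [ra ia] [rb ib]; apply: scalar_eq.
- by rewrite -(@derive_val _ _ _ _ _ _ _ ra) -(@derive_val _ _ _ _ _ _ _ rb).
- by rewrite -(@derive_val _ _ _ _ _ _ _ ia) -(@derive_val _ _ _ _ _ _ _ ib).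
Qed.

Lemma near_kderive x v f g a : (\near x, f x = g x) ->
  kderive x v f a -> kderive x v g a.
Proof.
by move=> fg [fr fi]; split; [move: fr|move: fi]; apply: near_eq_is_derive;
  apply: filterS fg => y /= ->.
Qed.

Lemma near_kcont x f g : (\near x, f x = g x) -> kcont x f -> kcont x g.
Proof.
move=> fg [fr fi]; have fgx := nbhs_singleton fg.
by split; rewrite /prop_for /continuous_at /= -fgx; [apply: cvg_trans fr|apply: cvg_trans fi];
  apply: near_eq_cvg; apply: filterS fg => y /= ->.
Qed.

Lemma kderive_cst x v (a : K) : kderive x v (fun=> a) 0.
Proof. by rewrite /kderive sre0 sim0; split; exact: is_derive_cst. Qed.

Lemma kderiveD x v f g a b : kderive x v f a -> kderive x v g b ->
  kderive x v (fun y => f y + g y) (a + b).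
Proof.
move=> [fr fi] [gr gi]; split.
- rewrite sreD (_ : _ \o _ = (sre \o f) + (sre \o g)); first exact: is_deriveD.
  by apply/funext => y /=; rewrite sreD.
- rewrite simD (_ : _ \o _ = (sim \o f) + (sim \o g)); first exact: is_deriveD.
  by apply/funext => y /=; rewrite simD.
Qed.

Lemma kderiveM x v f g a b : kderive x v f a -> kderive x v g b ->
  kderive x v (fun y => f y * g y) (a * g x + f x * b).
Proof.
move=> [fr fi] [gr gi]; split.
- rewrite (_ : _ \o _ = (sre \o f) * (sre \o g) - (sim \o f) * (sim \o g)); last first.
    by apply/funext => y /=; rewrite sreM.
  apply: is_derive_eq (is_deriveB (is_deriveM fr gr) (is_deriveM fi gi)) _.
  by rewrite sreD !sreM /= /GRing.scale /=; ring.
- rewrite (_ : _ \o _ = (sre \o f) * (sim \o g) + (sim \o f) * (sre \o g)); last first.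
    by apply/funext => y /=; rewrite simM.
  apply: is_derive_eq (is_deriveD (is_deriveM fr gi) (is_deriveM fi gr)) _.
  by rewrite simD !simM /= /GRing.scale /=; ring.
Qed.

Lemma kcont_cst x (a : K) : kcont x (fun=> a).
Proof. by split; exact: cst_continuous. Qed.

Lemma kcontD x f g : kcont x f -> kcont x g -> kcont x (fun y => f y + g y).
Proof.
move=> [fr fi] [gr gi]; split.
- rewrite (_ : _ \o _ = (sre \o f) + (sre \o g)); first exact: continuousD.
  by apply/funext => y /=; rewrite sreD.
- rewrite (_ : _ \o _ = (sim \o f) + (sim \o g)); first exact: continuousD.
  by apply/funext => y /=; rewrite simD.
Qed.

Lemma kcontM x f g : kcont x f -> kcont x g -> kcont x (fun y => f y * g y).
Proof.
move=> [fr fi] [gr gi]; split.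
- rewrite (_ : _ \o _ = (sre \o f) * (sre \o g) - (sim \o f) * (sim \o g)).
    by apply: continuousB; apply: continuousM.
  by apply/funext => y /=; rewrite sreM.
- rewrite (_ : _ \o _ = (sre \o f) * (sim \o g) + (sim \o f) * (sre \o g)).
    by apply: continuousD; apply: continuousM.
  by apply/funext => y /=; rewrite simM.
Qed.

Section Dir.
Context {I : Type}.
Variables (dir : I -> V) (U : set V).

(* Coinductive form of "all iterated derivatives along [dir] exist and are
   continuous on [U]": only the values on the open set [U] matter. *)
Definition csm f : Prop := exists C : set (V -> K), C f /\
  forall g, C g -> (forall x, U x -> kcont x g) /\
    forall i, exists g', C g' /\ forall x, U x -> kderive x (dir i) g (g' x).

Lemma csm_cont f x : csm f -> U x -> kcont x f.
Proof. by move=> [C [Cf CP]]; have [+ _] := CP _ Cf; exact. Qed.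

Lemma csm_deriv f i : csm f ->
  exists f', csm f' /\ forall x, U x -> kderive x (dir i) f (f' x).
Proof.
move=> [C [Cf CP]]; have [_ /(_ i)[f' [Cf' df]]] := CP _ Cf.
by exists f'; split => //; exists C.
Qed.

(** The algebra generated by [B] and the smooth functions, saturated under equality on [U]. By the
    Leibniz rule it is stable under derivation as soon as the derivatives of the members of [B] lie
    in it, so it can serve as the invariant class in [csm]: the members of [B] may differentiate
    into polynomials in themselves with smooth coefficients. *)
Inductive alg (B : set (V -> K)) : (V -> K) -> Prop :=
| alg_base b of B b : alg B b
| alg_csm f of csm f : alg B f
| alg_add f g of alg B f & alg B g : alg B (fun x => f x + g x)
| alg_mul f g of alg B f & alg B g : alg B (fun x => f x * g x)
| alg_eq f g of alg B f & (forall x, U x -> f x = g x) : alg B g.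

Hypothesis Uo : open U.

Lemma csm_alg (B : set (V -> K)) :
  (forall b, B b -> (forall x, U x -> kcont x b) /\
    forall i, exists b', alg B b' /\ forall x, U x -> kderive x (dir i) b (b' x)) ->
  forall f, alg B f -> csm f.
Proof.
move=> BP f Bf; exists (alg B); split => // g; elim => {g}.
- by move=> b /BP.
- move=> g sg; split=> [x Ux|i]; first exact: csm_cont sg Ux.
  by have [g' [sg' dg]] := csm_deriv i sg; exists g'; split => //; exact: alg_csm.
- move=> g h Bg [cg dg] Bh [ch dh]; split=> [x Ux|i].
    by apply: kcontD; [exact: cg|exact: ch].
  have [g' [Bg' gg]] := dg i; have [h' [Bh' hh]] := dh i.
  exists (fun x => g' x + h' x); split; first exact: alg_add.
  by move=> x Ux; apply: kderiveD; [exact: gg|exact: hh].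
- move=> g h Bg [cg dg] Bh [ch dh]; split=> [x Ux|i].
    by apply: kcontM; [exact: cg|exact: ch].
  have [g' [Bg' gg]] := dg i; have [h' [Bh' hh]] := dh i.
  exists (fun x => g' x * h x + g x * h' x); split.
    by apply: alg_add; apply: alg_mul.
  by move=> x Ux; apply: kderiveM; [exact: gg|exact: hh].
- move=> g h Bg [cg dg] gh.
  have gh' x : U x -> \near x, g x = h x.
    by move=> Ux; apply: filterS (open_nbhs_nbhs (conj Uo Ux)) => y /gh.
  split=> [x Ux|i]; first by apply: near_kcont (gh' x Ux) (cg x Ux).
  have [g' [Bg' gg]] := dg i; exists g'; split => // x Ux.
  exact: near_kderive (gh' x Ux) (gg x Ux).
Qed.

Let no_base b : (@set0 (V -> K)) b -> (forall x, U x -> kcont x b) /\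
    forall i, exists b', alg set0 b' /\ forall x, U x -> kderive x (dir i) b (b' x).
Proof. by []. Qed.

Lemma csm_cst (a : K) : csm (fun=> a).
Proof.
exists [set f | exists a : K, f = fun=> a]; split; first by exists a.
move=> _ [b ->]; split=> [x _|i]; first exact: kcont_cst.
by exists (fun=> 0); split; [exists 0|move=> x _; exact: kderive_cst].
Qed.

Lemma csmD f g : csm f -> csm g -> csm (fun x => f x + g x).
Proof. by move=> sf sg; apply: (csm_alg no_base); apply: alg_add; apply: alg_csm. Qed.

Lemma csmM f g : csm f -> csm g -> csm (fun x => f x * g x).
Proof. by move=> sf sg; apply: (csm_alg no_base); apply: alg_mul; apply: alg_csm. Qed.

Lemma csm_ext f g : csm f -> (forall x, U x -> f x = g x) -> csm g.
Proof. by move=> sf fg; apply: (csm_alg no_base); apply: alg_eq fg; apply: alg_csm. Qed.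

Lemma csmZ (a : K) f : csm f -> csm (fun x => a * f x).
Proof. exact: csmM (csm_cst a). Qed.

Lemma csmN f : csm f -> csm (fun x => - f x).
Proof. by move=> sf; apply: csm_ext (csmZ (-1) sf) _ => x _; rewrite mulN1r. Qed.

Lemma csmB f g : csm f -> csm g -> csm (fun x => f x - g x).
Proof. by move=> sf sg; apply: csmD => //; exact: csmN. Qed.

Lemma csm_sum (J : Type) (r : seq J) (F : J -> V -> K) :
  (forall j, csm (F j)) -> csm (fun x => \sum_(j <- r) F j x).
Proof.
move=> sF; elim: r => [|j r IH].
  by apply: csm_ext (csm_cst 0) _ => x _; rewrite big_nil.
by apply: csm_ext (csmD (sF j) IH) _ => x _; rewrite big_cons.
Qed.

Lemma csm_prod (J : Type) (r : seq J) (F : J -> V -> K) :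
  (forall j, csm (F j)) -> csm (fun x => \prod_(j <- r) F j x).
Proof.
move=> sF; elim: r => [|j r IH].
  by apply: csm_ext (csm_cst 1) _ => x _; rewrite big_nil.
by apply: csm_ext (csmM (sF j) IH) _ => x _; rewrite big_cons.
Qed.

End Dir.

Lemma csm_sub (I : Type) (dir : I -> V) (U W : set V) f :
  W `<=` U -> csm dir U f -> csm dir W f.
Proof.
move=> WU [C [Cf CP]]; exists C; split => // g /CP[cg dg]; split=> [x /WU/cg//|i].
by have [g' [Cg' gg]] := dg i; exists g'; split => // x /WU/gg.
Qed.

End SmoothClass.

(** * Derivatives as linear approximations, mean value estimates and the chain rule *)

Section DirectionalDerivatives.
Context {R : realType} {V : normedModType R}.

Lemma dnbhs0_ball (P : R -> Prop) : (\forall h \near 0^', P h) <->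
  exists2 d : R, 0 < d & forall h, h != 0 -> `|h| < d -> P h.
Proof.
split=> [/nbhs_ballP[d/= d0 dP]|[d d0 dP]].
  exists d => // h h0 hd; apply: dP => //.
  by rewrite -ball_normE /= sub0r normrN.
apply/nbhs_ballP; exists d => //= h; rewrite -ball_normE /= sub0r normrN => hd h0.
exact: dP.
Qed.

(** Without a quotient [h = 0] needs no exclusion, and the formula keeps its meaning when a seminorm
    replaces the absolute value, as in [pderive]. *)
Lemma is_deriveP (f : V -> R) (x v : V) (l : R) : is_derive x v f l <->
  forall e : R, 0 < e -> exists2 d : R, 0 < d & forall h : R, `|h| < d ->
    `|f (x + h *: v) - f x - h * l| <= e * `|h|.
Proof.
have key (h e : R) : h != 0 ->
    (`|l - h^-1 *: (f (h *: v + x) - f x)| <= e) = (`|f (x + h *: v) - f x - h * l| <= e * `|h|).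
  move=> h0; rewrite -(ler_pM2r (_ : 0 < `|h|)) ?normr_gt0// -normrM [h *: v + x]addrC.
  rewrite (_ : _ * h = - (f (x + h *: v) - f x - h * l)) ?normrN//.
  by rewrite /GRing.scale /=; field.
split=> [[df dl] e e0|H].
  have /cvgrPdist_le/(_ _ e0)/dnbhs0_ball[d d0 dP] := df.
  exists d => // h hd; have [->|h0] := eqVneq h 0.
    by rewrite scale0r addr0 subrr mul0r subrr normr0 mulr0.
  by have := dP h h0 hd; rewrite -[lim _]/('D_v f x) dl -key.
suff c : (fun h => h^-1 *: ((f \o shift x) (h *: v) - f x)) @ 0^' --> l.
  by apply: DeriveDef; [apply/cvg_ex; exists l|apply/cvg_lim].
apply/cvgrPdist_le => e e0; apply/dnbhs0_ball; have [d d0 dP] := H e e0.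
by exists d => // h h0 hd; rewrite /= key//; exact: dP.
Qed.

Lemma continuous_normP {W : normedModType R} (f : V -> W) (x : V) :
  {for x, continuous f} <->
  forall e : R, 0 < e -> exists2 d : R, 0 < d & forall y, `|y - x| < d -> `|f y - f x| <= e.
Proof.
split=> [/cvgrPdist_le cf e /cf/nbhs_ballP[d/= d0 dP]|H].
  exists d => // y yd; rewrite distrC; apply: dP.
  by rewrite -ball_normE /= distrC.
apply/cvgrPdist_le => e /H[d d0 dP]; apply/nbhs_ballP; exists d => // y.
by rewrite -ball_normE /= distrC => /dP; rewrite distrC.
Qed.

Lemma open_ballP (U : set V) (x : V) : open U -> U x ->
  exists2 d : R, 0 < d & forall y, `|y - x| < d -> U y.
Proof.
move=> oU Ux; have /nbhs_ballP[d/= d0 dU] := open_nbhs_nbhs (conj oU Ux).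
by exists d => // y yx; apply: dU; rewrite -ball_normE /= distrC.
Qed.

End DirectionalDerivatives.

Section MeanValue.
Context {R : realType}.

Lemma is_derive_cont (f : R -> R) (x l : R) : is_derive x 1 f l -> {for x, continuous f}.
Proof. by move=> [d _]; apply/differentiable_continuous/derivable1_diffP. Qed.

(** Assuming the bound on the whole interval of radius [|b - a|] about [a], and not only between [a]
    and [b], spares the applications a distinction of the order of [a] and [b]. *)
Lemma mean_value_le (f f' : R -> R) (a b M : R) :
  (forall t, `|t - a| <= `|b - a| -> is_derive t 1 f (f' t) /\ `|f' t| <= M) ->
  `|f b - f a| <= M * `|b - a|.
Proof.
move=> H; have mid c : c \in `[Num.min a b, Num.max a b] -> `|c - a| <= `|b - a|.
  rewrite in_itv /=; have [ab|ba] := leP a b => /andP[h1 h2].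
    by rewrite !ger0_norm ?subr_ge0// lerD2r.
  by rewrite ![`|_ - a|]distrC !ger0_norm ?subr_ge0// ?lerD2l ?lerN2 ?(ltW ba).
have [c cI e] : exists2 c, c \in `[Num.min a b, Num.max a b] &
    f (Num.max a b) - f (Num.min a b) = f' c * (Num.max a b - Num.min a b).
  apply: MVT_segment; first by have [//|/ltW] := leP a b.
    move=> x xI; suff /mid/H[] : x \in `[Num.min a b, Num.max a b] by [].
    by move: xI; rewrite !in_itv /= => /andP[/ltW -> /ltW ->].
  apply: continuous_in_subspaceT => x /set_mem xI; have [dx _] := H x (mid x xI).
  exact: is_derive_cont dx.
have -> : `|f b - f a| = `|f (Num.max a b) - f (Num.min a b)|.
  by have [//|_] := leP a b; rewrite distrC.
have -> : `|b - a| = `|Num.max a b - Num.min a b|.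
  by have [//|_] := leP a b; rewrite distrC.
by rewrite e normrM ler_wpM2r//; have [] := H c (mid c cI).
Qed.

Lemma is_derive_shift (V : normedModType R) (f : V -> R) (x v : V) (t l : R) :
  is_derive (x + t *: v) v f l -> is_derive t 1 (fun s => f (x + s *: v)) l.
Proof.
move=> /is_deriveP H; apply/is_deriveP => e /H[d d0 dP]; exists d => // h /dP.
by rewrite [h *: 1]mulr1 scalerDl addrA.
Qed.

End MeanValue.

Section ChainRule.
Context {R : realType} {n : nat}.
Local Notation E := 'rV[R]_n.

Lemma coord_le_norm (x : E) i : `|x 0 i| <= `|x|.
Proof.
rewrite [leRHS]/Num.Def.normr/= mx_normrE.
exact: (le_bigmax _ (fun ij : 'I_1 * 'I_n => `|x ij.1 ij.2|) (0, i)).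
Qed.

Lemma norm_le_coord (x : E) (M : R) : 0 <= M -> (forall i, `|x 0 i| <= M) -> `|x| <= M.
Proof.
move=> M0 xM; rewrite [leLHS]/Num.Def.normr/= mx_normrE bigmax_le// => -[i j] _ /=.
by rewrite ord1 xM.
Qed.

Lemma norm_delta_le (i : 'I_n) : `|delta_mx 0 i : E| <= 1.
Proof.
by apply: norm_le_coord => // j; rewrite mxE; case: (_ && _); rewrite ?normr1 ?normr0.
Qed.

(* Telescoping over the coordinates: the increment along each coordinate is
   controlled by the mean value theorem. *)
Lemma partials_differentiable (U : set E) (f : E -> R) (f' : 'I_n -> E -> R) (x : E) :
  open U -> U x ->
  (forall i y, U y -> is_derive y (delta_mx 0 i) f (f' i y)) ->
  (forall i, {for x, continuous (f' i)}) ->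
  forall e : R, 0 < e -> exists2 d : R, 0 < d & forall h : E, `|h| < d ->
    `|f (x + h) - f x - \sum_(i < n) f' i x * h 0 i| <= e * `|h|.
Proof.
move=> oU Ux df cf e e0.
(* Each of the [n] coordinates costs [e']; [n.+1] keeps the denominator positive when [n = 0]. *)
pose e' := e / n.+1%:R; have e'0 : 0 < e' by rewrite divr_gt0.
have [d d0 dP] : exists2 d : R, 0 < d & forall y, `|y - x| < d -> U y /\
    forall i, `|f' i y - f' i x| <= e'.
  have : \forall y \near x, U y /\ forall i, `|f' i y - f' i x| <= e'.
    apply: filterI; first exact: open_nbhs_nbhs.
    apply: (@filter_forall _ _ (fun i y => `|f' i y - f' i x| <= e') _ (nbhs_filter x)) => i; have /cvgrPdist_le/(_ _ e'0) := cf i.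
    by apply: filterS => y; rewrite distrC.
  move=> /nbhs_ballP[d/= d0 dP]; exists d => // y yx; apply: dP.
  by rewrite -ball_normE /= distrC.
exists d => // h hd.
pose z j : E := x + \row_i (if (i < j)%N then h 0 i else 0).
have z0 : z 0%N = x.
  by rewrite /z (_ : \row_i _ = 0) ?addr0//; apply/rowP => i; rewrite !mxE.
have zn : z n = x + h.
  by rewrite /z; congr (_ + _); apply/rowP => i; rewrite !mxE ltn_ord.
have zS (i : 'I_n) : z i.+1 = z i + h 0 i *: delta_mx 0 i.
  rewrite /z -addrA; congr (_ + _); apply/rowP => j; rewrite !mxE eqxx /= ltnS.
  rewrite -val_eqE /=; case: (ltngtP j i) => //= ji; rewrite ?(mulr0, mulr1, addr0, add0r)//.
  by congr (h 0 _); apply/val_inj.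
have zball (i : 'I_n) (t : R) : `|t| <= `|h 0 i| -> `|z i + t *: delta_mx 0 i - x| < d.
  move=> th; apply: le_lt_trans hd; apply: norm_le_coord => // j.
  rewrite /z !mxE eqxx /= [X in `|X|]addrC -[x 0 j + _ + _]addrA addKr.
  have [->|ji] := eqVneq j i.
    by rewrite ltnn add0r mulr1 (le_trans th)// coord_le_norm.
  by rewrite mulr0 addr0; case: ifP => _; rewrite ?normr0// coord_le_norm.
have step (i : 'I_n) : `|f (z i.+1) - f (z i) - f' i x * h 0 i| <= e' * `|h 0 i|.
  pose g t := f (z i + t *: delta_mx 0 i) - f' i x * t.
  have -> : f (z i.+1) - f (z i) - f' i x * h 0 i = g (h 0 i) - g 0.
    by rewrite /g zS scale0r addr0; ring.
  rewrite -[in `|h 0 i|](subr0 (h 0 i)).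
  apply: (@mean_value_le _ g (fun t => f' i (z i + t *: delta_mx 0 i) - f' i x)) => t.
  rewrite !subr0 => /zball/dP[Uz fz]; split; last exact: fz.
  have := is_derive_shift (df i _ Uz) => D.
  rewrite /g; apply: is_deriveB.
  apply/is_deriveP => eps eps0; exists 1 => // s _.
  rewrite [s *: 1]mulr1 mulrDr [_ * t + _]addrC addrK [s * _]mulrC subrr normr0.
  by rewrite mulr_ge0 ?(ltW eps0).
have -> : f (x + h) - f x - \sum_(i < n) f' i x * h 0 i =
    \sum_(i < n) (f (z i.+1) - f (z i) - f' i x * h 0 i).
  rewrite big_split /= sumrN; congr (_ - _).
  rewrite -(big_mkord xpredT (fun i => f (z i.+1) - f (z i))) telescope_sumr//.
  by rewrite zn z0.
apply: le_trans (ler_norm_sum _ _ _) _.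
apply: le_trans (ler_sum _ (fun i _ => step i)) _.
apply: (@le_trans _ _ (\sum_(i < n) e' * `|h|)).
  by apply: ler_sum => i _; rewrite ler_wpM2l ?(ltW e'0)// coord_le_norm.
rewrite sumr_const card_ord -[_ *+ n]mulr_natr mulrAC ler_wpM2r//.
by rewrite /e' -mulrA ler_piMr ?(ltW e0)// mulrC ler_pdivrMr// mul1r ler_nat.
Qed.

Lemma chain_rule {V : normedModType R} (U : set E) (f : E -> R) (f' : 'I_n -> E -> R)
    (c : V -> E) (c' : 'I_n -> R) (t v : V) :
  open U -> U (c t) ->
  (forall i y, U y -> is_derive y (delta_mx 0 i) f (f' i y)) ->
  (forall i, {for c t, continuous (f' i)}) ->
  (forall i, is_derive t v (fun s => c s 0 i) (c' i)) ->
  is_derive t v (f \o c) (\sum_(i < n) f' i (c t) * c' i).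
Proof.
move=> oU Ut df cf dc; apply/is_deriveP => e e0.
pose M := 1 + \sum_(i < n) `|c' i|.
have M0 : 0 < M by rewrite ltr_pwDl// sumr_ge0.
pose N := 1 + \sum_(i < n) `|f' i (c t)|.
have N0 : 0 < N by rewrite ltr_pwDl// sumr_ge0.
have e20 : 0 < e / 2 / M by rewrite !divr_gt0.
have [d d0 dP] := partials_differentiable oU Ut df cf e20.
(* The bound 1 makes [c] Lipschitz at [t] with constant [M]; the bound [e / 2 / N] absorbs the error
   of linearizing [c] under the partial derivatives of [f]. *)
have e30 : 0 < Num.min 1 (e / 2 / N) by rewrite lt_min ltr01 !divr_gt0.
have [r r0 rP] : exists2 r : R, 0 < r & forall h : R, `|h| < r -> forall i,
    `|c (t + h *: v) 0 i - c t 0 i - h * c' i| <= Num.min 1 (e / 2 / N) * `|h|.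
  have : \forall h \near (0 : R), forall i,
    `|c (t + h *: v) 0 i - c t 0 i - h * c' i| <= Num.min 1 (e / 2 / N) * `|h|.
    apply: (@filter_forall _ _ (fun i h => `|c (t + h *: v) 0 i - c t 0 i - h * c' i| <=
      Num.min 1 (e / 2 / N) * `|h|) _ (nbhs_filter (0 : R))) => i; have [r r0 rP] := (is_deriveP _ _ _ _).1 (dc i) _ e30.
    by apply/nbhs_ballP; exists r => // h; rewrite -ball_normE /= sub0r normrN => /rP.
  move=> /nbhs_ballP[r/= r0 rP]; exists r => // h hr; apply: rP.
  by rewrite -ball_normE /= sub0r normrN.
have cM (h : R) : `|h| < r -> `|c (t + h *: v) - c t| <= M * `|h|.
  move=> /rP hr; apply: norm_le_coord => [|i]; first by rewrite mulr_ge0// ltW.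
  rewrite !mxE -[X in `|X|](subrK (h * c' i)) (le_trans (ler_normD _ _))//.
  rewrite /M mulrDl lerD//.
    by rewrite (le_trans (hr i))// ler_wpM2r// ge_min lexx.
  by rewrite normrM mulrC ler_wpM2r// (bigD1 i)//= lerDl sumr_ge0.
exists (Num.min r (d / M)); first by rewrite lt_min r0 divr_gt0.
move=> h; rewrite lt_min => /andP[hr hd] /=.
have H1 : `|f (c (t + h *: v)) - f (c t) -
    \sum_(i < n) f' i (c t) * (c (t + h *: v) - c t) 0 i| <= e / 2 * `|h|.
  have := dP (c (t + h *: v) - c t); rewrite [c t + (_ - _)]addrC subrK => H.
  apply: le_trans (H _) _; first by rewrite (le_lt_trans (cM _ hr))// mulrC -ltr_pdivlMr.
  rewrite -mulrA ler_wpM2l ?divr_ge0 ?(ltW e0)//.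
  by rewrite mulrC ler_pdivrMr// mulrC cM.
rewrite (_ : f _ - f (c t) - _ = (f (c (t + h *: v)) - f (c t) -
   \sum_(i < n) f' i (c t) * (c (t + h *: v) - c t) 0 i) +
   \sum_(i < n) f' i (c t) * (c (t + h *: v) 0 i - c t 0 i - h * c' i)); last first.
  rewrite mulr_sumr -[RHS]addrA; congr (_ + _).
  rewrite -!sumrN -big_split /=; apply: eq_bigr => i _.
  by rewrite !mxE; ring.
rewrite (le_trans (ler_normD _ _))// [e in leRHS]splitr mulrDl lerD//=.
rewrite (le_trans (ler_norm_sum _ _ _))//.
apply: (@le_trans _ _ (\sum_(i < n) `|f' i (c t)| * (e / 2 / N * `|h|))).
  apply: ler_sum => i _; rewrite normrM ler_wpM2l// (le_trans (rP _ hr i))//.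
  by rewrite ler_wpM2r// ge_min lexx orbT.
rewrite -mulr_suml mulrA ler_wpM2r// mulrC mulrAC ler_pdivrMr//.
by rewrite ler_wpM2l ?divr_ge0 ?(ltW e0)// /N lerDr.
Qed.

End ChainRule.

Definition dir1 {R : realType} : unit -> R := fun=> 1.
Definition dirE {R : realType} {n : nat} : 'I_n -> 'rV[R]_n := fun i => delta_mx 0 i.
Definition rsm {R : realType} {V : normedModType R} {I : Type} (dir : I -> V)
  (U : set V) (g : V -> R) : Prop := @csm RealScalars R V I dir U g.

Section RealSmooth.
Context {R : realType} {V : normedModType R}.

Lemma kderive_real (x v : V) (g : V -> R) l :
  @kderive RealScalars R V x v g l <-> is_derive x v g l.
Proof. by split=> [[]//|gl]; split => //; exact: is_derive_cst. Qed.

Lemma kcont_real (x : V) (g : V -> R) :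
  @kcont RealScalars R V x g <-> {for x, continuous g}.
Proof. by split=> [[]//|gl]; split => //; exact: cst_continuous. Qed.

Context {k : scalar_kind} {I : Type}.
Local Notation K := (scal k R).
Variables (dir : I -> V) (U : set V).

Lemma rsm_csm (g : V -> R) : rsm dir U g -> csm dir U (@rscal k R \o g).
Proof.
move=> [C [Cg CP]]; exists [set h | exists2 g, C g & h = @rscal k R \o g].
have er (h : V -> R) : sre \o (@rscal k R \o h) = h.
  by apply/funext => y /=; rewrite sre_rscal.
have ei (h : V -> R) : sim \o (@rscal k R \o h) = cst 0.
  by apply/funext => y /=; rewrite sim_rscal.
split; first by exists g.
move=> _ [h /CP[ch dh] ->]; split=> [x /ch/kcont_real hc|i].
  by rewrite /kcont er ei; split => //; exact: cst_continuous.
have [h' [Ch' hh]] := dh i; exists (@rscal k R \o h'); split; first by exists h'.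
move=> x /hh/kderive_real hx; rewrite /kderive er ei /= sre_rscal sim_rscal.
by split => //; exact: is_derive_cst.
Qed.

Lemma csm_sre (f : V -> K) : csm dir U f -> rsm dir U (sre \o f).
Proof.
move=> [C [Cf CP]]; exists [set h | exists2 g, C g & h = sre \o g].
split; first by exists f.
move=> _ [g /CP[cg dg] ->]; split=> [x /cg[gr _]|i]; first exact/kcont_real.
have [g' [Cg' gg]] := dg i; exists (sre \o g'); split; first by exists g'.
by move=> x /gg[gr _]; exact/kderive_real.
Qed.

Lemma csm_sim (f : V -> K) : csm dir U f -> rsm dir U (sim \o f).
Proof.
move=> [C [Cf CP]]; exists [set h | exists2 g, C g & h = sim \o g].
split; first by exists f.
move=> _ [g /CP[cg dg] ->]; split=> [x /cg[_ gi]|i]; first exact/kcont_real.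
have [g' [Cg' gg]] := dg i; exists (sim \o g'); split; first by exists g'.
by move=> x /gg[_ gi]; exact/kderive_real.
Qed.

Lemma rsm_cont g x : rsm dir U g -> U x -> {for x, continuous g}.
Proof. by move=> sg /(csm_cont sg)/kcont_real. Qed.

Lemma rsm_deriv g i : rsm dir U g ->
  exists g', rsm dir U g' /\ forall x, U x -> is_derive x (dir i) g (g' x).
Proof.
by move=> /(csm_deriv i)[g' [sg' H]]; exists g'; split => // x /H/kderive_real.
Qed.

End RealSmooth.

Section Composition.
Context {k : scalar_kind} {R : realType} {V : normedModType R} {I : Type}.
Local Notation K := (scal k R).
Variables (dir : I -> V) (U : set V).
Hypothesis Uo : open U.

Lemma is_derive_line (f : V -> R) (x v : V) (l : R) :
  is_derive x v f l <-> is_derive (0 : R) 1 (fun s => f (x + s *: v)) l.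
Proof.
split=> /is_deriveP H; apply/is_deriveP => e /H[d d0 dP]; exists d => // h /dP;
by rewrite [h *: 1]mulr1 scale0r addr0 add0r.
Qed.

Lemma is_derive_comp1 (f : R -> R) (g : V -> R) (x v : V) (a b : R) :
  is_derive (g x) 1 f a -> is_derive x v g b -> is_derive x v (f \o g) (a * b).
Proof.
move=> fa /is_derive_line gb; apply/is_derive_line.
by apply: (@is_derive1_comp _ f (fun s => g (x + s *: v))) => //; rewrite scale0r addr0.
Qed.

Lemma csm_comp1 (W : set R) (rho : R -> K) (g : V -> R) :
  csm dir1 W rho -> rsm dir U g -> (forall x, U x -> W (g x)) ->
  csm dir U (rho \o g).
Proof.
move=> srho sg UW.
pose B := [set h : V -> K | exists2 rho, csm dir1 W rho & h = rho \o g].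
apply: (@csm_alg k R V I dir U Uo B); last by apply: alg_base; exists rho.
move=> {rho srho} _ [rho srho ->]; split=> [x Ux|i].
  have [cr ci] := csm_cont srho (UW x Ux); have cg := rsm_cont sg Ux.
  by split; [rewrite compA|rewrite compA]; apply: continuous_comp.
have [rho' [srho' dr]] := csm_deriv tt srho; have [g' [sg' dg]] := rsm_deriv i sg.
exists (fun x => (rho' \o g) x * (@rscal k R \o g') x); split.
  by apply: alg_mul; [apply: alg_base; exists rho'|apply: alg_csm; exact: rsm_csm].
move=> x Ux; have [rr ri] := dr _ (UW _ Ux); have dgx := dg _ Ux.
split; rewrite /= ?sreM ?simM sre_rscal sim_rscal ?(mulr0, subr0, add0r).
  exact: (is_derive_comp1 rr dgx).
exact: (is_derive_comp1 ri dgx).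
Qed.

(** The chain rule differentiates [f \o c] into products of functions of the same form with
    derivatives of the coordinates of [c]; hence these compositions generate an algebra to which
    [csm_alg] applies. *)
Lemma csm_compE (n : nat) (W : set 'rV[R]_n) (f : 'rV[R]_n -> K) (c : V -> 'rV[R]_n) :
  open W -> csm dirE W f -> (forall i, rsm dir U (fun x => c x 0 i)) ->
  (forall x, U x -> W (c x)) -> csm dir U (f \o c).
Proof.
move=> Wo sf sc UW.
have cc x : U x -> {for x, continuous c}.
  move=> Ux; apply/cvgrPdist_le => e e0.
  have : \forall y \near x, forall i, `|c x 0 i - c y 0 i| <= e.
    apply: (@filter_forall _ _ (fun i y => `|c x 0 i - c y 0 i| <= e) _ (nbhs_filter x)) => i.
    exact: (cvgrPdist_le _ _).1 (rsm_cont (sc i) Ux) e e0.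
  apply: filterS => y H; apply: norm_le_coord => [|i]; first exact: ltW.
  by rewrite !mxE.
pose B := [set h : V -> K | exists2 f, csm dirE W f & h = f \o c].
apply: (@csm_alg k R V I dir U Uo B); last by apply: alg_base; exists f.
move=> {f sf} _ [f sf ->]; split=> [x Ux|i].
  have [cr ci] := csm_cont sf (UW x Ux).
  by split; [rewrite compA|rewrite compA]; apply: continuous_comp => //; exact: cc.
have /choice[f' Hf] := fun j => csm_deriv j sf.
have /choice[c' Hc] := fun j => rsm_deriv i (sc j).
exists (fun x => \sum_(j < n) (f' j \o c) x * (@rscal k R \o c' j) x); split.
  have : forall r : seq 'I_n, alg dir U B (fun x => \sum_(j <- r) (f' j \o c) x * (@rscal k R \o c' j) x).
    elim=> [|j r IH].
      apply: alg_eq (alg_csm _ (csm_cst _ _ 0)) _ => x _; by rewrite big_nil.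
    apply: alg_eq (alg_add (alg_mul _ _) IH) _; last by move=> x _; rewrite big_cons.
      by apply: alg_base; exists (f' j) => //; have [] := Hf j.
    by apply: alg_csm; apply: rsm_csm; have [] := Hc j.
  exact.
move=> x Ux; have Wx := UW _ Ux.
have dc j : is_derive x (dir i) (fun y => c y 0 j) (c' j x) by have [_] := Hc j; exact.
split.
- have := @chain_rule R n V W (sre \o f) (fun j => sre \o f' j) c (fun j => c' j x) x (dir i) Wo Wx.
  have -> : sre (\sum_(j < n) (f' j \o c) x * (@rscal k R \o c' j) x) =
      \sum_(j < n) (sre \o f' j) (c x) * c' j x.
    by rewrite sre_sum; apply: eq_bigr => j _; rewrite /= sreM sre_rscal sim_rscal mulr0 subr0.
  apply => // j; first by move=> y Wy; have [_ /(_ y Wy)[]] := Hf j.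
  by have [sfj _] := Hf j; have [] := csm_cont sfj Wx.
- have := @chain_rule R n V W (sim \o f) (fun j => sim \o f' j) c (fun j => c' j x) x (dir i) Wo Wx.
  have -> : sim (\sum_(j < n) (f' j \o c) x * (@rscal k R \o c' j) x) =
      \sum_(j < n) (sim \o f' j) (c x) * c' j x.
    by rewrite sim_sum; apply: eq_bigr => j _; rewrite /= simM sre_rscal sim_rscal mulr0 add0r.
  apply => // j; first by move=> y Wy; have [_ /(_ y Wy)[]] := Hf j.
  by have [sfj _] := Hf j; have [] := csm_cont sfj Wx.
Qed.

End Composition.

Section SmoothOn.
Context {k : scalar_kind} {R : realType} {n : nat}.
Local Notation K := (scal k R).
Local Notation E := 'rV[R]_n.
Variable U : set E.

Lemma kderive_partial (f : E -> K) x i a : kderive x (delta_mx 0 i) f a -> partial i f x = a.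
Proof.
move=> [[_ dr] [_ di]]; apply: scalar_eq; first by rewrite sre_partial dr.
by rewrite sim_partial di.
Qed.

Lemma smooth_on_csm (f : E -> K) : smooth_on U f -> csm dirE U f.
Proof.
move=> sf; exists [set g | exists s, g = partials s f]; split; first by exists [::].
move=> _ [s ->]; split=> [x Ux|i]; first by have [] := sf s x Ux.
exists (partials (i :: s) f); split; first by exists (i :: s).
move=> x Ux; have [_ _ /(_ i)[dr di]] := sf s x Ux.
split; first by rewrite [X in is_derive _ _ _ X]sre_partial; exact: derivableP dr.
by rewrite [X in is_derive _ _ _ X]sim_partial; exact: derivableP di.
Qed.

Hypothesis Uo : open U.

Lemma partial_eq (f g : E -> K) : (forall x, U x -> f x = g x) ->
  forall i x, U x -> partial i f x = partial i g x.
Proof.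
move=> fg i x Ux; have nfg : \near x, f x = g x.
  by apply: filterS (open_nbhs_nbhs (conj Uo Ux)) => y /fg.
apply: scalar_eq; rewrite ?sre_partial ?sim_partial; apply: near_eq_derive;
  by apply: filterS nfg => y /= ->.
Qed.

Lemma csm_partial (f : E -> K) i : csm dirE U f -> csm dirE U (partial i f) /\
  forall x, U x -> kderive x (delta_mx 0 i) f (partial i f x).
Proof.
move=> /(csm_deriv i)[f' [sf' df]]; split.
  by apply: (csm_ext Uo sf') => x /df/kderive_partial.
by move=> x /df dx; rewrite (kderive_partial dx).
Qed.

Lemma csm_partials (f : E -> K) s : csm dirE U f -> csm dirE U (partials s f).
Proof. by move=> sf; elim: s => //= i s IH; have [] := csm_partial i IH. Qed.

Lemma csm_smooth_on (f : E -> K) : csm dirE U f -> smooth_on U f.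
Proof.
move=> sf s x Ux; have sg := csm_partials s sf; have [cr ci] := csm_cont sg Ux.
split; [exact: cr|exact: ci|move=> i].
by have [_ /(_ x Ux)[[dr _] [di _]]] := csm_partial i sg; split; [exact: dr|exact: di].
Qed.

End SmoothOn.

Section SmoothCurves.
Context {R : realType}.

Lemma smooth_curve_rsm (c : R -> R) :
  smooth_curve (V := R^o) c -> rsm dir1 setT c.
Proof.
move=> sc; exists [set g | exists m, g = derive1n (V := R^o) m c]; split; first by exists 0%N.
move=> _ [m ->]; have dm (t : R) : @is_derive R R R t 1 (derive1n (V := R^o) m c) (derive1n (V := R^o) m.+1 c t).
  by rewrite derive1nS derive1E; apply: derivableP; exact: sc.
split=> [x _|i]; first by apply/kcont_real; exact: is_derive_cont (dm x).
by exists (derive1n (V := R^o) m.+1 c); split; [exists m.+1|move=> x _; exact/kderive_real].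
Qed.

Lemma rsm_smooth_curve (c : R -> R) :
  rsm dir1 setT c -> smooth_curve (V := R^o) c.
Proof.
move=> sc m; have : rsm dir1 setT (derive1n (V := R^o) m c).
  elim: m => //= m IH; have [g' [sg' dg]] := rsm_deriv tt IH.
  apply: (csm_ext openT sg') => x _ /=.
  have [_ dx] := dg x I; move: dx; rewrite -derive1E => <-; by [].
by move=> /(rsm_deriv tt)[g' [_ dg]] t; have [] := dg t I.
Qed.

Context {n : nat}.
Local Notation E := 'rV[R]_n.

Lemma derive1n_coord (c : R -> E) : smooth_curve c ->
  forall m t i, derive1n m c t 0 i = derive1n m (fun s => c s 0 i) t.
Proof.
move=> sc; elim=> // m IH t i; rewrite !derive1nS !derive1E derive_mx ?mxE; last exact: sc.
by congr ('D_1 _ t); apply/funext => s; rewrite IH.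
Qed.

Lemma smooth_curve_coord (c : R -> E) : smooth_curve c <->
  forall i, rsm dir1 setT (fun t => c t 0 i).
Proof.
split=> [sc i|sc].
  apply: smooth_curve_rsm => m t.
  rewrite (_ : derive1n m _ = fun t => derive1n m c t 0 i); last first.
    by apply/funext => s; rewrite derive1n_coord.
  exact: (derivable_mxP _ _ _).1 (sc m t) 0 i.
have sc' i := rsm_smooth_curve (sc i).
suff H m : (forall t, derivable (derive1n m c) t 1) /\
    forall t i, derive1n m c t 0 i = derive1n m (fun s => c s 0 i) t.
  by move=> m; have [] := H m.
elim: m => [|m [dm IH]].
  by split=> // t; apply/derivable_mxP => i j; rewrite ord1; exact: sc' j 0%N t.
have e t i : derive1n m.+1 c t 0 i = derive1n m.+1 (fun s => c s 0 i) t.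
  rewrite !derive1nS !derive1E derive_mx ?mxE; last exact: dm.
  by congr ('D_1 _ t); apply/funext => s; rewrite IH.
split; last exact: e.
move=> t; apply/derivable_mxP => i j; rewrite ord1.
rewrite (_ : (fun x => _) = derive1n m.+1 (fun s => c s 0 j)); first exact: sc' j m.+1 t.
by apply/funext => s; rewrite e.
Qed.

End SmoothCurves.

Section RealSmoothAlgebra.
Context {R : realType} {V : normedModType R} {I : Type}.
Variables (dir : I -> V) (U : set V).
Hypothesis Uo : open U.
Implicit Types f g : V -> R.

Lemma rsm_cst (a : R) : rsm dir U (fun=> a).
Proof. exact: (@csm_cst RealScalars). Qed.

Lemma rsmD f g : rsm dir U f -> rsm dir U g -> rsm dir U (fun x => f x + g x).
Proof. exact: (@csmD RealScalars). Qed.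

Lemma rsmM f g : rsm dir U f -> rsm dir U g -> rsm dir U (fun x => f x * g x).
Proof. exact: (@csmM RealScalars). Qed.

Lemma rsmB f g : rsm dir U f -> rsm dir U g -> rsm dir U (fun x => f x - g x).
Proof. exact: (@csmB RealScalars). Qed.

Lemma rsm_ext f g : rsm dir U f -> (forall x, U x -> f x = g x) -> rsm dir U g.
Proof. exact: (@csm_ext RealScalars). Qed.

Lemma rsm_sum (J : Type) (r : seq J) (F : J -> V -> R) :
  (forall j, rsm dir U (F j)) -> rsm dir U (fun x => \sum_(j <- r) F j x).
Proof. exact: (@csm_sum RealScalars). Qed.

Lemma rsm_prod (J : Type) (r : seq J) (F : J -> V -> R) :
  (forall j, rsm dir U (F j)) -> rsm dir U (fun x => \prod_(j <- r) F j x).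
Proof. exact: (@csm_prod RealScalars). Qed.

Lemma rsmX f m : rsm dir U f -> rsm dir U (fun x => f x ^+ m).
Proof.
move=> sf; elim: m => [|m IH]; first by apply: rsm_ext (rsm_cst 1) _ => x _; rewrite expr0.
by apply: rsm_ext (rsmM sf IH) _ => x _; rewrite exprS.
Qed.

Lemma rsm_comp1 (W : set R) (rho : R -> R) g :
  rsm dir1 W rho -> rsm dir U g -> (forall x, U x -> W (g x)) -> rsm dir U (rho \o g).
Proof. exact: (@csm_comp1 RealScalars). Qed.

Lemma rsm_alg (B : set (V -> R)) :
  (forall b, B b -> (forall x, U x -> {for x, continuous b}) /\
    forall i, exists b', @alg RealScalars R V I dir U B b' /\
      forall x, U x -> is_derive x (dir i) b (b' x)) ->
  forall f, B f -> rsm dir U f.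
Proof.
move=> BP f Bf; apply: (@csm_alg RealScalars R V I dir U Uo B); last exact: alg_base.
move=> b /BP[cb db]; split=> [x /cb/kcont_real//|i].
by have [b' [Bb' dbb]] := db i; exists b'; split => // x /dbb/kderive_real.
Qed.

Lemma rsm_affine g (a : I -> R) : (forall x, U x -> {for x, continuous g}) ->
  (forall x i, U x -> is_derive x (dir i) g (a i)) -> rsm dir U g.
Proof.
move=> cg dg; exists [set h | h = g \/ rsm dir U h]; split; first by left.
move=> h [->|sh]; last first.
  split=> [x Ux|i]; first exact: csm_cont sh Ux.
  by have [g' [sg' H]] := csm_deriv i sh; exists g'; split => //; right.
split=> [x Ux|i]; first by apply/kcont_real; exact: cg.
exists (fun=> a i); split; first by right; exact: rsm_cst.
by move=> x Ux; apply/kderive_real; exact: dg.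
Qed.

End RealSmoothAlgebra.

(** * Flat functions, smooth steps and bumps on the line *)

Section Bumps.
Context {R : realType}.

Lemma rsm_id (W : set R) : rsm dir1 W id.
Proof.
apply: (@rsm_affine R R unit dir1 W id (fun=> 1)); first by move=> x _; exact: cvg_id.
Qed.

Lemma is_derive_inv (x : R) : x != 0 -> is_derive x 1 (fun y => y^-1) (- (x^-1 * x^-1)).
Proof.
move=> x0; have := @is_deriveV R id x 1 1 x0 (is_derive_id _ _).
by move/is_derive_eq; apply; rewrite /= /GRing.scale /= mulr1 expr2 invfM.
Qed.

Lemma rsm_inv : rsm dir1 [set x : R | 0 < x] (fun x => x^-1).
Proof.
have o : open [set x : R | 0 < x] by exact: open_gt.
apply: (@rsm_alg R R unit dir1 _ o [set f | f = fun x => x^-1]) => //.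
move=> _ ->; split=> [x /= x0|i].
  by apply: is_derive_cont; apply: is_derive_inv; rewrite gt_eqF.
exists (fun x => (-1) * (x^-1 * x^-1)); split.
  apply: (@alg_mul RealScalars R); first by apply: alg_csm; exact: rsm_cst.
  by apply: (@alg_mul RealScalars R); exact: alg_base.
by move=> x /= x0; rewrite mulN1r; apply: is_derive_inv; rewrite gt_eqF.
Qed.

(** The functions [t ^- m * exp (- 1 / t)], extended by zero. The derivative of one is a linear
    combination of two others, so all of them are smooth at once as the base of a generated
    algebra. *)
Definition flat (m : nat) (t : R) : R := if 0 < t then t^-1 ^+ m * expR (- t^-1) else 0.

Lemma flat_ge0 m t : 0 <= flat m t.
Proof.
by rewrite /flat; case: ifP => // t0; rewrite mulr_ge0 ?expR_ge0// exprn_ge0// invr_ge0 ltW.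
Qed.

Lemma flat_eq0 m t : t <= 0 -> flat m t = 0.
Proof. by rewrite /flat ltNge => ->. Qed.

(** The exponential series gives [v ^ (m + 2) <= (m + 2)! * expR v] at [v = 1 / t]. The bound is
    quadratic in order to make the derivative at 0 vanish. *)
Lemma flat_small m t : flat m t <= (m.+2)`!%:R * t ^+ 2.
Proof.
rewrite /flat; case: ifP => t0; last by rewrite mulr_ge0 ?sqr_ge0.
have v0 : 0 < t^-1 by rewrite invr_gt0.
have := expR_ge1Dxn m.+1 (ltW v0); set v := t^-1 in v0 *; set e := expR v => ev.
have e0 : 0 < e by exact: expR_gt0.
rewrite expRN -/e ler_pdivrMr//.
have -> : t = v^-1 by rewrite invrK.
have : v ^+ m.+2 / m.+2`!%:R <= e by rewrite (le_trans _ ev)// lerDr.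
rewrite ler_pdivrMr ?ltr0n ?fact_gt0// => H.
rewrite -mulrA mulrCA [v^-1 ^+ 2]exprVn [leRHS]mulrC ler_pdivlMr ?exprn_gt0//.
by rewrite -exprD addn2 [leRHS]mulrC.
Qed.

Lemma is_derive_flat m (t : R) : is_derive t 1 (flat m) (flat m.+2 t - m%:R * flat m.+1 t).
Proof.
have [t0|t0|<-] := ltgtP 0 t; last first.
- rewrite !flat_eq0// mulr0 subr0; apply/is_deriveP => e e0.
  pose C : R := m.+2`!%:R; have C0 : 0 < C by rewrite ltr0n fact_gt0.
  exists (e / C); first by rewrite divr_gt0.
  move=> h hd; rewrite add0r [h *: 1]mulr1 mulr0 (@flat_eq0 m 0)// !subr0 ger0_norm ?flat_ge0//.
  rewrite (le_trans (flat_small _ _))// -/C -(real_normK (num_real h)) expr2 mulrA ler_wpM2r//.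
  by rewrite mulrC -ler_pdivlMr// ltW.
- apply: near_eq_is_derive (_ : is_derive t 1 (cst 0) _).
    have : \forall y \near t, y < 0 by exact: (open_nbhs_nbhs (conj (@open_lt R 0) t0)).
    by apply: filterS => y y0; rewrite flat_eq0// ltW.
  by rewrite !flat_eq0 ?(ltW t0)// mulr0 subr0; exact: is_derive_cst.
- have t0' : t != 0 by rewrite gt_eqF.
  apply: near_eq_is_derive (_ : is_derive t 1 ((fun y => (y^-1) ^+ m) * (expR \o (fun y => - y^-1))) _).
    have : \forall y \near t, 0 < y by exact: (open_nbhs_nbhs (conj (@open_gt R 0) t0)).
    by apply: filterS => y y0 /=; rewrite /flat y0.
  have d1 := is_derive_inv t0'.
  have d2 : is_derive t 1 (fun y : R => y^-1 ^+ m) (m%:R * t^-1 ^+ m.-1 * (- (t^-1 * t^-1))).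
    have dx : is_derive (t^-1) 1 (fun y : R => y ^+ m) (m%:R * t^-1 ^+ m.-1).
      have -> : (fun y : R => y ^+ m) = (id : R -> R) ^+ m.
        by apply/funext => y; elim: (m) => // j IH; rewrite !exprS IH.
      apply: is_derive_eq (is_deriveX m (is_derive_id _ _)) _.
      by rewrite /GRing.scale /= mulr1.
    exact: (is_derive_comp1 dx d1).
  have d3 : is_derive t 1 (expR \o (fun y => - y^-1)) (expR (- t^-1) * (t^-1 * t^-1)).
    have dN : is_derive t 1 (fun y : R => - y^-1) (t^-1 * t^-1).
      by apply: is_derive_eq (is_deriveN d1) _; rewrite opprK.
    exact: (is_derive_comp1 (is_derive_expR _) dN).
  apply: is_derive_eq (is_deriveM d2 d3) _.
  rewrite /flat t0 /GRing.scale /= !exprS; case: m {d2} => [|m]; first by rewrite !mul0r mulr0 expr0; ring.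
  by rewrite /= !exprS; ring.
Qed.

Lemma rsm_flat m (U : set R) : open U -> rsm dir1 U (flat m).
Proof.
move=> Uo; apply: (@rsm_alg R R unit dir1 U Uo [set f | exists m, f = flat m]); last by exists m.
move=> _ [j ->]; split=> [x _|i]; first by apply: is_derive_cont; exact: is_derive_flat.
exists (fun x => flat j.+2 x + (- j%:R) * flat j.+1 x); split.
  apply: (@alg_add RealScalars R); first by apply: alg_base; exists j.+2.
  apply: (@alg_mul RealScalars R); last by apply: alg_base; exists j.+1.
  by apply: alg_csm; exact: rsm_cst.
by move=> x _; rewrite mulNr; exact: is_derive_flat.
Qed.

Definition step (t : R) : R := flat 0 t * (flat 0 t + flat 0 (1 - t))^-1.

Lemma flat_gt0 t : 0 < t -> 0 < flat 0 t.
Proof. by rewrite /flat => ->; rewrite mulr_gt0 ?expR_gt0// expr0. Qed.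

Lemma step_den t : 0 < flat 0 t + flat 0 (1 - t).
Proof.
have [t0|t0] := leP t 0; last by rewrite ltr_pwDl ?flat_gt0 ?flat_ge0.
by rewrite ltr_wpDl ?flat_ge0 ?flat_gt0// subr_gt0 (le_lt_trans t0).
Qed.

Lemma step0 t : t <= 0 -> step t = 0.
Proof. by move=> t0; rewrite /step flat_eq0// mul0r. Qed.

Lemma step1 t : 1 <= t -> step t = 1.
Proof.
move=> t1; have := step_den t; rewrite /step (@flat_eq0 _ (1 - t)) ?subr_le0// addr0 => d0.
by rewrite mulfV// gt_eqF.
Qed.

Lemma rsm_onem (a : R) : rsm dir1 setT (fun t : R => a - t).
Proof. exact (rsmB openT (rsm_cst dir1 setT a) (rsm_id setT)). Qed.

Lemma rsm_addl (a : R) : rsm dir1 setT (fun t : R => a + t).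
Proof. exact (rsmD openT (rsm_cst dir1 setT a) (rsm_id setT)). Qed.

Lemma rsm_step : rsm dir1 setT step.
Proof.
have s0 := rsm_flat 0 (@openT R).
have s1 := rsm_comp1 openT s0 (rsm_onem 1) (fun _ _ => I).
exact (rsmM openT s0 (rsm_comp1 openT rsm_inv (rsmD openT s0 s1) (fun t _ => step_den t))).
Qed.

Definition bump (t : R) : R := step (2 + t) * step (2 - t).

Lemma bump1 t : `|t| <= 1 -> bump t = 1.
Proof. by rewrite ler_norml => /andP[h1 h2]; rewrite /bump !step1 ?mulr1//; lra. Qed.

Lemma bump0 t : 2 <= `|t| -> bump t = 0.
Proof.
rewrite ler_normr => /orP[h|h]; rewrite /bump.
  by rewrite [step (2 - t)]step0 ?mulr0//; lra.
by rewrite step0 ?mul0r//; lra.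
Qed.

Lemma rsm_bump : rsm dir1 setT bump.
Proof.
exact (rsmM openT (rsm_comp1 openT rsm_step (rsm_addl 2) (fun _ _ => I))
                  (rsm_comp1 openT rsm_step (rsm_onem 2) (fun _ _ => I))).
Qed.

End Bumps.

(** * Curves in real modules with seminorms *)

Section SeminormCalculus.
Context {R : realType} {V : lmodType R}.

Definition rseminorm (p : V -> R) : Prop :=
  [/\ forall x, 0 <= p x, forall x y, p (x + y) <= p x + p y &
      forall (a : R) x, p (a *: x) = `|a| * p x].

(** The derivative of a curve as seen by one seminorm: [l] is determined only up to the kernel of
    [p], and becomes unique once a separating family of seminorms is used. *)
Definition pderive (p : V -> R) (c : R -> V) (t : R) (l : V) : Prop :=
  forall e : R, 0 < e -> exists2 d : R, 0 < d &
    forall h : R, `|h| < d -> p (c (t + h) - c t - h *: l) <= e * `|h|.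

Definition pcont {W : normedModType R} (p : V -> R) (f : W -> V) (x : W) : Prop :=
  forall e : R, 0 < e -> exists2 d : R, 0 < d &
    forall y, `|y - x| < d -> p (f y - f x) <= e.

Section OneSeminorm.
Variable p : V -> R.
Hypothesis sp : rseminorm p.

Lemma rsem_ge0 x : 0 <= p x. Proof. by case: sp. Qed.
Lemma rsemD x y : p (x + y) <= p x + p y. Proof. by case: sp. Qed.
Lemma rsemZ a x : p (a *: x) = `|a| * p x. Proof. by case: sp. Qed.
Lemma rsem0 : p 0 = 0. Proof. by rewrite -(scale0r 0) rsemZ normr0 mul0r. Qed.
Lemma rsemN x : p (- x) = p x. Proof. by rewrite -scaleN1r rsemZ normrN1 mul1r. Qed.
Lemma rsemB x y : p (x - y) <= p x + p y.
Proof. by rewrite (le_trans (rsemD _ _))// rsemN. Qed.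
Lemma rsem_sym x y : p (x - y) = p (y - x). Proof. by rewrite -rsemN opprB. Qed.
Lemma rsem_tri y x z : p (x - z) <= p (x - y) + p (y - z).
Proof. by rewrite (le_trans _ (rsemD _ _))// addrA subrK. Qed.

Lemma pderiveD c1 c2 t l1 l2 : pderive p c1 t l1 -> pderive p c2 t l2 ->
  pderive p (fun s => c1 s + c2 s) t (l1 + l2).
Proof.
move=> H1 H2 e e0; have e20 : 0 < e / 2 by rewrite divr_gt0.
have [d1 d10 P1] := H1 _ e20; have [d2 d20 P2] := H2 _ e20.
exists (Num.min d1 d2); first by rewrite lt_min d10.
move=> h; rewrite lt_min => /andP[/P1 h1 /P2 h2].
rewrite (_ : _ - _ - _ = (c1 (t + h) - c1 t - h *: l1) + (c2 (t + h) - c2 t - h *: l2)).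
  by rewrite (le_trans (rsemD _ _))// (splitr e) mulrDl lerD.
by rewrite scalerDr !opprD [RHS]addrACA; congr (_ + _); rewrite addrACA.
Qed.

Lemma pderiveZ (a : R) c t l : pderive p c t l -> pderive p (fun s => a *: c s) t (a *: l).
Proof.
move=> H e e0; have a0 : 0 < `|a| + 1 by rewrite ltr_wpDl.
have [d d0 P1] := H (e / (`|a| + 1)) (divr_gt0 e0 a0); exists d => // h /P1 hd.
rewrite (_ : _ - _ = a *: (c (t + h) - c t - h *: l)); last first.
  by rewrite !scalerBr !scalerA [a * h]mulrC.
rewrite rsemZ (le_trans (ler_wpM2l (normr_ge0 a) hd))// mulrA ler_wpM2r//.
by rewrite mulrC -mulrA ler_piMr ?(ltW e0)// mulrC ler_pdivrMr// mul1r lerDl.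
Qed.

Lemma pderiveN c t l : pderive p c t l -> pderive p (fun s => - c s) t (- l).
Proof.
move=> /(pderiveZ (-1)) H; rewrite -scaleN1r.
by rewrite (_ : (fun s => _) = fun s => -1 *: c s)//; apply/funext => s; rewrite scaleN1r.
Qed.

Lemma pderiveB c1 c2 t l1 l2 : pderive p c1 t l1 -> pderive p c2 t l2 ->
  pderive p (fun s => c1 s - c2 s) t (l1 - l2).
Proof. by move=> H1 /pderiveN; exact: pderiveD. Qed.

Lemma pderive_affine (c : R -> V) (nu t0 t : R) l : pderive p c (t0 + nu * t) l ->
  pderive p (fun s => c (t0 + nu * s)) t (nu *: l).
Proof.
move=> H e e0; have a0 : 0 < `|nu| + 1 by rewrite ltr_wpDl.
have [d d0 P1] := H (e / (`|nu| + 1)) (divr_gt0 e0 a0).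
exists (d / (`|nu| + 1)); first exact: divr_gt0.
move=> h; rewrite ltr_pdivlMr// => hd.
have nh : `|nu * h| < d.
  by rewrite normrM (le_lt_trans _ hd)// mulrC ler_wpM2l// lerDl.
have := P1 _ nh; rewrite mulrDr addrA scalerA [h * nu]mulrC => /le_trans; apply.
rewrite normrM mulrA ler_wpM2r// -mulrA ler_piMr ?(ltW e0)//.
by rewrite mulrC ler_pdivrMr// mul1r lerDl.
Qed.

Lemma pderive_shift (c : R -> V) (s t : R) l : pderive p c (t + s) l ->
  pderive p (fun r => c (r + s)) t l.
Proof.
by move=> H e /H[d d0 P1]; exists d => // h /P1; rewrite [t + s + h]addrAC.
Qed.

Lemma pderive_lin (z : V) (t : R) : pderive p (fun s => s *: z) t z.
Proof.
move=> e e0; exists 1 => // h _; rewrite scalerDl [t *: z + _]addrC addrK subrr rsem0.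
by rewrite mulr_ge0 ?(ltW e0).
Qed.

Lemma pderive_near (c1 c2 : R -> V) (t r : R) l : 0 < r ->
  (forall h, `|h| < r -> c1 (t + h) = c2 (t + h)) -> pderive p c1 t l -> pderive p c2 t l.
Proof.
move=> r0 c12 H e /H[d d0 P1]; exists (Num.min d r); first by rewrite lt_min d0.
move=> h; rewrite lt_min => /andP[/P1 hd hr]; rewrite -c12//.
by have := c12 0; rewrite normr0 addr0 => <-.
Qed.

Lemma pderive_uniq c t l1 l2 : pderive p c t l1 -> pderive p c t l2 -> p (l1 - l2) = 0.
Proof.
move=> H1 H2; apply/eqP; rewrite eq_le rsem_ge0 andbT; apply/ler_addgt0Pr => e e0; rewrite add0r.
have e20 : 0 < e / 2 by rewrite divr_gt0.
have [d1 d10 P1] := H1 _ e20; have [d2 d20 P2] := H2 _ e20.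
pose h := Num.min d1 d2 / 2; have m0 : 0 < Num.min d1 d2 by rewrite lt_min d10.
have h0 : 0 < h by rewrite divr_gt0.
have : `|h| < Num.min d1 d2 by rewrite gtr0_norm// /h ltr_pdivrMr// ltr_pMr// ltr1n.
rewrite lt_min => /andP[/P1 h1 /P2 h2].
have : p (h *: (l1 - l2)) <= e * `|h|.
  rewrite (_ : h *: _ = (c (t + h) - c t - h *: l2) - (c (t + h) - c t - h *: l1)).
    by rewrite (le_trans (rsemB _ _))// (splitr e) mulrDl lerD.
  by rewrite opprB [RHS]addrC subrKA scalerBr.
by rewrite rsemZ mulrC ler_pM2r ?normr_gt0 ?gt_eqF.
Qed.

Lemma pderive_pcont c t l : pderive p c t l -> pcont p c t.
Proof.
move=> H e e0; have [d d0 P1] := H 1 ltr01.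
have M0 : 0 < 1 + p l by rewrite ltr_pwDl// rsem_ge0.
exists (Num.min d (e / (1 + p l))); first by rewrite lt_min d0 divr_gt0.
move=> s; rewrite lt_min => /andP[/P1]; rewrite [t + _]addrC subrK => h1 h2.
rewrite -(subrK ((s - t) *: l) (c s - c t)) (le_trans (rsemD _ _))//.
rewrite rsemZ (le_trans (lerD h1 (lexx _)))// mul1r -[X in X + _]mulr1 -mulrDr.
by rewrite -ler_pdivlMr// ltW.
Qed.

(* The increments are followed up to the supremum of the set of times at which
   the estimate holds, since [p] cannot be differentiated along the curve. *)
Lemma seminorm_mean_value (c c' : R -> V) (a b M : R) :
  (forall t, `|t - a| <= `|b - a| -> pderive p c t (c' t) /\ p (c' t) <= M) ->
  p (c b - c a) <= M * `|b - a|.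
Proof.
have key (a1 b1 : R) : a1 <= b1 ->
  (forall t, a1 <= t <= b1 -> pderive p c t (c' t) /\ p (c' t) <= M) ->
  p (c b1 - c a1) <= M * (b1 - a1).
  move=> ab H; apply/ler_addgt0Pr => eta0 eta00.
  pose eta := eta0 / (b1 - a1 + 1).
  have ba1 : 0 < b1 - a1 + 1 by rewrite ltr_wpDl// subr_ge0.
  have eta_gt0 : 0 < eta by rewrite divr_gt0.
  have near_est t : a1 <= t <= b1 -> exists2 d, 0 < d &
      forall s, `|s - t| < d -> p (c s - c t) <= (M + eta) * `|s - t|.
    move=> /H[dt Mt]; have [d d0 P1] := dt _ eta_gt0; exists d => // s /P1.
    rewrite [t + _]addrC subrK => h1.
    rewrite -(subrK ((s - t) *: c' t) (c s - c t)) (le_trans (rsemD _ _))//.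
    by rewrite mulrDl addrC lerD// rsemZ mulrC ler_wpM2r.
  pose A := [set t | a1 <= t <= b1 /\ p (c t - c a1) <= (M + eta) * (t - a1)].
  have Aa : A a1 by rewrite /A /= lexx ab; split => //; rewrite !subrr rsem0 mulr0.
  have hsA : has_sup A by split; [exists a1|exists b1 => t [/andP[]]].
  pose tau := sup A.
  have a_tau : a1 <= tau by apply: ub_le_sup => //; case: hsA.
  have tau_b : tau <= b1 by apply: ge_sup; [exists a1|move=> t [/andP[]]].
  have [d d0 P1] := near_est tau (introT andP (conj a_tau tau_b)).
  have Atau : A tau.
    split; first by rewrite a_tau.
    have [t At tt] := sup_adherent d0 hsA; have [_ pt] := At.
    have tle : t <= tau by apply: ub_le_sup => //; case: hsA.
    rewrite (le_trans (rsem_tri (c t) _ _))// -(subrKA t tau) mulrDr lerD//.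
    rewrite rsem_sym -[tau - t]ger0_norm ?subr_ge0// distrC P1//.
    by rewrite distrC ger0_norm ?subr_ge0// ltrBlDr -ltrBlDl.
  have tau_eq : tau = b1.
    apply/eqP; rewrite eq_le tau_b /= leNgt; apply/negP => lt_tb.
    pose t := Num.min b1 (tau + d / 2).
    have tt : tau < t by rewrite lt_min lt_tb ltrDl divr_gt0.
    suff At : A t by have := ub_le_sup (proj2 hsA) At; rewrite leNgt tt.
    have tb : t <= b1 by rewrite ge_min lexx.
    split; first by rewrite (le_trans a_tau (ltW tt)) tb.
    have [_ ptau] := Atau.
    rewrite (le_trans (rsem_tri (c tau) _ _))// -(subrKA tau t) mulrDr lerD//.
    rewrite -[t - tau]ger0_norm ?subr_ge0 ?(ltW tt)// P1//.
    rewrite ger0_norm ?subr_ge0 ?(ltW tt)// ltrBlDl (le_lt_trans (_ : t <= tau + d / 2))//.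
      by rewrite ge_min lexx orbT.
    by rewrite ltrD2l ltr_pdivrMr// ltr_pMr// ltr1n.
  have [_] := Atau; rewrite tau_eq mulrDl => /le_trans; apply.
  by rewrite lerD2l /eta mulrAC ler_pdivrMr// ler_wpM2l ?(ltW eta00)// lerDl.
move=> H; have [ab|/ltW ba] := leP a b.
  rewrite ger0_norm ?subr_ge0//; apply: key => // t /andP[t1 t2]; apply: H.
  by rewrite !ger0_norm ?subr_ge0// lerD2r.
rewrite rsem_sym distrC ger0_norm ?subr_ge0//; apply: key => // t /andP[t1 t2]; apply: H.
by rewrite distrC [`|b - a|]distrC !ger0_norm ?subr_ge0// lerD2l lerN2.
Qed.

Definition delta {W : zmodType} (w : W) (f : W -> V) : W -> V := fun x => f (x + w) - f x.

Lemma pderive_delta_iter (m : nat) (s : R) (c : R -> V) (c' : R -> V) (t : R) :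
  (forall j, (j <= m)%N -> pderive p c (t + s *+ j) (c' (t + s *+ j))) ->
  pderive p (iter m (delta s) c) t (iter m (delta s) c' t).
Proof.
elim: m t => [|m IH] t H; first by have := H 0%N isT; rewrite mulr0n addr0.
apply: pderiveB.
  apply: pderive_shift; apply: IH => j jm; have := H j.+1 jm.
  by rewrite mulrS addrA.
by apply: IH => j jm; apply: H; exact: leqW.
Qed.

(** Here [d] lists a curve and its successive derivatives. In the induction, the difference of order
    [m + 1] is the increment over [s] of the difference of order [m], whose derivative is the same
    difference of [d j.+1]. The mean value estimate is applied after subtracting the linear curve
    [r *: (s ^+ m *: z)], and each order adds one [B]. *)
Lemma iter_delta_approx (d : nat -> R -> V) (m j : nat) (s t B : R) :
  (forall i r, `|r - t| <= `|s| *+ m -> pderive p (d i) r (d i.+1 r)) ->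
  (forall r, `|r - t| <= `|s| *+ m -> p (d (j + m).+1 r) <= B) ->
  p (iter m (delta s) (d j) t - s ^+ m *: d (j + m)%N t) <= B *+ m * `|s| ^+ m.+1.
Proof.
elim: m j t => [|m IH] j t dd dB.
  by rewrite expr0 scale1r addn0 subrr rsem0 mulr0n mul0r.
rewrite /= /delta; set A := iter m (delta s) (d j).
pose z := d (j + m.+1)%N t.
have near_t r i : (i <= m)%N -> `|r - t| <= `|s| -> forall q, `|q - r| <= `|s| *+ i -> `|q - t| <= `|s| *+ m.+1.
  move=> im rt q qr; rewrite -(subrKA r q) (le_trans (ler_normD _ _))// mulrS addrC lerD//.
  by rewrite (le_trans qr)// ler_wpMn2l.
have B0 : 0 <= B.
  by apply: le_trans (dB t _); [exact: rsem_ge0|rewrite subrr normr0 mulrn_wge0].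
have -> : A (t + s) - A t - s ^+ m.+1 *: z =
    A (t + s) - (t + s) *: (s ^+ m *: z) - (A t - t *: (s ^+ m *: z)).
  by rewrite scalerDl [t *: _ + _]addrC opprD addrA opprB subrKA addrAC scalerA -exprS.
have ts : t + s - t = s by rewrite addrC addKr.
rewrite exprSr mulrA -[in X in _ * X]ts.
apply: (@seminorm_mean_value (fun r => A r - r *: (s ^+ m *: z))
  (fun r => iter m (delta s) (d j.+1) r - s ^+ m *: z)) => r; rewrite ts => rt.
split.
  apply: pderiveB; last exact: pderive_lin.
  apply: pderive_delta_iter => i im; apply: dd; apply: (near_t r i im rt).
  by rewrite [r + _]addrC addrK -normrMn.
rewrite (le_trans (rsem_tri (s ^+ m *: d (j.+1 + m)%N r) _ _))//.
have H1 : p (iter m (delta s) (d j.+1) r - s ^+ m *: d (j.+1 + m)%N r) <= B *+ m * `|s| ^+ m.+1.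
  apply: IH => [i q qr|q qr]; first by apply: dd; exact: (near_t r m).
  by have := dB q (near_t r m (leqnn _) rt q qr); rewrite addnS addSn.
(* The base point of the derivative has moved from [t] to [r]; the bound on the next derivative pays
   for it. *)
have H2 : p (s ^+ m *: d (j.+1 + m)%N r - s ^+ m *: z) <= B * `|s| ^+ m.+1.
  rewrite -scalerBr rsemZ normrX exprSr mulrCA ler_wpM2l ?exprn_ge0//.
  rewrite /z addnS addSn.
  apply: (le_trans (@seminorm_mean_value (d (j + m).+1) (d (j + m).+2) t r B _)) => [q qt|].
    have qt' : `|q - t| <= `|s| *+ m.+1.
      by rewrite (le_trans (le_trans qt rt))// -[leLHS]mulr1n ler_wpMn2l.
    by split; [exact: dd|have := dB q qt'; rewrite addnS].
  by rewrite ler_wpM2l.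
by rewrite (le_trans (lerD H1 H2))// -mulrDl mulrSr.
Qed.

End OneSeminorm.
End SeminormCalculus.

Lemma compact_continuous_bounded {R : realType} {T : topologicalType} (f : T -> R) (A : set T) :
  compact A -> (forall x, A x -> {for x, continuous f}) ->
  exists2 B : R, 0 <= B & forall x, A x -> `|f x| <= B.
Proof.
move=> cA cf; have [->|A0] := eqVneq A set0; first by exists 0.
have cn : {within A, continuous (fun x => `|f x|)}.
  apply: continuous_in_subspaceT => x /set_mem Ax.
  exact: (continuous_comp (cf x Ax) (@norm_continuous _ _ _)).
have [c _ H] := @compact_EVT_max _ _ _ A ((set0P _).1 A0) cA cn.
by exists `|f c| => // x Ax; apply: H; rewrite inE.
Qed.

Lemma is_derive_affine {R : realType} (a b x : R) : is_derive x 1 (fun t : R => a * t + b) a.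
Proof.
apply/is_deriveP => e e0; exists 1 => // h _; rewrite mulrDr [h *: 1]mulr1.
rewrite (_ : _ - _ - _ = 0) ?normr0 ?mulr_ge0 ?(ltW e0)//; ring.
Qed.

(** * Gluing pieces at dyadic times into one smooth function *)

Section Gluing.
Context {R : realType}.
Implicit Types (a : nat -> R) (b : R -> R).

(** It says that [2 ^+ k * t] lies strictly between 2/3 and 4/3. These intervals are disjoint for
    different [k], since 4/3 is twice 2/3. *)
Definition dyad (k : nat) (t : R) : Prop := `|2 ^+ k * t - 1| < 3^-1.

Lemma dyad_uniq j k t : dyad j t -> dyad k t -> j = k.
Proof.
wlog jk : j k / (j < k)%N.
  by move=> W dj dk; case: (ltngtP j k) => // jk; [exact: W|apply/esym; exact: W].
rewrite /dyad !ltr_norml => /andP[h1 h2] /andP[h3 h4]; exfalso.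
have : 2 * (2 ^+ j * t) <= 2 ^+ k * t.
  have t0 : 0 < t.
    have : 0 < 2 ^+ j * t by lra.
    by rewrite pmulr_rgt0// exprn_gt0.
  by rewrite mulrA -exprS ler_pM2r// ler_eXn2l// ltr1n.
by set u := 2 ^+ j * t in h1 h2 *; set w := 2 ^+ k * t in h3 h4 *; lra.
Qed.

Definition glue a b (t : R) : R :=
  if pselect (exists k, dyad k t) is left h
  then a (projT1 (cid h)) * b (2 ^+ projT1 (cid h) * t) else 0.

Lemma glueE a b k t : dyad k t -> glue a b t = a k * b (2 ^+ k * t).
Proof.
move=> dk; rewrite /glue; case: pselect => [h|]; last by case; exists k.
by rewrite (dyad_uniq (projT2 (cid h)) dk).
Qed.

Lemma glue0 a b t : (forall k, ~ dyad k t) -> glue a b t = 0.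
Proof. by move=> nd; rewrite /glue; case: pselect => // h; exfalso; case: h => k /nd. Qed.

Definition rapid a : Prop := forall m : nat, exists C, forall k, `|a k| * 2 ^+ (k * m) <= C.
Definition around1 b : Prop := forall s, 4^-1 < `|s - 1| -> b s = 0.

Lemma rapid_shift a : rapid a -> rapid (fun k => 2 ^+ k * a k).
Proof.
move=> ra m; have [C HC] := ra m.+1; exists C => k; rewrite normrM normrX ger0_norm//.
by rewrite mulrAC mulrC -exprD -mulnS.
Qed.

Lemma around1_bounded b : rsm dir1 setT b -> around1 b -> exists2 B : R, 0 <= B & forall s, `|b s| <= B.
Proof.
move=> sb zb.
have [B B0 HB] := @compact_continuous_bounded R R b `[0, 2] (@segment_compact _ _ _)
  (fun x _ => rsm_cont sb I).
exists B => // s; have [s1|s1] := ltP 4^-1 `|s - 1|; first by rewrite zb// normr0.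
by apply: HB; move: s1; rewrite /= in_itv /= ler_norml => /andP[s1 s2]; apply/andP; split; lra.
Qed.

Lemma is_derive_glue a b b' (t : R) : rapid a -> rsm dir1 setT b -> around1 b ->
  (forall s : R, is_derive s 1 b (b' s)) ->
  is_derive t 1 (glue a b) (glue (fun k => 2 ^+ k * a k) b' t).
Proof.
move=> ra sb zb db; have [[k dk]|nd] := pselect (exists k, dyad k t).
  rewrite (glueE _ _ dk).
  have dk' : \near t, a k * b (2 ^+ k * t) = glue a b t.
    have [d d0 dP] : exists2 d : R, 0 < d & forall h, `|h - t| < d -> dyad k h.
      have e0 : 0 < (3^-1 - `|2 ^+ k * t - 1|) / 2 by rewrite divr_gt0// subr_gt0.
      have [d d0 dP] := (continuous_normP _ _).1 (is_derive_cont (is_derive_affine (2 ^+ k) (-1) t)) _ e0.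
      exists d => // h /dP; move: dk; rewrite /dyad => dk H.
      have := ler_normD (2 ^+ k * h - 1 - (2 ^+ k * t - 1)) (2 ^+ k * t - 1).
      rewrite subrK => /le_lt_trans; apply; lra.
    apply/nbhs_ballP; exists d => // h; rewrite -ball_normE /= distrC => /dP dh.
    by rewrite (glueE _ _ dh).
  apply: near_eq_is_derive dk' _.
  have dl : is_derive t 1 (fun t : R => 2 ^+ k * t) (2 ^+ k).
    rewrite (_ : (fun t => _) = fun t => 2 ^+ k * t + 0); first exact: is_derive_affine.
    by apply/funext => s; rewrite addr0.
  have dc := is_derive_comp1 (db _) dl.
  by apply: is_derive_eq (is_deriveZ (a k) dc) _; rewrite /GRing.scale /=; ring.
have {}nd k : ~ dyad k t by move=> dk; apply: nd; exists k.
rewrite (glue0 _ _ nd).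
have [->|t0] := eqVneq t 0.
  have [B B0 HB] := around1_bounded sb zb; have [C HC] := ra 2%N.
  have C0 : 0 <= C by rewrite (le_trans _ (HC 0%N))// mulr_ge0.
  have g0 : glue a b 0 = 0.
    by apply: glue0 => k; rewrite /dyad mulr0 sub0r normrN normr1 ltNge invf_le1 ?ler1n.
  (* On [dyad k] one has [1 <= 3 * (2 ^+ k * h) ^+ 2], so the decay of [a k] like [4 ^ - k] becomes
     a quadratic bound in [h], and the derivative at 0 is 0. *)
  have small h : `|glue a b h| <= (3 * C * B) * `|h| ^+ 2.
    have [[k dk]|n] := pselect (exists k, dyad k h); last first.
      rewrite glue0 ?normr0; last by move=> k dk; apply: n; exists k.
      by rewrite !mulr_ge0.
    rewrite (glueE _ _ dk) normrM mulrAC ler_pM//.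
    have := HC k; move: dk; rewrite /dyad ltr_norml => /andP[h1 h2] H.
    rewrite real_normK ?num_real//.
    have u1 : 2 / 3 < 2 ^+ k * h by lra.
    have : 1 <= 3 * (2 ^+ k * h) ^+ 2 by nra.
    rewrite exprMn -!exprM => v1.
    rewrite (le_trans (_ : _ <= `|a k| * (3 * (2 ^+ (k * 2) * h ^+ 2))))//.
      by rewrite ler_peMr.
    rewrite (_ : _ * (3 * _) = 3 * (`|a k| * 2 ^+ (k * 2)) * h ^+ 2); last by ring.
    by rewrite ler_wpM2r ?sqr_ge0// ler_wpM2l.
  apply/is_deriveP => e e0; pose D := 3 * C * B + 1.
  have D0 : 0 < D by rewrite ltr_wpDl// !mulr_ge0.
  exists (e / D); first exact: divr_gt0.
  move=> h hd; rewrite g0 add0r mulr0 !subr0 [h *: 1]mulr1 (le_trans (small h))//.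
  rewrite expr2 mulrA ler_wpM2r//.
  rewrite (le_trans (_ : _ <= D * `|h|))//; first by rewrite ler_wpM2r// lerDl.
  by rewrite mulrC -ler_pdivlMr// ltW.
have dc : is_derive t 1 (cst 0 : R -> R) 0 by exact: is_derive_cst.
apply: near_eq_is_derive dc.
(* A nearby [h] may enter some [dyad k] although [t] lies in none. As [b] vanishes already at
   distance 1/4 from 1, while [dyad] reaches to 1/3, the value at [h] is still 0 when [h] is within
   [|t| / 100] of [t]. *)
have t100 : 0 < `|t| / 100 by rewrite divr_gt0 ?normr_gt0.
apply/nbhs_ballP; exists (`|t| / 100) => // h; rewrite -ball_normE /= => ht.
have [[k dk]|n] := pselect (exists k, dyad k h); last first.
  by rewrite glue0// => k dk; apply: n; exists k.
rewrite (glueE _ _ dk) zb ?mulr0// ltNge; apply/negP => hk; apply: (nd k).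
have p0 : 0 < 2 ^+ k :> R by rewrite exprn_gt0.
have h1 : `|2 ^+ k * t - 2 ^+ k * h| < 2 ^+ k * `|t| / 100.
  by rewrite -mulrBr normrM (gtr0_norm p0) -mulrA ltr_pM2l.
have h2 : 2 ^+ k * `|t| = `|2 ^+ k * t| by rewrite normrM (gtr0_norm p0).
move: h1 hk; rewrite h2 /dyad; set u := 2 ^+ k * t; set w := 2 ^+ k * h.
move=> h1 hk; have h3 : `|u| <= `|u - w| + `|w - 1| + 1.
  by rewrite -{1}(subrK w u) (le_trans (ler_normD _ _))// -addrA lerD2l
    -{1}(subrK 1 w) (le_trans (ler_normD _ _))// normr1.
have h4 : `|u - 1| <= `|u - w| + `|w - 1| by rewrite -(subrKA w u) ler_normD.
by rewrite (le_lt_trans h4)//; lra.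
Qed.

(** Glued functions form a class stable under derivation: the amplitudes become [2 ^+ k * a k],
    which still decrease rapidly, and [b] becomes its derivative. *)
Lemma rsm_glue a b : rapid a -> rsm dir1 setT b -> around1 b -> rsm dir1 setT (glue a b).
Proof.
move=> ra sb zb.
exists [set g | exists a b, [/\ rapid a, rsm dir1 setT b, around1 b & g = glue a b]].
split; first by exists a, b.
move=> _ {ra sb zb} [{}a [{}b [ra sb zb ->]]].
have [b' [sb' db]] := rsm_deriv tt sb.
have db' (s : R) : is_derive s 1 b (b' s) by exact: db.
have dg t := is_derive_glue t ra sb zb db'.
split=> [t _|[]]; first by apply/kcont_real; exact: is_derive_cont (dg t).
exists (glue (fun k => 2 ^+ k * a k) b'); split; last by move=> t _; exact/kderive_real.
exists (fun k => 2 ^+ k * a k), b'; split => //; first exact: rapid_shift.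
move=> s s1; have [_ <-] := db' s.
have -> : 'D_1 b s = 'D_1 (cst 0) s.
  apply: near_eq_derive; apply/nbhs_ballP; exists (`|s - 1| - 4^-1); first by rewrite /= subr_gt0.
  move=> y; rewrite -ball_normE /= => ys; rewrite zb//.
  by have := ler_normD (s - y) (y - 1); rewrite subrKA; lra.
exact: derive_cst.
Qed.

Lemma rapid_quadratic : rapid (fun k => 2^-1 ^+ (k * k)).
Proof.
move=> m; exists (2 ^+ (m * m)) => k.
rewrite ger0_norm ?exprn_ge0// exprVn mulrC ler_pdivrMr ?exprn_gt0// -exprD.
rewrite ler_eXn2l ?ltr1n//; have [km|mk] := leqP k m.
  by rewrite (leq_trans _ (leq_addr _ _))// leq_mul2r km orbT.
by rewrite (leq_trans _ (leq_addl _ _))// leq_mul2l (ltnW mk) orbT.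
Qed.

Lemma rapid_le a a' : rapid a -> (forall k, `|a' k| <= `|a k|) -> rapid a'.
Proof.
move=> ra H m; have [C HC] := ra m; exists C => k.
by rewrite (le_trans _ (HC k))// ler_wpM2r// exprn_ge0.
Qed.

End Gluing.

Section CurveLemma.
Context {R : realType} {n : nat}.
Local Notation E := 'rV[R]_n.

(* The special curve lemma of convenient calculus. *)
Lemma curve_through (x v : E) (r : R) : 0 < r -> exists2 mu : nat -> R,
  (forall k, 0 < mu k) & forall xs : nat -> E, (forall k, `|xs k - x| <= mu k) ->
  exists c : R -> E, [/\ smooth_curve c, forall t, `|c t - x| < r, c 0 = x &
    forall k h, `|h| <= 2^-1 ^+ k / 8 -> c (2^-1 ^+ k + h) = xs k + (mu k * 2 ^+ k * h) *: v].
Proof.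
move=> r0.
(* [b0] is 1 within 1/8 of 1 and 0 beyond 1/4; it puts the curve at [xs k]. [b1] agrees with [s - 1]
   near 1 and contributes the velocity [mu k * 2 ^+ k] along [v]. *)
pose b0 (s : R) := bump (8 * (s - 1)); pose b1 (s : R) := (s - 1) * b0 s.
have sl : rsm dir1 setT (fun s : R => s - 1).
  exact (rsmB openT (rsm_id setT) (rsm_cst dir1 setT 1)).
have sb0 : rsm dir1 setT b0.
  exact (rsm_comp1 openT rsm_bump (rsmM openT (rsm_cst dir1 setT 8) sl) (fun _ _ => I)).
have sb1 : rsm dir1 setT b1 by exact (rsmM openT sl sb0).
have z0 : around1 b0.
  by move=> s s1; apply: bump0; rewrite normrM ger0_norm//; lra.
have z1 : around1 b1 by move=> s /z0 e; rewrite /b1 e mulr0.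
have [B0 B00 HB0] := around1_bounded sb0 z0; have [B1 B10 HB1] := around1_bounded sb1 z1.
pose D := B0 + B1 * `|v| + 1.
have D0 : 0 < D by rewrite ltr_wpDl// addr_ge0// mulr_ge0.
(* The first factor keeps the curve in the ball of radius [r], the second decreases faster than any
   power of [2 ^ - k]. Neither depends on [xs], so the points can be chosen afterwards, violating
   some estimate at a rate expressed by [mu]. *)
pose mu k := Num.min 1 (r / D) * 2^-1 ^+ (k * k).
have l0 : 0 < Num.min 1 (r / D) by rewrite lt_min ltr01 divr_gt0.
have mu0 k : 0 < mu k by rewrite mulr_gt0// exprn_gt0.
exists mu => // xs xsx.
have rmu : rapid mu.
  apply: rapid_le rapid_quadratic _ => k; rewrite /mu normrM ler_piMl//.
  by rewrite gtr0_norm// ge_min lexx.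
have rxs i : rapid (fun k => (xs k - x) 0 i).
  by apply: rapid_le rmu _ => k; rewrite (le_trans (coord_le_norm _ _))// (le_trans (xsx k))// ler_norm.
pose c (t : R) : E := \row_i (x 0 i + (glue (fun k => (xs k - x) 0 i) b0 t + v 0 i * glue mu b1 t)).
have cd k t : dyad k t -> c t = x + (b0 (2 ^+ k * t) *: (xs k - x) + (mu k * b1 (2 ^+ k * t)) *: v).
  by move=> dk; apply/rowP => i; rewrite !mxE !(glueE _ _ dk) !mxE; congr (_ + _); congr (_ + _); rewrite mulrC.
have cn t : (forall k, ~ dyad k t) -> c t = x.
  by move=> nd; apply/rowP => i; rewrite !mxE !(glue0 _ _ nd) mulr0 !addr0.
exists c; split.
- apply/smooth_curve_coord => i.
  have e : (fun t => c t 0 i) = fun t => x 0 i + (glue (fun k => (xs k - x) 0 i) b0 t + v 0 i * glue mu b1 t).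
    by apply/funext => t; rewrite mxE.
  rewrite e.
  exact (rsmD openT (rsm_cst dir1 setT _) (rsmD openT (rsm_glue (rxs i) sb0 z0)
    (rsmM openT (rsm_cst dir1 setT _) (rsm_glue rmu sb1 z1)))).
- move=> t; have [[k dk]|nd] := pselect (exists k, dyad k t); last first.
    by rewrite cn ?subrr ?normr0// => k dk; apply: nd; exists k.
  rewrite (cd _ _ dk) addrC addKr.
  rewrite (le_lt_trans (ler_normD _ _))//.
  rewrite [`|b0 _ *: _|]normrZ [`|(mu k * _) *: _|]normrZ (normrM (mu k)) (gtr0_norm (mu0 k)).
  apply: (@le_lt_trans _ _ (mu k * (B0 + B1 * `|v|))).
    rewrite mulrDr lerD//; first by rewrite mulrC ler_pM// HB0.
    by rewrite -mulrA ler_wpM2l ?(ltW (mu0 k))// ler_wpM2r// HB1.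
  apply: (@le_lt_trans _ _ (r / D * (B0 + B1 * `|v|))).
    rewrite ler_wpM2r ?addr_ge0 ?mulr_ge0//.
    rewrite /mu (le_trans (_ : _ <= Num.min 1 (r / D)))//.
      by rewrite ler_piMr ?(ltW l0)// exprn_ile1// invf_le1 ?ler1n.
    by rewrite ge_min lexx orbT.
  by rewrite mulrAC ltr_pdivrMr// ltr_pM2l// ltrDl.
- apply: cn => k; rewrite /dyad mulr0 sub0r normrN normr1 ltNge invf_le1 ?ler1n//.
- move=> k h hk.
  have e : 2 ^+ k * (2^-1 ^+ k + h) - 1 = 2 ^+ k * h.
    by rewrite mulrDr exprVn mulfV ?expf_neq0// addrC addKr.
  have e8 : `|2 ^+ k * h| <= 8^-1.
    rewrite normrM ger0_norm ?exprn_ge0// mulrC -ler_pdivlMr ?exprn_gt0//.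
    by rewrite mulrC -exprVn.
  have dk : dyad k (2^-1 ^+ k + h) by rewrite /dyad e; lra.
  have be : b0 (2 ^+ k * (2^-1 ^+ k + h)) = 1.
    by rewrite /b0 e bump1// normrM ger0_norm//; lra.
  by rewrite (cd _ _ dk) /b1 be e scale1r mulr1 mulrA addrA [x + _]addrC subrK.
Qed.

End CurveLemma.

(** * Pure derivatives of a map that is smooth along smooth curves *)

Section Boman.
Context {R : realType} {V : lmodType R} {n : nat}.
Local Notation E := 'rV[R]_n.
Variables (PP : set (V -> R)) (U : set E) (f : E -> V).
Hypothesis PPs : forall p, PP p -> rseminorm p.
Hypothesis PPsep : forall z, (forall p, PP p -> p z = 0) -> z = 0.
Hypothesis Uo : open U.

Definition tower (c : R -> V) (d : nat -> R -> V) : Prop :=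
  d 0%N = c /\ forall m t p, PP p -> pderive p (d m) t (d m.+1 t).

Hypothesis f_smooth : forall c : R -> E, smooth_curve c -> (forall t, U (c t)) ->
  exists d, tower (f \o c) d.

Lemma vec_uniq (z w : V) : (forall p, PP p -> p (z - w) = 0) -> z = w.
Proof. by move=> H; apply/eqP; rewrite -subr_eq0; apply/eqP/PPsep. Qed.

(** Derivatives depend on the germ of the curve only, and are unique because the seminorms in [PP]
    separate points; an affine change of time contributes the power of [nu]. *)
Lemma tower_germ c1 c2 d1 d2 (t1 t2 nu r : R) : 0 < r -> tower c1 d1 -> tower c2 d2 ->
  (forall h, `|h| < r -> c2 (t2 + h) = c1 (t1 + nu * h)) ->
  forall m h, `|h| < r -> d2 m (t2 + h) = nu ^+ m *: d1 m (t1 + nu * h).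
Proof.
move=> r0 [<- D1] [<- D2] c12; elim=> [|m IH] h hr.
  by rewrite expr0 scale1r c12.
apply: vec_uniq => p Pp; have sp := PPs Pp.
apply: (pderive_uniq sp (D2 m (t2 + h) p Pp)).
have rh : 0 < r - `|h| by rewrite subr_gt0.
have H : pderive p (fun s => nu ^+ m *: d1 m (t1 - nu * t2 + nu * s)) (t2 + h)
    (nu ^+ m *: (nu *: d1 m.+1 (t1 + nu * h))).
  apply: pderiveZ => //; apply: pderive_affine => //.
  have -> : t1 - nu * t2 + nu * (t2 + h) = t1 + nu * h by ring.
  exact: D1.
rewrite exprSr -scalerA; apply: pderive_near rh _ H => s sr.
rewrite -[t2 + h + s]addrA IH; last by rewrite (le_lt_trans (ler_normD _ _))// -ltrBrDl.
by congr (_ *: d1 m _); ring.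
Qed.

(** A segment has to be continued to a curve defined for all times with values in [U], since
    [f_smooth] speaks about such curves only. The special curve lemma with the constant sequence [x]
    does this: its curve is affine near time 1 with velocity [mu 0 *: v], which a change of time
    normalizes. *)
Lemma line_curve x v : U x -> exists r : R, 0 < r /\ exists c : R -> E,
  [/\ smooth_curve c, forall t, U (c t) & forall h, `|h| < r -> c h = x + h *: v].
Proof.
move=> Ux; have [rho rho0 HU] := open_ballP Uo Ux.
have [mu mu0 H] := curve_through x v rho0.
have [|c [sc cU _ cl]] := H (fun=> x) _; first by move=> k; rewrite subrr normr0 ltW.
have cl0 := cl 0%N; rewrite !expr0 in cl0.
have m0 := mu0 0%N.
exists (mu 0%N / 8); split; first by rewrite divr_gt0.
exists (fun t => c (1 + (mu 0%N)^-1 * t)); split.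
- apply/smooth_curve_coord => i.
  exact (rsm_comp1 openT ((smooth_curve_coord c).1 sc i) (rsmD openT (rsm_cst dir1 setT 1)
    (rsmM openT (rsm_cst dir1 setT _) (rsm_id setT))) (fun _ _ => Logic.I)).
- by move=> t; apply: HU; exact: cU.
- move=> h hr; rewrite cl0; first by rewrite mulr1 mulVKf// gt_eqF.
  by rewrite normrM gtr0_norm ?invr_gt0// mulrC ler_pdivrMr// mulrC mul1r ltW.
Qed.

(** The derivative of order [m] along [v], read off from an arbitrary curve that is affine near time
    0; [dvE] shows that the choice does not matter. The default 0 occurs only where no such curve
    exists, which [line_curve] excludes on [U]. *)
Definition dv (m : nat) (v x : E) : V := xget 0 [set z | exists (r : R) (c : R -> E) d,
  [/\ 0 < r, tower (f \o c) d, forall h, `|h| < r -> c h = x + h *: v & z = d m 0]].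

Lemma dvE m v x c d (t0 nu r : R) : U x -> 0 < r -> tower (f \o c) d ->
  (forall h, `|h| < r -> c (t0 + h) = x + (nu * h) *: v) ->
  d m t0 = nu ^+ m *: dv m v x.
Proof.
move=> Ux r0 td cl.
have [r1 [c1 [d1 [r10 td1 cl1 ->]]]] : [set z | exists (r : R) (c : R -> E) d,
    [/\ 0 < r, tower (f \o c) d, forall h, `|h| < r -> c h = x + h *: v & z = d m 0]] (dv m v x).
  apply: xgetPex; have [r1 [r10 [c1 [sc1 cU1 cl1]]]] := line_curve v Ux.
  have [d1 td1] := f_smooth sc1 cU1.
  by exists (d1 m 0); exists r1, c1, d1.
pose rr := Num.min r (r1 / (`|nu| + 1)).
have nu1 : 0 < `|nu| + 1 by rewrite ltr_wpDl.
have rr0 : 0 < rr by rewrite lt_min r0 divr_gt0.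
have := @tower_germ _ _ _ _ 0 t0 nu rr rr0 td1 td _ m 0.
rewrite normr0 mulr0 !addr0; apply => // h; rewrite lt_min => /andP[hr].
rewrite ltr_pdivlMr// => hr1 /=; rewrite cl// cl1 add0r//.
by rewrite normrM (le_lt_trans _ hr1)// mulrC ler_wpM2l// lerDl.
Qed.

Lemma dv0 v x : U x -> dv 0 v x = f x.
Proof.
move=> Ux; have [r [r0 [c [sc cU cl]]]] := line_curve v Ux.
have [d td] := f_smooth sc cU.
have := @dvE 0 v x c d 0 1 r Ux r0 td; rewrite expr0 scale1r => <-.
  by case: td => -> _ /=; rewrite cl ?normr0// scale0r addr0.
by move=> h hr; rewrite add0r mul1r cl.
Qed.

(** The curve chosen at [x] is affine on a neighbourhood of 0, so its derivatives are also the
    values of [dv] at the neighbouring points of the line. *)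
Lemma dv_pderive p m v x : PP p -> U x ->
  pderive p (fun s => dv m v (x + s *: v)) 0 (dv m.+1 v x).
Proof.
move=> Pp Ux; have [r [r0 [c [sc cU cl]]]] := line_curve v Ux.
have [d td] := f_smooth sc cU.
have H j h : `|h| < r -> d j h = dv j v (x + h *: v).
  move=> hr; have rh : 0 < r - `|h| by rewrite subr_gt0.
  have Uxh : U (x + h *: v) by rewrite -cl.
  rewrite (@dvE j v (x + h *: v) c d h 1 (r - `|h|))// ?expr1n ?scale1r// => s sr.
  rewrite cl ?mul1r ?scalerDl ?addrA//.
  by rewrite (le_lt_trans (ler_normD _ _))// -ltrBrDl.
have -> : dv m.+1 v x = d m.+1 0 by rewrite H ?normr0// scale0r addr0.
apply: pderive_near r0 _ (td.2 m 0 p Pp) => h hr.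
by rewrite add0r H.
Qed.

Lemma dv_pderive_line p m v x s : PP p -> U (x + s *: v) ->
  pderive p (fun s => dv m v (x + s *: v)) s (dv m.+1 v (x + s *: v)).
Proof.
move=> Pp Us; have := dv_pderive m v Pp Us => H e /H[d d0 P1]; exists d => // h /P1.
by rewrite add0r scale0r addr0 scalerDl addrA.
Qed.

Lemma two_pow_small (e : R) : 0 < e -> exists k : nat, 2^-1 ^+ k < e.
Proof.
move=> e0; have [k Hk] : exists k, e^-1 < k%:R.
  by exists (Num.truncn e^-1).+1; exact: truncnS_gt.
exists k; rewrite exprVn invf_plt ?posrE ?exprn_gt0// (lt_trans Hk)//.
by rewrite -natrX ltr_nat ltn_expl.
Qed.

(* If [dv m v] were unbounded near [x], a curve through points where it is
   large would have an unbounded derivative of order [m]. *)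
Lemma dv_bounded p m v x : PP p -> U x -> exists2 r : R, 0 < r &
  exists B : R, forall y, `|y - x| < r -> U y /\ p (dv m v y) <= B.
Proof.
move=> Pp Ux; have sp := PPs Pp; have [rho rho0 HU] := open_ballP Uo Ux.
apply: contrapT => nb.
have [mu mu0 H] := curve_through x v rho0.
pose nu k := mu k * 2 ^+ k; have nu0 k : 0 < nu k by rewrite mulr_gt0// exprn_gt0.
(* The curve passes [xs k] with velocity [nu k *: v], so its derivative of order [m] there carries
   the factor [nu k ^+ m]; the threshold is divided by it in advance. *)
have /choice[xs Hxs] : forall k : nat, exists y, [/\ `|y - x| <= mu k, U y & k%:R / nu k ^+ m < p (dv m v y)].
  move=> k; apply: contrapT => nk; apply: nb; exists (Num.min rho (mu k)).
    by rewrite lt_min rho0 mu0.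
  exists (k%:R / nu k ^+ m) => y; rewrite lt_min => /andP[/HU Uy ymu]; split => //.
  by rewrite leNgt; apply/negP => H1; apply: nk; exists y; split => //; exact: ltW.
have [|c [sc cU _ cl]] := H xs; first by move=> k; have [] := Hxs k.
have [d td] : exists d, tower (f \o c) d by apply: f_smooth => // t; apply: HU; exact: cU.
have dk k : d m (2^-1 ^+ k) = nu k ^+ m *: dv m v (xs k).
  have [_ Uk _] := Hxs k.
  have r80 : 0 < 2^-1 ^+ k / 8 :> R by rewrite divr_gt0// exprn_gt0.
  by apply: (@dvE m v (xs k) c d _ (nu k) _ Uk r80 td) => h /ltW/cl.
have big k : k%:R < p (d m (2^-1 ^+ k)).
  have [_ _] := Hxs k; rewrite dk rsemZ// normrX gtr0_norm// ltr_pdivrMr ?exprn_gt0//.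
  by rewrite mulrC.
have [dl dl0 Hd] := pderive_pcont sp (td.2 m 0 p Pp) ltr01.
have [k0 Hk0] := two_pow_small dl0.
pose M := p (d m 0) + 1.
have [k1 Hk1] : exists k : nat, M <= k%:R.
  by exists (Num.truncn M).+1; apply: ltW; exact: truncnS_gt.
pose k := maxn k0 k1.
have hk : `|2^-1 ^+ k - 0 : R| < dl.
  rewrite subr0 ger0_norm ?exprn_ge0// (le_lt_trans _ Hk0)//.
  by rewrite ler_wiXn2l ?invr_ge0 ?invf_le1 ?ler1n// leq_maxl.
have := Hd _ hk; have := big k; have := rsem_tri sp (d m 0) (d m (2^-1 ^+ k)) 0.
rewrite !subr0 => h1 h2 h3.
have : M <= k%:R by rewrite (le_trans Hk1)// ler_nat leq_maxr.
rewrite /M; lra.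
Qed.

(** Points violating continuity, taken within [mu k] of [x], lie on one smooth curve through [x],
    and [f] is continuous along it. No velocity has to be prescribed, hence the direction 0. *)
Lemma f_pcont p x : PP p -> U x -> pcont p f x.
Proof.
move=> Pp Ux; have sp := PPs Pp; have [rho rho0 HU] := open_ballP Uo Ux.
move=> e e0; apply: contrapT => nb.
have [mu mu0 H] := curve_through x 0 rho0.
have /choice[xs Hxs] : forall k : nat, exists y, `|y - x| <= mu k /\ e < p (f y - f x).
  move=> k; apply: contrapT => nk; apply: nb; exists (mu k) => // y ymu.
  by rewrite leNgt; apply/negP => H1; apply: nk; exists y; split => //; exact: ltW.
have [|c [sc cU c0 cl]] := H xs; first by move=> k; have [] := Hxs k.
have [d [d0 td]] : exists d, tower (f \o c) d by apply: f_smooth => // t; apply: HU; exact: cU.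
have [dl dl0 Hd] := pderive_pcont sp (td 0%N 0 p Pp) e0.
have [k Hk] := two_pow_small dl0.
have [_] := Hxs k; rewrite ltNge => /negP; apply.
have -> : xs k = c (2^-1 ^+ k).
  by have := cl k 0; rewrite addr0 mulr0 scale0r addr0 => -> //; rewrite normr0 divr_ge0// exprn_ge0.
have -> : f x = (f \o c) 0 by rewrite /= c0.
rewrite -[f (c _)]/((f \o c) _) -d0; apply: Hd.
by rewrite subr0 ger0_norm ?exprn_ge0.
Qed.

Lemma iter_delta_line m (s : R) (v x : E) (g : E -> V) (t : R) :
  iter m (delta s) (fun s => g (x + s *: v)) t = iter m (delta (s *: v)) g (x + t *: v).
Proof.
elim: m t => //= m IH t; rewrite /delta !IH; congr (iter m _ g _ - _).
by rewrite scalerDl addrA.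
Qed.

(** The error is governed by the local bound on the pure derivative of order [m + 1]. The uniformity
    in [y] is essential: through it continuity passes from [f] to [dv]. *)
Lemma dv_approx p m v x : PP p -> U x -> exists2 r : R, 0 < r & exists2 B : R, 0 <= B &
  forall y s, `|y - x| < r -> `|s| < r ->
    p (iter m (delta (s *: v)) f y - s ^+ m *: dv m v y) <= B * `|s| ^+ m.+1.
Proof.
move=> Pp Ux; have sp := PPs Pp.
have [r r0 [B HB]] := dv_bounded m.+1 v Pp Ux.
have B0 : 0 <= B.
  by have [|_] := HB x _; [rewrite subrr normr0|apply: le_trans; exact: rsem_ge0].
pose D := 1 + m%:R * `|v|; have D0 : 0 < D by rewrite ltr_pwDl// mulr_ge0.
exists (r / 2 / D); first by rewrite !divr_gt0.
exists (B *+ m) => [|y s yx sr]; first by rewrite mulrn_wge0.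
have near_x q : `|q - 0| <= `|s| *+ m -> `|y + q *: v - x| < r.
  rewrite subr0 => qs; rewrite addrAC (le_lt_trans (ler_normD _ _))// (splitr r) ltrD//.
    rewrite (lt_le_trans yx)// ler_pdivrMr// ler_peMr ?divr_ge0 ?(ltW r0)//.
    by rewrite lerDl mulr_ge0.
  rewrite normrZ; move: sr; rewrite ltr_pdivlMr// => /(le_lt_trans _); apply.
  rewrite (le_trans (ler_wpM2r (normr_ge0 v) qs))// -mulr_natr -mulrA ler_wpM2l//.
  by rewrite lerDr.
have := @iter_delta_approx R V p sp (fun j s => dv j v (y + s *: v)) m 0 s 0 B.
rewrite add0n scale0r addr0 => H.
have <- : iter m (delta s) (fun s => dv 0 v (y + s *: v)) 0 = iter m (delta (s *: v)) f y.
  rewrite -[y in RHS]addr0 -(scale0r v) -iter_delta_line.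
  have : forall t : R, 0 <= t * s -> `|t| <= `|s| *+ 0 -> True by [].
  have key : forall j (t : R), (forall i, (i <= j)%N -> U (y + (t + s *+ i) *: v)) ->
      iter j (delta s) (fun s => dv 0 v (y + s *: v)) t =
      iter j (delta s) (fun s => f (y + s *: v)) t.
    elim=> [|j IH] t Ut /=; first by rewrite dv0//; have := Ut 0%N isT; rewrite mulr0n addr0.
    rewrite /delta !IH// => i ij; first by apply: Ut; exact: leqW.
    by rewrite -addrA -mulrS; exact: Ut.
  move=> _; apply: key => i im; have [] // := HB (y + (0 + s *+ i) *: v) _.
  apply: near_x; rewrite add0r subr0 normrMn; exact: ler_wpMn2l.
apply: H => [i q qs|q qs].
  by apply: dv_pderive_line => //; have [] := HB _ (near_x _ qs).
by have [] := HB _ (near_x _ qs).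
Qed.

Lemma pcont_delta p m w x (g : E -> V) : rseminorm p ->
  (forall i, (i <= m)%N -> pcont p g (x + w *+ i)) -> pcont p (iter m (delta w) g) x.
Proof.
move=> sp; elim: m x => [|m IH] x H; first by have := H 0%N isT; rewrite mulr0n addr0.
move=> e e0; have e20 : 0 < e / 2 by rewrite divr_gt0.
have [|d1 d10 H1] := IH (x + w) _ _ e20.
  by move=> i im; rewrite -addrA -mulrS; exact: H.
have [|d2 d20 H2] := IH x _ _ e20; first by move=> i im; apply: H; exact: leqW.
exists (Num.min d1 d2); first by rewrite lt_min d10.
move=> y; rewrite lt_min => /andP[y1 y2].
set F := iter m (delta w) g in H1 H2.
change (p (F (y + w) - F y - (F (x + w) - F x)) <= e).
rewrite (_ : _ - _ = (F (y + w) - F (x + w)) - (F y - F x)).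
  rewrite (le_trans (rsemB sp _ _))// (splitr e) lerD//; last exact: H2.
  by apply: H1; rewrite opprD addrACA subrr addr0.
by rewrite !opprB addrACA [RHS]addrACA [- F y + _]addrC.
Qed.

(** For a fixed small [s] the values of [dv m v] at [y] and [x] are compared through differences of
    [f] with step [s *: v], which are continuous; only then is [y] brought close to [x]. *)
Lemma dv_pcont p m v x : PP p -> U x -> pcont p (dv m v) x.
Proof.
move=> Pp Ux e e0; have sp := PPs Pp.
have [r r0 [B B0 HB]] := dv_approx m v Pp Ux; have [rho rho0 HU] := open_ballP Uo Ux.
(* Three requirements: [dv_approx] applies, each of its two errors is at most [e / 3] after division
   by [s ^+ m], and the points [x + (i * s) *: v] with [i <= m] stay in [U]. *)
pose s := Num.min (Num.min (r / 2) (e / 3 / (B + 1))) (rho / 2 / (1 + m%:R * `|v|)).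
have D0 : 0 < 1 + m%:R * `|v| by rewrite ltr_pwDl// mulr_ge0.
have B10 : 0 < B + 1 by rewrite ltr_wpDl.
have s0 : 0 < s by rewrite !lt_min !divr_gt0.
have sr : `|s| < r.
  rewrite gtr0_norm// (le_lt_trans (_ : _ <= r / 2))//.
    by rewrite !ge_min lexx.
  by rewrite ltr_pdivrMr// ltr_pMr// ltr1n.
have sB : B * s <= e / 3.
  rewrite (le_trans (_ : _ <= (B + 1) * s))//; first by rewrite ler_wpM2r ?(ltW s0)// lerDl.
  by rewrite mulrC -ler_pdivlMr// !ge_min lexx orbT.
have srho : m%:R * `|v| * s < rho.
  rewrite (@le_lt_trans _ _ (rho / 2))//.
    rewrite (le_trans (_ : _ <= (1 + m%:R * `|v|) * s))//.
      by rewrite ler_wpM2r ?(ltW s0)// lerDr.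
    by rewrite mulrC -ler_pdivlMr// !ge_min lexx !orbT.
  by rewrite ltr_pdivrMr// ltr_pMr// ltr1n.
have sm0 : 0 < s ^+ m by rewrite exprn_gt0.
have e3 : 0 < e / 3 * s ^+ m by rewrite mulr_gt0// divr_gt0.
have [|d d0 Hd] := @pcont_delta p m (s *: v) x f sp _ _ e3.
  move=> i im; apply: f_pcont => //; apply: HU; rewrite addrC addKr normrMn normrZ gtr0_norm//.
  rewrite (le_lt_trans _ srho)// -[_ *+ i]mulr_natl -mulrA [s * _]mulrC ler_wpM2r ?ler_nat//.
  by rewrite mulr_ge0// ltW.
exists (Num.min d r); first by rewrite lt_min d0.
move=> y; rewrite lt_min => /andP[yd yr].
have H1 := HB y s yr sr; have xr : `|x - x| < r by rewrite subrr normr0.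
have H2 := HB x s xr sr; have H3 := Hd y yd.
have : p (s ^+ m *: (dv m v y - dv m v x)) <= e * s ^+ m.
  set a := iter m _ _ y in H1 H3; set b := iter m _ _ x in H2 H3.
  rewrite scalerBr (le_trans (rsem_tri sp a _ _))// rsem_sym//.
  rewrite (le_trans (lerD H1 (rsem_tri sp b _ _)))//.
  rewrite (le_trans (lerD (lexx _) (lerD H3 H2)))//.
  have -> : B * `|s| ^+ m.+1 = (B * s) * s ^+ m by rewrite gtr0_norm// exprS mulrA.
  have e_eq : e * s ^+ m = e / 3 * s ^+ m + (e / 3 * s ^+ m + e / 3 * s ^+ m) by field.
  by rewrite e_eq lerD// ?lerD// ler_wpM2r// ltW.
by rewrite rsemZ// gtr0_norm// mulrC ler_pM2r.
Qed.

End Boman.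

(** * Boman's theorem *)

Section Differences.
Context {R : realType} {V : lmodType R} {E : lmodType R}.
Implicit Types (f g : E -> V) (ws : seq E).

Definition mdelta ws f : E -> V := foldr (fun w g => delta w g) f ws.

Lemma mdelta_zero ws f x : 0 \in ws -> mdelta ws f x = 0.
Proof.
elim: ws x => // w ws IH x; rewrite inE => /predU1P[<-|/IH H]; rewrite /= /delta.
  by rewrite addr0 subrr.
by rewrite !H subrr.
Qed.

Fixpoint damped (r : R) ws (j : nat) : seq E :=
  if ws is w :: ws' then (1 - r / j%:R) *: w :: damped r ws' j.+1 else [::].

(** The terms of the expanded damped difference: its sign, its displacement at [r = 0], and the
    coefficient of [r] in the displacement. *)
Fixpoint dterms ws (j : nat) : seq (R * (E * E)) :=
  if ws is w :: ws' then
    [seq (t.1, (t.2.1 + w, t.2.2 - j%:R^-1 *: w)) | t <- dterms ws' j.+1] ++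
    [seq (- t.1, t.2) | t <- dterms ws' j.+1]
  else [:: (1, (0, 0))].

Lemma mdelta_damped r ws j f x :
  mdelta (damped r ws j) f x = \sum_(t <- dterms ws j) t.1 *: f (x + t.2.1 + r *: t.2.2).
Proof.
elim: ws j x => [|w ws IH] j x; first by rewrite big_seq1 /= scaler0 !addr0 scale1r.
rewrite /= /delta !IH big_cat !big_map /=; congr (_ + _).
  apply: eq_bigr => t _; congr (_ *: f _).
  rewrite scalerBl scale1r scalerBr scalerA -!addrA; congr (_ + _).
  by rewrite [RHS]addrCA; congr (_ + _); rewrite addrC -addrA.
by rewrite -sumrN; apply: eq_bigr => t _; rewrite scaleNr.
Qed.

Lemma damped0 ws j : damped 0 ws j = ws.
Proof. by elim: ws j => //= w ws IH j; rewrite mul0r subr0 scale1r IH. Qed.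

Lemma damped_zero ws i j : (i < size ws)%N -> 0 \in damped (j.+1 + i)%:R ws j.+1.
Proof.
elim: ws i j => // w ws IH [|i] j /= ilt; rewrite inE.
  by rewrite addn0 mulfV ?pnatr_eq0// subrr scale0r eqxx.
by rewrite -addSnnS (IH i j.+1 ilt) orbT.
Qed.

(** The iterated difference is an alternating sum of the values at [0, ..., m], of which only the
    one at 0 survives. *)
Lemma iter_delta_support (F : R -> V) (m : nat) :
  (forall i, (0 < i <= m)%N -> F i%:R = 0) -> iter m (delta 1) F 0 = (-1) ^+ m *: F 0.
Proof.
have z : forall m i, (0 < i)%N -> (forall j, (0 < j <= m + i)%N -> F j%:R = 0) ->
    iter m (delta 1) F i%:R = 0.
  elim=> [|j IH] i i0 H /=; first by rewrite H// i0 leqnn.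
  rewrite /delta natr1 !IH ?subrr// => l /andP[l0 li]; apply: H; rewrite l0.
    by rewrite (leq_trans li).
  by rewrite (leq_trans li)// addSn addnS.
elim: m => [|m IH] H; first by rewrite expr0 scale1r.
rewrite /= /delta add0r IH; last by move=> i /andP[i0 im]; apply: H; rewrite i0 leqW.
have := z m 1%N isT; rewrite addn1 => -> //.
by rewrite sub0r exprS mulN1r scaleNr.
Qed.

Lemma iter_delta_sum (T : Type) (r : seq T) (F : T -> R -> V) (a : T -> R) m s :
  iter m (delta 1) (fun s => \sum_(t <- r) a t *: F t s) s =
  \sum_(t <- r) a t *: iter m (delta 1) (F t) s.
Proof.
elim: m s => // m IH s; rewrite /= /delta !IH -sumrB; apply: eq_bigr => t _.
by rewrite scalerBr.
Qed.

Lemma iter_delta_line1 m (f : E -> V) (y w : E) (s : R) :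
  iter m (delta 1) (fun s => f (y + s *: w)) s = iter m (delta w) f (y + s *: w).
Proof.
by elim: m s => //= m IH s; rewrite /delta !IH scalerDl scale1r addrA.
Qed.

(* Djokovic's identity: a mixed difference is a combination of pure ones.
   Applying the [M]-th difference in [r] to the mixed difference with steps
   [(1 - r / j) w_j] kills all the terms with [0 < r <= M]. *)
Lemma mdelta_pure ws f x :
  mdelta ws f x = \sum_(t <- dterms ws 1)
    ((-1) ^+ size ws * t.1) *: iter (size ws) (delta t.2.2) f (x + t.2.1).
Proof.
have := @iter_delta_support (fun r => mdelta (damped r ws 1) f x) (size ws) _.
rewrite damped0 => H; have {H}H : iter (size ws) (delta 1) (fun r => mdelta (damped r ws 1) f x) 0 =
    (-1) ^+ size ws *: mdelta ws f x.
  apply: H => -[|i]// /andP[_ im]; apply: mdelta_zero.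
  by have := damped_zero 0 im; rewrite add1n.
have /(congr1 (fun z => (-1) ^+ size ws *: z)) := H.
rewrite scalerA -exprMn mulrNN mulr1 expr1n scale1r => <-.
have -> : (fun r => mdelta (damped r ws 1) f x) =
    fun r => \sum_(t <- dterms ws 1) t.1 *: f (x + t.2.1 + r *: t.2.2).
  by apply/funext => r; rewrite mdelta_damped.
rewrite (iter_delta_sum _ (fun t s => f (x + t.2.1 + s *: t.2.2)) (fun t => t.1)).
rewrite scaler_sumr; apply: eq_bigr => t _.
by rewrite scalerA iter_delta_line1 scale0r addr0.
Qed.

Lemma dterms_scale (s : R) ws j :
  dterms [seq s *: w | w <- ws] j = [seq (t.1, (s *: t.2.1, s *: t.2.2)) | t <- dterms ws j].
Proof.
elim: ws j => [|w ws IH] j /=; first by rewrite !scaler0.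
rewrite IH map_cat -!map_comp; congr (_ ++ _); apply: eq_map => t //=.
by rewrite scalerDr scalerBr !scalerA mulrC.
Qed.

End Differences.

Section BomanTheorem.
Context {R : realType} {V : lmodType R} {n : nat}.
Local Notation E := 'rV[R]_n.
Variables (PP : set (V -> R)) (U : set E) (f : E -> V).
Hypothesis PPs : forall p, PP p -> rseminorm p.
Hypothesis PPsep : forall z, (forall p, PP p -> p z = 0) -> z = 0.
Hypothesis Uo : open U.
Hypothesis f_smooth : forall c : R -> E, smooth_curve c -> (forall t, U (c t)) ->
  exists d, tower PP (f \o c) d.
Local Notation dv := (dv PP f).

(** The combination of Djokovic's identity is taken as the definition of a mixed derivative, instead
    of iterated derivation. Its continuity is then inherited from the pure derivatives; what remains
    is that [mixed (w :: ws)] is the derivative of [mixed ws] along [w]. *)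
Definition mixed (ws : seq E) (x : E) : V :=
  \sum_(t <- dterms ws 1) ((-1) ^+ size ws * t.1) *: dv (size ws) t.2.2 x.

Lemma mixed_pcont p ws x : PP p -> U x -> pcont p (mixed ws) x.
Proof.
move=> Pp Ux; have sp := PPs Pp; rewrite /mixed.
elim: (dterms ws 1) => [|t r IH] e e0.
  by exists 1 => // y _; rewrite !big_nil subrr (rsem0 sp) ltW.
have e20 : 0 < e / 2 by rewrite divr_gt0.
have [d1 d10 H1] := IH _ e20; pose a := (-1) ^+ size ws * t.1.
have a0 : 0 < `|a| + 1 by rewrite ltr_wpDl.
have [d2 d20 H2] := dv_pcont PPs PPsep Uo f_smooth (size ws) t.2.2 Pp Ux (divr_gt0 e20 a0).
exists (Num.min d1 d2); first by rewrite lt_min d10.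
move=> y; rewrite lt_min => /andP[/H1 h1 /H2 h2]; rewrite !big_cons opprD addrACA.
rewrite (le_trans (rsemD sp _ _))// (splitr e) lerD//.
rewrite -scalerBr (rsemZ sp) -/a mulrC; move: h2; rewrite ler_pdivlMr// => /(le_trans _); apply.
by rewrite ler_wpM2l ?(rsem_ge0 sp)// lerDl.
Qed.

(** Not only the step but also the base point varies, by [y] and by the displacements [s *: t.2.1];
    continuity of the pure derivatives brings it back to [x]. *)
Lemma mixed_approx p ws x : PP p -> U x -> forall e, 0 < e -> exists2 r : R, 0 < r &
  forall y s, `|y - x| < r -> `|s| < r ->
    p (mdelta [seq s *: w | w <- ws] f y - s ^+ size ws *: mixed ws x) <= e * `|s| ^+ size ws.
Proof.
move=> Pp Ux; have sp := PPs Pp; set M := size ws.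
suff H : forall r : seq (R * (E * E)), forall e, 0 < e -> exists2 d : R, 0 < d &
    forall y s, `|y - x| < d -> `|s| < d ->
    p (\sum_(t <- r) ((-1) ^+ M * t.1) *: iter M (delta (s *: t.2.2)) f (y + s *: t.2.1) -
       s ^+ M *: \sum_(t <- r) ((-1) ^+ M * t.1) *: dv M t.2.2 x) <= e * `|s| ^+ M.
  move=> e /(H (dterms ws 1))[d d0 Hd]; exists d => // y s yd sd.
  have := Hd y s yd sd; rewrite mdelta_pure size_map -/M dterms_scale big_map /=.
  exact.
elim=> [|t r IH] e e0.
  exists 1 => // y s _ _; rewrite !big_nil scaler0 subrr (rsem0 sp).
  by rewrite mulr_ge0 ?(ltW e0)// exprn_ge0.
have e20 : 0 < e / 2 by rewrite divr_gt0.
have [d1 d10 H1] := IH _ e20; pose a := (-1) ^+ M * t.1.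
have a0 : 0 < `|a| + 1 by rewrite ltr_wpDl.
have e40 : 0 < e / 2 / (`|a| + 1) / 2 by rewrite !divr_gt0.
have [d2 d20 [B B0 H2]] := dv_approx PPs PPsep Uo f_smooth M t.2.2 Pp Ux.
have [d3 d30 H3] := dv_pcont PPs PPsep Uo f_smooth M t.2.2 Pp Ux e40.
pose D := 1 + `|t.2.1|; have D0 : 0 < D by rewrite ltr_pwDl.
pose d := Num.min d1 (Num.min (Num.min d2 d3 / 2 / D) (e / 2 / (`|a| + 1) / 2 / (B + 1))).
have B10 : 0 < B + 1 by rewrite ltr_wpDl.
have m0 : 0 < Num.min d2 d3 by rewrite lt_min d20.
exists d; first by rewrite !lt_min d10 /= !divr_gt0.
move=> y s; rewrite !lt_min => /and3P[y1 y2 _] /and3P[s1 s2 s3].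
rewrite !big_cons scalerDr opprD addrACA (le_trans (rsemD sp _ _))//.
rewrite (splitr e) mulrDl lerD//; last exact: H1.
rewrite -/a (scalerA (s ^+ M) a) [s ^+ M * a]mulrC -(scalerA a) -scalerBr (rsemZ sp).
have D1 : 1 <= D by rewrite lerDl.
have sD : `|s| <= `|s| * D by rewrite ler_peMr.
have yb : `|y + s *: t.2.1 - x| < Num.min d2 d3.
  rewrite addrAC (le_lt_trans (ler_normD _ _))// (splitr (Num.min d2 d3)) ltrD//.
    by rewrite (lt_le_trans y2)// ler_pdivrMr// ler_peMr// divr_ge0// ltW.
  rewrite normrZ (le_lt_trans (_ : _ <= `|s| * D))//; first by rewrite ler_wpM2l// lerDr.
  by rewrite -ltr_pdivlMr.
have sb : `|s| < Num.min d2 d3.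
  rewrite (le_lt_trans sD)// -ltr_pdivlMr// (lt_le_trans s2)//.
  by rewrite ler_wpM2r ?invr_ge0 ?(ltW D0)// ler_pdivrMr// ler_peMr ?(ltW m0)// ler1n.
move: yb sb; rewrite !lt_min => /andP[yb2 yb3] /andP[sb2 sb3].
have h2 := H2 _ _ yb2 sb2; have h3 := H3 _ yb3.
have key : p (iter M (delta (s *: t.2.2)) f (y + s *: t.2.1) - s ^+ M *: dv M t.2.2 x) <=
    e / 2 / (`|a| + 1) * `|s| ^+ M.
  rewrite (le_trans (rsem_tri sp (s ^+ M *: dv M t.2.2 (y + s *: t.2.1)) _ _))//.
  rewrite (splitr (e / 2 / (`|a| + 1))) mulrDl lerD//.
    rewrite (le_trans h2)// exprS mulrA ler_wpM2r ?exprn_ge0//.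
    rewrite (le_trans (_ : _ <= (B + 1) * `|s|))//; first by rewrite ler_wpM2r// lerDl.
    by rewrite mulrC -ler_pdivlMr// ltW.
  by rewrite -scalerBr (rsemZ sp) normrX mulrC ler_wpM2r ?exprn_ge0.
rewrite (le_trans (ler_wpM2l (normr_ge0 a) key))// mulrA ler_wpM2r ?exprn_ge0//.
by rewrite mulrC mulrAC ler_pdivrMr// ler_wpM2l ?(ltW e20)// lerDl.
Qed.

Lemma mdelta_telescope (ws : seq E) (w x : E) (N : nat) :
  \sum_(0 <= j < N) mdelta (w :: ws) f (x + w *+ j) =
  mdelta ws f (x + w *+ N) - mdelta ws f x.
Proof.
rewrite -[in X in _ - X](addr0 x) -[in X in _ - X](mulr0n w).
rewrite -(telescope_sumr (fun j => mdelta ws f (x + w *+ j)))//.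
by apply: eq_big_nat => j _; rewrite /= /delta mulrSr addrA.
Qed.

(** The increment of [mixed ws] over [h *: w] is compared with that of the mixed difference of [f]
    with steps scaled by [s = h / N]. The latter is a telescoping sum of [N] mixed differences with
    the extra step [s *: w], each equal to [s ^ (M + 1)] times [mixed (w :: ws) x] up to
    [e * |s| ^ (M + 1)]. Passing from differences to [mixed ws] at both ends costs [eta * |s| ^ M],
    with [eta] arbitrary because [N] may grow while [h] stays fixed. *)
Lemma mixed_pderive p ws w x : PP p -> U x ->
  pderive p (fun s => mixed ws (x + s *: w)) 0 (mixed (w :: ws) x).
Proof.
move=> Pp Ux e e0; have sp := PPs Pp; have [rho rho0 HU] := open_ballP Uo Ux.
have [r r0 Hr] := mixed_approx (w :: ws) Pp Ux e0.
pose D := 1 + `|w|; have D0 : 0 < D by rewrite ltr_pwDl.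
have D1 : 1 <= D by rewrite lerDl.
exists (Num.min r rho / D); first by rewrite divr_gt0// lt_min r0.
move=> h; rewrite ltr_pdivlMr// lt_min => /andP[hr hrho].
have [->|h0] := eqVneq h 0.
  by rewrite addr0 !scale0r subrr subr0 (rsem0 sp) normr0 mulr0.
rewrite add0r scale0r addr0.
have hw s : `|s| <= `|h| -> `|x + s *: w - x| < r /\ `|x + s *: w - x| < rho.
  move=> sh; rewrite addrC addKr normrZ.
  have : `|s| * `|w| <= `|h| * D by rewrite ler_pM// lerDr.
  by move=> H; split; exact: le_lt_trans H _.
have Uxh : U (x + h *: w) by apply: HU; have [] := hw h (lexx _).
apply/ler_addgt0Pr => eta eta0; have eta20 : 0 < eta / 2 by rewrite divr_gt0.
have [r1 r10 H1] := mixed_approx ws Pp Uxh eta20.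
have [r2 r20 H2] := mixed_approx ws Pp Ux eta20.
have rr0 : 0 < Num.min r1 r2 by rewrite lt_min r10.
(* [N] is chosen after [h] and [eta], so that the step [h / N] is small enough for the
   approximations at both ends of the segment. *)
have [N HN] : exists N : nat, `|h| / Num.min r1 r2 < N%:R.
  by exists (Num.truncn (`|h| / Num.min r1 r2)).+1; exact: truncnS_gt.
have N0 : 0 < N%:R :> R by rewrite (le_lt_trans _ HN)// divr_ge0// ltW.
pose s := h / N%:R.
have s0 : s != 0 by rewrite mulf_neq0// invr_eq0 gt_eqF.
have sN : s *+ N = h by rewrite -mulr_natr divfK// gt_eqF.
have sNn : `|s| *+ N = `|h| by rewrite -normrMn sN.
have : `|s| < Num.min r1 r2.
  by rewrite normrM normfV (gtr0_norm N0) ltr_pdivrMr// mulrC -ltr_pdivrMr.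
rewrite lt_min => /andP[sr1 sr2].
have sr : `|s| < r.
  rewrite (le_lt_trans _ hr)// (le_trans (_ : _ <= `|h|))//; last by rewrite ler_peMr.
  rewrite normrM normfV (gtr0_norm N0) ler_piMr// invf_le1// ler1n.
  by move: N0; rewrite ltr0n.
set M := size ws; set P' := mixed (w :: ws) x.
pose sw := [seq s *: w | w <- ws].
have tele : p (mdelta sw f (x + h *: w) - mdelta sw f x - (h * s ^+ M) *: P') <= e * `|h| * `|s| ^+ M.
  have -> : x + h *: w = x + (s *: w) *+ N by rewrite -sN scalerMnl.
  rewrite -mdelta_telescope.
  have -> : (h * s ^+ M) *: P' = \sum_(0 <= j < N) s ^+ M.+1 *: P'.
    by rewrite sumr_const_nat subn0 -scaler_nat scalerA -sN -mulr_natl exprS mulrA.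
  rewrite -sumrB.
  have -> : e * `|h| * `|s| ^+ M = \sum_(0 <= j < N) e * `|s| ^+ M.+1.
    by rewrite sumr_const_nat subn0 -[RHS]mulr_natr -sNn -mulr_natr exprS; ring.
  have : forall N', (N' <= N)%N ->
      p (\sum_(0 <= j < N') (mdelta (s *: w :: sw) f (x + s *: w *+ j) - s ^+ M.+1 *: P')) <=
      \sum_(0 <= j < N') e * `|s| ^+ M.+1.
    elim=> [|N' IH] NN; first by rewrite !big_geq// (rsem0 sp).
    rewrite !big_nat_recr //= (le_trans (rsemD sp _ _))// lerD ?IH ?(ltnW NN)//.
    apply: (Hr _ s _ sr); rewrite scalerMnl.
    have [] // := hw (s *+ N'); rewrite -sNn normrMn.
    by apply: ler_wpMn2l => //; exact: ltnW.
  exact.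
have a1 : p (mdelta sw f (x + h *: w) - s ^+ M *: mixed ws (x + h *: w)) <= eta / 2 * `|s| ^+ M.
  by apply: H1 => //; rewrite subrr normr0.
have a2 : p (mdelta sw f x - s ^+ M *: mixed ws x) <= eta / 2 * `|s| ^+ M.
  by apply: H2 => //; rewrite subrr normr0.
have sM0 : 0 < `|s| ^+ M by rewrite exprn_gt0// normr_gt0.
rewrite -(ler_pM2r sM0) mulrC -normrX -(rsemZ sp) normrX.
set X := mdelta sw f (x + h *: w) in tele a1; set Y := mdelta sw f x in tele a2.
rewrite (_ : s ^+ M *: _ = (X - Y - (h * s ^+ M) *: P') -
   (X - s ^+ M *: mixed ws (x + h *: w)) + (Y - s ^+ M *: mixed ws x)).
  rewrite (le_trans (rsemD sp _ _))// (le_trans (lerD (rsemB sp _ _) (lexx _)))//.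
  rewrite (le_trans (lerD (lerD tele a1) a2))//.
  rewrite [leRHS](_ : _ = e * `|h| * `|s| ^+ M + eta / 2 * `|s| ^+ M + eta / 2 * `|s| ^+ M)//.
  by field.
rewrite !scalerBr scalerA [s ^+ M * h]mulrC.
set a := s ^+ M *: mixed ws _; set b := s ^+ M *: _ x; set c := _ *: P'.
clearbody X Y a b c.
by rewrite opprB -[X - Y - c]addrA [X + _ + _]addrC subrKA [- Y - c]addrC [a + (- c - Y)]addrA subrKA addrAC.
Qed.

Lemma mixed_nil x : U x -> mixed [::] x = f x.
Proof.
by move=> Ux; rewrite /mixed /= big_seq1 /= mulr1 expr0 scale1r (dv0 PPs PPsep Uo f_smooth).
Qed.

End BomanTheorem.

(** * Symmetry of second derivatives *)

Section Schwarz.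
Context {R : realType} {V : normedModType R} {I : Type}.
Variables (dir : I -> V) (U : set V).
Hypothesis Uo : open U.

(** The mean value estimate is used twice: along [dir i], for the increment of [f] over
    [s *: dir j], and then along [dir j], for [fi]. *)
Lemma second_difference (f fi fij : V -> R) (i j : I) (x : V) : U x ->
  (forall y, U y -> is_derive y (dir i) f (fi y)) ->
  (forall y, U y -> is_derive y (dir j) fi (fij y)) ->
  {for x, continuous fij} -> forall e, 0 < e -> exists2 d : R, 0 < d & forall s : R, `|s| < d ->
  `|f (x + s *: dir i + s *: dir j) - f (x + s *: dir i) - (f (x + s *: dir j) - f x) - s * s * fij x|
  <= e * `|s| * `|s|.
Proof.
move=> Ux di dj cij e e0.
have [d1 d10 H1] := (continuous_normP _ _).1 cij e e0.
have [d2 d20 HU] := open_ballP Uo Ux.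
pose D := `|dir i| + `|dir j| + 1; have D0 : 0 < D by rewrite ltr_wpDl ?addr_ge0.
exists (Num.min d1 d2 / D); first by rewrite divr_gt0// lt_min d10.
move=> s; rewrite ltr_pdivlMr// => sD.
have near_x a b : `|a| <= `|s| -> `|b| <= `|s| ->
    U (x + a *: dir i + b *: dir j) /\ `|fij (x + a *: dir i + b *: dir j) - fij x| <= e.
  move=> sa sb; have : `|x + a *: dir i + b *: dir j - x| < Num.min d1 d2.
    rewrite [X in `|X|]addrC -[x + _ + _]addrA addKr (le_lt_trans (ler_normD _ _))// !normrZ (le_lt_trans _ sD)//.
    rewrite /D !mulrDr mulr1 (le_trans (lerD (ler_wpM2r (normr_ge0 _) sa) (ler_wpM2r (normr_ge0 _) sb)))//.
    by rewrite lerDl.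
  by rewrite lt_min => /andP[/H1 h /HU].
pose g t := f (x + t *: dir i + s *: dir j) - f (x + t *: dir i) - t * (s * fij x).
have -> : f (x + s *: dir i + s *: dir j) - f (x + s *: dir i) - (f (x + s *: dir j) - f x) - s * s * fij x
    = g s - g 0 by rewrite /g !scale0r !addr0; ring.
have -> : e * `|s| * `|s| = e * `|s| * `|s - 0| by rewrite subr0.
apply: (@mean_value_le _ g (fun t => fi (x + t *: dir i + s *: dir j) - fi (x + t *: dir i) - s * fij x)).
move=> t; rewrite !subr0 => ts; split.
  have [U1 _] := near_x _ _ ts (lexx _).
  have s00 : `|0 : R| <= `|s| by rewrite normr0.
  have [U2 _] := near_x _ _ ts s00; rewrite scale0r addr0 in U2.
  have e1 : (fun t => f (x + t *: dir i + s *: dir j)) = fun t => f (x + s *: dir j + t *: dir i).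
    by apply/funext => r; rewrite addrAC.
  have D1 : is_derive t 1 (fun t => f (x + t *: dir i + s *: dir j)) (fi (x + t *: dir i + s *: dir j)).
    by rewrite e1; apply: is_derive_shift; rewrite addrAC; exact: di.
  have D2 := is_derive_shift (di _ U2).
  have D3 : is_derive t 1 (fun t => t * (s * fij x)) (s * fij x).
    rewrite (_ : (fun t => _) = fun t => (s * fij x) * t + 0); first exact: is_derive_affine.
    by apply/funext => r; rewrite addr0 mulrC.
  exact: (is_deriveB (is_deriveB D1 D2) D3).
pose h r := fi (x + t *: dir i + r *: dir j) - r * fij x.
have -> : fi (x + t *: dir i + s *: dir j) - fi (x + t *: dir i) - s * fij x = h s - h 0.
  by rewrite /h scale0r addr0 mul0r subr0 addrAC.
have -> : e * `|s| = e * `|s - 0| by rewrite subr0.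
apply: (@mean_value_le _ h (fun r => fij (x + t *: dir i + r *: dir j) - fij x)) => r.
rewrite !subr0 => rs; have [U1 H] := near_x _ _ ts rs; split => //.
have D3 : is_derive r 1 (fun t => t * fij x) (fij x).
  rewrite (_ : (fun t => _) = fun t => fij x * t + 0); first exact: is_derive_affine.
  by apply/funext => r'; rewrite addr0 mulrC.
exact: (is_deriveB (is_derive_shift (dj _ U1)) D3).
Qed.

(** The second difference with equal steps is symmetric in [i] and [j], and [s * s] times either
    mixed derivative approximates it to higher order. *)
Lemma schwarz (f fi fj fij fji : V -> R) (i j : I) (x : V) : U x ->
  (forall y, U y -> is_derive y (dir i) f (fi y)) ->
  (forall y, U y -> is_derive y (dir j) f (fj y)) ->
  (forall y, U y -> is_derive y (dir j) fi (fij y)) ->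
  (forall y, U y -> is_derive y (dir i) fj (fji y)) ->
  {for x, continuous fij} -> {for x, continuous fji} -> fij x = fji x.
Proof.
move=> Ux di dj dij dji cij cji; apply/eqP; rewrite -subr_eq0 -normr_le0.
apply/ler_addgt0Pr => e e0; rewrite add0r; have e20 : 0 < e / 2 by rewrite divr_gt0.
have [d1 d10 H1] := second_difference Ux di dij cij e20.
have [d2 d20 H2] := second_difference Ux dj dji cji e20.
have m0 : 0 < Num.min d1 d2 by rewrite lt_min d10.
pose s := Num.min d1 d2 / 2; have s0 : 0 < s by rewrite divr_gt0.
have : `|s| < Num.min d1 d2 by rewrite gtr0_norm// ltr_pdivrMr// ltr_pMr// ltr1n.
rewrite lt_min => /andP[/H1 h1 /H2]; rewrite [x + s *: dir j + s *: dir i]addrAC => h2.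
have ss : 0 < s * s by rewrite mulr_gt0.
rewrite -(ler_pM2r ss) -{1}(gtr0_norm ss) -normrM.
set A := f (x + s *: dir i + s *: dir j) in h1 h2.
rewrite (_ : (_ - _) * _ = (A - f (x + s *: dir j) - (f (x + s *: dir i) - f x) - s * s * fji x) -
  (A - f (x + s *: dir i) - (f (x + s *: dir j) - f x) - s * s * fij x)); last by ring.
rewrite (le_trans (ler_normB _ _))// (le_trans (lerD h2 h1))// gtr0_norm//.
by rewrite le_eqVlt; apply/orP; left; apply/eqP; field.
Qed.

Lemma kschwarz {k : scalar_kind} (f fi fj fij fji : V -> scal k R) (i j : I) (x : V) : U x ->
  (forall y, U y -> kderive y (dir i) f (fi y)) ->
  (forall y, U y -> kderive y (dir j) f (fj y)) ->
  (forall y, U y -> kderive y (dir j) fi (fij y)) ->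
  (forall y, U y -> kderive y (dir i) fj (fji y)) ->
  kcont x fij -> kcont x fji -> fij x = fji x.
Proof.
move=> Ux di dj dij dji [cr ci] [cr' ci']; apply: scalar_eq.
- apply: (@schwarz (sre \o f) (sre \o fi) (sre \o fj) (sre \o fij) (sre \o fji) i j x Ux) => //.
  + by move=> y /di[].
  + by move=> y /dj[].
  + by move=> y /dij[].
  + by move=> y /dji[].
- apply: (@schwarz (sim \o f) (sim \o fi) (sim \o fj) (sim \o fij) (sim \o fji) i j x Ux) => //.
  + by move=> y /di[].
  + by move=> y /dj[].
  + by move=> y /dij[].
  + by move=> y /dji[].
Qed.

End Schwarz.

Lemma partialC {k : scalar_kind} {R : realType} {n : nat} (U : set 'rV[R]_n)
    (f : 'rV[R]_n -> scal k R) i j x : open U -> csm dirE U f -> U x ->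
  partial i (partial j f) x = partial j (partial i f) x.
Proof.
move=> Uo sf Ux; have [si di] := csm_partial Uo i sf; have [sj dj] := csm_partial Uo j sf.
have [sji dji] := csm_partial Uo i sj; have [sij dij] := csm_partial Uo j si.
exact: (kschwarz Uo Ux dj di dji dij (csm_cont sji Ux) (csm_cont sij Ux)).
Qed.

(** * Powers of operators that commute up to an equivalence *)

Section MultiIndexPowers.
Context {n : nat}.
Local Notation mi := (multi_index n).

Definition madd (alpha : mi) (i : 'I_n) : mi := fun j => (alpha j + (j == i))%N.

Lemma morder_madd (alpha : mi) i : morder (madd alpha i) = (morder alpha).+1.
Proof.
rewrite /morder /madd big_split /= (bigD1 i)//= [X in (_ + X)%N](bigD1 i)//= eqxx.
rewrite [X in (_ + (_ + X))%N]big1 ?addn0 ?addn1// => j /negbTE ->; by [].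
Qed.

Variables (T : Type) (D : 'I_n -> T -> T) (P : T -> Prop) (eqv : T -> T -> Prop).
Hypothesis PD : forall i f, P f -> P (D i f).
Hypothesis eqv_refl : forall f, eqv f f.
Hypothesis eqv_trans : forall f g h, eqv f g -> eqv g h -> eqv f h.

Lemma mpow_ind (Q : T -> Prop) : (forall i f, Q f -> Q (D i f)) ->
  forall alpha f, Q f -> Q (mpow D alpha f).
Proof.
move=> QD alpha f Qf; rewrite /mpow; elim: (enum 'I_n) => //= i s IH.
by elim: (alpha i) => //= m; exact: QD.
Qed.

Hypothesis D_eqv : forall i f g, P f -> P g -> eqv f g -> eqv (D i f) (D i g).

Lemma mpow_eqv alpha f g : P f -> P g -> eqv f g -> eqv (mpow D alpha f) (mpow D alpha g).
Proof.
move=> Pf Pg fg; rewrite /mpow.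
suff : [/\ P (foldr (fun i => iter (alpha i) (D i)) f (enum 'I_n)),
    P (foldr (fun i => iter (alpha i) (D i)) g (enum 'I_n)) &
    eqv (foldr (fun i => iter (alpha i) (D i)) f (enum 'I_n))
        (foldr (fun i => iter (alpha i) (D i)) g (enum 'I_n))] by case.
elim: (enum 'I_n) => //= i s IH; elim: (alpha i) => //= m [Pf' Pg' fg'].
by split; [exact: PD|exact: PD|exact: D_eqv].
Qed.

Hypothesis D_comm : forall i j f, P f -> eqv (D i (D j f)) (D j (D i f)).

Let fold (s : seq 'I_n) (alpha : mi) f := foldr (fun i => iter (alpha i) (D i)) f s.

Let P_iter i m f : P f -> P (iter m (D i) f).
Proof. by move=> Pf; elim: m => //= m; exact: PD. Qed.

Let P_fold s alpha f : P f -> P (fold s alpha f).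
Proof. by move=> Pf; elim: s => //= i s IH; exact: P_iter. Qed.

Let iter_eqv i m f g : P f -> P g -> eqv f g -> eqv (iter m (D i) f) (iter m (D i) g).
Proof. by move=> Pf Pg fg; elim: m => //= m IH; apply: D_eqv => //; exact: P_iter. Qed.

Let iter_comm i j m f : P f -> eqv (D i (iter m (D j) f)) (iter m (D j) (D i f)).
Proof.
move=> Pf; elim: m => [|m IH] /=; first exact: eqv_refl.
apply: eqv_trans (D_comm _ _ (P_iter _ _ Pf)) _.
by apply: D_eqv => //; [apply: PD; exact: P_iter|apply: P_iter; exact: PD].
Qed.

Let fold_comm i s alpha f : P f -> eqv (D i (fold s alpha f)) (fold s alpha (D i f)).
Proof.
move=> Pf; elim: s => [|j s IH] /=; first exact: eqv_refl.
apply: eqv_trans (iter_comm _ _ _ (P_fold _ _ Pf)) _.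
by apply: iter_eqv => //; [apply: PD; exact: P_fold|apply: P_fold; exact: PD].
Qed.

(** [mpow] applies the operators in a fixed order of the indices, so the additional [D i] must be
    commuted to its place. Commutation is assumed on a class [P] and up to [eqv] only: derivatives
    of kernels will commute for regular kernels, and at [x] in [Omega]. *)
Lemma mpow_madd alpha i f : P f -> eqv (mpow D (madd alpha i) f) (mpow D alpha (D i f)).
Proof.
move=> Pf; rewrite /mpow -/(fold _ (madd alpha i) f) -/(fold _ alpha (D i f)).
have := mem_enum 'I_n i; have := enum_uniq 'I_n; rewrite inE.
elim: (enum 'I_n) => //= j s IH /andP[js us].
have fold_notin : i \notin s -> fold s (madd alpha i) f = fold s alpha f.
  elim: (s) => //= l s' IH'; rewrite inE negb_or => /andP[il /IH' ->].
  by rewrite /madd [l == i]eq_sym (negbTE il) addn0.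
rewrite inE => /predU1P[ij|is_].
  rewrite -ij in js *; rewrite fold_notin// {1}/madd eqxx addn1 iterSr.
  apply: iter_eqv; [by apply: PD; exact: P_fold|by apply: P_fold; exact: PD|exact: fold_comm].
have ji : (j == i) = false by apply: contraNF js => /eqP ->.
rewrite {1}/madd ji addn0; apply: iter_eqv; [exact: P_fold|by apply: P_fold; exact: PD|exact: IH].
Qed.

End MultiIndexPowers.

(** * Test functions *)

Section TestRealModule.
Context {k : scalar_kind} {R : realType} {n : nat} {Omega : set 'rV[R]_n}.

(* A real module for both kinds of scalars, so that the calculus of curves in
   real modules with seminorms applies. *)
Definition rtest : Type := testfun k Omega.
HB.instance Definition _ := GRing.Zmodule.on rtest.

Definition rtest_scale (a : R) (phi : rtest) : rtest := rscal a *: (phi : testfun k Omega).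

Fact rtest_scaleA a b phi : rtest_scale a (rtest_scale b phi) = rtest_scale (a * b) phi.
Proof. by rewrite /rtest_scale scalerA rscalM. Qed.

Fact rtest_scale1 : left_id 1 rtest_scale.
Proof. by move=> phi; rewrite /rtest_scale rscal1 scale1r. Qed.

Fact rtest_scaleDr : right_distributive rtest_scale +%R.
Proof. by move=> a phi psi; rewrite /rtest_scale scalerDr. Qed.

Fact rtest_scaleDl phi : {morph rtest_scale^~ phi : a b / a + b}.
Proof. by move=> a b; rewrite /rtest_scale rscalD scalerDl. Qed.

HB.instance Definition _ := GRing.Zmodule_isLmodule.Build R rtest
  rtest_scaleA rtest_scale1 rtest_scaleDr rtest_scaleDl.

End TestRealModule.
Arguments rtest k {R n} Omega.

Section TestFunctions.
Context {k : scalar_kind} {R : realType} {n : nat} {Omega : set 'rV[R]_n}.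
Local Notation K := (scal k R).
Local Notation E := 'rV[R]_n.
Local Notation D := (testfun k Omega).
Local Notation setTo := (@openT E).

Lemma test_is_test (phi : D) : is_test Omega phi.
Proof. by have := testP phi; rewrite inE. Qed.

Lemma test_csm (phi : D) : csm dirE setT (phi : E -> K).
Proof. by have [sf _ _] := test_is_test phi; exact: smooth_on_csm. Qed.

Lemma test_eq (phi psi : D) : (forall y, phi y = psi y) -> phi = psi.
Proof. by move=> H; apply/val_inj/funext. Qed.

Lemma testD (phi psi : D) y : (phi + psi) y = (phi y + psi y :> K).
Proof. by []. Qed.

Lemma testZ (a : K) (phi : D) y : (a *: phi) y = (a * phi y :> K).
Proof. by []. Qed.

Lemma testN (phi : D) y : (- phi) y = (- (phi y) :> K).
Proof. by []. Qed.

Lemma test0 y : (0 : D) y = 0 :> K.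
Proof. by []. Qed.

Lemma test_sum (J : Type) (r : seq J) (F : J -> D) y :
  (\sum_(j <- r) F j) y = (\sum_(j <- r) F j y : K).
Proof. by elim: r => [|j r IH]; rewrite ?big_nil// !big_cons -IH. Qed.

Lemma supp_sub (f : E -> K) (L : set E) : closed L -> (forall y, ~ L y -> f y = 0) -> supp f `<=` L.
Proof.
move=> cL H y sy; rewrite (closure_id L).1//; apply: closureS sy => z /= fz.
by apply: contrapT => /H.
Qed.

Lemma supp_out (f : E -> K) y : ~ supp f y -> f y = 0.
Proof. by move=> ns; apply: contrapT => fy; apply: ns; exact: subset_closure. Qed.

Lemma test_out (phi : D) y : ~ Omega y -> phi y = 0 :> K.
Proof. by move=> ny; apply: supp_out => sy; apply: ny; have [_ _] := test_is_test phi; exact. Qed.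

Lemma is_test_intro (f : E -> K) (L : set E) : csm dirE setT f -> compact L -> L `<=` Omega ->
  (forall y, ~ L y -> f y = 0) -> is_test Omega f.
Proof.
move=> sf cL LO H; have cl : closed L by apply: compact_closed => //; exact: norm_hausdorff.
split; first exact (csm_smooth_on setTo sf).
  by apply: subclosed_compact cL _; [exact: closed_closure|exact: supp_sub].
by move=> y /(supp_sub cl H)/LO.
Qed.

Lemma mktest_ex : {mk : (E -> K) -> D | forall f, is_test Omega f -> mk f = f :> (E -> K)}.
Proof. by exists (insubd (0 : D)) => f tf; rewrite insubdK// inE. Qed.

(** A total constructor, so that families of test functions can be given by formulas; nothing is
    known of its value outside [is_test]. *)
Definition mktest : (E -> K) -> D := projT1 mktest_ex.

Lemma mktestE (f : E -> K) : is_test Omega f -> mktest f = f :> (E -> K).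
Proof. exact: projT2 mktest_ex f. Qed.

Lemma kderive_out (f : E -> K) (L : set E) v x l : closed L -> (forall y, ~ L y -> f y = 0) ->
  ~ L x -> kderive x v f l -> l = 0.
Proof.
move=> cL H nx fl; apply: kderive_unique fl _.
apply: near_kderive (kderive_cst x v 0); have oL : open (~` L) by exact: closed_openC.
by apply: filterS (open_nbhs_nbhs (conj oL nx)) => y /H.
Qed.

Lemma partial_out (f : E -> K) (L : set E) i y : csm dirE setT f -> closed L ->
  (forall y, ~ L y -> f y = 0) -> ~ L y -> partial i f y = 0.
Proof.
by move=> sf cL H ny; have [_ /(_ y I)] := csm_partial setTo i sf; exact: kderive_out cL H ny.
Qed.

Lemma dtest_is_test i (phi : D) : is_test Omega (partial i phi).
Proof.
have [_ cs sO] := test_is_test phi; have sf := test_csm phi.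
apply: (is_test_intro (L := supp phi)) => //; first by have [] := csm_partial setTo i sf.
by move=> y ny; exact (partial_out i sf (@closed_closure _ _) (@supp_out phi) ny).
Qed.

Lemma dtest_ex : {dt : 'I_n -> D -> D | forall i phi, dt i phi = partial i phi :> (E -> K)}.
Proof. by exists (fun i phi => mktest (partial i phi)) => i phi; exact/mktestE/dtest_is_test. Qed.

Definition dtest : 'I_n -> D -> D := projT1 dtest_ex.

Lemma dtestE i (phi : D) : dtest i phi = partial i phi :> (E -> K).
Proof. exact: projT2 dtest_ex i phi. Qed.

Lemma dtest_kderive i (phi : D) y : kderive y (delta_mx 0 i) (phi : E -> K) (dtest i phi y).
Proof. by rewrite dtestE; have [_ +] := csm_partial setTo i (test_csm phi); exact. Qed.

Lemma dtestD i (phi psi : D) : dtest i (phi + psi) = dtest i phi + dtest i psi.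
Proof.
apply: test_eq => y; apply: kderive_unique (dtest_kderive _ _ _) _.
exact: kderiveD (dtest_kderive _ _ _) (dtest_kderive _ _ _).
Qed.

Lemma dtestZ i (a : K) (phi : D) : dtest i (a *: phi) = a *: dtest i phi.
Proof.
apply: test_eq => y; apply: kderive_unique (dtest_kderive _ _ _) _.
have := kderiveM (kderive_cst y (delta_mx 0 i) a) (dtest_kderive i phi y).
by rewrite mul0r add0r.
Qed.

Lemma dtestC i j (phi : D) : dtest i (dtest j phi) = dtest j (dtest i phi).
Proof.
apply: test_eq => y; rewrite (dtestE i (dtest j phi)) (dtestE j phi) (dtestE j (dtest i phi)) (dtestE i phi).
exact (partialC i j setTo (test_csm phi) Logic.I).
Qed.

Lemma mpow_dtest alpha (phi : D) : mpow partial alpha phi = mpow dtest alpha phi :> (E -> K).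
Proof.
rewrite /mpow; elim: (enum 'I_n) => //= i s ->.
by elim: (alpha i) => //= m ->; rewrite dtestE.
Qed.

Lemma mpow_dtest_madd alpha i (phi : D) :
  mpow dtest (madd alpha i) phi = mpow dtest alpha (dtest i phi).
Proof.
apply: (@mpow_madd n D dtest (fun=> True) eq) => //; last by move=> *; exact: dtestC.
- by move=> f g h -> ->.
- by move=> j f g _ _ ->.
Qed.

Lemma mpow_dtestD alpha (phi psi : D) :
  mpow dtest alpha (phi + psi) = mpow dtest alpha phi + mpow dtest alpha psi.
Proof.
rewrite /mpow; elim: (enum 'I_n) => //= i s ->.
by elim: (alpha i) => //= m ->; rewrite dtestD.
Qed.

Lemma mpow_dtestZ alpha a (phi : D) : mpow dtest alpha (a *: phi) = a *: mpow dtest alpha phi.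
Proof.
rewrite /mpow; elim: (enum 'I_n) => //= i s ->.
by elim: (alpha i) => //= m ->; rewrite dtestZ.
Qed.

Lemma kcont_modulus (f : E -> K) (x : E) : kcont x f -> {for x, continuous (fun y => modulus (f y))}.
Proof.
move=> [cr ci].
have c2 : {for x, continuous (fun y => sre (f y) ^+ 2 + sim (f y) ^+ 2)}.
  rewrite (_ : (fun y => _) = ((sre \o f) * (sre \o f) + (sim \o f) * (sim \o f))); last first.
    by apply/funext => y.
  by apply: continuousD; apply: continuousM.
exact: (continuous_comp c2 (@sqrt_continuous R _)).
Qed.

Lemma test_bounded (phi : D) : exists2 B : R, 0 <= B & forall y, modulus (phi y) <= B.
Proof.
have [_ cs _] := test_is_test phi.
have [B B0 HB] := @compact_continuous_bounded R E (fun y => modulus (phi y)) (supp phi) cs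
  (fun y _ => kcont_modulus (csm_cont (test_csm phi) I)).
exists B => // y; have [sy|ny] := pselect (supp phi y).
  by rewrite (le_trans _ (HB y sy))// ler_norm.
by rewrite supp_out ?modulus0.
Qed.

(** Multi-indices of order at most [m] have entries at most [m], hence come from a finite type of
    finite functions, over which the absolute values are summed. *)
Lemma finitely_many_bound (m : nat) (F : multi_index n -> R) :
  exists B : R, forall alpha, (morder alpha <= m)%N -> F alpha <= B.
Proof.
pose mi (a : {ffun 'I_n -> 'I_m.+1}) : multi_index n := fun i => a i.
exists (\sum_(a : {ffun 'I_n -> 'I_m.+1}) `|F (mi a)|) => alpha am.
have ai i : (alpha i < m.+1)%N.
  by rewrite ltnS (leq_trans _ am)// /morder (bigD1 i)//= leq_addr.
rewrite (bigD1 [ffun i => Ordinal (ai i)])//=.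
rewrite (_ : mi _ = alpha); last by apply/funext => i; rewrite /mi ffunE.
by rewrite (le_trans (ler_norm _))// lerDl sumr_ge0.
Qed.

Lemma Cnorm_ubound m (phi : D) : has_ubound [set r | exists (alpha : multi_index n) (x : E),
    (morder alpha <= m)%N /\ r = modulus (mpow partial alpha phi x)].
Proof.
have /choice[F HF] : forall alpha : multi_index n, exists B, forall y,
    modulus (mpow dtest alpha phi y) <= B.
  by move=> alpha; have [B _ HB] := test_bounded (mpow dtest alpha phi); exists B.
have [B HB] := finitely_many_bound m F.
exists B => _ [alpha [x [am ->]]]; rewrite mpow_dtest (le_trans _ (HB alpha am))//.
Qed.

Lemma le_Cnorm m (phi : D) alpha y : (morder alpha <= m)%N ->
  modulus (mpow dtest alpha phi y) <= Cnorm m phi.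
Proof.
move=> am; apply: ub_le_sup; first exact: Cnorm_ubound.
by exists alpha, y; rewrite mpow_dtest.
Qed.

Lemma Cnorm_le m (phi : D) B :
  (forall alpha y, (morder alpha <= m)%N -> modulus (mpow dtest alpha phi y) <= B) ->
  Cnorm m phi <= B.
Proof.
move=> H; apply: ge_sup => [|_ [alpha [x [am ->]]]]; last by rewrite mpow_dtest; exact: H.
exists (modulus (mpow partial (fun=> 0%N) phi 0)), (fun=> 0%N), 0; split => //.
by rewrite /morder big1.
Qed.

Lemma mpow0 (T : Type) (A : 'I_n -> T -> T) (f : T) : mpow A (fun=> 0%N) f = f.
Proof. by rewrite /mpow; elim: (enum 'I_n). Qed.

Lemma test_le_Cnorm m (phi : D) y : modulus (phi y) <= Cnorm m phi.
Proof.
by have := @le_Cnorm m phi (fun=> 0%N) y; rewrite mpow0; apply; rewrite /morder big1.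
Qed.

Lemma Cnorm_ge0 m (phi : D) : 0 <= Cnorm m phi.
Proof. exact: le_trans (modulus_ge0 _) (test_le_Cnorm m phi 0). Qed.

Lemma Cnorm_dtest m i (phi : D) : Cnorm m (dtest i phi) <= Cnorm m.+1 phi.
Proof.
apply: Cnorm_le => alpha y am; rewrite -mpow_dtest_madd; apply: le_Cnorm.
by rewrite morder_madd.
Qed.

Lemma eval_seminorm y : continuous_seminorm (fun phi : D => modulus (phi y)).
Proof.
split; first split=> [phi|phi psi|a phi]; first exact: modulus_ge0.
- by rewrite testD; exact: modulusD.
- by rewrite testZ modulusM.
by move=> L _; exists 0%N, 1 => phi _; rewrite mul1r; exact: test_le_Cnorm.
Qed.

Lemma dtest_supp i (phi : D) L : closed L -> supp phi `<=` L -> supp (dtest i phi) `<=` L.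
Proof.
move=> cL sL; apply: supp_sub => // y ny; rewrite dtestE.
apply (partial_out i (test_csm phi) cL (L := L)) => // z nz.
by apply: supp_out => /sL.
Qed.

Lemma cpt_in_closed (L W : set E) : cpt_in L W -> closed L.
Proof. by move=> [cL _]; apply: compact_closed => //; exact: norm_hausdorff. Qed.

Lemma dtest_seminorm i (p : D -> R) :
  continuous_seminorm p -> continuous_seminorm (p \o dtest i).
Proof.
move=> [[p0 pD pZ] pc]; split; first split=> [phi|phi psi|a phi] /=; first exact: p0.
- by rewrite dtestD; exact: pD.
- by rewrite dtestZ.
move=> L cL; have [m [C H]] := pc L cL; exists m.+1, `|C| => phi sL /=.
rewrite (le_trans (H _ (dtest_supp (cpt_in_closed cL) sL)))//.
rewrite (le_trans (ler_wpM2r (Cnorm_ge0 _ _) (ler_norm C)))//.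
by rewrite ler_wpM2l// Cnorm_dtest.
Qed.

Definition PPD : set (rtest k Omega -> R) := @continuous_seminorm k R n Omega.

Lemma PPD_seminorm p : PPD p -> rseminorm p.
Proof.
move=> [[p0 pD pZ] _]; split=> // a phi.
by have := pZ (rscal a) phi; rewrite modulus_rscal.
Qed.

Lemma PPD_sep (phi : rtest k Omega) : (forall p, PPD p -> p phi = 0) -> phi = 0.
Proof.
move=> H; apply: test_eq => y; rewrite test0; apply: modulus_eq0.
exact: H (eval_seminorm y).
Qed.

Lemma test_curve_derivativeP (c d : R -> D) : test_curve_derivative c d <->
  forall p t, PPD p -> pderive (V := rtest k Omega) p c t (d t).
Proof.
pose V := rtest k Omega.
have key (p : V -> R) t h : PPD p -> h != 0 ->
    p (mkscalar h^-1 0 *: (c (h + t) - c t) - d t) =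
    `|h|^-1 * p ((c (t + h) : V) - c t - h *: (d t : V)).
  move=> Pp h0; have sp := PPD_seminorm Pp; rewrite -normfV -(rsemZ sp).
  congr p; rewrite [in RHS]scalerBr scalerA mulVf// scale1r [t + h]addrC.
  by [].
split=> H p t Pp.
- have /cvgrPdist_le H1 := H p t Pp; move=> e e0.
  have /dnbhs0_ball[d0 d00 dP] := H1 e e0; exists d0 => // h hd.
  have sp := PPD_seminorm Pp.
  have [->|h0] := eqVneq h 0.
    by rewrite scale0r addr0 !subrr (rsem0 sp) normr0 mulr0.
  have := dP h h0 hd; rewrite sub0r normrN /= key// ger0_norm; last first.
    by rewrite mulr_ge0 ?invr_ge0// (rsem_ge0 sp).
  by rewrite mulrC ler_pdivrMr ?normr_gt0.
- apply/cvgrPdist_le => e e0; apply/dnbhs0_ball; have [d0 d00 dP] := H p t Pp e e0.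
  exists d0 => // h h0 hd; have sp := PPD_seminorm Pp.
  rewrite sub0r normrN /= key// ger0_norm; last first.
    by rewrite mulr_ge0 ?invr_ge0// (rsem_ge0 sp).
  by rewrite mulrC ler_pdivrMr ?normr_gt0//; exact: dP.
Qed.

Lemma smooth_test_curveP (c : R -> D) : smooth_test_curve c <->
  exists d, tower (V := rtest k Omega) PPD c d.
Proof.
split=> [[d [d0 H]]|[d [d0 H]]]; exists d; split => // m.
  by move=> t p Pp; exact: ((test_curve_derivativeP _ _).1 (H m)).
by apply/test_curve_derivativeP => p t Pp; exact: H.
Qed.

End TestFunctions.

(** * Smooth families of test functions *)

Section TestValuedMaps.
Context {k : scalar_kind} {R : realType} {n : nat} {Omega : set 'rV[R]_n}.
Local Notation K := (scal k R).
Local Notation E := 'rV[R]_n.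
Local Notation D := (testfun k Omega).
Local Notation V := (rtest k Omega).
Hypothesis Oo : open Omega.
Local Notation PPD := (@PPD k R n Omega).
Implicit Types (g h : E -> D) (u : D -> K).

Definition xderive g (i : 'I_n) (x : E) (l : D) : Prop :=
  forall p, PPD p -> pderive (V := V) p (fun s => g (x + s *: delta_mx 0 i)) 0 l.

Definition xcont g (x : E) : Prop := forall p, PPD p -> pcont (V := V) p g x.

(** The analogue of [csm] for families of test functions, with limits in every continuous seminorm.
    Convergence in D(Omega), and not merely of the values at each [y], is what allows a distribution
    to be applied. *)
Definition dsm g : Prop := exists C : set (E -> D), C g /\ forall h, C h ->
  (forall x, Omega x -> xcont h x) /\
  forall i, exists h', C h' /\ forall x, Omega x -> xderive h i x (h' x).

Lemma dsm_cont g x : dsm g -> Omega x -> xcont g x.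
Proof. by move=> [C [Cg CP]]; have [+ _] := CP _ Cg; exact. Qed.

Lemma dsm_deriv g i : dsm g ->
  exists g', dsm g' /\ forall x, Omega x -> xderive g i x (g' x).
Proof.
move=> [C [Cg CP]]; have [_ /(_ i)[g' [Cg' dg]]] := CP _ Cg.
by exists g'; split => //; exists C.
Qed.

(** Boman's theorem: the maps [mixed ws] are continuous on [Omega] and form a class stable under
    derivation, and the empty list gives back [g]. *)
Lemma dsm_of_curves g :
  (forall c : R -> E, smooth_curve c -> (forall t, Omega (c t)) -> smooth_test_curve (g \o c)) ->
  dsm g.
Proof.
move=> Hg.
have Hf (c : R -> E) : smooth_curve c -> (forall t, Omega (c t)) ->
    exists d, tower (V := V) PPD (g \o c) d.
  by move=> sc cO; apply/smooth_test_curveP; exact: Hg.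
pose M ws : E -> D := mixed (V := V) PPD g ws.
exists [set h | exists ws, forall x, Omega x -> h x = M ws x]; split.
  exists [::] => x Ox; rewrite /M.
  by rewrite (mixed_nil (@PPD_seminorm k R n Omega) (@PPD_sep k R n Omega) Oo Hf Ox).
move=> h [ws hE]; split=> [x Ox p Pp|i].
  move=> e e0; have [d1 d10 H1] := mixed_pcont (@PPD_seminorm k R n Omega) (@PPD_sep k R n Omega) Oo Hf ws Pp Ox e0.
  have [d2 d20 H2] := open_ballP Oo Ox.
  exists (Num.min d1 d2); first by rewrite lt_min d10.
  by move=> y; rewrite lt_min => /andP[/H1 h1 /H2 Oy]; rewrite !hE.
exists (M (delta_mx 0 i :: ws)); split; first by exists (delta_mx 0 i :: ws).
move=> x Ox p Pp.
have H := mixed_pderive (@PPD_seminorm k R n Omega) (@PPD_sep k R n Omega) Oo Hf ws (delta_mx 0 i) Pp Ox.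
have [r r0 HO] := open_ballP Oo Ox.
apply: pderive_near r0 _ H => s sr; rewrite add0r hE//; apply: HO.
rewrite addrC addKr normrZ (le_lt_trans _ sr)// ler_piMr//; exact: norm_delta_le.
Qed.

Lemma dsmD g h : dsm g -> dsm h -> dsm (fun x => g x + h x).
Proof.
move=> sg sh; exists [set w | exists g h, [/\ dsm g, dsm h & w = fun x => g x + h x]].
split; first by exists g, h.
move=> _ {g h sg sh} [g [h [sg sh ->]]]; split=> [x Ox p Pp e e0|i].
  have sp := PPD_seminorm Pp; have e20 : 0 < e / 2 by rewrite divr_gt0.
  have [d1 d10 H1] := dsm_cont sg Ox Pp e20; have [d2 d20 H2] := dsm_cont sh Ox Pp e20.
  exists (Num.min d1 d2); first by rewrite lt_min d10.
  move=> y; rewrite lt_min => /andP[/H1 h1 /H2 h2].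
  by rewrite opprD addrACA (le_trans (rsemD sp _ _))// (splitr e) lerD.
have [g' [sg' dg]] := dsm_deriv i sg; have [h' [sh' dh]] := dsm_deriv i sh.
exists (fun x => g' x + h' x); split; first by exists g', h'.
move=> x Ox p Pp; exact: (pderiveD (PPD_seminorm Pp) (dg x Ox p Pp) (dh x Ox p Pp)).
Qed.

Lemma xderiveD g h i x a b : xderive g i x a -> xderive h i x b ->
  xderive (fun x => g x + h x) i x (a + b).
Proof.
by move=> dg dh p Pp; exact: (pderiveD (PPD_seminorm Pp) (dg p Pp) (dh p Pp)).
Qed.

Lemma dtestB j (phi psi : D) : dtest j (phi - psi) = dtest j phi - dtest j psi.
Proof. by rewrite dtestD -scaleN1r dtestZ scaleN1r. Qed.

Lemma xderive_dtest g i j x l : xderive g i x l -> xderive (fun x => dtest j (g x)) i x (dtest j l).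
Proof.
move=> H p Pp e e0; have [d d0 P1] := H _ (dtest_seminorm j Pp) e e0.
exists d => // s /P1.
have E1 (a b : D) : dtest j a - dtest j b - rscal s *: dtest j l = dtest j (a - b - rscal s *: l).
  by rewrite !dtestB dtestZ.
have := E1 (g (x + (0 + s) *: delta_mx 0 i)) (g (x + 0 *: delta_mx 0 i)).
by move=> E2 H1; move: H1; rewrite /= -E2.
Qed.

Lemma dsm_dtest j g : dsm g -> dsm (fun x => dtest j (g x)).
Proof.
move=> sg; exists [set w | exists2 g, dsm g & w = fun x => dtest j (g x)].
split; first by exists g.
move=> _ {g sg} [g sg ->]; split=> [x Ox p Pp e e0|i].
  have [d d0 H] := dsm_cont sg Ox (dtest_seminorm j Pp) e0; exists d => // y /H /=.
  by rewrite dtestB.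
have [g' [sg' dg]] := dsm_deriv i sg.
exists (fun x => dtest j (g' x)); split; first by exists g'.
by move=> x Ox; apply: xderive_dtest; exact: dg.
Qed.

Lemma distributionB u phi psi : distributions k Omega u -> u (phi - psi) = u phi - u psi.
Proof. by move=> [uD uZ _]; rewrite uD -scaleN1r uZ mulN1r. Qed.

Lemma distribution0 u : distributions k Omega u -> u 0 = 0.
Proof. by move=> [_ uZ _]; rewrite -(scale0r 0) uZ mul0r. Qed.

Lemma distribution_sum u (J : Type) (r : seq J) (F : J -> D) : distributions k Omega u ->
  u (\sum_(j <- r) F j) = \sum_(j <- r) u (F j).
Proof.
move=> du; elim: r => [|j r IH]; first by rewrite !big_nil distribution0.
by rewrite !big_cons -IH; case: du.
Qed.

Lemma eval_distribution y : distributions k Omega (fun phi : D => phi y).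
Proof. by split => //; exact: eval_seminorm. Qed.

Lemma pderive_distribution u (c : R -> D) t l : distributions k Omega u ->
  (forall p, PPD p -> pderive (V := V) p c t l) -> kderive (t : R) 1 (u \o c) (u l).
Proof.
move=> du dg; have [uD uZ up] := du.
have H := dg _ up.
have ue s : u (c (t + s)) - u (c t) - rscal s * u l = u (c (t + s) - c t - rscal s *: l).
  by rewrite !distributionB// uZ.
split; apply/is_deriveP => e /H[d d0 P1]; exists d => // s /P1; apply: le_trans;
  rewrite [s *: 1]mulr1 /=.
- have := sre_le_modulus (u (c (t + s) - c t - rscal s *: l)).
  by rewrite -ue !sreD !sreN sreM sre_rscal sim_rscal mul0r subr0.
- have := sim_le_modulus (u (c (t + s) - c t - rscal s *: l)).
  by rewrite -ue !simD !simN simM sre_rscal sim_rscal mul0r addr0.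
Qed.

Lemma xderive_distribution u g i x l : distributions k Omega u -> xderive g i x l ->
  kderive x (delta_mx 0 i) (fun x => u (g x)) (u l).
Proof.
move=> du dg; have [Hr Hi] := pderive_distribution du dg.
split; [apply/is_derive_line; exact: Hr|apply/is_derive_line; exact: Hi].
Qed.

Lemma xcont_distribution u g x : distributions k Omega u -> xcont g x ->
  kcont x (fun x => u (g x)).
Proof.
move=> du cg; have [_ _ up] := du.
split; apply/continuous_normP => e /(cg _ up)[d d0 H]; exists d => // y /H; apply: le_trans.
- have := sre_le_modulus (u (g y - g x)); by rewrite distributionB// sreD sreN.
- have := sim_le_modulus (u (g y - g x)); by rewrite distributionB// simD simN.
Qed.

Lemma dsm_distribution u g : distributions k Omega u -> dsm g -> csm dirE Omega (fun x => u (g x)).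
Proof.
move=> du sg; exists [set w | exists2 g, dsm g & w = fun x => u (g x)]; split; first by exists g.
move=> _ {g sg} [g sg ->]; split=> [x Ox|i].
  by apply: xcont_distribution => //; exact: dsm_cont.
have [g' [sg' dg]] := dsm_deriv i sg.
exists (fun x => u (g' x)); split; first by exists g'.
by move=> x Ox; apply: xderive_distribution => //; exact: dg.
Qed.

(** A single family [h] serves all distributions. With evaluation at [y] it is identified as the
    derivative of the kernel; with [u] it gives the derivative of [u] along the family. *)
Lemma mpow_distribution alpha g : dsm g -> exists2 h, dsm h &
  forall u F, distributions k Omega u -> (forall x, Omega x -> F x = u (g x)) ->
  forall x, Omega x -> mpow partial alpha F x = u (h x).
Proof.
move=> sg.
pose Q (op : (E -> K) -> E -> K) := exists2 h, dsm h &
  forall u F, distributions k Omega u -> (forall x, Omega x -> F x = u (g x)) ->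
  forall x, Omega x -> op F x = u (h x).
have Qp i op : Q op -> Q (fun F => partial i (op F)).
  move=> [h sh hE]; have [h' [sh' dh]] := dsm_deriv i sh; exists h' => // u F du FE x Ox.
  rewrite (partial_eq Oo (hE u F du FE))//.
  exact: kderive_partial (xderive_distribution du (dh x Ox)).
rewrite /mpow; elim: (enum 'I_n) => [|i s IH] /=; first by exists g.
by elim: (alpha i) => [|m IHm] //=; apply: (Qp i _ IHm).
Qed.

(** Kernels that come from a smooth family of test functions for [x] in [Omega]. Outside [Omega] the
    extension by zero need not be differentiable in [x]; hence the relation [keq], which compares
    kernels at [x] in [Omega] only. On [kreg] the operators [partialx], [partialy] and [partialxy]
    are stable, additive and commuting up to [keq]. *)
Definition kreg (F : E -> E -> K) : Prop :=
  exists2 g, dsm g & forall x, Omega x -> F x = g x :> (E -> K).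

Definition keq (F G : E -> E -> K) : Prop := forall x, Omega x -> F x = G x.

Lemma keq_refl F : keq F F. Proof. by []. Qed.
Lemma keq_sym F G : keq F G -> keq G F. Proof. by move=> H x Ox; rewrite H. Qed.
Lemma keq_trans F G H : keq F G -> keq G H -> keq F H.
Proof. by move=> FG GH x Ox; rewrite FG// GH. Qed.

Lemma partialx_eq i F G : keq F G -> keq (partialx i F) (partialx i G).
Proof.
move=> FG x Ox; apply/funext => y; rewrite /partialx; apply: (partial_eq Oo) => // z Oz.
by rewrite FG.
Qed.

Lemma partialy_eq i F G : keq F G -> keq (partialy i F) (partialy i G).
Proof. by move=> FG x Ox; apply/funext => y; rewrite /partialy FG. Qed.

Lemma partialx_kreg i F : kreg F -> exists2 g, dsm g & exists2 g', dsm g' &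
  [/\ keq F (fun x => g x), keq (partialx i F) (fun x => g' x) &
      forall x, Omega x -> xderive g i x (g' x)].
Proof.
move=> [g sg gE]; have [g' [sg' dg]] := dsm_deriv i sg; exists g => //; exists g' => //.
split => // x Ox; apply/funext => y; rewrite /partialx.
rewrite (partial_eq (g := fun x => g x y) Oo)//; last by move=> z Oz; rewrite gE.
exact: kderive_partial (xderive_distribution (eval_distribution y) (dg x Ox)).
Qed.

Lemma partialy_kreg i F g : keq F (fun x => g x) -> keq (partialy i F) (fun x => dtest i (g x)).
Proof. by move=> FE x Ox; apply/funext => y; rewrite /partialy FE// dtestE. Qed.

Lemma kreg_partialx i F : kreg F -> kreg (partialx i F).
Proof. by move=> /(partialx_kreg i)[g sg [g' sg' [_ H _]]]; exists g'. Qed.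

Lemma kreg_partialy i F : kreg F -> kreg (partialy i F).
Proof.
move=> [g sg gE]; exists (fun x => dtest i (g x)); first exact: dsm_dtest.
exact: partialy_kreg.
Qed.

Lemma kregD F G : kreg F -> kreg G -> kreg (fun x y => F x y + G x y).
Proof.
move=> [g sg gE] [h sh hE]; exists (fun x => g x + h x); first exact: dsmD.
by move=> x Ox; apply/funext => y; rewrite gE// hE.
Qed.

Lemma kreg_partialxy i F : kreg F -> kreg (partialxy i F).
Proof. by move=> rF; apply: kregD; [exact: kreg_partialx|exact: kreg_partialy]. Qed.

Lemma partialxy_eq i F G : keq F G -> keq (partialxy i F) (partialxy i G).
Proof.
move=> FG x Ox; apply/funext => y; rewrite /partialxy.
by rewrite (partialx_eq i FG)// (partialy_eq i FG).
Qed.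

Lemma partialxC i j F : kreg F -> keq (partialx i (partialx j F)) (partialx j (partialx i F)).
Proof.
move=> [g sg gE] x Ox; apply/funext => y; rewrite /partialx.
apply: (partialC i j Oo _ Ox).
apply: (csm_ext Oo (dsm_distribution (eval_distribution y) sg)) => z Oz.
by rewrite gE.
Qed.

Lemma partialyC i j F : kreg F -> keq (partialy i (partialy j F)) (partialy j (partialy i F)).
Proof.
move=> [g sg gE]; apply: keq_trans (partialy_kreg i (partialy_kreg j gE)) _.
apply: keq_sym; apply: keq_trans (partialy_kreg j (partialy_kreg i gE)) _.
by move=> x Ox; rewrite dtestC.
Qed.

Lemma partialx_unique i F (g' : E -> D) : (exists2 g : E -> D, keq F (fun x => g x) &
  forall x, Omega x -> xderive g i x (g' x)) -> keq (partialx i F) (fun x => g' x).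
Proof.
move=> [g gE dg] x Ox; apply/funext => y; rewrite /partialx.
rewrite (partial_eq (g := fun x => g x y) Oo)//; last by move=> z Oz; rewrite gE.
exact: kderive_partial (xderive_distribution (eval_distribution y) (dg x Ox)).
Qed.

(** No symmetry argument in the pair [(x, y)] is involved: [dtest j] is linear and continuous on
    test functions, hence commutes with limits in [x]. *)
Lemma partialxyC' i j F : kreg F -> keq (partialx i (partialy j F)) (partialy j (partialx i F)).
Proof.
move=> rF; have [g sg [g' sg' [gE gE' dg]]] := partialx_kreg i rF.
apply: keq_trans (keq_sym (partialy_kreg j gE')).
apply: partialx_unique.
exists (fun x => dtest j (g x)); first exact: partialy_kreg.
by move=> x Ox; apply: xderive_dtest; exact: dg.
Qed.

Lemma partialxD i F G : kreg F -> kreg G ->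
  keq (partialx i (fun x y => F x y + G x y)) (fun x y => partialx i F x y + partialx i G x y).
Proof.
move=> rF rG; have [g sg [g' sg' [gE gE' dg]]] := partialx_kreg i rF.
have [h sh [h' sh' [hE hE' dh]]] := partialx_kreg i rG.
have H : keq (partialx i (fun x y => F x y + G x y)) (fun x => g' x + h' x).
  apply: partialx_unique.
  exists (fun x => g x + h x); first by move=> x Ox; apply/funext => y; rewrite gE// hE.
  by move=> x Ox; apply: xderiveD; [exact: dg|exact: dh].
by apply: keq_trans H _ => x Ox; apply/funext => y; rewrite gE'// hE'.
Qed.

Lemma partialyD i F G : kreg F -> kreg G ->
  keq (partialy i (fun x y => F x y + G x y)) (fun x y => partialy i F x y + partialy i G x y).
Proof.
move=> [g sg gE] [h sh hE].
have H : keq (fun x y => F x y + G x y) (fun x => g x + h x).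
  by move=> x Ox; apply/funext => y; rewrite gE// hE.
apply: keq_trans (partialy_kreg i H) _ => x Ox; apply/funext => y.
by rewrite dtestD /= (partialy_kreg i gE)// (partialy_kreg i hE).
Qed.

Lemma keqE F G x y : keq F G -> Omega x -> F x y = G x y.
Proof. by move=> FG Ox; rewrite FG. Qed.

Lemma keqD F F' G G' : keq F F' -> keq G G' ->
  keq (fun x y => F x y + G x y) (fun x y => F' x y + G' x y).
Proof. by move=> FF GG x Ox; apply/funext => y; congr (_ + _); exact: keqE. Qed.

Lemma partialxyD i F G : kreg F -> kreg G ->
  keq (partialxy i (fun x y => F x y + G x y)) (fun x y => partialxy i F x y + partialxy i G x y).
Proof.
move=> rF rG; apply: keq_trans (keqD (partialxD i rF rG) (partialyD i rF rG)) _.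
by move=> x Ox; apply/funext => y; rewrite addrACA.
Qed.

Lemma partialxy_yC i j F : kreg F ->
  keq (partialxy i (partialy j F)) (partialy j (partialxy i F)).
Proof.
move=> rF; apply: keq_trans (keqD (partialxyC' i j rF) (partialyC i j rF)) _.
exact: keq_sym (partialyD j (kreg_partialx i rF) (kreg_partialy i rF)).
Qed.

Lemma partialxy_xC i j F : kreg F ->
  keq (partialxy i (partialx j F)) (partialx j (partialxy i F)).
Proof.
move=> rF; apply: keq_trans (keqD (partialxC i j rF) (keq_sym (partialxyC' j i rF))) _.
exact: keq_sym (partialxD j (kreg_partialx i rF) (kreg_partialy i rF)).
Qed.

Lemma partialxyC i j F : kreg F -> keq (partialxy i (partialxy j F)) (partialxy j (partialxy i F)).
Proof.
move=> rF; apply: keq_trans (partialxyD i (kreg_partialx j rF) (kreg_partialy j rF)) _.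
exact: keqD (partialxy_xC i j rF) (partialxy_yC i j rF).
Qed.

End TestValuedMaps.

Section Extension.
Context {T U : Type} (A : set T) (v : U).

Lemma valL_in (f : A -> U) (w : A) : valL_ v f (val w) = f w.
Proof. by have := congr1 (@^~ w) (valLK v f). Qed.

Lemma valL_inE (f : A -> U) x (Ax : A x) : valL_ v f x = f (SigSub (mem_set Ax)).
Proof. exact: (valL_in f (SigSub (mem_set Ax))). Qed.

End Extension.

(** * Compact neighbourhoods and uniform estimates *)

Section Fattening.
Context {R : realType} {n : nat}.
Local Notation E := 'rV[R]_n.

(** A union of closed balls for the sup norm, which is the norm of row vectors; (LSK1) speaks of
    Euclidean balls, hence the comparison with [enorm]. *)
Definition fat (d : R) (L : set E) : set E := [set y | exists2 x, L x & `|y - x| <= d].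

Lemma compact_fat d (L : set E) : compact L -> compact (fat d L).
Proof.
move=> cL; have cB : compact [set z : E | `|z| <= d].
  apply: bounded_closed_compact.
    by exists d; split; [exact: num_real|move=> M dM z /= zd; rewrite (le_trans zd)// ltW].
  exact: (closed_comp (fun x _ => @norm_continuous _ _ x) (@closed_le R d)).
have -> : fat d L = (fun p : E * E => p.1 + p.2) @` (L `*` [set z : E | `|z| <= d]).
  apply/seteqP; split=> [y [x Lx yx]|_ [[x z] [/= Lx zd] <-]].
    by exists (x, y - x) => //=; rewrite addrC subrK.
  by exists x => //; rewrite addrC addKr.
apply: continuous_compact; last exact: compact_setX.
by apply: continuous_subspaceT => p; exact: add_continuous.
Qed.

Lemma fat_cpt_in (L W : set E) : open W -> cpt_in L W ->
  exists2 d : R, 0 < d & cpt_in (fat d L) W.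
Proof.
move=> oW [cL]; rewrite ((interior_id W).1 oW) => LW.
have := (compact_near_coveringP L).1 cL R (nbhs (0 : R))
  (fun d x => forall y, `|y - x| <= `|d| -> W y) _.
move=> /(_ _)[x /LW Wx|/= d d0 Hd].
  have [r r0 HW] := open_ballP oW Wx.
  exists ([set x' | `|x' - x| < r / 2], [set d : R | `|d| < r / 2]); first split => /=.
  - by apply/nbhs_ballP; exists (r / 2); [exact: divr_gt0|move=> y; rewrite -ball_normE /= distrC].
  - apply/nbhs_ballP; exists (r / 2); first exact: divr_gt0.
    by move=> y; rewrite -ball_normE /= sub0r normrN.
  move=> [x' d] /= [h1 h2] y yx'; apply: HW; rewrite -(subrKA x' y) (splitr r).
  by rewrite (le_lt_trans (ler_normD _ _))// ltrD// (le_lt_trans yx').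
exists (d / 2); first exact: divr_gt0.
split; first exact: compact_fat.
rewrite ((interior_id W).1 oW) => y [x Lx yx].
apply: (Hd (d / 2) _ x Lx y).
  by rewrite /= sub0r normrN ger0_norm ?divr_ge0 ?(ltW d0)// ltr_pdivrMr// ltr_pMr// ltr1n.
by rewrite (le_trans yx)// ler_norm.
Qed.

Lemma fat_interior d (L : set E) : 0 < d -> L `<=` (fat d L)°.
Proof.
move=> d0 x Lx; apply/nbhs_ballP; exists d => // y; rewrite -ball_normE /= => /ltW yx.
by exists x => //; rewrite distrC.
Qed.

Lemma norm_le_enorm (x : E) : `|x| <= enorm x.
Proof.
apply: norm_le_coord => [|i]; first exact: sqrtr_ge0.
rewrite -sqrtr_sqr ler_sqrt ?sumr_ge0// => [|j _]; last exact: sqr_ge0.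
by rewrite (bigD1 i)//= lerDl sumr_ge0// => j _; exact: sqr_ge0.
Qed.

Lemma enorm_le_norm (x : E) : enorm x <= n%:R * `|x|.
Proof.
have H : \sum_(i < n) x 0 i ^+ 2 <= (n%:R * `|x|) ^+ 2.
  apply: (@le_trans _ _ (\sum_(i < n) `|x| ^+ 2)).
    by apply: ler_sum => i _; rewrite -(real_normK (num_real (x 0 i))) lerXn2r ?nnegrE ?coord_le_norm.
  rewrite sumr_const card_ord -[_ *+ n]mulr_natl exprMn ler_wpM2r ?sqr_ge0// -natrX ler_nat.
  by case: (n) => // m; rewrite expnS leq_pmulr// expn_gt0.
by rewrite /enorm (le_trans (ler_wsqrtr H))// sqrtr_sqr ger0_norm ?mulr_ge0.
Qed.

End Fattening.

Section UniformBigO.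
Context {k : scalar_kind} {R : realType} {T : Type}.
Local Notation K := (scal k R).
Implicit Types (X : set T) (F G : @I01 R -> T -> K).

Lemma I01_gt0 (e : @I01 R) : 0 < val e.
Proof. by have /set_mem[] := valP e; case/andP. Qed.

Lemma I01_le1 (e : @I01 R) : val e <= 1.
Proof. by have /set_mem := valP e; rewrite /I01 /= => /andP[]. Qed.

Lemma bigO_eq X F G g : (forall e x, X x -> F e x = G e x) -> unif_bigO X F g -> unif_bigO X G g.
Proof.
move=> FG [e0 [C [e00 C0 H]]]; exists e0, C; split => // e x ee Xx.
by rewrite -FG//; exact: H.
Qed.

Lemma bigO_mono X F g h : (forall e : @I01 R, g (val e) <= h (val e)) ->
  unif_bigO X F g -> unif_bigO X F h.
Proof.
move=> gh [e0 [C [e00 C0 H]]]; exists e0, C; split => // e x ee Xx.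
by rewrite (le_trans (H e x ee Xx))// ler_wpM2l// ltW.
Qed.

Lemma bigOD X F G g : unif_bigO X F g -> unif_bigO X G g ->
  unif_bigO X (fun e x => F e x + G e x) g.
Proof.
move=> [e0 [C [e00 C0 H]]] [e1 [C1 [e10 C10 H1]]]; exists (Num.min e0 e1), (C + C1).
split; [by rewrite lt_min e00|exact: addr_gt0|].
move=> e x; rewrite le_min => /andP[h0 h1] Xx.
by rewrite (le_trans (modulusD _ _))// mulrDl lerD// ?H ?H1.
Qed.

Lemma bigON X F g : unif_bigO X F g -> unif_bigO X (fun e x => - F e x) g.
Proof.
move=> [e0 [C [e00 C0 H]]]; exists e0, C; split => // e x h Xx.
by rewrite modulusN; exact: H.
Qed.

Lemma exprN_mono (m p : nat) (e : @I01 R) : (m <= p)%N -> (val e) ^- m <= (val e) ^- p.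
Proof.
move=> mp; have e0 := I01_gt0 e.
rewrite lef_pV2 ?posrE ?exprn_gt0//.
by rewrite ler_wiXn2l ?(ltW e0)// I01_le1.
Qed.

End UniformBigO.

(** * Stability of kernel bounds under differentiation *)

Section Moderate.
Context {k : scalar_kind} {R : realType} {n : nat} {Omega : set 'rV[R]_n}.
Local Notation K := (scal k R).
Local Notation E := 'rV[R]_n.
Local Notation D := (testfun k Omega).
Hypothesis Oo : open Omega.
Implicit Types (phi : @I01 R -> Omega -> D) (u : D -> K).
Local Notation kregO := (@kreg k R n Omega).
Local Notation keqO := (@keq k R n Omega).

Definition slice phi (e : @I01 R) : E -> D := 'valL_0 (phi e).

Lemma kernel_slice phi e x : Omega x -> kernel_fun phi e x = slice phi e x :> (E -> K).
Proof. by move=> Ox; rewrite /kernel_fun /slice !(valL_inE _ _ Ox). Qed.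

Lemma slice_dsm phi e : smooth_kernel phi -> dsm (slice phi e).
Proof.
move=> sk; apply: (dsm_of_curves Oo) => c sc cO.
pose c' t : Omega := SigSub (mem_set (cO t)).
have := sk (fun=> e) c' _ _.
have -> : (fun t => phi e (c' t)) = slice phi e \o c.
  by apply/funext => t; rewrite -[RHS]/('valL_0 (phi e) (c t)) (valL_inE _ _ (cO t)).
by apply => //; apply: (@rsm_smooth_curve R (fun=> val e)); exact: rsm_cst.
Qed.

Lemma kernel_kreg phi e : smooth_kernel phi -> kregO (kernel_fun phi e).
Proof.
by move=> sk; exists (slice phi e); [exact: slice_dsm|move=> x; exact: kernel_slice].
Qed.

Lemma mpow_partialxE alpha (F : E -> E -> K) x y :
  mpow partialx alpha F x y = mpow partial alpha (fun x' => F x' y) x.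
Proof.
suff H : forall x, mpow partialx alpha F x y = mpow partial alpha (fun x' => F x' y) x by [].
rewrite /mpow; elim: (enum 'I_n) => //= i s IH {}x.
elim: (alpha i) x => //= m IHm x; rewrite {1}/partialx; congr (partial i _ x).
exact/funext.
Qed.

Lemma mpow_partialyE alpha (F : E -> E -> K) x :
  mpow partialy alpha F x = mpow partial alpha (F x).
Proof.
rewrite /mpow; elim: (enum 'I_n) => //= i s IH.
by elim: (alpha i) => //= m IHm; rewrite {1}/partialy IHm.
Qed.

(** The estimates of (LSK2) with [j] further powers of [1 / e]. Quantifying over all [a] and [b]
    makes the condition stable: [partialy] raises [j] by one, [partialxy] keeps it, and [partialx]
    is their difference. *)
Definition kernel_bound (L : set E) (j : nat) (F : @I01 R -> E -> E -> K) : Prop :=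
  (forall e, kregO (F e)) /\ forall a b : multi_index n,
    unif_bigO (L `*` Omega)
      (fun e z => mpow partialxy a (mpow partialy b (F e)) z.1 z.2)
      (fun e => e ^- (n + morder b + j)).

Let kreg_mpowy b (F : E -> E -> K) : kregO F -> kregO (mpow partialy b F).
Proof. by apply: mpow_ind => i f; exact: kreg_partialy. Qed.

Let mpowxy_eq a (F G : E -> E -> K) : kregO F -> kregO G ->
  keqO F G -> keqO (mpow partialxy a F) (mpow partialxy a G).
Proof.
apply: (@mpow_eqv n _ partialxy kregO keqO).
- by move=> i f; exact: kreg_partialxy.
- by move=> i f g _ _; exact: partialxy_eq.
Qed.

Let mpowy_madd b i (F : E -> E -> K) : kregO F ->
  keqO (mpow partialy (madd b i) F) (mpow partialy b (partialy i F)).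
Proof.
apply (@mpow_madd n (E -> E -> K) partialy kregO keqO).
- by move=> l f; exact: kreg_partialy.
- exact: keq_refl.
- exact: keq_trans.
- by move=> l f g _ _; exact: partialy_eq.
- by move=> l m f; exact: partialyC.
Qed.

Let mpowxy_madd b i (F : E -> E -> K) : kregO F ->
  keqO (mpow partialxy (madd b i) F) (mpow partialxy b (partialxy i F)).
Proof.
apply (@mpow_madd n (E -> E -> K) partialxy kregO keqO).
- by move=> l f; exact: kreg_partialxy.
- exact: keq_refl.
- exact: keq_trans.
- by move=> l f g _ _; exact: partialxy_eq.
- by move=> l m f; exact: partialxyC.
Qed.

Lemma kernel_bound_y (L : set E) j F i : L `<=` Omega ->
  kernel_bound L j F -> kernel_bound L j.+1 (fun e => partialy i (F e)).
Proof.
move=> LO [rF bF]; split=> [e|a b]; first exact: kreg_partialy.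
have := bF a (madd b i); rewrite morder_madd [(n + _.+1)%N]addnS addSnnS => H.
apply: bigO_eq H => e z [Lz _].
apply: (keqE _ _ (LO _ Lz)); apply: mpowxy_eq.
- exact/kreg_mpowy/rF.
- exact/kreg_mpowy/kreg_partialy/rF.
- exact: mpowy_madd (rF e).
Qed.

(** The new [partialxy i] acts before the derivatives in [y]; it has to be commuted past them before
    it can be absorbed into the multi-index [a]. *)
Lemma kernel_bound_xy (L : set E) j F i : L `<=` Omega ->
  kernel_bound L j F -> kernel_bound L j (fun e => partialxy i (F e)).
Proof.
move=> LO [rF bF]; split=> [e|a b]; first exact: kreg_partialxy.
have := bF (madd a i) b; apply: bigO_eq => e z [Lz _].
apply: (keqE _ _ (LO _ Lz)).
apply: (@keq_trans _ _ _ _ _ (mpow partialxy a (partialxy i (mpow partialy b (F e))))).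
  exact: mpowxy_madd (kreg_mpowy b (rF e)).
apply: mpowxy_eq.
- exact/(kreg_partialxy Oo)/kreg_mpowy/rF.
- exact/kreg_mpowy/(kreg_partialxy Oo)/rF.
have : kregO (F e) := rF e; move: (F e) => G.
rewrite /mpow; elim: (enum 'I_n) => //= l s IH rG.
have rH : kregO (foldr (fun i => iter (b i) (partialy i)) G s).
  elim: (s) => //= m s' IH'; elim: (b m) => //= q; exact: kreg_partialy.
have rH' : kregO (foldr (fun i => iter (b i) (partialy i)) (partialxy i G) s).
  elim: (s) => [|m s' IH'] /=; first exact: kreg_partialxy.
  by elim: (b m) => //= q; exact: kreg_partialy.
have {IH rG}IH := IH rG; elim: (b l) => //= m IHm.
apply: keq_trans (partialxy_yC Oo i l _) _; first by elim: (m) => //= q; exact: kreg_partialy.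
exact: partialy_eq.
Qed.

Lemma mpowD (A : 'I_n -> (E -> E -> K) -> E -> E -> K) b (F G : E -> E -> K) :
  (forall i F, kregO F -> kregO (A i F)) ->
  (forall i F G, keqO F G -> keqO (A i F) (A i G)) ->
  (forall i F G, kregO F -> kregO G ->
     keqO (A i (fun x y => F x y + G x y)) (fun x y => A i F x y + A i G x y)) ->
  kregO F -> kregO G ->
  keqO (mpow A b (fun x y => F x y + G x y)) (fun x y => mpow A b F x y + mpow A b G x y).
Proof.
move=> Ar Ae AD rF rG; rewrite /mpow.
suff : [/\ kregO (foldr (fun i => iter (b i) (A i)) F (enum 'I_n)),
  kregO (foldr (fun i => iter (b i) (A i)) G (enum 'I_n)) &
  keqO (foldr (fun i => iter (b i) (A i)) (fun x y => F x y + G x y) (enum 'I_n))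
   (fun x y => foldr (fun i => iter (b i) (A i)) F (enum 'I_n) x y +
     foldr (fun i => iter (b i) (A i)) G (enum 'I_n) x y)] by case.
elim: (enum 'I_n) => //= i s IH; elim: (b i) => //= m [r1 r2 e].
split; [exact: Ar|exact: Ar|].
exact: keq_trans (Ae i _ _ e) (AD i _ _ r1 r2).
Qed.

Lemma kernel_boundD (L : set E) j F G : L `<=` Omega -> kernel_bound L j F ->
  kernel_bound L j G -> kernel_bound L j (fun e x y => F e x y + G e x y).
Proof.
move=> LO [rF bF] [rG bG]; split=> [e|a b]; first exact: kregD.
apply: bigO_eq (bigOD (bF a b) (bG a b)) => e z [Lz _].
have E1 : keqO (mpow partialy b (fun x y => F e x y + G e x y))
    (fun x y => mpow partialy b (F e) x y + mpow partialy b (G e) x y).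
  apply: mpowD => //.
  - by move=> i H; exact: kreg_partialy.
  - by move=> i H H'; exact: partialy_eq.
  - by move=> i H H'; exact: partialyD.
have E2 : keqO (mpow partialxy a (mpow partialy b (fun x y => F e x y + G e x y)))
    (fun x y => mpow partialxy a (mpow partialy b (F e)) x y +
                mpow partialxy a (mpow partialy b (G e)) x y).
  apply: keq_trans (mpowxy_eq a _ _ E1) _.
  - exact/kreg_mpowy/(kregD (rF e) (rG e)).
  - exact: kregD (kreg_mpowy b (rF e)) (kreg_mpowy b (rG e)).
  apply: mpowD.
  - by move=> i H; exact: kreg_partialxy.
  - by move=> i H H'; exact: partialxy_eq.
  - by move=> i H H'; exact: partialxyD.
  - exact/kreg_mpowy/rF.
  - exact/kreg_mpowy/rG.
exact/esym/(keqE _ E2 (LO _ Lz)).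
Qed.

Lemma mpowN a (F : E -> E -> K) (A : 'I_n -> (E -> E -> K) -> E -> E -> K) :
  (forall i F, kregO F -> kregO (A i F)) ->
  (forall i F G, keqO F G -> keqO (A i F) (A i G)) ->
  (forall i F, kregO F -> keqO (A i (fun x y => - F x y)) (fun x y => - A i F x y)) ->
  kregO F -> keqO (mpow A a (fun x y => - F x y)) (fun x y => - mpow A a F x y).
Proof.
move=> Ar Ae AN rF; rewrite /mpow.
suff : kregO (foldr (fun i => iter (a i) (A i)) F (enum 'I_n)) /\
  keqO (foldr (fun i => iter (a i) (A i)) (fun x y => - F x y) (enum 'I_n))
   (fun x y => - foldr (fun i => iter (a i) (A i)) F (enum 'I_n) x y) by case.
elim: (enum 'I_n) => //= i s IH; elim: (a i) => //= m [r1 e].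
split; first exact: Ar.
exact: keq_trans (Ae i _ _ e) (AN i _ r1).
Qed.

End Moderate.

(** * Moderateness *)

Section ModerateProof.
Context {k : scalar_kind} {R : realType} {n : nat} {Omega : set 'rV[R]_n}.
Local Notation K := (scal k R).
Local Notation E := 'rV[R]_n.
Local Notation D := (testfun k Omega).
Local Notation V := (rtest k Omega).
Hypothesis Oo : open Omega.
Implicit Types (phi : @I01 R -> Omega -> D) (u : D -> K).
Local Notation kregO := (@kreg k R n Omega).
Local Notation keqO := (@keq k R n Omega).
Local Notation PPD := (@PPD k R n Omega).

Lemma xderiveN (g : E -> D) i x l : xderive g i x l -> xderive (fun x => - g x) i x (- l).
Proof. by move=> dg p Pp; exact: (pderiveN (PPD_seminorm Pp) (dg p Pp)). Qed.

Lemma dsmN (g : E -> D) : dsm g -> dsm (fun x => - g x).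
Proof.
move=> sg; exists [set w | exists2 g, dsm g & w = fun x => - g x]; split; first by exists g.
move=> _ {g sg} [g sg ->]; split=> [x Ox p Pp e e0|i].
  have sp := PPD_seminorm Pp; have [d d0 H] := dsm_cont sg Ox Pp e0; exists d => // y /H.
  rewrite -(rsemN sp); congr (p _ <= _).
  by rewrite opprB opprK addrC.
have [g' [sg' dg]] := dsm_deriv i sg.
exists (fun x => - g' x); split; first by exists g'.
by move=> x Ox; apply: xderiveN; exact: dg.
Qed.

Lemma kregN (F : E -> E -> K) : kregO F -> kregO (fun x y => - F x y).
Proof.
move=> [g sg gE]; exists (fun x => - g x); first exact: dsmN.
by move=> x Ox; apply/funext => y; rewrite gE.
Qed.

Lemma partialxN i (F : E -> E -> K) : kregO F ->
  keqO (partialx i (fun x y => - F x y)) (fun x y => - partialx i F x y).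
Proof.
move=> rF; have [g sg [g' sg' [gE gE' dg]]] := partialx_kreg Oo i rF.
apply: (@keq_trans _ _ _ _ _ (fun x => - g' x)).
  apply: (partialx_unique Oo); exists (fun x => - g x).
    by move=> x Ox; apply/funext => y; rewrite gE.
  by move=> x Ox; apply: xderiveN; exact: dg.
by move=> x Ox; apply/funext => y; rewrite gE'.
Qed.

Lemma dtestN j (psi : D) : dtest j (- psi) = - dtest j psi.
Proof. by rewrite -scaleN1r dtestZ scaleN1r. Qed.

Lemma partialyN i (F : E -> E -> K) : kregO F ->
  keqO (partialy i (fun x y => - F x y)) (fun x y => - partialy i F x y).
Proof.
move=> [g sg gE]; have H : keqO (fun x y => - F x y) (fun x => - g x).
  by move=> x Ox; apply/funext => y; rewrite gE.
apply: keq_trans (partialy_kreg (g := fun x => - g x) i H) _ => x Ox; apply/funext => y.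
by rewrite dtestN (partialy_kreg i gE).
Qed.

Lemma partialxyN i (F : E -> E -> K) : kregO F ->
  keqO (partialxy i (fun x y => - F x y)) (fun x y => - partialxy i F x y).
Proof.
move=> rF; apply: keq_trans (keqD (partialxN i rF) (partialyN i rF)) _.
by move=> x Ox; apply/funext => y; rewrite -opprD.
Qed.

Lemma kernel_boundN (L : set E) j (F : @I01 R -> E -> E -> K) : L `<=` Omega ->
  kernel_bound (Omega := Omega) L j F -> kernel_bound (Omega := Omega) L j (fun e x y => - F e x y).
Proof.
move=> LO [rF bF]; split=> [e|a b]; first exact: kregN.
apply: bigO_eq (bigON (bF a b)) => e z [Lz _].
have ry : forall b' G, kregO G -> kregO (mpow partialy b' G).
  by move=> b' G; apply: mpow_ind => i f; exact: kreg_partialy.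
have rx : forall b' G, kregO G -> kregO (mpow partialxy b' G).
  by move=> b' G; apply: mpow_ind => i f; exact: kreg_partialxy.
have E1 : keqO (mpow partialy b (fun x y => - F e x y)) (fun x y => - mpow partialy b (F e) x y).
  apply: mpowN (rF e).
  - by move=> i H; exact: kreg_partialy.
  - by move=> i H H'; exact: partialy_eq.
  - by move=> i H; exact: partialyN.
have E2 : keqO (mpow partialxy a (mpow partialy b (fun x y => - F e x y)))
    (fun x y => - mpow partialxy a (mpow partialy b (F e)) x y).
  apply: (@keq_trans _ _ _ _ _ (mpow partialxy a (fun x y => - mpow partialy b (F e) x y))).
    apply: (@mpow_eqv n _ partialxy kregO keqO).
    - by move=> i f; exact: kreg_partialxy.
    - by move=> i f g _ _; exact: partialxy_eq.
    - exact/ry/kregN/rF.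
    - exact/kregN/ry/rF.
    - exact: E1.
  apply: mpowN (ry b _ (rF e)).
  - by move=> i H; exact: kreg_partialxy.
  - by move=> i H H'; exact: partialxy_eq.
  - by move=> i H; exact: partialxyN.
exact/esym/(keqE _ E2 (LO _ Lz)).
Qed.

Lemma kernel_bound_mono (L : set E) j j' (F : @I01 R -> E -> E -> K) : (j <= j')%N ->
  kernel_bound (Omega := Omega) L j F -> kernel_bound (Omega := Omega) L j' F.
Proof.
move=> jj [rF bF]; split=> // a b; apply: bigO_mono (bF a b) => e.
by apply: exprN_mono; rewrite leq_add2l.
Qed.

Lemma kernel_bound_x (L : set E) j (F : @I01 R -> E -> E -> K) i : L `<=` Omega ->
  kernel_bound (Omega := Omega) L j F ->
  kernel_bound (Omega := Omega) L j.+1 (fun e => partialx i (F e)).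
Proof.
move=> LO bF; have H1 := kernel_bound_mono (leqnSn j) (kernel_bound_xy Oo i LO bF).
have H2 := kernel_boundN LO (kernel_bound_y Oo i LO bF).
have := kernel_boundD Oo LO H1 H2.
rewrite (_ : (fun e x y => _) = fun e => partialx i (F e))//.
by apply/funext => e; apply/funext => x; apply/funext => y; rewrite /partialxy addrK.
Qed.

Lemma kernel_bound_mpowx (L : set E) (a : multi_index n) : L `<=` Omega ->
  exists j, forall F : @I01 R -> E -> E -> K,
    kernel_bound (Omega := Omega) L 0 F -> kernel_bound (Omega := Omega) L j (fun e => mpow partialx a (F e)).
Proof.
move=> LO; rewrite /mpow; elim: (enum 'I_n) => [|i s IH] /=; first by exists 0%N.
elim: (a i) => [|m [j Hj]] //=; exists j.+1 => F /Hj; exact: kernel_bound_x.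
Qed.

Lemma unif_bigO_finite (M : nat) (T : Type) (X : set T) (F : multi_index n -> @I01 R -> T -> K)
    (g : R -> R) : (forall e : @I01 R, 0 <= g (val e)) ->
  (forall b, (morder b <= M)%N -> unif_bigO X (F b) g) ->
  exists e0 C : R, [/\ 0 < e0, 0 < C & forall b (e : @I01 R) x, (morder b <= M)%N ->
    val e <= e0 -> X x -> modulus (F b e x) <= C * g (val e)].
Proof.
move=> g0 H.
have /choice[ec Hec] : forall b : multi_index n, exists ec : R * R, (morder b <= M)%N ->
    [/\ 0 < ec.1, 0 < ec.2 & forall (e : @I01 R) x, val e <= ec.1 -> X x ->
       modulus (F b e x) <= ec.2 * g (val e)].
  move=> b; have [bM|bM] := boolP (morder b <= M)%N; last by exists (0, 0).
  by have [e0 [C H1]] := H b bM; exists (e0, C).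
(* Only upper bounds are available for finitely many numbers, so the common threshold is obtained
   from a bound on the inverses of the thresholds. *)
have [B HB] := finitely_many_bound M (fun b => (ec b).1^-1).
have [C HC] := finitely_many_bound M (fun b => (ec b).2).
have B0 : 0 < `|B| + 1 by rewrite ltr_wpDl.
exists (`|B| + 1)^-1, (`|C| + 1); split; first by rewrite invr_gt0.
  by rewrite ltr_wpDl.
move=> b e x bM ee Xx; have [e0 C0 H1] := Hec b bM.
rewrite (le_trans (H1 e x _ Xx))//.
  rewrite (le_trans ee)// -[leRHS]invrK lef_pV2 ?posrE ?invr_gt0//.
  by rewrite (le_trans (HB b bM))// (le_trans (ler_norm B))// lerDl.
by rewrite ler_wpM2r// (le_trans (HC b bM))// (le_trans (ler_norm C))// lerDl.
Qed.

Lemma distribution_curve u (c : R -> D) : distributions k Omega u -> smooth_test_curve c ->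
  csm dir1 setT (u \o c).
Proof.
move=> du /smooth_test_curveP[d [<- td]].
have H m t : kderive (t : R) 1 (u \o d m) (u (d m.+1 t)).
  by apply: (pderive_distribution du) => p Pp; exact: td.
exists [set w | exists m, w = u \o d m]; split; first by exists 0%N.
move=> _ [m ->]; split=> [t _|i].
  have [Hr Hi] := H m t.
  by split; [exact: is_derive_cont Hr|exact: is_derive_cont Hi].
by exists (u \o d m.+1); split; [exists m.+1|move=> t _; exact: H].
Qed.

Lemma csm_smooth_curves (w : R -> K) : csm dir1 setT w ->
  smooth_curve (V := R^o) (sre \o w) /\ smooth_curve (V := R^o) (sim \o w).
Proof. by move=> sw; split; apply: rsm_smooth_curve; [exact: csm_sre|exact: csm_sim]. Qed.

Lemma iota_basic u : distributions k Omega u -> basic_space (iota_emb u).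
Proof.
move=> du c x sc _; exact: (csm_smooth_curves (distribution_curve du sc)).
Qed.

(* The order of the pole depends on [L], on [alpha] and on the order of the
   distribution near [L], but not on the smoothing kernel. *)
Lemma iota_moderate u : distributions k Omega u -> moderate_space k Omega (iota_emb u).
Proof.
move=> du; split; first exact: iota_basic.
(* [L1] leaves room to differentiate at the points of [L]; [L2] will contain the supports of the
   kernels centred in [L1] for small [e], and determines the order [M] of [u]. *)
move=> L cL alpha; have [d1 d10 cL1] := fat_cpt_in Oo cL; have [d2 d20 cL2] := fat_cpt_in Oo cL1.
set L1 := fat d1 L in cL1 cL2; set L2 := fat d2 L1 in cL2.
have LO : L `<=` Omega by move=> x /(proj2 cL)/interior_subset.
have L1O : L1 `<=` Omega by move=> x /(proj2 cL1)/interior_subset.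
have [_ _ [_ uc]] := du; have [M [C HC]] := uc _ cL2.
have [j Hj] := kernel_bound_mpowx alpha LO.
(* The exponent collects [n] from the scaling in (LSK2), [M] from the derivatives in [y] that
   control [u], and [j] from the derivatives in [x]. *)
exists 0%N, (n + M + j)%N => phi [sk lsk1 lsk2 _].
have kb0 : kernel_bound (Omega := Omega) L 0 (kernel_fun phi).
  by split=> [e|a b]; [exact: kernel_kreg|rewrite addn0; exact: lsk2].
have [_ kb] := Hj _ kb0.
have g0 (e : @I01 R) : 0 <= (val e) ^- (n + M + j).
  by rewrite invr_ge0 exprn_ge0// ltW// I01_gt0.
have [|e0 [C1 [e00 C10 H1]]] := @unif_bigO_finite M _ (L `*` Omega)
  (fun b e z => mpow partialy b (mpow partialx alpha (kernel_fun phi e)) z.1 z.2) (fun e => e ^- (n + M + j)) g0.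
  move=> b bM; have H := kb (fun=> 0%N) b.
  have H' : unif_bigO (L `*` Omega)
    (fun e z => mpow partialy b (mpow partialx alpha (kernel_fun phi e)) z.1 z.2)
    (fun e => e ^- (n + morder b + j)).
    by apply: bigO_eq H => e z _; rewrite mpow0.
  by apply: bigO_mono H' => e; apply: exprN_mono; rewrite leq_add2r leq_add2l.
have [e1 [C2 [e10 C20 H2]]] := lsk1 _ cL1.
(* (LSK1) holds for [e] strictly below [e1], hence the half; [d2 / C2] keeps the supports within
   distance [d2] of their centres. *)
exists (Num.min e0 (Num.min (e1 / 2) (d2 / C2))), (`|C| * C1 + 1); split.
- by rewrite !lt_min e00 !divr_gt0.
- by rewrite ltr_wpDl// mulr_ge0// ltW.
move=> e x; rewrite !le_min => /and3P[ee0 ee1 eed] Lx; have Ox := LO _ Lx.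
have ee1' : val e < e1.
  by rewrite (le_lt_trans ee1)// ltr_pdivrMr// ltr_pMr// ltr1n.
have [h sh hE] := mpow_distribution Oo alpha (slice_dsm Oo e sk).
have -> : test_derivative (iota_emb u) phi alpha e x = u (h x).
  apply: hE => // z Oz; rewrite (valL_inE _ _ Oz); congr u.
  by rewrite /slice (valL_inE _ _ Oz).
have hy y : h x y = mpow partialx alpha (kernel_fun phi e) x y.
  rewrite mpow_partialxE; apply/esym; apply: (hE _ _ (eval_distribution y)) => // z Oz.
  by rewrite kernel_slice.
have zero z y : L1 z -> ~ L2 y -> kernel_fun phi e z y = 0.
  move=> L1z ny; have Oz := L1O _ L1z; rewrite /kernel_fun (valL_inE _ _ Oz).
  apply: supp_out => /(H2 (SigSub (mem_set Oz)) e L1z ee1') yb; apply: ny; exists z => //.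
  rewrite (le_trans (norm_le_enorm _))// ltW// (lt_le_trans yb)//= mulrC -ler_pdivlMr//.
have sh2 : supp (h x) `<=` L2.
  apply: supp_sub (cpt_in_closed cL2) _ => y ny; rewrite hy mpow_partialxE.
  (* For [y] outside [L2] the kernel vanishes at all centres in the open set [W], so its derivatives
     in [x] vanish there as well. *)
  pose W := L1°; have Wo : open W by exact: open_interior.
  have Wx : W x by apply: fat_interior.
  suff Hz : forall z, W z -> mpow partial alpha (fun x' => kernel_fun phi e x' y) z = 0 by exact: Hz.
  apply: (@mpow_ind n _ partial (fun f => forall z, W z -> f z = 0)).
    move=> i f f0 z Wz; rewrite (partial_eq (g := fun=> 0) Wo)//.
    exact: kderive_partial (kderive_cst _ _ _).
  by move=> z /interior_subset L1z; exact: zero.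
rewrite (le_trans (HC _ sh2))// (le_trans (ler_wpM2r (Cnorm_ge0 _ _) (ler_norm C)))//.
have Cn : Cnorm M (h x) <= C1 * val e ^- (n + M + j).
  apply: Cnorm_le => b y bM; have [Oy|ny] := pselect (Omega y); last first.
    by rewrite test_out// modulus0 mulr_ge0// ltW.
  have := H1 b e (x, y) bM ee0 (conj Lx Oy) => /=.
  rewrite mpow_partialyE (_ : mpow partialx alpha (kernel_fun phi e) x = h x :> (E -> K)); last first.
    by apply/funext => z; rewrite hy.
  by rewrite mpow_dtest.
rewrite (le_trans (ler_wpM2l (normr_ge0 C) Cn))// mulrA ler_wpM2r//.
by rewrite lerDl.
Qed.

Lemma sigma_basic (f : Omega -> K) : smooth_fun k Omega f -> basic_space (k := k) (sigma_emb f).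
Proof.
move=> sf c x _ sx; apply: csm_smooth_curves.
have := csm_compE openT Oo (smooth_on_csm sf) ((smooth_curve_coord _).1 sx).
have xO t : setT t -> Omega (val (x t)) by move=> _; exact: set_mem (valP (x t)).
move=> /(_ xO); rewrite (_ : 'valL_0 f \o _ = fun t => sigma_emb f (c t) (x t))//.
by apply/funext => t; rewrite /comp valL_in.
Qed.

Lemma mpow_partial_csm (U : set E) alpha (f : E -> K) : open U -> csm dirE U f ->
  csm dirE U (mpow partial alpha f).
Proof.
by move=> Uo sf; apply: mpow_ind => // i g sg; have [] := csm_partial Uo i sg.
Qed.

Lemma csm_bounded (L : set E) (f : E -> K) : cpt_in L Omega -> csm dirE Omega f ->
  exists2 B : R, 0 <= B & forall x, L x -> modulus (f x) <= B.
Proof.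
move=> [cL LO] sf.
have [B B0 HB] := @compact_continuous_bounded R E (fun y => modulus (f y)) L cL
  (fun y Ly => kcont_modulus (csm_cont sf (interior_subset (LO _ Ly)))).
by exists B => // x /HB; rewrite ger0_norm// modulus_ge0.
Qed.

Lemma sigma_moderate (f : Omega -> K) : smooth_fun k Omega f ->
  moderate_space k Omega (sigma_emb f).
Proof.
move=> sf; split; first exact: sigma_basic.
move=> L cL alpha; exists 0%N, 0%N => phi _.
have [B B0 HB] := csm_bounded cL (mpow_partial_csm alpha Oo (smooth_on_csm sf)).
exists 1, (B + 1); split => //; first by rewrite ltr_wpDl.
move=> e x _ Lx; rewrite expr0 invr1 mulr1 (le_trans (HB x Lx))// lerDl//.
Qed.

End ModerateProof.

(** * Integration *)

Section CompactlySupportedIntegrals.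
Context {R : realType}.
Local Notation mu := (@lebesgue_measure R).

Definition cc1 (B : R) (F : R -> R) : Prop := continuous F /\ forall t, B < `|t| -> F t = 0.

Implicit Types (B M a : R) (F G : R -> R).

Lemma cc1_lin B F G a : cc1 B F -> cc1 B G -> cc1 B (fun t => a * F t + G t).
Proof.
move=> [cF zF] [cG zG]; split=> [t|t tB]; last by rewrite zF// zG// mulr0 addr0.
have ca : {for t, continuous (fun=> a : R)} by exact: cst_continuous.
exact: (continuousD (continuousM ca (cF t)) (cG t)).
Qed.

Lemma cc1_integrable B F : cc1 B F -> mu.-integrable `[- B, B] (EFin \o F).
Proof.
move=> [cF _]; apply: continuous_compact_integrable; first exact: segment_compact.
exact: continuous_subspaceT.
Qed.

Lemma cc1_restrict B F : cc1 B F ->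
  Rintegral mu setT F = Rintegral mu `[- B, B] F.
Proof.
move=> [_ zF]; rewrite [RHS]Rintegral_mkcond; congr Rintegral; apply/funext => t.
rewrite patchE; case: ifPn => // tB; apply: zF; rewrite ltNge; apply: contra tB.
by rewrite ler_norml => tB; rewrite inE /= in_itv.
Qed.

Lemma rint1_lin B F G a : cc1 B F -> cc1 B G ->
  Rintegral mu setT (fun t => a * F t + G t) = a * Rintegral mu setT F + Rintegral mu setT G.
Proof.
move=> cF cG; rewrite (cc1_restrict (cc1_lin a cF cG)) (cc1_restrict cF) (cc1_restrict cG).
have c0 : cc1 B (fun=> 0) by split => // t; exact: cst_continuous.
have caF : cc1 B (fun t => a * F t).
  have -> : (fun t => a * F t) = fun t => a * F t + 0 by apply/funext => t; rewrite addr0.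
  exact: cc1_lin.
rewrite RintegralD ?RintegralZl//; exact: cc1_integrable.
Qed.

Lemma rint1_bound B F M : 0 <= B -> cc1 B F -> (forall t, `|F t| <= M) ->
  `|Rintegral mu setT F| <= 2 * B * M.
Proof.
move=> B0 cF FM; rewrite (cc1_restrict cF).
have iF := cc1_integrable cF; apply: le_trans (le_normr_Rintegral _ iF) _ => //.
have cn : cc1 B (fun t => `|F t|).
  move: cF => [cF zF]; split=> [t|t /zF ->]; last by rewrite normr0.
  exact: (continuous_comp (cF t) (@norm_continuous _ _ _)).
have iM : mu.-integrable `[- B, B] (EFin \o (fun=> M)).
  apply: continuous_compact_integrable; first exact: segment_compact.
  by apply: continuous_subspaceT => t; exact: cst_continuous.
apply: le_trans (le_Rintegral _ (cc1_integrable cn) iM (fun t _ => FM t)) _ => //.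
rewrite Rintegral_cst//= lebesgue_measure_itv/=.
case: ifPn => [_|]; last first.
  rewrite lte_fin -leNgt => BB; have -> : B = 0 by lra.
  by rewrite !mulr0 mul0r.
by rewrite -EFinB /= opprK mulrC; apply: ler_wpM2r; [exact: le_trans (normr_ge0 _) (FM 0)|lra].
Qed.

Lemma rint1_derive B F G : 0 < B -> cc1 B F -> (forall t : R, is_derive t 1 G (F t)) ->
  Rintegral mu setT F = G B - G (- B).
Proof.
move=> B0 cF dG; rewrite (cc1_restrict cF) /Rintegral.
have cG (t : R) : {for t, continuous G} := is_derive_cont (dG t).
rewrite (@continuous_FTC2 R F G (- B) B) //.
- by rewrite ltrNl -subr_gt0 opprK addr_gt0.
- by move: cF => [cF _]; exact: continuous_subspaceT.
- split=> [t _||]; first by have [] := dG t.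
  + exact: cvg_at_right_filter (cG _).
  + exact: cvg_at_left_filter (cG _).
- by move=> t _; rewrite derive1E; have [] := dG t.
Qed.

End CompactlySupportedIntegrals.

Section CompactlySupportedIntegralsRn.
Context {R : realType}.

Definition cc n (B : R) (f : 'rV[R]_n -> R) : Prop :=
  continuous f /\ forall (y : 'rV[R]_n) (i : 'I_n), B < `|y 0 i| -> f y = 0.

Lemma cc_lin n B (f g : 'rV[R]_n -> R) a : cc B f -> cc B g -> cc B (fun y => a * f y + g y).
Proof.
move=> [cf zf] [cg zg]; split=> [t|y i yB]; last by rewrite (zf y i)// (zg y i)// mulr0 addr0.
have ca : {for t, continuous (fun=> a : R)} by exact: cst_continuous.
exact: (continuousD (continuousM ca (cf t)) (cg t)).
Qed.

Lemma norm_ball_compact n (B : R) : compact [set y : 'rV[R]_n | `|y| <= B].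
Proof.
apply: bounded_closed_compact.
  by exists B; split; [exact: num_real|move=> M dM z /= zd; rewrite (le_trans zd)// ltW].
exact: (closed_comp (fun x _ => @norm_continuous _ _ x) (@closed_le R B)).
Qed.

Lemma cc_uniform n B (f : 'rV[R]_n -> R) : 0 <= B -> cc B f -> forall e, 0 < e ->
  exists2 d : R, 0 < d & forall x y, `|y - x| < d -> `|f y - f x| <= e.
Proof.
move=> B0 [cf zf] e e0.
pose L := [set y : 'rV[R]_n | `|y| <= B + 1].
have cL : compact L := @norm_ball_compact n (B + 1).
pose P (d : R) (x : 'rV[R]_n) := forall y, `|y - x| < `|d| -> `|f y - f x| <= e.
have e20 : 0 < e / 2 by rewrite divr_gt0.
have := (compact_near_coveringP L).1 cL R (nbhs (0 : R)) P _.
move=> /(_ _)[x _|/= d0 d00 Hd].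
  have [r r0 Hr] := (continuous_normP _ _).1 (cf x) _ e20.
  exists ([set x' | `|x' - x| < r / 2], [set d : R | `|d| < r / 2]); first split => /=.
  - by apply/nbhs_ballP; exists (r / 2); [exact: divr_gt0|move=> y; rewrite -ball_normE /= distrC].
  - apply/nbhs_ballP; exists (r / 2); first exact: divr_gt0.
    by move=> y; rewrite -ball_normE /= sub0r normrN.
  move=> [x' d] /= [h1 h2] y yx'.
  have yx : `|y - x| < r.
    by rewrite -(subrKA x' y) (splitr r) (le_lt_trans (ler_normD _ _))// ltrD// (lt_trans yx').
  have xx : `|x' - x| < r by rewrite (lt_trans h1)// ltr_pdivrMr// ltr_pMr// ltr1n.
  by rewrite -(subrKA (f x)) (le_trans (ler_normD _ _))// (splitr e) lerD ?Hr// distrC Hr.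
exists (Num.min 1 (d0 / 2)); first by rewrite lt_min ltr01 divr_gt0.
move=> x y; rewrite lt_min => /andP[yx1 yxd].
have [Lx|nLx] := pselect (L x).
  apply: (Hd (d0 / 2) _ x Lx y).
    by rewrite /= sub0r normrN ger0_norm ?divr_ge0 ?(ltW d00)// ltr_pdivrMr// ltr_pMr// ltr1n.
  by rewrite (lt_le_trans yxd)// ler_norm.
have [i xi] : exists i, B + 1 < `|x 0 i|.
  apply: contrapT => nx; apply: nLx; apply: norm_le_coord; first by rewrite addr_ge0.
  by move=> i; rewrite leNgt; apply/negP => xi; apply: nx; exists i.
have yi : `|x 0 i| <= `|y 0 i| + 1.
  rewrite -(subrK (y 0 i) (x 0 i)) (le_trans (ler_normD _ _))// addrC lerD2l ltW//.
  by rewrite (le_lt_trans _ yx1)// distrC; have := coord_le_norm (y - x) i; rewrite !mxE.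
rewrite (zf x i) ?(zf y i) ?subrr ?normr0 ?(ltW e0)//; lra.
Qed.

Definition row_slice n (f : 'rV[R]_n.+1 -> R) (t : R) : 'rV[R]_n -> R :=
  fun v => f (row_mx (const_mx t : 'rV[R]_1) v).

Lemma row_mx_coord n (t : R) (v : 'rV[R]_n) :
  (row_mx (const_mx t : 'rV[R]_1) v : 'rV[R]_n.+1) 0 ord0 = t /\
  forall i, (row_mx (const_mx t : 'rV[R]_1) v : 'rV[R]_n.+1) 0 (lift ord0 i) = v 0 i.
Proof.
split=> [|i].
  have e : ord0 = lshift n (0 : 'I_1) :> 'I_(1 + n) by exact: val_inj.
  apply: (etrans (congr1 (fun j : 'I_(1 + n) => row_mx (const_mx t : 'rV[R]_1) v 0 j) e)).
  by rewrite row_mxEl mxE.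
have e : lift ord0 i = rshift 1 i :> 'I_(1 + n) by exact: val_inj.
apply: (etrans (congr1 (fun j : 'I_(1 + n) => row_mx (const_mx t : 'rV[R]_1) v 0 j) e)).
by rewrite row_mxEr.
Qed.

Lemma row_mx_dist n (t s : R) (v w : 'rV[R]_n) (r : R) : 0 <= r -> `|t - s| <= r -> `|v - w| <= r ->
  `|(row_mx (const_mx t : 'rV[R]_1) v : 'rV[R]_n.+1) - row_mx (const_mx s : 'rV[R]_1) w| <= r.
Proof.
move=> r0 ts vw; apply: norm_le_coord => // i.
have [t1 t2] := row_mx_coord t v; have [s1 s2] := row_mx_coord s w.
rewrite [X in `|X|](_ : _ = (row_mx (const_mx t : 'rV[R]_1) v : 'rV[R]_n.+1) 0 i -
  (row_mx (const_mx s : 'rV[R]_1) w : 'rV[R]_n.+1) 0 i); last by rewrite mxE [X in _ + X]mxE.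
case: (unliftP ord0 i) => [j ->|->]; last by rewrite t1 s1.
rewrite t2 s2; apply: le_trans vw.
by have := coord_le_norm (v - w) j; rewrite mxE [X in _ + X]mxE.
Qed.

Lemma cc_slice n (B : R) (f : 'rV[R]_n.+1 -> R) t : cc B f -> cc B (row_slice f t).
Proof.
move=> [cf zf]; split=> [v|v i vB]; last first.
  by rewrite /row_slice (zf _ (lift ord0 i))//; have [_ ->] := row_mx_coord t v.
apply/continuous_normP => e e0; 
have [d d0 Hd] := (continuous_normP _ _).1 (cf (row_mx (const_mx t : 'rV[R]_1) (v : 'rV[R]_n) : 'rV[R]_n.+1)) _ e0.
exists d => // w wv; apply: Hd; apply: le_lt_trans wv.
by apply: row_mx_dist => //; rewrite subrr normr0.
Qed.

Let good n (B : R) : Prop :=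
  (forall (f g : 'rV[R]_n -> R) a, cc B f -> cc B g ->
     rintegral (fun y => a * f y + g y) = a * rintegral f + rintegral g) /\
  (forall (f : 'rV[R]_n -> R) M, cc B f -> (forall y, `|f y| <= M) ->
     `|rintegral f| <= (2 * B) ^+ n * M).

Let slice_cc1 n (B : R) (f : 'rV[R]_n.+1 -> R) : 0 <= B -> good n B -> cc B f ->
  cc1 B (fun t => rintegral (row_slice f t)).
Proof.
move=> B0 [IHl IHb] cf; split=> [t|t tB].
  apply/continuous_normP => e e0.
  have D0 : 0 < (2 * B) ^+ n + 1 by rewrite ltr_wpDl// exprn_ge0// mulr_ge0.
  have [d d0 Hd] := cc_uniform B0 cf (divr_gt0 e0 D0).
  exists d => // s st.
  have -> : rintegral (row_slice f s) - rintegral (row_slice f t) =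
      rintegral (fun v => -1 * row_slice f t v + row_slice f s v).
    by rewrite IHl; [rewrite mulN1r addrC|exact: cc_slice|exact: cc_slice].
  apply: le_trans (IHb _ (e / ((2 * B) ^+ n + 1)) _ _) _.
  - by apply: cc_lin; exact: cc_slice.
  - move=> v; rewrite mulN1r addrC; apply: Hd.
    apply: le_lt_trans st.
    by apply: row_mx_dist => //; rewrite subrr normr0.
  by rewrite mulrC mulrAC ler_pdivrMr// ler_wpM2l ?(ltW e0)// lerDl.
apply/eqP; rewrite -normr_le0.
have := IHb (row_slice f t) 0 (cc_slice t cf); rewrite mulr0; apply => v.
have [_ zf] := cf; rewrite /row_slice (zf _ ord0) ?normr0//.
by have [-> _] := row_mx_coord t v.
Qed.

(** Linearity and the bound are proved in one induction on [n]: the one-dimensional statements apply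
    to the slice integral once it is known to be continuous, and this follows from both statements
    for the slices, applied to the difference of two slices. *)
Lemma rintegralP n (B : R) : 0 <= B ->
  (forall (f g : 'rV[R]_n -> R) a, cc B f -> cc B g ->
     rintegral (fun y => a * f y + g y) = a * rintegral f + rintegral g) /\
  (forall (f : 'rV[R]_n -> R) M, cc B f -> (forall y, `|f y| <= M) ->
     `|rintegral f| <= (2 * B) ^+ n * M).
Proof.
move=> B0; elim: n => [|n [IHl IHb]].
  by split=> [//|f M _ fM]; rewrite expr0 mul1r; exact: fM.
have c1 := fun f => @slice_cc1 n B f B0 (conj IHl IHb).
split=> [f g a cf cg|f M cf fM] /=.
  rewrite -(rint1_lin a (c1 _ cf) (c1 _ cg)); congr Rintegral; apply/funext => t.
  by rewrite -IHl//; exact: cc_slice.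
rewrite exprS -mulrA; apply: (rint1_bound B0 (c1 _ cf)) => t.
by apply: IHb; [exact: cc_slice|move=> v; exact: fM].
Qed.

Lemma rintegral_slice_cc1 n (B : R) (f : 'rV[R]_n.+1 -> R) : 0 <= B -> cc B f ->
  cc1 B (fun t => rintegral (row_slice f t)).
Proof. by move=> B0; exact/slice_cc1/rintegralP. Qed.

End CompactlySupportedIntegralsRn.

(** The coinductive class requires one derivative on all of [U]. At each point a local derivative is
    chosen and evaluated there; by uniqueness of derivatives the resulting function agrees near a
    point with the local derivative chosen at that point, hence is locally smooth again. *)
Lemma csm_local {k : scalar_kind} {R : realType} {V : normedModType R} {I : Type}
    (dir : I -> V) (U : set V) (f : V -> scal k R) : open U ->
  (forall x, U x -> exists W : set V, [/\ open W, W x & csm dir W f]) -> csm dir U f.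
Proof.
move=> Uo lf; exists [set g | forall x, U x -> exists W : set V, [/\ open W, W x & csm dir W g]].
split=> // g lg; split=> [x Ux|i].
  by have [W [_ Wx cg]] := lg x Ux; exact: csm_cont cg Wx.
have ex x : exists p : set V * (V -> scal k R), U x -> [/\ open p.1, p.1 x, p.1 `<=` U, csm dir p.1 p.2 &
    forall y, p.1 y -> kderive y (dir i) g (p.2 y)].
  have [Ux|nUx] := pselect (U x); last by exists (setT, fun=> 0).
  have [W [Wo Wx cg]] := lg x Ux; have [g' [cg' dg]] := csm_deriv i cg.
  exists (W `&` U, g') => _; split=> //=.
  - exact: openI.
  - exact: (csm_sub (@subIsetl _ W U) cg').
  - by move=> y [/dg].
pose p x := projT1 (cid (ex x)).
have pP x : U x -> [/\ open (p x).1, (p x).1 x, (p x).1 `<=` U, csm dir (p x).1 (p x).2 &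
    forall y, (p x).1 y -> kderive y (dir i) g ((p x).2 y)].
  exact: projT2 (cid (ex x)).
exists (fun x => (p x).2 x); split=> [x Ux|x Ux]; have [Wo Wx WU cg' dg] := pP x Ux.
  exists (p x).1; split=> //; apply: (csm_ext Wo cg') => y Wy.
  have [_ Wyy _ _ dgy] := pP y (WU _ Wy).
  exact: kderive_unique (dg _ Wy) (dgy _ Wyy).
exact: dg.
Qed.

Section ScalarIntegrals.
Context {k : scalar_kind} {R : realType} {n : nat}.
Local Notation K := (scal k R).
Local Notation E := 'rV[R]_n.
Implicit Types (f g : E -> K) (B M : R).

Definition kcc B f : Prop :=
  (forall x, kcont x f) /\ forall (y : E) (i : 'I_n), B < `|y 0 i| -> f y = 0.

Lemma kcc_sre B f : kcc B f -> cc B (sre \o f).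
Proof. by move=> [cf zf]; split=> [x|y i yB /=]; [have [] := cf x|rewrite (zf y i)// sre0]. Qed.

Lemma kcc_sim B f : kcc B f -> cc B (sim \o f).
Proof. by move=> [cf zf]; split=> [x|y i yB /=]; [have [] := cf x|rewrite (zf y i)// sim0]. Qed.

Lemma rintegral_cst0 : rintegral (fun _ : E => 0 : R) = 0 :> R.
Proof.
have c0 : cc (n := n) (0 : R) (fun=> 0 : R) by split=> // x; exact: cst_continuous.
have [lin _] := @rintegralP R n 0 (lexx 0).
have /= := lin (fun=> 0) (fun=> 0) (-1) c0 c0.
have -> : (fun _ : E => -1 * 0 + 0 : R) = fun=> 0 by apply/funext => y; rewrite mulr0 addr0.
by move=> ->; rewrite mulN1r addNr.
Qed.

Lemma sre_integral f : sre (integral_Rn f) = rintegral (sre \o f).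
Proof. exact: sre_mk. Qed.

Lemma sim_integral f : sim (integral_Rn f) = rintegral (sim \o f).
Proof.
rewrite /integral_Rn; case: k f => f //=.
by rewrite (_ : _ \o _ = fun=> 0)// rintegral_cst0.
Qed.

Lemma integral_RnZD B f g (a : K) : 0 <= B -> kcc B f -> kcc B g ->
  integral_Rn (fun y => a * f y + g y) = a * integral_Rn f + integral_Rn g.
Proof.
move=> B0 cf cg; have [lin _] := @rintegralP R n B B0.
have [[fr fi] [gr gi]] := conj (conj (kcc_sre cf) (kcc_sim cf)) (conj (kcc_sre cg) (kcc_sim cg)).
apply: scalar_eq.
  rewrite sreD sreM !sre_integral !sim_integral -mulNr -addrA -lin// -lin//; last exact: cc_lin.
  by congr rintegral; apply/funext => y /=; rewrite sreD sreM mulNr addrA.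
rewrite simD simM !sim_integral !sre_integral -addrA -lin// -lin//; last exact: cc_lin.
by congr rintegral; apply/funext => y /=; rewrite simD simM addrA.
Qed.

Lemma integral_Rn_le B f M : 0 <= B -> kcc B f -> (forall y, modulus (f y) <= M) ->
  modulus (integral_Rn f) <= (2 * B) ^+ n * M *+ 2.
Proof.
move=> B0 cf fM; have [_ bd] := @rintegralP R n B B0.
apply: le_trans (modulus_le _) _; rewrite sre_integral sim_integral mulr2n.
apply: lerD; apply: bd.
- exact: kcc_sre.
- by move=> y; exact: le_trans (sre_le_modulus _) (fM y).
- exact: kcc_sim.
- by move=> y; exact: le_trans (sim_le_modulus _) (fM y).
Qed.

Lemma compact_cube (L : set E) : compact L ->
  exists2 B : R, 0 < B & forall y i, L y -> `|y 0 i| <= B.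
Proof.
move=> cL; have [B B0 LB] := @compact_continuous_bounded R E (fun y => `|y|) L cL
  (fun x _ => @norm_continuous _ _ x).
exists (B + 1) => [|y i Ly]; first exact: ltr_wpDl.
apply: le_trans (coord_le_norm y i) _; have := LB y Ly; rewrite normr_id => yB.
by apply: le_trans yB _; rewrite lerDl.
Qed.

Lemma kcc_cube (L : set E) B f : (forall y i, L y -> `|y 0 i| <= B) ->
  csm dirE setT f -> (forall y, ~ L y -> f y = 0) -> kcc B f.
Proof.
move=> LB cf zf; split=> [x|y i yB]; first exact: csm_cont cf _.
by apply: zf => Ly; move: yB; rewrite ltNge LB.
Qed.

Lemma csm_mul_supp (U L : set E) f g : open U -> closed L -> L `<=` U ->
  csm dirE U f -> csm dirE setT g -> (forall y, ~ L y -> g y = 0) ->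
  csm dirE setT (fun y => f y * g y).
Proof.
move=> Uo cL LU cf cg zg; apply: csm_local => [|x _]; first exact: openT.
have [Lx|nLx] := pselect (L x).
  exists U; split=> //; first exact: LU.
  by apply: csmM => //; exact: csm_sub cg.
exists (~` L); split=> //; first exact: closed_openC.
apply: (csm_ext (closed_openC cL) (csm_cst dirE (~` L) 0)) => y Ly.
by rewrite zg// mulr0.
Qed.

End ScalarIntegrals.

(** * Smooth functions as distributions, and the difference of the two embeddings *)

Section FunctionsAsDistributions.
Context {k : scalar_kind} {R : realType} {n : nat} {Omega : set 'rV[R]_n}.
Local Notation K := (scal k R).
Local Notation E := 'rV[R]_n.
Local Notation D := (testfun k Omega).
Hypothesis Oo : open Omega.

Lemma product_is_test (f : E -> K) (phi : D) : csm dirE Omega f ->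
  is_test Omega (fun y => f y * phi y).
Proof.
move=> cf; have [sphi cphi phiO] := test_is_test phi.
have zphi y : ~ supp phi y -> (f y * phi y : K) = 0 by move=> /supp_out ->; rewrite mulr0.
apply: (is_test_intro _ cphi phiO zphi).
apply: (csm_mul_supp Oo _ phiO cf (test_csm phi)); first exact: closed_closure.
by move=> y; exact: supp_out.
Qed.

Lemma smooth_fun_csm (f : Omega -> K) : smooth_fun k Omega f -> csm dirE Omega ('valL_0 f).
Proof. exact: smooth_on_csm. Qed.

Lemma kcc_product (f : E -> K) (phi : D) (L : set E) B : csm dirE Omega f ->
  supp phi `<=` L -> (forall y i, L y -> `|y 0 i| <= B) -> kcc B (fun y => f y * phi y).
Proof.
move=> cf pL LB; apply: (kcc_cube LB).
  by have [sp _ _] := product_is_test phi cf; exact: smooth_on_csm.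
by move=> y nLy; rewrite (@supp_out k R n (phi : E -> K) y) ?mulr0// => /pL.
Qed.

Lemma distr_of_distribution (f : Omega -> K) : smooth_fun k Omega f ->
  distributions k Omega (distr_of f).
Proof.
move=> /smooth_fun_csm cf.
have cube (phi psi : D) : exists2 B : R, 0 < B & kcc B (fun y => 'valL_0 f y * phi y) /\
    kcc B (fun y => 'valL_0 f y * psi y).
  have [[_ cphi _] [_ cpsi _]] := (test_is_test phi, test_is_test psi).
  have [B B0 HB] := compact_cube (compactU cphi cpsi).
  by exists B => //; split; apply: (kcc_product cf _ HB) => y; [left|right].
have lin a (phi psi : D) : distr_of f (a *: phi + psi) = a * distr_of f phi + distr_of f psi.
  have [B B0 [c1 c2]] := cube phi psi; rewrite /distr_of -(integral_RnZD a (ltW B0) c1 c2).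
  by congr integral_Rn; apply/funext => y; rewrite testD testZ mulrDr mulrCA.
have u0 : distr_of f 0 = 0.
  by have := lin (-1) 0 0; rewrite scaler0 add0r mulN1r addNr.
have linD phi psi : distr_of f (phi + psi) = distr_of f phi + distr_of f psi.
  by have := lin 1 phi psi; rewrite scale1r mul1r.
have linZ a phi : distr_of f (a *: phi) = a * distr_of f phi.
  by have := lin a phi 0; rewrite !addr0 u0 addr0.
split=> //; split.
  split=> [phi|phi psi|a phi]; first exact: modulus_ge0.
  - by rewrite linD; exact: modulusD.
  - by rewrite linZ modulusM.
move=> L cL; have [M M0 HM] := csm_bounded cL cf.
have [cptL LO] := cL; have [B B0 HB] := compact_cube cptL.
exists 0%N, ((2 * B) ^+ n * M *+ 2) => phi pL.
have zphi y : ~ L y -> phi y = 0 :> K by move=> nL; apply: supp_out => /pL.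
rewrite (_ : _ * Cnorm 0 phi = (2 * B) ^+ n * (M * Cnorm 0 phi) *+ 2); last first.
  by rewrite mulrnAl mulrA.
apply: integral_Rn_le (ltW B0) (kcc_product cf pL HB) _ => y.
rewrite modulusM; have [Ly|nLy] := pselect (L y).
  by apply: ler_pM; [exact: modulus_ge0|exact: modulus_ge0|exact: HM|exact: test_le_Cnorm].
by rewrite zphi// modulus0 mulr0 mulr_ge0// Cnorm_ge0.
Qed.

End FunctionsAsDistributions.

Section MpowRelations.
Context {n : nat}.
(** A ternary relation suffices to carry an identity such as [h = f - g], together with the
    smoothness of its members, through all derivatives. *)
Lemma mpow_rel3 (T : Type) (A : 'I_n -> T -> T) (Q : T -> T -> T -> Prop) alpha f g h :
  (forall i f g h, Q f g h -> Q (A i f) (A i g) (A i h)) -> Q f g h ->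
  Q (mpow A alpha f) (mpow A alpha g) (mpow A alpha h).
Proof.
move=> AQ Q0; rewrite /mpow; elim: (enum 'I_n) => [//|i s IH] /=.
by elim: (alpha i) => [//|m IHm]; rewrite !iterS; exact: AQ.
Qed.
End MpowRelations.

Section Negligible.
Context {k : scalar_kind} {R : realType} {n : nat} {Omega : set 'rV[R]_n}.
Local Notation K := (scal k R).
Local Notation E := 'rV[R]_n.
Local Notation D := (testfun k Omega).
Hypothesis Oo : open Omega.

Lemma mpow_partialB alpha (f g h : E -> K) : csm dirE Omega f -> csm dirE Omega g ->
  (forall x, Omega x -> h x = f x - g x) -> forall x, Omega x ->
  mpow partial alpha h x = mpow partial alpha f x - mpow partial alpha g x.
Proof.
move=> cf cg hE.
pose Q (f g h : E -> K) := [/\ csm dirE Omega f, csm dirE Omega g &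
  forall x, Omega x -> h x = f x - g x].
have [] // : Q (mpow partial alpha f) (mpow partial alpha g) (mpow partial alpha h).
apply: mpow_rel3 => // i {cf cg hE}f {}g {}h [cf cg hE].
have [cf' df] := csm_partial Oo i cf; have [cg' dg] := csm_partial Oo i cg.
split=> // x Ox; rewrite (partial_eq Oo hE i Ox); apply: kderive_partial.
have m1 := kderiveM (kderive_cst x (delta_mx 0 i) (-1)) (dg x Ox).
have := kderiveD (df x Ox) m1; rewrite mul0r add0r mulN1r.
by rewrite (_ : (fun y => f y + -1 * g y) = fun y => f y - g y)//; apply/funext => y; rewrite mulN1r.
Qed.

(** Differentiation under the integral sign is here the continuity of the distribution [distr_of f]:
    [mpow_distribution] is used for it and for the evaluations, with the same family [h]. *)
Lemma LSK3_integralE (phi : @I01 R -> Omega -> D) (f : Omega -> K) alpha e x :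
  smooth_kernel phi -> smooth_fun k Omega f -> Omega x ->
  integral_Rn (fun y => 'valL_0 f y * mpow partialx alpha (kernel_fun phi e) x y)
    - mpow partial alpha ('valL_0 f) x =
  mpow partial alpha ('valL_0 (fun x : Omega => distr_of f (phi e x) - f x)) x.
Proof.
move=> sphi sf Ox; have uf := distr_of_distribution Oo sf.
have [h dh hE] := mpow_distribution Oo alpha (slice_dsm Oo e sphi).
have cF : csm dirE Omega (fun x => distr_of f (slice phi e x)).
  exact: dsm_distribution uf (slice_dsm Oo e sphi).
have gE y : Omega y -> 'valL_0 (fun x : Omega => distr_of f (phi e x) - f x) y =
    distr_of f (slice phi e y) - 'valL_0 f y.
  by move=> Oy; rewrite /slice !valL_inE.
rewrite (mpow_partialB alpha cF (smooth_fun_csm sf) gE Ox) (hE _ _ uf (fun y _ => erefl) x Ox); congr (_ - _).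
congr integral_Rn; apply/funext => y; congr (_ * _); rewrite mpow_partialxE.
apply: (hE (fun psi : D => psi y) _ (eval_distribution y)) Ox => z Oz.
by rewrite kernel_slice.
Qed.

Lemma basic_spaceB (F G : D -> Omega -> K) :
  basic_space F -> basic_space G -> basic_space (F - G).
Proof.
move=> bF bG c x sc sx; have [F1 F2] := bF c x sc sx; have [G1 G2] := bG c x sc sx.
split; apply: rsm_smooth_curve.
  apply: (rsm_ext openT (rsmB openT (smooth_curve_rsm F1) (smooth_curve_rsm G1))) => t _.
  by rewrite -sreN -sreD.
apply: (rsm_ext openT (rsmB openT (smooth_curve_rsm F2) (smooth_curve_rsm G2))) => t _.
by rewrite -simN -simD.
Qed.

Lemma embedding_difference_negligible (f : Omega -> K) : smooth_fun k Omega f ->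
  negligible_space k Omega (iota_emb (distr_of f) - sigma_emb f).
Proof.
move=> sf; have uf := distr_of_distribution Oo sf; split.
  exact: basic_spaceB (iota_basic uf) (sigma_basic Oo sf).
move=> L cL alpha m; exists m => phi [sphi _ _ l3].
apply: (bigO_mono (g := fun e => e ^+ m.+1)) => [e|].
  by rewrite exprS ler_piMl ?exprn_ge0 ?(ltW (I01_gt0 e))// I01_le1.
apply: bigO_eq (l3 L cL alpha f sf) => e x Lx.
have [_ LO] := cL; have Ox := interior_subset (LO _ Lx).
by rewrite (LSK3_integralE alpha e sphi sf Ox).
Qed.

End Negligible.

(** * Kernels with vanishing moments *)

Section Primitives.
Context {R : realType}.
Local Notation mu := (@lebesgue_measure R).
Implicit Types (B t : R) (f F : R -> R).

Lemma derive0_eq F (a b : R) : (forall t : R, `|t - a| <= `|b - a| -> is_derive t 1 F (0 : R)) ->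
  F b = F a.
Proof.
move=> dF; apply/eqP; rewrite -subr_eq0 -normr_le0.
have := @mean_value_le R F (fun=> 0) a b 0; rewrite mul0r; apply => t /dF dt.
by split=> //; rewrite normr0.
Qed.

Lemma primitive f B : continuous f -> (forall t, t <= - B -> f t = 0) ->
  exists F, (forall t : R, is_derive t 1 F (f t)) /\ forall t, t <= - B -> F t = 0.
Proof.
(* Starting the integral at [- B - 1] instead of [- B] lets the fundamental theorem apply at every
   [t > - B - 1], while near the other [t] both [f] and [F] vanish. *)
move=> cf zf; pose F x := Rintegral mu [set` `[- B - 1, x]] f.
have F0 t : t <= - B -> F t = 0.
  move=> tB; rewrite /F /Rintegral integral0_eq// => s /=; rewrite in_itv /= => /andP[_ st].
  by rewrite zf// (le_trans st).
exists F; split=> // t; have [tB|tB] := ltP (- B - 1) t.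
  have ti : mu.-integrable `[- B - 1, t + 1] (EFin \o f).
    apply: continuous_compact_integrable; first exact: segment_compact.
    exact: continuous_subspaceT.
  have t1 : t < t + 1 by rewrite ltrDl.
  have [d1 d2] := continuous_FTC1_closed t1 ti tB (cf t).
  by apply: DeriveDef => //; rewrite -d2 derive1E.
have ft : f t = 0 by apply: zf; lra.
rewrite ft; apply/kderive_real; apply: (@near_kderive RealScalars R R^o t 1 (fun=> 0)).
  near=> s; rewrite F0 //; near: s; apply/nbhs_ballP; exists 1 => //= s.
  by rewrite /ball /= ltr_norml => /andP[h _]; lra.
exact: (@kderive_cst RealScalars R R^o).
Unshelve. all: by end_near. Qed.

(** The moment appears as the total increase of a primitive. In this form scaling and translation of
    [f] are substitutions in [F], and no integral has to be transformed. *)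
Definition moment B f (j : nat) (m : R) : Prop := exists F,
  [/\ forall t : R, is_derive t 1 F (t ^+ j * f t),
      forall t, t <= - B -> F t = 0 & forall t, B <= t -> F t = m].

Lemma moment_exists B f j : 0 <= B -> continuous f -> (forall t, B <= `|t| -> f t = 0) ->
  exists m, moment B f j m.
Proof.
move=> B0 cf zf.
have cg : continuous (fun t => t ^+ j * f t).
  move=> t; exact: (continuousM (rsm_cont (rsmX openT j (rsm_id setT)) I) (cf t)).
have [|F [dF F0]] := primitive cg (B := B).
  by move=> t tB; rewrite zf ?mulr0// ler_normr; apply/orP; right; lra.
exists (F B), F; split=> // t tB; apply/esym/derive0_eq => s.
rewrite distrC [X in _ <= X]distrC [X in _ <= X]ger0_norm ?subr_ge0// => sB; rewrite (_ : 0 = s ^+ j * f s); first exact: dF.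
have Bs : B <= s by move: sB; rewrite ler_norml => /andP[_ h]; lra.
by rewrite zf ?mulr0// (le_trans Bs)// ler_norm.
Qed.

Definition transition A (H : R -> R) : Prop :=
  [/\ rsm dir1 setT H, forall t, t <= - A -> H t = 0 & forall t, A <= t -> H t = 1].

Definition jump (H : R -> R) t := H (t + 1) - H t.

Lemma rsm_jump A H : transition A H -> rsm dir1 setT (jump H).
Proof.
move=> [sH _ _]; have s1 := rsm_comp1 openT sH (rsm_addl 1) (fun _ _ => I).
apply: (rsm_ext openT (rsmB openT s1 sH)) => t _.
by rewrite /jump /= [1 + t]addrC.
Qed.

Lemma jump_out A H t : transition A H -> A + 1 <= `|t| -> jump H t = 0.
Proof.
move=> [_ H0 H1]; rewrite ler_normr => /orP[] h; rewrite /jump.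
  by rewrite !H1 ?subrr//; lra.
by rewrite !H0 ?subrr//; lra.
Qed.

Lemma jump_telescope A H (N : nat) t : transition A H -> `|t| <= N%:R - A ->
  \sum_(i < (N + N).+1) jump H (t + N%:R - i%:R) = 1.
Proof.
move=> [_ H0 H1]; rewrite ler_norml => /andP[t1 t2].
transitivity (\sum_(0 <= i < (N + N).+1)
    (- (H (t + N%:R + 1 - i.+1%:R)) - (- H (t + N%:R + 1 - i%:R)))).
  rewrite big_mkord; apply: eq_bigr => i _; rewrite /jump opprK [RHS]addrC -natr1.
  by congr (H _ - H _); ring.
rewrite telescope_sumr// H0 ?H1; first by rewrite oppr0 sub0r opprK.
- by rewrite subr0; lra.
- by rewrite -natr1 natrD; lra.
Qed.

(** For a primitive [P] of [H] the function [P s - s] is constant where [H = 1]; hence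
    [P (t + 1) - P t], a primitive of the jump, passes from 0 to 1. *)
Lemma jump_mass A H : 0 <= A -> transition A H -> moment (A + 1) (jump H) 0 1.
Proof.
move=> A0 [sH H0 H1]; have cH : continuous H by move=> t; exact: rsm_cont sH I.
have [P [dP P0]] := primitive cH H0.
have dshift (t : R) : is_derive t 1 (fun s => P (s + 1)) (H (t + 1)).
  have id1 : is_derive (t : R) 1 (fun s : R => 1 * s + 1) 1 by exact: is_derive_affine.
  have e1 : 1 * t + 1 = t + 1 by rewrite mul1r.
  have := is_derive_comp1 (f := P) (g := fun s : R => 1 * s + 1) _ id1.
  move=> /(_ (H (t + 1))); rewrite mulr1 e1 => /(_ (dP _)).
  by rewrite (_ : P \o _ = fun s => P (s + 1))//; apply/funext => s /=; rewrite mul1r.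
exists (fun t => P (t + 1) - P t); split=> [t|t tA|t tA].
- by rewrite expr0 mul1r; exact: is_deriveB.
- by rewrite !P0 ?subrr//; lra.
have e s : A <= s -> P s - s = P A - A.
  move=> As; apply/esym/(@derive0_eq (fun s => P s - s)) => r.
  rewrite distrC [X in _ <= X]distrC [X in _ <= X]ger0_norm ?subr_ge0// ler_norml => /andP[_ h].
  have -> : 0 = H r - 1 :> R by rewrite H1 ?subrr//; lra.
  by apply: is_deriveB.
have := e (t + 1); have := e t; lra.
Qed.

(* Richardson extrapolation: [b = 1 / (2 ^ q - 1)] cancels the moment of order
   [q] of the jump, and keeps its mass and the partition of unity given by its
   translates. *)
Definition richardson (b : R) (H : R -> R) t :=
  (1 + b) * H t - b / 2 * (H (t / 2) + H ((t + 1) / 2)).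

Lemma rsm_half H (c : R) : rsm dir1 setT H -> rsm dir1 setT (fun t => H ((t + c) / 2)).
Proof.
move=> sH; have sg : rsm dir1 setT (fun t : R => (t + c) / 2).
  exact (rsmM openT (rsmD openT (rsm_id setT) (rsm_cst dir1 setT c)) (rsm_cst dir1 setT 2^-1)).
exact: (rsm_comp1 openT sH sg (fun _ _ => I)).
Qed.

Lemma transition_richardson A b H : 0 <= A -> transition A H ->
  transition (A + A + 1) (richardson b H).
Proof.
move=> A0 [sH H0 H1]; split=> [|t tA|t tA].
- have s0 := rsm_half 0 sH; have s1 := rsm_half 1 sH.
  apply: (rsm_ext openT (rsmB openT (rsmM openT (rsm_cst dir1 setT (1 + b)) sH)
    (rsmM openT (rsm_cst dir1 setT (b / 2)) (rsmD openT s0 s1)))) => t _.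
  by rewrite addr0.
- by rewrite /richardson !H0; lra.
- by rewrite /richardson !H1; lra.
Qed.

(** Two half steps telescope: [H (t / 2) + H ((t + 1) / 2)] has the jump [jump H (t / 2)]. The
    kernel is thus corrected by a copy twice as wide and remains the jump of a transition
    function. *)
Lemma jump_richardson b H t :
  jump (richardson b H) t = (1 + b) * jump H t - b / 2 * jump H (t / 2).
Proof.
rewrite /jump /richardson; have -> : (t + 1 + 1) / 2 = t / 2 + 1 by field.
by ring.
Qed.

Lemma moment_richardson B b H j m : 0 <= B -> moment B (jump H) j m ->
  moment (B + B) (jump (richardson b H)) j ((1 + b - b * 2 ^+ j) * m).
Proof.
move=> B0 [F [dF F0 F1]].
exists (fun t => (1 + b) * F t - b * 2 ^+ j * F (t / 2)); split=> [t|t tB|t tB].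
- have ih : is_derive (t : R) 1 (fun s : R => 2^-1 * s + 0) 2^-1 by exact: is_derive_affine.
  have := is_derive_comp1 (f := F) (g := fun s : R => 2^-1 * s + 0) (dF _) ih.
  rewrite (_ : F \o _ = fun s => F (s / 2)); last by apply/funext => s /=; rewrite addr0 mulrC.
  rewrite addr0 => d2; have d1 := is_deriveZ (1 + b) (dF t).
  have d3 := is_deriveZ (b * 2 ^+ j) d2.
  have := is_deriveB d1 d3; rewrite jump_richardson => d4.
  apply: (is_derive_eq d4); rewrite /GRing.scale /= [2^-1 * t]mulrC exprMn exprVn.
  have n0 : (2 : R) ^+ j != 0 by rewrite expf_neq0// pnatr_eq0.
  by field.
- by rewrite !F0 ?mulr0 ?subrr//; lra.
- by rewrite !F1; [ring|lra|lra].
Qed.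

Lemma moment_kernel (q : nat) : exists A H, [/\ 0 <= A, transition A H &
  forall j, (j <= q)%N -> moment (A + 1) (jump H) j (j == 0%N)%:R].
Proof.
elim: q => [|q [A [H [A0 tH mH]]]].
  exists 1, step; have t1 : transition 1 step.
    split=> [|t t1|t t1]; [exact: rsm_step|by apply: step0; lra|exact: step1].
  by split=> // -[|j]// _; exact: jump_mass.
have p1 : 1 < 2 ^+ q.+1 :> R by rewrite exprn_egt1// ltr1n.
pose b : R := (2 ^+ q.+1 - 1)^-1.
have n0 : 2 ^+ q.+1 - 1 != 0 :> R by rewrite subr_eq0 gt_eqF.
have cH : continuous (jump H) by move=> t; exact: rsm_cont (rsm_jump tH) I.
exists (A + A + 1), (richardson b H); split; [lra|exact: transition_richardson|].
move=> j jq; have A1 : 0 <= A + 1 by lra.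
have eA : A + A + 1 + 1 = A + 1 + (A + 1) by ring.
have [m mj] : exists m, moment (A + 1) (jump H) j m /\
    (1 + b - b * 2 ^+ j) * m = (j == 0%N)%:R.
  (* For [j = q + 1] the factor [1 + b - b * 2 ^+ j] is 0. For [0 < j <= q] the moment is 0 already
     and stays so, and the mass is multiplied by [1 + b - b]. *)
  move: jq; rewrite leq_eqVlt => /orP[/eqP ->|jq]; last first.
    exists (j == 0%N)%:R; split; first exact: mH.
    by case: j {jq} => [|j] /=; rewrite ?mulr0// expr0; ring.
  have [m hm] := @moment_exists (A + 1) (jump H) q.+1 A1 cH (fun t => @jump_out A H t tH).
  exists m; split=> //=; rewrite (_ : 1 + b - _ = 0) ?mul0r// /b.
  by field.
by move: mj => [/(moment_richardson b A1) + <-]; rewrite eA.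
Qed.

End Primitives.

(** * Mollification errors for kernels with vanishing moments *)

Section OneDimensionalMollification.
Context {R : realType}.
Local Notation mu := (@lebesgue_measure R).
Implicit Types (B M s t : R) (F G : R -> R).

Lemma is_derive_bigsum {V : normedModType R} (J : Type) (r : seq J) (F : J -> V -> R) (dF : J -> R) (x v : V) :
  (forall j, is_derive x v (F j) (dF j)) ->
  is_derive x v (fun y => \sum_(j <- r) F j y) (\sum_(j <- r) dF j).
Proof.
move=> dFP; elim: r => [|j r IH].
  rewrite big_nil; have -> : (fun y => \sum_(j <- [::]) F j y) = cst 0.
    by apply/funext => y; rewrite big_nil.
  exact: is_derive_cst.
rewrite big_cons; have -> : (fun y => \sum_(l <- j :: r) F l y) = fun y => F j y + \sum_(l <- r) F l y.
  by apply/funext => y; rewrite big_cons.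
exact: is_deriveD.
Qed.

Lemma cc1_mono B B' F : B <= B' -> cc1 B F -> cc1 B' F.
Proof. by move=> BB [cF zF]; split=> // t tB; apply: zF; exact: le_lt_trans tB. Qed.

(** A primitive is constant outside the support, so only the length [2 * r] of the support enters
    and not the bound [B]. With [r = e * B] this length cancels the factor [e^-1] of the scaled
    kernel. *)
Lemma rint1_local B s r F M : 0 <= B -> 0 < r -> cc1 B F -> (forall t, r <= `|t - s| -> F t = 0) ->
  (forall t, `|F t| <= M) -> `|Rintegral mu setT F| <= 2 * r * M.
Proof.
move=> B0 r0 [cF zF] sF FM; have F0 t : t <= - (B + 1) -> F t = 0.
  by move=> tB; apply: zF; rewrite ltr_normr; apply/orP; right; lra.
have [G [dG _]] := primitive cF F0.
have s0 := normr_ge0 s; have [s1 s2] : s <= `|s| /\ - `|s| <= s.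
  by split; [exact: ler_norm|rewrite lerNl -normrN ler_norm].
pose C := B + 1 + `|s| + r.
have C0 : 0 < C by rewrite /C; lra.
have cC : cc1 C F by apply: (@cc1_mono B); [rewrite /C; lra|].
rewrite (rint1_derive C0 cC dG).
have e1 : G (s + r) = G C.
  apply: derive0_eq => t; rewrite [X in _ <= X]distrC [X in _ <= X]ger0_norm; last by rewrite /C; lra.
  rewrite ler_norml => /andP[h _]; rewrite -(sF t); first exact: dG.
  by rewrite ler_normr; apply/orP; left; lra.
have e2 : G (s - r) = G (- C).
  apply: derive0_eq => t; rewrite [X in _ <= X]ger0_norm; last by rewrite /C; lra.
  rewrite ler_norml => /andP[_ h]; rewrite -(sF t); first exact: dG.
  by rewrite ler_normr; apply/orP; right; lra.
have m1 : `|G (s + r) - G s| <= M * `|s + r - s|.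
  by apply: (@mean_value_le R G F) => t _; split; [exact: dG|exact: FM].
have m2 : `|G (s - r) - G s| <= M * `|s - r - s|.
  by apply: (@mean_value_le R G F) => t _; split; [exact: dG|exact: FM].
have n1 : `|s + r - s| = r by rewrite [s + r]addrC addrK ger0_norm ?ltW.
have n2 : `|s - r - s| = r by rewrite [s - r]addrC addrK normrN ger0_norm ?ltW.
rewrite n1 in m1; rewrite n2 in m2; rewrite -e1 -e2.
rewrite (_ : G (s + r) - G (s - r) = (G (s + r) - G s) - (G (s - r) - G s)); last by ring.
by apply: le_trans (ler_normB _ _) _; apply: le_trans (lerD m1 m2) _; lra.
Qed.

Definition taylor_poly (h : nat -> R -> R) (m : nat) s t :=
  \sum_(j < m) h j s * (t - s) ^+ j / j`!%:R.

Lemma taylor_poly_derive h m s t :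
  is_derive t 1 (taylor_poly h m.+1 s) (taylor_poly (fun j => h j.+1) m s t).
Proof.
have dX (j : nat) : is_derive t 1 (fun t => (t - s) ^+ j) (j%:R * (t - s) ^+ j.-1).
  have d1 : is_derive (t : R) 1 (fun t : R => 1 * t + - s) 1 by exact: is_derive_affine.
  have d2 := is_deriveX j d1; rewrite !mul1r in d2.
  rewrite (_ : (fun t => (t - s) ^+ j) = (fun t : R => 1 * t + - s) ^+ j); last first.
    by apply/funext => r; rewrite fctE mul1r.
  by apply: (is_derive_eq d2); rewrite /GRing.scale /= mulr1 -mulr_natl mulrC.
have -> : taylor_poly h m.+1 s = fun t => h 0%N s + \sum_(j < m) (h j.+1 s / j.+1`!%:R) * (t - s) ^+ j.+1.
  apply/funext => r; rewrite /taylor_poly big_ord_recl expr0 mulr1 fact0 divr1; congr (_ + _).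
  by apply: eq_bigr => j _; rewrite mulrAC.
have ds := is_derive_bigsum (index_enum 'I_m) (fun j : 'I_m => is_deriveZ (h j.+1 s / j.+1`!%:R) (dX j.+1)).
apply: (is_derive_eq (is_deriveD (is_derive_cst (h 0%N s) t 1) ds)).
rewrite add0r; apply: eq_bigr => j _; rewrite /GRing.scale /= factS natrM.
have n1 : (j.+1%:R : R) != 0 by rewrite pnatr_eq0.
have n2 : (j`!%:R : R) != 0 by rewrite pnatr_eq0 -lt0n fact_gt0.
by field; rewrite n2 -natr1 in n1 *; rewrite addrC.
Qed.

(** The derivative of the remainder is the remainder for the shifted sequence [h j.+1], so the mean
    value estimate gives the induction. The factorial of the usual remainder is given up. *)
Lemma taylor (q : nat) : forall h M s t, 0 <= M ->
  (forall j (r : R), is_derive r 1 (h j) (h j.+1 r)) -> (forall r, `|h q.+1 r| <= M) ->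
  `|h 0%N t - taylor_poly h q.+1 s t| <= M * `|t - s| ^+ q.+1.
Proof.
elim: q => [|q IH] h M s t M0 dh hM.
  rewrite /taylor_poly big_ord_recl big_ord0 expr0 mulr1 fact0 divr1 addr0 expr1.
  by apply: (@mean_value_le R (h 0%N) (h 1%N)).
pose rem t := h 0%N t - taylor_poly h q.+2 s t.
have rem0 : rem s = 0.
  rewrite /rem /taylor_poly big_ord_recl big1 ?subrr ?expr0 ?mulr1 ?fact0 ?divr1 ?addr0 ?subrr//.
  by move=> j _; rewrite exprS mul0r mulr0 mul0r.
rewrite -[X in `|X|]subr0 -[X in _ - X]rem0.
rewrite exprSr mulrA; apply: (@mean_value_le R rem
  (fun t => h 1%N t - taylor_poly (fun j => h j.+1) q.+1 s t)) => r rt; split.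
  by apply: is_deriveB; exact: taylor_poly_derive.
apply: le_trans (IH (fun j => h j.+1) M s r M0 (fun j => dh j.+1) hM) _.
by rewrite ler_wpM2l// lerXn2r ?nnegrE.
Qed.

Section Kernel.
Variables (B X : R) (chi : R -> R) (q : nat).
Hypothesis B0 : 0 < B.
Hypothesis X0 : 0 <= X.
Hypothesis chi_cont : continuous chi.
Hypothesis chi_out : forall t, B <= `|t| -> chi t = 0.
Hypothesis chi_le : forall t, `|chi t| <= X.
Hypothesis chi_moment : forall j, (j <= q)%N -> moment B chi j (j == 0%N)%:R.

Definition kap (e s t : R) := e^-1 * chi (e^-1 * (t - s)).

Lemma kap_out (e s t : R) : 0 < e -> e * B <= `|t - s| -> kap e s t = 0.
Proof.
by move=> e0 h; rewrite /kap chi_out ?mulr0// normrM normfV (gtr0_norm e0) ler_pdivlMl.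
Qed.

Lemma kap_le (e s t : R) : 0 < e -> `|kap e s t| <= e^-1 * X.
Proof. by move=> e0; rewrite normrM normfV (gtr0_norm e0) ler_wpM2l// invr_ge0 ltW. Qed.

Lemma kap_cont (e s : R) : continuous (kap e s).
Proof.
move=> t; have c1 : {for t, continuous (fun t => e^-1 * (t - s))}.
  have := @is_derive_affine R e^-1 (- (e^-1 * s)) t => /is_derive_cont.
  by rewrite (_ : (fun t => e^-1 * (t - s)) = fun t => e^-1 * t + - (e^-1 * s))//; apply/funext => r; rewrite mulrBr.
have cc : {for t, continuous (fun=> e^-1 : R)} by exact: cst_continuous.
exact: (continuousM cc (continuous_comp c1 (@chi_cont _))).
Qed.

Lemma kap_mul_cc1 (e s : R) (h : R -> R) : 0 < e -> e <= 1 -> continuous h -> cc1 (`|s| + B) (fun t => h t * kap e s t).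
Proof.
move=> e0 e1 ch; split=> [t|t tB].
  have cht : {for t, continuous h} := ch t.
  have ckt : {for t, continuous (kap e s)} := @kap_cont e s t.
  exact: (continuousM cht ckt).
rewrite kap_out ?mulr0//; apply: (@le_trans _ _ B).
  by rewrite ler_piMl// ltW.
by have := ler_normD (t - s) s; rewrite subrK; lra.
Qed.

(** Substituting [(t - s) / e] into the primitives from [chi_moment] yields a primitive of the
    integrand, whose total increase comes from the mass term alone. *)
Lemma kap_poly (e s : R) (c : nat -> R) : 0 < e -> e <= 1 ->
  Rintegral mu setT (fun t => (\sum_(j < q.+1) c j * (t - s) ^+ j) * kap e s t) = c 0%N.
Proof.
move=> e0 e1; have ex j : exists F, (j <= q)%N ->
    [/\ forall t : R, is_derive t 1 F (t ^+ j * chi t),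
      forall t, t <= - B -> F t = 0 & forall t, B <= t -> F t = (j == 0%N)%:R].
  have [jq|nq] := boolP (j <= q)%N; last by exists (fun=> 0).
  by have [F HF] := chi_moment jq; exists F.
pose F j := projT1 (cid (ex j)); have FP j := projT2 (cid (ex j)) : (j <= q)%N -> 
    [/\ forall t : R, is_derive t 1 (F j) (t ^+ j * chi t),
      forall t, t <= - B -> F j t = 0 & forall t, B <= t -> F j t = (j == 0%N)%:R].
have dF (j : 'I_q.+1) (t : R) : is_derive t 1 (fun t => (c j * e ^+ j) * F j (e^-1 * t + - (e^-1 * s)))
    (c j * (t - s) ^+ j * kap e s t).
  have [dFj _ _] := FP j (ltn_ord j).
  have ih : is_derive (t : R) 1 (fun t : R => e^-1 * t + - (e^-1 * s)) e^-1 by exact: is_derive_affine.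
  have d1 := is_derive_comp1 (f := F j) (g := fun t : R => e^-1 * t + - (e^-1 * s)) (dFj _) ih.
  apply: (is_derive_eq (is_deriveZ (c j * e ^+ j) d1)).
  rewrite /GRing.scale /= -mulrBr /kap exprMn exprVn.
  have ne : e ^+ j != 0 by rewrite expf_neq0// gt_eqF.
  rewrite [_^-1 * (t - s) ^+ j]mulrC -!mulrA; congr (_ * _); rewrite mulrCA; congr (_ * _).
  by rewrite mulVKf// mulrC.
have dsum (t : R) := is_derive_bigsum (index_enum 'I_q.+1) (fun j : 'I_q.+1 => dF j t).
pose B' : R := `|s| + B.
have B'0 : 0 < B' by rewrite ltr_wpDl.
have s1 : s <= `|s| by exact: ler_norm.
have s2 : - `|s| <= s by rewrite lerNl -normrN ler_norm.
have ei : 1 <= e^-1 by rewrite invf_ge1.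
have right : B <= e^-1 * B' + - (e^-1 * s).
  rewrite -mulrBr; apply: (@le_trans _ _ (B' - s)); first by rewrite /B'; lra.
  by apply: ler_peMl => //; rewrite /B'; move: B0 s1; lra.
have left : e^-1 * (- B') + - (e^-1 * s) <= - B.
  rewrite -mulrBr lerNr -mulrN; apply: (@le_trans _ _ (- (- B' - s))); first by rewrite /B'; lra.
  by apply: ler_peMl => //; rewrite /B'; move: B0 s2; lra.
have cp : continuous (fun t : R => \sum_(j < q.+1) c j * (t - s) ^+ j).
  move=> t; apply: rsm_cont (I : setT t); apply: (rsm_sum openT) => j.
  have sm : rsm dir1 setT (fun t : R => t - s) := rsmB openT (rsm_id setT) (rsm_cst dir1 setT s).
  exact (rsmM openT (rsm_cst dir1 setT (c j)) (rsmX openT j sm)).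
pose G (t : R) := \sum_(j < q.+1) c j * e ^+ j * F j (e^-1 * t + - (e^-1 * s)).
have dG (t : R) : is_derive t 1 G ((fun t => \sum_(j < q.+1) c j * (t - s) ^+ j) t * kap e s t).
  by apply: (is_derive_eq (dsum t)); rewrite mulr_suml.
apply: (etrans (rint1_derive B'0 (kap_mul_cc1 s e0 e1 cp) dG)); rewrite /G.
rewrite [X in _ - X]big1 ?subr0; last first.
  by move=> j _; have [_ F0 _] := FP j (ltn_ord j); rewrite F0 ?mulr0.
rewrite big_ord_recl big1 ?addr0; last first.
  by move=> j _; have [_ _ F1] := FP (lift ord0 j) (ltn_ord (lift ord0 j)); rewrite F1 ?mulr0.
by have [_ _ F1] := FP 0%N (leq0n q); rewrite F1// mulr1 expr0 mulr1.
Qed.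

(** The Taylor polynomial of degree [q] at [s] is integrated exactly by [kap_poly]. The remainder is
    at most [M * (e * B) ^+ q.+1] on the support, whose length [2 * (e * B)] cancels the [e^-1] of
    the kernel. *)
Lemma mollify1 (e s : R) (h : nat -> R -> R) M : 0 < e -> e <= 1 -> 0 <= M ->
  (forall j (r : R), is_derive r 1 (h j) (h j.+1 r)) -> (forall r, `|h q.+1 r| <= M) ->
  `|Rintegral mu setT (fun t => h 0%N t * kap e s t) - h 0%N s| <= 2 * B * X * B ^+ q.+1 * (M * e ^+ q.+1).
Proof.
move=> e0 e1 M0 dh hM; pose p t := \sum_(j < q.+1) (h j s / j`!%:R) * (t - s) ^+ j.
have pE t : p t = taylor_poly h q.+1 s t by apply: eq_bigr => j _; rewrite mulrAC.
have ch : continuous (h 0%N) by move=> t; exact: is_derive_cont (dh 0%N t).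
have cp : continuous p.
  move=> t; rewrite (_ : p = taylor_poly h q.+1 s); last exact/funext.
  exact: is_derive_cont (taylor_poly_derive h q s t).
have c1 := kap_mul_cc1 s e0 e1 ch; have c2 := kap_mul_cc1 s e0 e1 cp.
have := kap_poly s (fun j => h j s / j`!%:R) e0 e1; rewrite fact0 divr1 => <-.
rewrite -[X in `|X|]addrC -[X in X + _]mulN1r -(rint1_lin (-1) c2 c1).
have -> : 2 * B * X * B ^+ q.+1 * (M * e ^+ q.+1) = 2 * (e * B) * (M * (e * B) ^+ q.+1 * (e^-1 * X)).
  by rewrite exprMn; field; rewrite gt_eqF.
have B's : 0 <= `|s| + B by rewrite addr_ge0// ltW.
apply: (rint1_local B's (s := s)); first exact: mulr_gt0.
- exact: cc1_lin.
- by move=> t st; rewrite kap_out// !mulr0 addr0.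
move=> t; have [st|st] := leP (e * B) `|t - s|.
  rewrite kap_out// !mulr0 addr0 normr0 !mulr_ge0// ?exprn_ge0 ?mulr_ge0 ?invr_ge0 ?ltW//.
rewrite mulN1r addrC -mulrBl normrM; apply: ler_pM => //; last exact: kap_le.
rewrite pE; apply: le_trans (taylor s t M0 dh hM) _.
by rewrite ler_wpM2l// lerXn2r ?nnegrE//; [exact/ltW/mulr_gt0|exact: ltW].
Qed.

End Kernel.
End OneDimensionalMollification.

Section RowSlices.
Context {R : realType} {n : nat}.

Definition hrow (t : R) (v : 'rV[R]_n) : 'rV[R]_n.+1 := row_mx (const_mx t : 'rV[R]_1) v.

Lemma hrow0 t v : hrow t v 0 ord0 = t.
Proof. by have [] := row_mx_coord t v. Qed.

Lemma hrow_lift t v i : hrow t v 0 (lift ord0 i) = v 0 i.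
Proof. by have [_] := row_mx_coord t v; exact. Qed.

Lemma rowP_lift (y z : 'rV[R]_n.+1) : y 0 ord0 = z 0 ord0 ->
  (forall i, y 0 (lift ord0 i) = z 0 (lift ord0 i)) -> y = z.
Proof. by move=> e0 ei; apply/rowP => j; case: (unliftP ord0 j) => [i ->|->]. Qed.

Lemma hrow_eq (y : 'rV[R]_n.+1) : y = hrow (y 0 ord0) (\row_i y 0 (lift ord0 i)).
Proof. by apply: rowP_lift => [|i]; rewrite ?hrow0 ?hrow_lift ?mxE. Qed.

Lemma row_slice_derive (h : 'rV[R]_n.+1 -> R) t v i l :
  is_derive (hrow t v) (delta_mx 0 (lift ord0 i)) h l ->
  is_derive v (delta_mx 0 i) (row_slice h t) l.
Proof.
move=> /is_derive_line dh; apply/is_derive_line.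
rewrite (_ : (fun s => _) = fun s => h (hrow t v + s *: delta_mx 0 (lift ord0 i)))//.
apply/funext => s; rewrite /row_slice -/(hrow _ _); congr h; apply: rowP_lift => [|j].
  by rewrite hrow0 [RHS]mxE hrow0 !mxE mulr0 addr0.
by rewrite hrow_lift [RHS]mxE hrow_lift !mxE (inj_eq (@lift_inj _ ord0)).
Qed.

Lemma head_derive (h : 'rV[R]_n.+1 -> R) t v l :
  is_derive (hrow t v) (delta_mx 0 ord0) h l -> is_derive t 1 (fun t => h (hrow t v)) l.
Proof.
move=> /is_derive_line dh; apply/is_derive_line.
rewrite (_ : (fun s => _) = fun s => h (hrow t v + s *: delta_mx 0 ord0))//.
apply/funext => s; congr h; apply: rowP_lift => [|j].
  by rewrite hrow0 [RHS]mxE hrow0 !mxE !eqxx.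
by rewrite hrow_lift [RHS]mxE hrow_lift !mxE mulr0 addr0.
Qed.

End RowSlices.

Section Mollification.
Context {R : realType}.
Local Notation mu := (@lebesgue_measure R).

Lemma rintegralZ n (B : R) (f : 'rV[R]_n -> R) a : 0 <= B -> cc B f ->
  rintegral (fun y => a * f y) = a * rintegral f.
Proof.
move=> B0 cf; have [lin _] := @rintegralP R n B B0.
have c0 : cc B (fun _ : 'rV[R]_n => 0 : R) by split=> // x; exact: cst_continuous.
have := lin f (fun=> 0) a cf c0; rewrite rintegral_cst0 addr0 => <-.
by congr rintegral; apply/funext => y; rewrite addr0.
Qed.

Lemma coord_cont n (i : 'I_n) : continuous (fun y : 'rV[R]_n => y 0 i).
Proof.
move=> x; apply/continuous_normP => e e0; exists e => // y /ltW; apply: le_trans.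
by have := coord_le_norm (y - x) i; rewrite !mxE.
Qed.

Lemma continuous_bigprod {T : topologicalType} (J : Type) (r : seq J) (F : J -> T -> R) :
  (forall j, continuous (F j)) -> continuous (fun y => \prod_(j <- r) F j y).
Proof.
move=> cF; elim: r => [|j r IH] x.
  by rewrite (_ : (fun y => _) = cst 1); [exact: cst_continuous|apply/funext => y; rewrite big_nil].
rewrite (_ : (fun y => _) = fun y => F j y * \prod_(l <- r) F l y); last first.
  by apply/funext => y; rewrite big_cons.
have c1 : {for x, continuous (F j)} := cF j x.
have c2 : {for x, continuous (fun y => \prod_(l <- r) F l y)} := IH x.
exact: (continuousM c1 c2).
Qed.

Section Kernel.
Variables (B X : R) (chi : R -> R) (q : nat).
Hypothesis B0 : 0 < B.
Hypothesis X0 : 0 <= X.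
Hypothesis chi_cont : continuous chi.
Hypothesis chi_out : forall t, B <= `|t| -> chi t = 0.
Hypothesis chi_le : forall t, `|chi t| <= X.
Hypothesis chi_moment : forall j, (j <= q)%N -> moment B chi j (j == 0%N)%:R.

Definition kapn n (e : R) (x y : 'rV[R]_n) := \prod_(i < n) kap chi e (x 0 i) (y 0 i).

Lemma kapn_out n (e : R) (x y : 'rV[R]_n) i : 0 < e -> e * B <= `|y 0 i - x 0 i| -> kapn e x y = 0.
Proof. by move=> e0 h; rewrite /kapn (bigD1 i)//= (kap_out chi_out e0 h) mul0r. Qed.

Lemma kapn_mul_cc n (e : R) (x : 'rV[R]_n) (h : 'rV[R]_n -> R) : 0 < e -> e <= 1 -> continuous h ->
  cc (`|x| + B) (fun y => h y * kapn e x y).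
Proof.
move=> e0 e1 ch; split=> [y|y i yB].
  have c1 : {for y, continuous h} := ch y.
  have c2 : {for y, continuous (kapn e x)}.
    apply: continuous_bigprod => i z.
    exact: (continuous_comp (@coord_cont n i z) (@kap_cont R chi chi_cont e (x 0 i) _)).
  exact: (continuousM c1 c2).
rewrite (@kapn_out n e x y i) ?mulr0//; apply: (@le_trans _ _ B).
  by rewrite ler_piMl// ltW.
have := ler_normD (y 0 i - x 0 i) (x 0 i); rewrite subrK.
by have := coord_le_norm x i; lra.
Qed.

(** Induction on the dimension: the last [n] coordinates are mollified inside, the first one
    outside. As the kernel is a product over the coordinates, only derivatives [d i j] along one
    coordinate at a time occur, and no mixed ones. *)
Lemma mollify n : exists2 C : R, 0 <= C &
  forall (e : R) (h : 'rV[R]_n -> R) (d : 'I_n -> nat -> 'rV[R]_n -> R) (M : R) (x : 'rV[R]_n),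
    0 < e -> e <= 1 -> 0 <= M -> continuous h -> (forall i, d i 0%N = h) ->
    (forall i j y, is_derive y (delta_mx 0 i) (d i j) (d i j.+1 y)) ->
    (forall i y, `|d i q.+1 y| <= M) ->
    `|rintegral (fun y => h y * kapn e x y) - h x| <= C * (M * e ^+ q.+1).
Proof.
elim: n => [|n [C C0 IH]].
  exists 0 => // e h d M x e0 e1 M0 _ _ _ _.
  rewrite /= /kapn big_ord0 mulr1 (_ : x = 0) ?subrr ?normr0 ?mul0r//.
  by apply/rowP => -[].
exists (2 * B * X * C + 2 * B * X * B ^+ q.+1).
  by rewrite addr_ge0// !mulr_ge0// ?exprn_ge0// ltW.
move=> e h d M x e0 e1 M0 ch d0 dd dM.
pose x0 := x 0 ord0; pose x' : 'rV[R]_n := \row_i x 0 (lift ord0 i).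
have xE : x = hrow x0 x' := hrow_eq x.
have kE t v : kapn e x (hrow t v) = kap chi e x0 t * kapn e x' v.
  rewrite /kapn big_ord_recl hrow0; congr (_ * _); apply: eq_bigr => i _.
  by rewrite hrow_lift mxE.
have xB' : 0 <= `|x'| + B by rewrite addr_ge0// ltW.
have xB : 0 <= `|x| + B by rewrite addr_ge0// ltW.
have chs (t : R) : continuous (row_slice h t).
  move=> v; apply: (@continuous_comp _ _ _ (hrow t) h); last exact: ch.
  apply/continuous_normP => r r0; exists r => // w /ltW wv.
  by apply: row_mx_dist; rewrite ?subrr ?normr0// ltW.
pose J t := rintegral (fun v => row_slice h t v * kapn e x' v).
have sliceE t : rintegral (row_slice (fun y => h y * kapn e x y) t) = kap chi e x0 t * J t.
  rewrite /J -(rintegralZ _ xB' (kapn_mul_cc x' e0 e1 (chs t))).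
  by congr rintegral; apply/funext => v; rewrite /row_slice -/(hrow t v) kE mulrCA.
have dh j (t : R) v : is_derive t 1 (fun t => d ord0 j (hrow t v)) (d ord0 j.+1 (hrow t v)).
  exact: head_derive (dd _ _ _).
have bJ (t : R) : `|J t - h (hrow t x')| <= C * (M * e ^+ q.+1).
  apply: (IH e (row_slice h t) (fun i j => row_slice (d (lift ord0 i) j) t) M x') => //.
  - by move=> i; rewrite d0.
  - by move=> i j v; apply: row_slice_derive; exact: dd.
  - by move=> i v; exact: dM.
have c1 : cc1 (`|x| + B) (fun t => kap chi e x0 t * J t).
  have := rintegral_slice_cc1 xB (kapn_mul_cc x e0 e1 ch).
  by rewrite (_ : (fun t => _) = fun t => kap chi e x0 t * J t)//; apply/funext => t; rewrite sliceE.
have ch0 : continuous (fun t => d ord0 0%N (hrow t x')).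
  by move=> t; exact: is_derive_cont (dh 0%N t x').
have c2 : cc1 (`|x| + B) (fun t => d ord0 0%N (hrow t x') * kap chi e x0 t).
  apply: cc1_mono (kap_mul_cc1 B0 chi_cont chi_out x0 e0 e1 ch0).
  by rewrite lerD2r coord_le_norm.
rewrite [rintegral _](_ : _ = Rintegral mu setT (fun t => kap chi e x0 t * J t)); last first.
  by congr Rintegral; apply/funext => t; exact: sliceE.
rewrite (_ : _ - h x = (Rintegral mu setT (fun t => kap chi e x0 t * J t) -
    Rintegral mu setT (fun t => d ord0 0%N (hrow t x') * kap chi e x0 t)) +
    (Rintegral mu setT (fun t => d ord0 0%N (hrow t x') * kap chi e x0 t) - d ord0 0%N (hrow x0 x'))); last first.
  by rewrite addrA subrK d0 -xE.
apply: le_trans (ler_normD _ _) _; rewrite [leRHS]mulrDl; apply: lerD; last first.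
  apply: (@mollify1 R B X chi q B0 X0 chi_cont chi_out chi_le chi_moment e x0
    (fun j t => d ord0 j (hrow t x')) M) => // j t; exact: dh.
rewrite -[X in `|X|]addrC -[X in X + _]mulN1r -(rint1_lin (-1) c2 c1).
have -> : 2 * B * X * C * (M * e ^+ q.+1) = 2 * (e * B) * (e^-1 * X * (C * (M * e ^+ q.+1))).
  by field; rewrite gt_eqF.
have fE (t : R) : -1 * (d ord0 0%N (hrow t x') * kap chi e x0 t) + kap chi e x0 t * J t =
    kap chi e x0 t * (J t - h (hrow t x')).
  by rewrite d0 mulN1r addrC mulrBr [h _ * _]mulrC.
apply: (rint1_local xB (s := x0)); first exact: mulr_gt0.
- exact: cc1_lin.
- by move=> t st; rewrite fE (kap_out chi_out e0 st) mul0r.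
- by move=> t; rewrite fE normrM; apply: ler_pM => //; exact: kap_le.
Qed.

End Kernel.

(** For each [y] the mean value estimate bounds the error of the linear approximation, uniformly in
    [y] by the last hypothesis; integration over the cube of side [2 * B] keeps the order. *)
Lemma integral_deriv n (B : R) (Phi dPhi : R -> 'rV[R]_n -> R) (t : R) : 0 <= B ->
  (forall s, cc B (Phi s)) -> (forall s, cc B (dPhi s)) ->
  (forall (s : R) y, is_derive s 1 (fun s => Phi s y) (dPhi s y)) ->
  (forall e : R, 0 < e -> exists2 d : R, 0 < d &
     forall s y, `|s - t| < d -> `|dPhi s y - dPhi t y| <= e) ->
  is_derive t 1 (fun s => rintegral (Phi s)) (rintegral (dPhi t)).
Proof.
move=> B0 cP cdP dP ud; apply/is_deriveP => e e0.
have [lin bd] := @rintegralP R n B B0.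
have D0 : 0 < (2 * B) ^+ n + 1 by rewrite ltr_wpDl// exprn_ge0// mulr_ge0.
have [d d0 Hd] := ud _ (divr_gt0 e0 D0).
exists d => // h hd; have -> : h *: (1 : R) = h by rewrite /GRing.scale /= mulr1.
have -> : rintegral (Phi (t + h)) - rintegral (Phi t) - h * rintegral (dPhi t) =
    rintegral (fun y => - h * dPhi t y + (-1 * Phi t y + Phi (t + h) y)).
  rewrite lin//; last exact: cc_lin.
  by rewrite lin//; ring.
apply: le_trans (bd _ (e / ((2 * B) ^+ n + 1) * `|h|) _ _) _.
- by apply: cc_lin => //; exact: cc_lin.
- move=> y; pose F s := Phi s y - (s - t) * dPhi t y.
  have dF (s : R) : is_derive s 1 F (dPhi s y - dPhi t y).
    have d1 : is_derive (s : R) 1 (fun s : R => dPhi t y * s + - (dPhi t y * t)) (dPhi t y).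
      exact: is_derive_affine.
    rewrite (_ : F = fun s => Phi s y - (dPhi t y * s + - (dPhi t y * t))).
      exact: is_deriveB.
    by apply/funext => r; rewrite /F mulrBl; ring.
  have := @mean_value_le R F (fun s => dPhi s y - dPhi t y) t (t + h) (e / ((2 * B) ^+ n + 1)).
  have -> : t + h - t = h by ring.
  have -> : F (t + h) - F t = - h * dPhi t y + (-1 * Phi t y + Phi (t + h) y).
    by rewrite /F; ring.
  by apply=> s st; split; [exact: dF|apply: Hd; exact: le_lt_trans hd].
rewrite mulrA; apply: ler_wpM2r => //.
by rewrite mulrC mulrAC ler_pdivrMr// ler_wpM2l ?(ltW e0)// lerDl.
Qed.

(** In a tail coordinate the slice integrals vanish by induction. In the head coordinate the slice
    integral of [h] is a primitive of that of [hi], and it is 0 at both ends. *)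
Lemma by_parts n (B : R) : 0 <= B -> forall (h hi : 'rV[R]_n -> R) (i : 'I_n), cc B h -> cc B hi ->
  (forall y, is_derive y (delta_mx 0 i) h (hi y)) -> rintegral hi = 0.
Proof.
move=> B0; elim: n => [h hi []//|n IH] h hi i ch chi dh.
case: (unliftP ord0 i) dh => [j ->|->] dh.
  rewrite -[LHS]/(Rintegral mu setT (fun t => rintegral (row_slice hi t))).
  rewrite (_ : (fun t => _) = cst 0) ?Rintegral_cst ?mul0r//; apply/funext => t.
  apply: (IH (row_slice h t) (row_slice hi t) j); [exact: cc_slice|exact: cc_slice|].
  by move=> v; apply: row_slice_derive; exact: dh.
have dG (t : R) : is_derive t 1 (fun t => rintegral (row_slice h t)) (rintegral (row_slice hi t)).
  apply: (integral_deriv B0 (fun s => cc_slice s ch) (fun s => cc_slice s chi)).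
    by move=> s v; exact: head_derive (dh _).
  move=> e e0; have [d d0 Hd] := cc_uniform B0 chi e0.
  exists d => // s y st; apply: Hd; apply: le_lt_trans st.
  by apply: row_mx_dist => //; rewrite subrr normr0.
have B1 : 0 < B + 1 by rewrite ltr_wpDl.
have c1 : cc1 (B + 1) (fun t => rintegral (row_slice hi t)).
  by apply: cc1_mono (rintegral_slice_cc1 B0 chi); rewrite lerDl.
have [_ G0] := rintegral_slice_cc1 B0 ch.
rewrite -[LHS]/(Rintegral mu setT (fun t => rintegral (row_slice hi t))) (rint1_derive B1 c1 dG).
by rewrite !G0 ?subrr// ?normrN gtr0_norm// ltrDl.
Qed.

End Mollification.

(** * Mollification *)

Section ScaledProfiles.
Context {R : realType} {n : nat}.
Local Notation E := 'rV[R]_n.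
Local Notation T := (testfun RealScalars (setT : set E)).

Lemma is_derive_scaled {V : normedModType R} (f : V -> R) (p x v : V) (c l : R) :
  is_derive (p + c *: x) v f l -> is_derive x v (fun x => f (p + c *: x)) (c * l).
Proof.
move=> /is_derive_line df; apply/is_derive_line.
have ih : is_derive (0 : R) 1 (fun s : R => c * s + 0) c by exact: is_derive_affine.
have := is_derive_comp1 (f := fun s => f (p + c *: x + s *: v)) (g := fun s : R => c * s + 0) _ ih.
move=> /(_ l); rewrite mulr0 addr0 => /(_ df); rewrite mulrC.
rewrite (_ : _ \o _ = fun s => f (p + c *: (x + s *: v)))//; apply/funext => s /=.
by rewrite addr0 scalerDr scalerA addrA.
Qed.

Lemma rsm_coord (i : 'I_n) (U : set E) : rsm dirE U (fun y : E => y 0 i).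
Proof.
apply: (@rsm_affine R _ _ dirE U (fun y : E => y 0 i) (fun j => (j == i)%:R)) => [y _|y j _].
  exact: coord_cont.
apply/is_deriveP => e e0; exists 1 => // h _; rewrite !mxE eqxx /=.
by rewrite [i == j]eq_sym [y 0 i + _]addrC addrK subrr normr0 mulr_ge0// ltW.
Qed.

Lemma profile_is_test (B : R) (chi : R -> R) : 0 < B -> rsm dir1 setT chi ->
  (forall t, B <= `|t| -> chi t = 0) ->
  is_test (k := RealScalars) setT (fun y : E => \prod_(i < n) chi (y 0 i)).
Proof.
move=> B0 sc zc; apply: (is_test_intro _ (@norm_ball_compact R n B)) => // [|y /= yB].
  apply: (rsm_prod openT) => i.
  exact: (rsm_comp1 openT sc (rsm_coord i setT) (fun _ _ => I)).
have [i yi] : exists i, B < `|y 0 i|.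
  apply: contrapT => nx; apply: yB; apply: norm_le_coord; first exact: ltW.
  by move=> i; rewrite leNgt; apply/negP => yi; apply: nx; exists i.
by rewrite (bigD1 i)//= zc ?mul0r// ltW.
Qed.

Definition scl (e : R) (Xi : T) (y x : E) : R := Xi (e^-1 *: (y - x)).

Lemma scl_derive_y e (Xi : T) i y x :
  is_derive y (delta_mx 0 i) (fun y => scl e Xi y x) (e^-1 * scl e (dtest i Xi) y x).
Proof.
have eE z : e^-1 *: (z - x) = - (e^-1 *: x) + e^-1 *: z by rewrite scalerBr addrC.
rewrite /scl eE (_ : (fun y => _) = fun y => Xi (- (e^-1 *: x) + e^-1 *: y)); last first.
  by apply/funext => z; rewrite eE.
apply: is_derive_scaled; apply/kderive_real; exact: dtest_kderive.
Qed.

Lemma scl_derive_x e (Xi : T) i y x :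
  is_derive x (delta_mx 0 i) (fun x => scl e Xi y x) (- (e^-1 * scl e (dtest i Xi) y x)).
Proof.
have eE z : e^-1 *: (y - z) = e^-1 *: y + (- e^-1) *: z by rewrite scalerBr scaleNr.
rewrite /scl eE (_ : (fun y => _) = fun x => Xi (e^-1 *: y + (- e^-1) *: x)); last first.
  by apply/funext => z; rewrite eE.
rewrite -mulNr; apply: is_derive_scaled; apply/kderive_real; exact: dtest_kderive.
Qed.

Lemma test_cc {k : scalar_kind} {Omega : set E} (phi : testfun k Omega) :
  exists2 B : R, 0 <= B & kcc B (phi : E -> scal k R).
Proof.
have [_ cphi _] := test_is_test phi; have [B B0 HB] := compact_cube cphi.
exists B; first exact: ltW.
by apply: kcc_cube HB (test_csm phi) _ => y; exact: supp_out.
Qed.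

Lemma real_test_cc (Xi : T) : exists2 B : R, 0 <= B & cc B (Xi : E -> R).
Proof. by have [B B0 /kcc_sre] := test_cc Xi; exists B. Qed.

Lemma scl_cont e (Xi : T) x : continuous (fun y => scl e Xi y x).
Proof.
have [B _ [cX _]] := real_test_cc Xi.
move=> y; have c1 : {for y, continuous (fun=> e^-1 : R)} by exact: cst_continuous.
have c2 : {for y, continuous (fun z : E => z - x)}.
  have ci : {for y, continuous (fun z : E => z)} by exact: cvg_id.
  have cx : {for y, continuous (fun _ : E => x)} by exact: cst_continuous.
  exact: (continuousB ci cx).
have c3 : {for y, continuous (fun y : E => e^-1 *: (y - x))} := continuousZ c1 c2.
exact: (continuous_comp c3 (cX _)).
Qed.

Definition moll (e : R) (Xi : T) (h : E -> R) (x : E) : R :=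
  rintegral (fun y => h y * (e ^- n * scl e Xi y x)).

Lemma cc_mul (B : R) (f g : E -> R) : cc B f -> continuous g -> cc B (fun y => f y * g y).
Proof.
move=> [cf zf] cg; split=> [y|y i yB]; last by rewrite (zf y i)// mul0r.
have c1 : {for y, continuous f} := cf y; have c2 : {for y, continuous g} := cg y.
exact: (continuousM c1 c2).
Qed.

(** The derivative in [x] falls on the kernel, where it is minus the derivative in [y]; integration
    by parts moves it to [h]. *)
Lemma moll_derive (e : R) (Xi : T) (B M : R) (h hi : E -> R) (i : 'I_n) x :
  0 < e -> 0 <= B -> cc B h -> cc B hi -> (forall y, `|h y| <= M) ->
  (forall y, is_derive y (delta_mx 0 i) h (hi y)) ->
  is_derive x (delta_mx 0 i) (moll e Xi h) (moll e Xi hi x).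
Proof.
move=> e0 B0 ch chi hM dh; have M0 : 0 <= M by exact: le_trans (hM 0).
pose c := e ^- n; pose Xd := dtest i Xi.
have cscl (Ya : T) (a : R) z : continuous (fun y => a * scl e Ya y z).
  move=> y; have c1 : {for y, continuous (fun=> a : R)} by exact: cst_continuous.
  have c2 : {for y, continuous (fun y => scl e Ya y z)} := @scl_cont e Ya z y.
  exact: (continuousM c1 c2).
have cl (a : R) (Ya : T) (f : E -> R) z : cc B f -> cc B (fun y => f y * (a * scl e Ya y z)).
  by move=> cf; apply: cc_mul.
pose xs (s : R) : E := x + s *: delta_mx 0 i.
pose Phi s y := h y * (c * scl e Xi y (xs s)).
pose dPhi s y := h y * ((- (c * e^-1)) * scl e Xd y (xs s)).
have dP : is_derive (0 : R) 1 (fun s => rintegral (Phi s)) (rintegral (dPhi 0)).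
  apply: (integral_deriv B0) => [s|s|s y|r r0]; [exact: cl|exact: cl| |].
    have d1 := is_derive_shift (scl_derive_x e Xi i y (xs s)).
    have d2 := is_deriveZ (h y) (is_deriveZ c d1).
    by apply: (is_derive_eq d2); rewrite /dPhi /GRing.scale /= -/Xd; ring.
  have [B' B'0 cX] := real_test_cc Xd.
  have W0 : 0 < M * (c * e^-1) + 1.
    by rewrite ltr_wpDl// mulr_ge0// mulr_ge0 ?invr_ge0 ?exprn_ge0 ?ltW.
  have [d d0 Hd] := cc_uniform B'0 cX (divr_gt0 r0 W0).
  have xs0 s z : e^-1 *: (z - xs s) - e^-1 *: (z - xs 0) = (- (e^-1 * s)) *: delta_mx 0 i.
    rewrite -scalerBr /xs scale0r addr0 opprD addrA [z - x - _]addrC addrK.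
    by rewrite scalerN scalerA scaleNr.
  exists (e * d); first exact: mulr_gt0.
  move=> s y; rewrite subr0 => sd; rewrite /dPhi -mulrBr -mulrBr 2!normrM normrN.
  have b1 : `|scl e Xd y (xs s) - scl e Xd y (xs 0)| <= r / (M * (c * e^-1) + 1).
    apply: Hd; rewrite xs0 normrZ normrN normrM normfV (gtr0_norm e0).
    apply: (@le_lt_trans _ _ (e^-1 * `|s|)); last by rewrite ltr_pdivrMl.
    by rewrite -[leRHS]mulr1 ler_wpM2l ?norm_delta_le// mulr_ge0// invr_ge0 ltW.
  rewrite [`|c / e|]ger0_norm; last by rewrite mulr_ge0 ?invr_ge0 ?exprn_ge0 ?ltW.
  rewrite mulrA; apply: (@le_trans _ _ (M * (c / e) * (r / (M * (c * e^-1) + 1)))).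
    apply: ler_pM => //; first by rewrite mulr_ge0// mulr_ge0 ?invr_ge0 ?exprn_ge0 ?ltW.
    by apply: ler_wpM2r => //; rewrite mulr_ge0 ?invr_ge0 ?exprn_ge0 ?ltW.
  by rewrite mulrCA ler_piMr ?(ltW r0)// ler_pdivrMr// mul1r lerDl.
have -> : moll e Xi hi x = rintegral (dPhi 0).
  pose H y := h y * (c * scl e Xi y x).
  pose Hi y := -1 * dPhi 0 y + hi y * (c * scl e Xi y x).
  have xs00 : xs 0 = x by rewrite /xs scale0r addr0.
  have [lin _] := @rintegralP R n B B0.
  have cHi : cc B Hi by apply: cc_lin; exact: cl.
  have dH y : is_derive y (delta_mx 0 i) H (Hi y).
    have d1 := is_deriveM (dh y) (is_deriveZ c (scl_derive_y e Xi i y x)).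
    apply: (is_derive_eq d1); rewrite /Hi /dPhi -/Xd xs00.
    by rewrite /GRing.scale /= /GRing.scale /=; ring.
  have := by_parts B0 (cl c Xi h x ch) cHi dH; rewrite lin; [|exact: cl|exact: cl].
  by rewrite mulN1r => /eqP; rewrite addrC subr_eq0 => /eqP.
by apply/is_derive_line; exact: dP.
Qed.

End ScaledProfiles.

Lemma mpow_morph {n : nat} (S T : Type) (A : 'I_n -> S -> S) (B : 'I_n -> T -> T) (v : S -> T) alpha s :
  (forall i s, B i (v s) = v (A i s)) -> mpow B alpha (v s) = v (mpow A alpha s).
Proof.
move=> AB; rewrite /mpow; elim: (enum 'I_n) => [//|i r IH] /=.
by rewrite IH; elim: (alpha i) => [//|m IHm]; rewrite !iterS IHm AB.
Qed.

(** Bookkeeping for powers of [1 / e]: the index bounds those already present, and each operator may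
    add one. *)
Lemma mpow_count {n : nat} (T : Type) (A : 'I_n -> T -> T) (Q : nat -> T -> Prop) alpha m f :
  (forall i m f, Q m f -> Q m.+1 (A i f)) -> Q m f -> Q (m + morder alpha)%N (mpow A alpha f).
Proof.
move=> AQ Qf; rewrite /morder -big_enum /mpow /=; elim: (enum 'I_n) => [|i r IH].
  by rewrite big_nil addn0.
rewrite big_cons addnCA /=; elim: (alpha i) => [//|j IHj]; exact: AQ.
Qed.

Section ScalarDerivatives.
Context {k : scalar_kind} {R : realType} {V : normedModType R}.
Local Notation K := (scal k R).

Lemma kderive_rscal (x v : V) (f : V -> R) l :
  is_derive x v f l -> kderive x v (fun x => rscal (f x) : K) (rscal l).
Proof.
move=> df; split.
  by rewrite sre_rscal (_ : sre \o _ = f)//; apply/funext => y /=; rewrite sre_rscal.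
rewrite sim_rscal (_ : sim \o _ = cst 0); first exact: is_derive_cst.
by apply/funext => y /=; rewrite sim_rscal.
Qed.

Lemma kderiveZ (x v : V) (f : V -> K) (a l : K) :
  kderive x v f l -> kderive x v (fun x => a * f x) (a * l).
Proof.
by move=> df; have := kderiveM (kderive_cst x v a) df; rewrite mul0r add0r.
Qed.

Lemma kderiveB (x v : V) (f g : V -> K) (a b : K) :
  kderive x v f a -> kderive x v g b -> kderive x v (fun x => f x - g x) (a - b).
Proof.
move=> df dg; have := kderiveD df (kderiveZ (-1) dg); rewrite mulN1r.
by rewrite (_ : (fun x => f x + -1 * g x) = fun x => f x - g x)//; apply/funext => y; rewrite mulN1r.
Qed.

End ScalarDerivatives.

(** * Finite sums of terms that are stable under differentiation *)

Section Terms.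
Context {k : scalar_kind} {R : realType} {n : nat} {Omega : set 'rV[R]_n}.
Local Notation K := (scal k R).
Local Notation E := 'rV[R]_n.
Local Notation D := (testfun k Omega).
Local Notation T := (testfun RealScalars (setT : set E)).

Definition kmoll (e : R) (Xi : T) (g : E -> K) (x : E) : K :=
  integral_Rn (fun y => g y * rscal (e ^- n * scl e Xi y x)).

Lemma sre_kmoll e Xi g x : sre (kmoll e Xi g x) = moll e Xi (sre \o g) x.
Proof.
rewrite sre_integral; congr rintegral; apply/funext => y /=.
by rewrite sreM sre_rscal sim_rscal mulr0 subr0.
Qed.

Lemma sim_kmoll e Xi g x : sim (kmoll e Xi g x) = moll e Xi (sim \o g) x.
Proof.
rewrite sim_integral; congr rintegral; apply/funext => y /=.
by rewrite simM sre_rscal sim_rscal mulr0 add0r.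
Qed.

Lemma kmoll_derive e Xi i (g : D) x : 0 < e ->
  kderive x (delta_mx 0 i) (kmoll e Xi g) (kmoll e Xi (dtest i g) x).
Proof.
move=> e0.
have [_ cg _] := test_is_test g; have [_ cdg _] := test_is_test (dtest i g).
have [B B0 HB] := compact_cube (compactU cg cdg).
have c1 : kcc B (g : E -> K).
  apply: (kcc_cube HB (test_csm g)) => y nL; apply: supp_out => gy; apply: nL; by left.
have c2 : kcc B (dtest i g : E -> K).
  apply: (kcc_cube HB (test_csm _)) => y nL; apply: supp_out => gy; apply: nL; by right.
have [M M0 gM] := test_bounded g.
have [d1 d2] := (fun y => (dtest_kderive i g y).1, fun y => (dtest_kderive i g y).2).
split.
  rewrite sre_kmoll (_ : sre \o kmoll e Xi g = moll e Xi (sre \o g)); last first.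
    by apply/funext => y; exact: sre_kmoll.
  apply: (moll_derive Xi x e0 (ltW B0) (kcc_sre c1) (kcc_sre c2) (M := M)) => // y.
  exact: le_trans (sre_le_modulus _) (gM y).
rewrite sim_kmoll (_ : sim \o kmoll e Xi g = moll e Xi (sim \o g)); last first.
  by apply/funext => y; exact: sim_kmoll.
apply: (moll_derive Xi x e0 (ltW B0) (kcc_sim c1) (kcc_sim c2) (M := M)) => // y.
exact: le_trans (sim_le_modulus _) (gM y).
Qed.

Section Estimate.
Variables (B X : R) (chi : R -> R) (q : nat) (Xi : T).
Hypothesis B0 : 0 < B.
Hypothesis X0 : 0 <= X.
Hypothesis chi_cont : continuous chi.
Hypothesis chi_out : forall t, B <= `|t| -> chi t = 0.
Hypothesis chi_le : forall t, `|chi t| <= X.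
Hypothesis chi_moment : forall j, (j <= q)%N -> moment B chi j (j == 0%N)%:R.
Hypothesis XiE : Xi = (fun y : E => \prod_(i < n) chi (y 0 i)) :> (E -> R).

Lemma kapnE (e : R) (x y : E) : kapn chi e x y = e ^- n * scl e Xi y x.
Proof.
rewrite /kapn /scl XiE big_split /= prodr_const card_ord exprVn; congr (_ * _).
by apply: eq_bigr => i _; rewrite !mxE.
Qed.

(** The derivatives of order [q + 1] along the coordinates are those of a test function, hence
    bounded on the whole space; the constant is therefore independent of [x]. *)
Lemma kmoll_estimate (g : D) : exists2 C : R, 0 <= C &
  forall (e : @I01 R) x, modulus (kmoll (val e) Xi g x - g x) <= C * val e ^+ q.+1.
Proof.
have [C C0 HC] := mollify B0 X0 chi_cont chi_out chi_le chi_moment n.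
have ex i : exists M : R, 0 <= M /\ forall y, modulus (iter q.+1 (dtest i) g y) <= M.
  by have [M M0 HM] := test_bounded (iter q.+1 (dtest i) g); exists M.
pose N i := projT1 (cid (ex i)).
have [N0 NM] : (forall i, 0 <= N i) /\ forall i y, modulus (iter q.+1 (dtest i) g y) <= N i.
  by split=> i; have [] := projT2 (cid (ex i)).
pose M := \sum_i N i; have M0 : 0 <= M by apply: sumr_ge0 => i _; exact: N0.
have gM i y : modulus (iter q.+1 (dtest i) g y) <= M.
  by apply: le_trans (NM i y) _; rewrite /M (bigD1 i)//= lerDl sumr_ge0.
exists (C * M *+ 2) => [|e x]; first by rewrite mulrn_wge0// mulr_ge0.
have [e0 e1] := (I01_gt0 e, I01_le1 e).
have [B' _ cg] := test_cc g.
rewrite mulrnAl mulr2n -mulrA; apply: le_trans (modulus_le _) _; apply: lerD.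
  rewrite sreD sreN sre_kmoll /moll.
  rewrite (_ : (fun y => _) = fun y => (sre \o g) y * kapn chi (val e) x y); last first.
    by apply/funext => y; rewrite kapnE.
  apply: (HC (val e) (sre \o g) (fun i j => sre \o (iter j (dtest i) g : D)) M x) => //.
  - by have [] := kcc_sre cg.
  - by move=> i j y; have [] := dtest_kderive i (iter j (dtest i) g) y.
  - by move=> i y; exact: le_trans (sre_le_modulus _) (gM i y).
rewrite simD simN sim_kmoll /moll.
rewrite (_ : (fun y => _) = fun y => (sim \o g) y * kapn chi (val e) x y); last first.
  by apply/funext => y; rewrite kapnE.
apply: (HC (val e) (sim \o g) (fun i j => sim \o (iter j (dtest i) g : D)) M x) => //.
- by have [] := kcc_sim cg.
- by move=> i j y; have [] := dtest_kderive i (iter j (dtest i) g) y.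
- by move=> i y; exact: le_trans (sim_le_modulus _) (gM i y).
Qed.

(** Errors [b (T g - g)] of the mollification [T], summed over pairs [(b, g)]. By the Leibniz rule,
    and because [T] commutes with derivatives, differentiation becomes the operation [derror] on
    lists; estimating all derivatives reduces to order zero. *)
Definition error_sum (l : seq (D * D)) (e : R) (x : E) : K :=
  \sum_(p <- l) p.1 x * (kmoll e Xi p.2 x - p.2 x).

Definition derror (i : 'I_n) (l : seq (D * D)) : seq (D * D) :=
  flatten [seq [:: (dtest i p.1, p.2); (p.1, dtest i p.2)] | p <- l].

Lemma partial_error_sum i l e : 0 < e ->
  partial i (error_sum l e) = error_sum (derror i l) e.
Proof.
move=> e0; apply/funext => x; apply: kderive_partial; rewrite /error_sum /derror.
elim: l => [|[b g] l IH].
  rewrite big_nil (_ : (fun x => _) = fun=> 0); first exact: kderive_cst.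
  by apply/funext => y; rewrite big_nil.
rewrite (_ : (fun x => _) = fun x => b x * (kmoll e Xi g x - g x) +
    \sum_(p <- l) p.1 x * (kmoll e Xi p.2 x - p.2 x)); last first.
  by apply/funext => y; rewrite big_cons.
rewrite /= !big_cons /= addrA; apply: kderiveD IH; apply: kderiveM; first exact: dtest_kderive.
by apply: kderiveB; [exact: kmoll_derive|exact: dtest_kderive].
Qed.

Lemma error_sum_bound l : exists2 C : R, 0 <= C &
  forall (e : @I01 R) x, modulus (error_sum l (val e) x) <= C * val e ^+ q.+1.
Proof.
elim: l => [|[b g] l [C C0 HC]].
  by exists 0 => // e x; rewrite /error_sum big_nil modulus0 mul0r.
have [M M0 bM] := test_bounded b; have [C1 C10 gC] := kmoll_estimate g.
exists (M * C1 + C) => [|e x]; first by rewrite addr_ge0// mulr_ge0.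
rewrite /error_sum big_cons mulrDl; apply: le_trans (modulusD _ _) _; apply: lerD; last exact: HC.
by rewrite modulusM -mulrA; apply: ler_pM; [exact: modulus_ge0|exact: modulus_ge0|exact: bM|exact: gC].
Qed.

(** The list [l] depends neither on [e] nor on [x], so its symbolic derivative is a fixed finite
    list with a uniform bound. Equality is asked on an open [U] around [L] so that derivatives agree
    on [L]. *)
Lemma LSK3_of_terms (phi : @I01 R -> Omega -> D) : open Omega -> smooth_kernel phi ->
  (forall L (f : Omega -> K), cpt_in L Omega -> smooth_fun k Omega f ->
    exists e0 (U : set E) l, [/\ 0 < e0, open U, L `<=` U, U `<=` Omega &
      forall (e : @I01 R) x, val e <= e0 -> U x ->
        distr_of f (slice phi e x) - 'valL_0 f x = error_sum l (val e) x]) ->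
  LSK3 q phi.
Proof.
move=> Oo sphi loc L cL alpha f sf; have [e0 [U [l [e00 Uo LU UO HU]]]] := loc L f cL sf.
have [C C0 HC] := error_sum_bound (mpow derror alpha l).
exists e0, (C + 1); split=> //; first exact: ltr_wpDl.
move=> e x ee Lx; have Ox := UO _ (LU _ Lx).
rewrite (LSK3_integralE Oo alpha e sphi sf Ox).
have loc_eq : forall x, U x -> mpow partial alpha
    ('valL_0 (fun x : Omega => distr_of f (phi e x) - f x)) x =
  mpow partial alpha (error_sum l (val e)) x.
  pose Q (F G _ : E -> K) := forall x, U x -> F x = G x.
  apply: (@mpow_rel3 n _ (@partial k R n) Q alpha _ _ (error_sum l (val e))) => [i F G H FG y Uy|y Uy].
    exact (partial_eq Uo FG i Uy).
  by rewrite -HU// /slice; have Oy := UO _ Uy; rewrite !valL_inE.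
rewrite (loc_eq x (LU _ Lx)).
rewrite (mpow_morph (A := derror) (v := fun l => error_sum l (val e))); last first.
  by move=> i l1; exact: (partial_error_sum i l1 (I01_gt0 e)).
apply: le_trans (HC e x) _; rewrite ler_wpM2r ?exprn_ge0 ?(ltW (I01_gt0 e))//.
by rewrite lerDl.
Qed.

End Estimate.

(** [((b, a), (Xi, j))] encodes [b x * a y * e ^- (n + j) * Xi ((y - x) / e)]. Lists of such terms
    are stable under [partialy], which may raise [j] by one, and under [partialxy], which leaves [j]
    alone because it annihilates functions of [y - x]. *)
Definition kterm : Type := ((D * D) * (T * nat))%type.

Definition kernel_term (t : kterm) (e : R) (x y : E) : K :=
  t.1.1 x * (t.1.2 y * rscal (e ^- (n + t.2.2) * scl e t.2.1 y x)).

Definition kernel_sum (l : seq kterm) (e : R) (x y : E) : K := \sum_(t <- l) kernel_term t e x y.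

Definition dterm_y (i : 'I_n) (l : seq kterm) : seq kterm :=
  flatten [seq [:: ((t.1.1, dtest i t.1.2), t.2); (t.1, (dtest i t.2.1, t.2.2.+1))] | t <- l].

Definition dterm_xy (i : 'I_n) (l : seq kterm) : seq kterm :=
  flatten [seq [:: ((dtest i t.1.1, t.1.2), t.2); ((t.1.1, dtest i t.1.2), t.2)] | t <- l].

Let pow_succ (e : R) j : e ^- (n + j.+1) = e ^- (n + j) * e^-1.
Proof. by rewrite addnS exprSr invfM. Qed.

Lemma kernel_sum_derive_y i l e x y :
  kderive y (delta_mx 0 i) (kernel_sum l e x) (kernel_sum (dterm_y i l) e x y).
Proof.
rewrite /kernel_sum /dterm_y; elim: l => [|[[b a] [Xi j]] l IH].
  rewrite big_nil (_ : (fun y => _) = fun=> 0); first exact: kderive_cst.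
  by apply/funext => z; rewrite big_nil.
rewrite (_ : (fun y => _) = fun y => kernel_term ((b, a), (Xi, j)) e x y +
    \sum_(t <- l) kernel_term t e x y); last first.
  by apply/funext => z; rewrite big_cons.
rewrite /= !big_cons /= addrA; apply: kderiveD IH.
have d1 := @kderive_rscal k _ _ _ _ _ _ (is_deriveZ (e ^- (n + j)) (scl_derive_y e Xi i y x)).
have := kderiveZ (b x : K) (kderiveM (dtest_kderive i a y) d1).
by rewrite /GRing.scale /= /GRing.scale /= mulrA -pow_succ mulrDr.
Qed.

(** In the sum with the derivative in [y] the contributions of [Xi] cancel, and with them the extra
    power of [1 / e]; the derivative in [x] by itself is left as an unnamed value. *)
Lemma kernel_sum_derive_x i l e x y : exists a : K,
  kderive x (delta_mx 0 i) (fun x => kernel_sum l e x y) a /\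
  a + kernel_sum (dterm_y i l) e x y = kernel_sum (dterm_xy i l) e x y.
Proof.
rewrite /kernel_sum /dterm_y /dterm_xy; elim: l => [|[[b a] [Xi j]] l [c [IH Ec]]].
  exists 0; rewrite !big_nil addr0; split=> //.
  rewrite (_ : (fun y => _) = fun=> 0); first exact: kderive_cst.
  by apply/funext => z; rewrite big_nil.
have d1 := @kderive_rscal k _ _ _ _ _ _ (is_deriveZ (e ^- (n + j)) (scl_derive_x e Xi i y x)).
have d2 := kderiveM (dtest_kderive i b x) (kderiveZ (a y : K) d1).
eexists; split.
  rewrite (_ : (fun x => _) = fun x => kernel_term ((b, a), (Xi, j)) e x y +
    \sum_(t <- l) kernel_term t e x y); last by apply/funext => z; rewrite big_cons.
  exact: kderiveD d2 IH.
rewrite /= !big_cons /= -Ec /kernel_term /= pow_succ /GRing.scale /= /GRing.scale /=.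
by rewrite mulrN rscalN [in rscal (_ * (_ * _))]mulrA; ring.
Qed.

Lemma partialy_kernel_sum i l e : partialy i (kernel_sum l e) = kernel_sum (dterm_y i l) e.
Proof.
apply/funext => x; apply/funext => y; apply: kderive_partial; exact: kernel_sum_derive_y.
Qed.

Lemma partialxy_kernel_sum i l e : partialxy i (kernel_sum l e) = kernel_sum (dterm_xy i l) e.
Proof.
apply/funext => x; apply/funext => y; have [a [da <-]] := kernel_sum_derive_x i l e x y.
by rewrite /partialxy partialy_kernel_sum; congr (_ + _); exact: kderive_partial da.
Qed.

Lemma kernel_sum_bound (m : nat) l : all (fun t : kterm => (t.2.2 <= m)%N) l ->
  exists2 C : R, 0 <= C & forall (e : @I01 R) x y, modulus (kernel_sum l (val e) x y) <= C * val e ^- (n + m).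
Proof.
elim: l => [_|[[b a] [Xi j]] l IH /= /andP[jm /IH[C C0 HC]]].
  by exists 0 => // e x y; rewrite /kernel_sum big_nil modulus0 mul0r.
have [M1 M10 b1] := test_bounded b; have [M2 M20 b2] := test_bounded a.
have [M3 M30 b3] := test_bounded Xi.
exists (M1 * (M2 * M3) + C) => [|e x y]; first by rewrite addr_ge0// !mulr_ge0.
rewrite /kernel_sum big_cons mulrDl; apply: le_trans (modulusD _ _) _; apply: lerD; last exact: HC.
rewrite /kernel_term !modulusM modulus_rscal normrM -!mulrA.
have p0 : 0 <= val e ^- (n + j) by rewrite invr_ge0 exprn_ge0// ltW// I01_gt0.
have b3' z : `|Xi z : R| <= M3 by apply: le_trans (b3 z); exact: (@sre_le_modulus RealScalars).
apply: ler_pM; rewrite ?modulus_ge0 ?mulr_ge0//; first exact: modulus_ge0.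
apply: ler_pM; rewrite ?modulus_ge0 ?mulr_ge0//.
rewrite mulrC (ger0_norm p0); apply: ler_pM => //; first exact: b3'.
by apply: exprN_mono; rewrite leq_add2l.
Qed.

(** Symbolic differentiation of a list independent of [e]: only derivatives in [y] raise the
    exponent, which therefore ends at [n + morder beta] at most. *)
Lemma LSK2_of_terms (phi : @I01 R -> Omega -> D) : open Omega ->
  (forall L, cpt_in L Omega ->
    exists e0 (U : set E) l, [/\ 0 < e0, open U, L `<=` U,
      all (fun t : kterm => (t.2.2 <= 0)%N) l &
      forall (e : @I01 R) x, val e <= e0 -> U x ->
        kernel_fun phi e x = kernel_sum l (val e) x]) ->
  LSK2 phi.
Proof.
move=> Oo loc L cL alpha beta; have [e0 [U [l [e00 Uo LU l0 HU]]]] := loc L cL.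
pose l' := mpow dterm_xy alpha (mpow dterm_y beta l).
have lm : all (fun t : kterm => (t.2.2 <= morder beta)%N) l'.
  pose Q m (l : seq kterm) := all (fun t : kterm => (t.2.2 <= m)%N) l.
  apply: (@mpow_ind n _ dterm_xy (Q (morder beta))) => [i r|].
    by rewrite /Q /dterm_xy; elim: r => [//|t r IH] /= /andP[-> /IH ->].
  rewrite -[morder beta]add0n; apply: (mpow_count (Q := Q)) => // i m r.
  rewrite /Q /dterm_y; elim: r => [//|t r IH] /= /andP[tm /IH ->].
  by rewrite ltnS tm (leq_trans tm).
have [C C0 HC] := kernel_sum_bound lm.
exists e0, (C + 1); split=> //; first exact: ltr_wpDl.
move=> e [x y] ee [/= Lx _].
have keqx i F G : keq (Omega := U) F G -> keq (Omega := U) (partialxy i F) (partialxy i G).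
  exact: partialxy_eq.
have keqy i F G : keq (Omega := U) F G -> keq (Omega := U) (partialy i F) (partialy i G).
  exact: partialy_eq.
pose Q (F G H : E -> E -> K) := keq (Omega := U) F G.
have q1 : Q (mpow partialy beta (kernel_fun phi e)) (mpow partialy beta (kernel_sum l (val e)))
   (mpow partialy beta (kernel_sum l (val e))).
  by apply: (mpow_rel3 (Q := Q)) => [i F G H|z Uz]; [exact: keqy|exact: HU].
have q2 : Q (mpow partialxy alpha (mpow partialy beta (kernel_fun phi e)))
   (mpow partialxy alpha (mpow partialy beta (kernel_sum l (val e))))
   (mpow partialxy alpha (mpow partialy beta (kernel_sum l (val e)))).
  by apply: (mpow_rel3 (Q := Q)) => [i F G H|]; [exact: keqx|exact: q1].
rewrite (keqE y q2 (LU _ Lx)).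
rewrite (mpow_morph (A := dterm_y) (v := fun l => kernel_sum l (val e))); last first.
  by move=> i r; exact: partialy_kernel_sum.
rewrite (mpow_morph (A := dterm_xy) (v := fun l => kernel_sum l (val e))); last first.
  by move=> i r; exact: partialxy_kernel_sum.
apply: le_trans (HC e x y) _; rewrite ler_wpM2r ?invr_ge0 ?exprn_ge0 ?(ltW (I01_gt0 e))//.
by rewrite lerDl.
Qed.

End Terms.

(** * Smooth curves of test functions *)

Section JointSmoothness.
Context {k : scalar_kind} {R : realType} {n : nat} {Omega : set 'rV[R]_n}.
Local Notation K := (scal k R).
Local Notation E := 'rV[R]_n.
Local Notation E1 := 'rV[R]_n.+1.
Local Notation D := (testfun k Omega).
Local Notation V := (rtest k Omega).
Implicit Types (H : E1 -> K).

Lemma csm_hrow H t : csm dirE setT H -> csm dirE setT (fun y : E => H (hrow t y)).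
Proof.
move=> cH; apply: (csm_compE openT (c := hrow t) openT cH) => // i.
case: (unliftP ord0 i) => [j ->|->].
  rewrite (_ : (fun y => _) = fun y : E => y 0 j); first exact: rsm_coord.
  by apply/funext => y; rewrite hrow_lift.
rewrite (_ : (fun y => _) = fun _ : E => t); first exact: rsm_cst.
by apply/funext => y; rewrite hrow0.
Qed.

Lemma kderive_head H (t : R) y : csm dirE setT H ->
  kderive t 1 (fun t => H (hrow t y)) (partial ord0 H (hrow t y)).
Proof.
move=> cH; have [_ dH] := csm_partial openT ord0 cH; have [d1 d2] := dH (hrow t y) I.
by split; [exact: (head_derive (h := sre \o H) d1)|exact: (head_derive (h := sim \o H) d2)].
Qed.

Lemma kderive_tail H (t : R) y i : csm dirE setT H ->
  kderive y (delta_mx 0 i) (fun y => H (hrow t y)) (partial (lift ord0 i) H (hrow t y)).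
Proof.
move=> cH; have [_ dH] := csm_partial openT (lift ord0 i) cH; have [d1 d2] := dH (hrow t y) I.
by split; [exact: (row_slice_derive (h := sre \o H) d1)|exact: (row_slice_derive (h := sim \o H) d2)].
Qed.

Lemma second_order (f f1 f2 : R -> R) (t h M : R) : 0 <= M ->
  (forall s : R, is_derive s 1 f (f1 s)) -> (forall s : R, is_derive s 1 f1 (f2 s)) ->
  (forall s, `|s - t| <= `|h| -> `|f2 s| <= M) ->
  `|f (t + h) - f t - h * f1 t| <= M * `|h| * `|h|.
Proof.
move=> M0 d1 d2 fM; have e1 : t + h - t = h by rewrite addrC addKr.
pose g s := f s - (f1 t * s + - (f1 t * t)).
have dg (s : R) : is_derive s 1 g (f1 s - f1 t).
  by apply: is_deriveB; exact: is_derive_affine.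
have := @mean_value_le R g (fun s => f1 s - f1 t) t (t + h) (M * `|h|); rewrite e1.
rewrite (_ : g (t + h) - g t = f (t + h) - f t - h * f1 t); last by rewrite /g; ring.
apply=> s st; split; first exact: dg.
apply: (@le_trans _ _ (M * `|s - t|)); last by rewrite ler_wpM2l.
apply: (@mean_value_le R f1 f2) => r rt; split; first exact: d2.
by apply: fM; exact: le_trans st.
Qed.

Definition fiber H (t : R) : D := mktest (fun y => H (hrow t y)).

Section LocalSupport.
Variables (t r : R) (L : set E).
Hypothesis r0 : 0 < r.
Hypothesis cL : cpt_in L Omega.

(** A compact set common to all times near [t] puts the nearby test functions into one subspace D_L,
    where a continuous seminorm is controlled by finitely many derivatives. *)
Definition fibered H : Prop := csm dirE setT H /\
  forall (s : R) y, `|s - t| < r -> ~ L y -> H (hrow s y) = 0.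

Lemma fibered_partial j H : fibered H -> fibered (partial j H).
Proof.
move=> [cH zH]; split; first by have [] := csm_partial openT j cH.
move=> s y sr nLy; case: (unliftP ord0 j) => [i ->|->]; last first.
  apply: (kderive_unique (kderive_head s y cH)).
  apply: (near_kderive (f := fun=> 0)); last exact: kderive_cst.
  near=> s'; rewrite zH//; near: s'; apply/nbhs_ballP; exists (r - `|s - t|) => /=.
    by rewrite subr_gt0.
  move=> s'; rewrite /ball /= => st; rewrite -(subrKA s) (le_lt_trans (ler_normD _ _))//.
  by rewrite distrC -ltrBrDr.
apply: (kderive_out (cpt_in_closed cL) _ nLy (kderive_tail s y i cH)) => z nLz.
exact: zH.
Unshelve. all: by end_near. Qed.

Lemma fiberE H s y : fibered H -> `|s - t| < r -> fiber H s y = H (hrow s y).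
Proof.
move=> [cH zH] st; have [cptL LO] := cL; rewrite /fiber mktestE//.
apply: (is_test_intro (csm_hrow s cH) cptL) => [z /LO /interior_subset //|z nLz].
exact: zH.
Qed.

Lemma dtest_fiber i H s : fibered H -> `|s - t| < r ->
  dtest i (fiber H s) = fiber (partial (lift ord0 i) H) s.
Proof.
move=> fH st; apply: test_eq => y; rewrite fiberE//; last exact: fibered_partial.
apply: (kderive_unique (dtest_kderive i (fiber H s) y)).
rewrite (_ : (fiber H s : E -> K) = fun y => H (hrow s y)); last by apply/funext => z; rewrite fiberE.
by have [cH _] := fH; exact: kderive_tail.
Qed.

Lemma fiber_second_order H : fibered H -> exists2 M : R, 0 <= M &
  forall h y, `|h| < r ->
    modulus (H (hrow (t + h) y) - H (hrow t y) - rscal h * partial ord0 H (hrow t y)) <= M * `|h| * `|h|.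
Proof.
move=> fH; have fH1 := fibered_partial ord0 fH; have [cH zH] := fH; have [cH1 zH1] := fH1.
have [cH2 _] := fibered_partial ord0 fH1.
have [cptL _] := cL; have [B B0 LB] := compact_cube cptL.
pose A := `|t| + r + B; have A0 : 0 <= A by rewrite !addr_ge0// ltW.
have [M M0 HM] := compact_continuous_bounded (@norm_ball_compact R n.+1 A)
  (fun x _ => kcont_modulus (csm_cont cH2 (I : setT x))).
exists (M + M); first exact: addr_ge0.
move=> h y hr; have [Ly|nLy] := pselect (L y); last first.
  have tt : `|t - t| < r by rewrite subrr normr0.
  rewrite !zH ?zH1// ?mulr0 ?subr0 ?modulus0 ?mulr_ge0 ?addr_ge0//.
  by rewrite [t + h]addrC addrK.
have M2 s : `|s - t| <= `|h| -> modulus (partial ord0 (partial ord0 H) (hrow s y)) <= M.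
  move=> st; have := HM (hrow s y); rewrite ger0_norm ?modulus_ge0//; apply=> /=.
  apply: norm_le_coord => // i; case: (unliftP ord0 i) => [j ->|->].
    by rewrite hrow_lift (le_trans (LB y j Ly))// lerDr addr_ge0// ltW.
  rewrite hrow0 -(subrK t s) (le_trans (ler_normD _ _))//.
  by have := le_trans st (ltW hr); rewrite /A; move: B0; lra.
have hd s := kderive_head s y cH; have hd1 s := kderive_head s y cH1.
rewrite 2!mulrDl; apply: le_trans (modulus_le _) _; apply: lerD.
  rewrite !(sreD, sreN) sreM sre_rscal sim_rscal mul0r subr0.
  apply: (second_order (f := fun s => sre (H (hrow s y))) M0 (fun s => (hd s).1) (fun s => (hd1 s).1)) => s st.
  exact: le_trans (sre_le_modulus _) (M2 s st).
rewrite !(simD, simN) simM sre_rscal sim_rscal mul0r addr0.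
apply: (second_order (f := fun s => sim (H (hrow s y))) M0 (fun s => (hd s).2) (fun s => (hd1 s).2)) => s st.
exact: le_trans (sim_le_modulus _) (M2 s st).
Qed.

(** Bundling the functions with [fibered] makes the partial derivatives total operators on one type,
    as [mpow_morph] requires. *)
Let FF := {H : E1 -> K | fibered H}.
Let dFF (j : 'I_n.+1) (F : FF) : FF := exist _ (partial j (sval F)) (fibered_partial j (svalP F)).

Let FF_eq (F G : FF) : sval F = sval G -> F = G.
Proof. by case: F G => [F pF] [G pG] /= e; subst G; congr exist; exact: Prop_irrelevance. Qed.

Let dF alpha := mpow (fun i => dFF (lift ord0 i)) alpha.

Let mpow_fiber alpha (F : FF) s : `|s - t| < r ->
  mpow dtest alpha (fiber (sval F) s) = fiber (sval (dF alpha F)) s.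
Proof.
move=> st; apply: (mpow_morph (v := fun F : FF => fiber (sval F) s)) => i G.
by rewrite dtest_fiber//; exact: svalP.
Qed.

Let mpow_head alpha (F : FF) : dF alpha (dFF ord0 F) = dFF ord0 (dF alpha F).
Proof.
apply: (mpow_morph (v := dFF ord0)) => i G; apply: FF_eq; apply/funext => x /=.
by have [cG _] := svalP G; exact: (partialC _ _ openT cG I).
Qed.

(** The error of the linear approximation is supported in [L], so [p] sees finitely many of its
    derivatives in [y]. Each of them is the corresponding error for another fibered function, since
    the derivative in time commutes with those in [y]; the second derivative in time bounds it by a
    multiple of [h * h], uniformly in [y]. *)
Lemma fiber_pderive H (p : V -> R) : fibered H -> PPD p ->
  pderive (V := V) p (fiber H) t (fiber (partial ord0 H) t).
Proof.
move=> fH pp e e0; have [_ /(_ L cL)[N [C pC]]] := pp.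
pose F0 : FF := exist _ H fH; have tt : `|t - t| < r by rewrite subrr normr0.
have ex alpha : exists M : R, forall h y, `|h| < r ->
    modulus (sval (dF alpha F0) (hrow (t + h) y) - sval (dF alpha F0) (hrow t y)
      - rscal h * partial ord0 (sval (dF alpha F0)) (hrow t y)) <= M * `|h| * `|h|.
  by have [M _ HM] := fiber_second_order (svalP (dF alpha F0)); exists M.
pose Mf alpha := projT1 (cid (ex alpha)); have MfP alpha := projT2 (cid (ex alpha)).
have [M HM] := finitely_many_bound N Mf.
have W0 : 0 < `|C| * `|M| + 1 by rewrite ltr_wpDl// mulr_ge0.
exists (Num.min r (e / (`|C| * `|M| + 1))); first by rewrite lt_min r0 divr_gt0.
move=> h; rewrite lt_min => /andP[hr he].
have th : `|t + h - t| < r by rewrite [t + h]addrC addrK.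
pose psi : D := fiber H (t + h) - fiber H t - rscal h *: fiber (partial ord0 H) t.
rewrite -[X in p X]/psi; have f1 := fibered_partial ord0 fH.
have sp : supp psi `<=` L.
  apply: (supp_sub (cpt_in_closed cL)) => y nLy.
  have [_ zH] := fH; have [_ zH1] := f1.
  by rewrite /psi !testD !testN testZ !fiberE// !zH ?zH1// mulr0 !subr0.
have bpsi : Cnorm N psi <= `|M| * (`|h| * `|h|).
  apply: Cnorm_le => alpha y aN.
  rewrite /psi -[- fiber H t]scaleN1r -[- (rscal h *: _)]scaleN1r !mpow_dtestD !mpow_dtestZ.
  rewrite (mpow_fiber alpha F0 th) (mpow_fiber alpha F0 tt) (mpow_fiber alpha (dFF ord0 F0) tt) mpow_head.
  rewrite !testD !testZ !fiberE//; try exact: svalP.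
  rewrite !mulN1r mulrA; apply: le_trans (MfP alpha h y hr) _.
  by rewrite ler_wpM2r// ler_wpM2r// (le_trans (HM _ aN)) ?ler_norm.
apply: le_trans (pC psi sp) _; apply: (@le_trans _ _ (`|C| * (`|M| * (`|h| * `|h|)))).
  apply: (@le_trans _ _ (`|C| * Cnorm N psi)); last by rewrite ler_wpM2l.
  by rewrite ler_wpM2r ?Cnorm_ge0 ?ler_norm.
rewrite !mulrA; apply: ler_wpM2r => //.
have := ltW he; rewrite ler_pdivlMr// => hW; apply: le_trans hW.
by rewrite mulrC ler_wpM2l// lerDl.
Qed.

End LocalSupport.

(** The successive derivatives of the curve are the fibers of the iterated time derivatives of [H].
    In this way kernels given by explicit formulas are shown to be smooth. *)
Lemma smooth_test_curve_joint H (c : R -> D) : csm dirE setT H ->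
  (forall t y, c t y = H (hrow t y)) ->
  (forall t : R, exists r (L : set E), [/\ 0 < r, cpt_in L Omega &
    forall s y, `|s - t| < r -> ~ L y -> H (hrow s y) = 0]) ->
  smooth_test_curve c.
Proof.
move=> cH cE sH; apply/smooth_test_curveP.
exists (fun m => fiber (iter m (partial ord0) H)); split=> [|m t p pp].
  apply/funext => t; apply: test_eq => y; rewrite cE.
  have [r [L [r0 cL zH]]] := sH t.
  by rewrite /= (@fiberE t r L)// subrr normr0.
have [r [L [r0 cL zH]]] := sH t; rewrite iterS.
apply: (@fiber_pderive t r L) => //; elim: m => [//|m IH]; rewrite iterS.
exact: fibered_partial.
Qed.

End JointSmoothness.

(** * Smoothing kernels *)

Section Cutoffs.
Context {k : scalar_kind} {R : realType} {n : nat} {Omega : set 'rV[R]_n}.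
Local Notation K := (scal k R).
Local Notation E := 'rV[R]_n.
Local Notation D := (testfun k Omega).
Hypothesis Oo : open Omega.

Lemma norm_gt_coord (x : E) (d : R) : 0 <= d -> d < `|x| -> exists i, d < `|x 0 i|.
Proof.
move=> d0 dx; apply: contrapT => nx; move: dx; apply/negP; rewrite -leNgt.
by apply: norm_le_coord => // i; rewrite leNgt; apply/negP => xi; apply: nx; exists i.
Qed.

(** One minus the product of the [1 - b x] over a finite cover is 1 where some bump is 1, and 0
    where all bumps are 0. The bumps are 1 within [d / 2] of their centres and 0 beyond [d], so the
    support stays in [fat d L]. *)
Lemma cutoff (L : set E) : cpt_in L Omega -> exists theta : D, forall y, L y -> theta y = 1 :> K.
Proof.
move=> cL; have [d d0 [cf fO]] := fat_cpt_in Oo cL; have [cptL _] := cL.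
have d20 : 0 < d / 2 by rewrite divr_gt0.
pose ball2 (x : E) : set E := [set y | `|y - x| < d / 2].
have cv : @cover_compact E L by rewrite -compact_cover.
have [x _|x Lx|s sL Ls] := cv E L ball2.
- rewrite /ball2; rewrite openE => y /= yx; apply/nbhs_ballP; exists (d / 2 - `|y - x|) => /=.
    by rewrite subr_gt0.
  move=> z; rewrite -ball_normE /= => yz; rewrite -(subrKA y) (le_lt_trans (ler_normD _ _))//.
  by rewrite distrC -ltrBrDr.
- by exists x => //; rewrite /ball2 /= subrr normr0.
pose b (x y : E) : R := \prod_(i < n) bump (2 / d * (y 0 i - x 0 i)).
have sb x : rsm dirE setT (b x).
  apply: (rsm_prod openT) => i.
  have sg : rsm dirE setT (fun y : E => 2 / d * (y 0 i - x 0 i)).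
    exact (rsmM openT (rsm_cst dirE setT (2 / d)) (rsmB openT (rsm_coord i setT) (rsm_cst dirE setT (x 0 i)))).
  exact: (rsm_comp1 openT rsm_bump sg (fun _ _ => I)).
have b1 (x y : E) : `|y - x| <= d / 2 -> b x y = 1.
  move=> yx; rewrite /b big1// => i _; apply: bump1.
  rewrite normrM ger0_norm ?divr_ge0 ?(ltW d0)// mulrC -ler_pdivlMr ?divr_gt0//.
  rewrite mul1r invf_div; apply: le_trans yx.
  by have := coord_le_norm (y - x) i; rewrite !mxE.
have b0 (x y : E) : d < `|y - x| -> b x y = 0.
  move=> yx; case: (@norm_gt_coord (y - x) d (ltW d0) yx) => i; rewrite !mxE => /ltW di.
  rewrite /b (bigD1 i)//= bump0 ?mul0r// normrM ger0_norm ?divr_ge0 ?(ltW d0)//.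
  by rewrite mulrAC ler_pdivlMr// ler_pM2l.
pose ss : seq E := finmap.enum_fset s.
pose th (y : E) : R := 1 - \prod_(x <- ss) (1 - b x y).
have sth : rsm dirE setT th.
  apply: (rsmB openT (rsm_cst dirE setT 1)); apply: (rsm_prod openT) => x.
  exact: (rsmB openT (rsm_cst dirE setT 1) (sb x)).
have tt : is_test Omega (fun y => rscal (th y) : K).
  apply: (is_test_intro (rsm_csm sth) cf) => [y /fO /interior_subset //|y nfy].
  rewrite /= /th big1_seq ?subrr ?rscal0// => x /= xs; rewrite b0 ?subr0// ltNge.
  by apply/negP => yx; apply: nfy; exists x => //; have := sL _ xs; rewrite inE.
exists (mktest (fun y => rscal (th y))) => y Ly; rewrite mktestE//.
have [x /= xs yx] := Ls y Ly.
by rewrite /th (big_rem x (xs : x \in ss))/= b1 ?subrr ?mul0r ?subr0 ?rscal1// ltW.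
Qed.

(** The cutoffs belong to the sets of points of norm at most [j] and at distance at least
    [1 / (j + 1)] from the complement. If [L] is bounded by [B] and [fat d L] lies in [Omega], then
    [j >= B + 1 / d] suffices for [L] to be in such a set. *)
Lemma exhaustion : exists theta : nat -> D, forall L, cpt_in L Omega ->
  exists J : nat, forall j y, (J <= j)%N -> L y -> theta j y = 1 :> K.
Proof.
pose Kj (j : nat) : set E := [set y | `|y| <= j%:R /\ forall z, ~ Omega z -> j.+1%:R^-1 <= `|z - y|].
have cK j : cpt_in (Kj j) Omega.
  split; last first.
    move=> y [_ hy]; move: (Oo); rewrite openE; apply; apply: contrapT => nO.
    by have := hy y nO; rewrite subrr normr0 leNgt invr_gt0 ltr0Sn.
  apply: (subclosed_compact _ (@norm_ball_compact R n j%:R)); last by move=> y [].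
  rewrite (_ : Kj j = [set y | `|y| <= j%:R] `&`
      \bigcap_(z in ~` Omega) [set y | j.+1%:R^-1 <= `|z - y|]); last first.
    by apply/seteqP; split=> y [h1 h2]; split=> // z nO; exact: h2.
  apply: closedI.
    exact: (closed_comp (fun x _ => @norm_continuous _ _ x) (@closed_le R j%:R)).
  apply: closed_bigI => z _.
  have cz : continuous (fun y : E => `|z - y|).
    move=> y; have c1 : {for y, continuous (fun _ : E => z)} by exact: cst_continuous.
    have c2 : {for y, continuous (fun y : E => y)} by exact: cvg_id.
    exact: (continuous_comp (continuousB c1 c2) (@norm_continuous _ _ _)).
  exact: (closed_comp (fun y _ => cz y) (@closed_ge R j.+1%:R^-1)).
exists (fun j => projT1 (cid (cutoff (cK j)))) => L cL.
have [d d0 [_ fO]] := fat_cpt_in Oo cL; have [cptL _] := cL.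
have [B B0 LB] := compact_cube cptL.
have Bd0 : 0 <= B + d^-1 by rewrite addr_ge0 ?invr_ge0 ?(ltW B0)// ltW.
exists (Num.bound (B + d^-1)) => j y jJ Ly; apply: (projT2 (cid (cutoff (cK j)))).
have jB : B + d^-1 <= j%:R.
  by apply: ltW; apply: lt_le_trans (archi_boundP Bd0) _; rewrite ler_nat.
have di0 : 0 < d^-1 by rewrite invr_gt0.
split.
  apply: (@le_trans _ _ B); last by move: jB di0; lra.
  by apply: norm_le_coord => [|i]; [exact: ltW|exact: LB].
move=> z nO; apply: (@le_trans _ _ d).
  rewrite -[leRHS]invrK lef_pV2 ?posrE ?ltr0Sn// -natr1.
  by move: jB B0; lra.
rewrite leNgt; apply/negP => zy; apply: nO; apply: interior_subset; apply: fO.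
by exists y => //; exact: ltW.
Qed.

End Cutoffs.

Section StepPartition.
Context {R : realType}.

Lemma transition_step : transition (1 : R) step.
Proof. by split=> [|t t1|t t1]; [exact: rsm_step|apply: step0; lra|exact: step1]. Qed.

Lemma jump_sum (H : R -> R) (T : R) (N : nat) :
  \sum_(j < N) jump H (T - j%:R) = H (T + 1) - H (T + 1 - N%:R).
Proof.
transitivity (\sum_(0 <= j < N) (- H (T + 1 - j.+1%:R) - - H (T + 1 - j%:R))).
  rewrite big_mkord; apply: eq_bigr => j _; rewrite /jump opprK [RHS]addrC -natr1.
  by congr (H _ - H _); ring.
by rewrite telescope_sumr// subr0 opprK addrC.
Qed.

(** A partition of unity in the variable [1 / e]: smooth in [e > 0], and moving to higher indices as
    [e] tends to 0. *)
Definition wgt (e : R) (j : nat) : R := jump step (e^-1 - j%:R).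

Lemma wgt0 e j : 2 <= `|e^-1 - j%:R| -> wgt e j = 0.
Proof. by move=> h; apply: (jump_out transition_step); lra. Qed.

Lemma wgt_sum e (N : nat) : 0 <= e^-1 -> e^-1 + 2 <= N%:R -> \sum_(j < N) wgt e j = 1.
Proof. by move=> e0 eN; rewrite jump_sum step1 ?step0 ?subr0//; lra. Qed.

End StepPartition.

Section Kernel.
Context {k : scalar_kind} {R : realType} {n : nat} {Omega : set 'rV[R]_n}.
Local Notation K := (scal k R).
Local Notation E := 'rV[R]_n.
Local Notation E1 := 'rV[R]_n.+1.
Local Notation D := (testfun k Omega).
Local Notation T := (testfun RealScalars (setT : set E)).
Hypothesis Oo : open Omega.
Variables (B : R) (Xi : T) (theta : nat -> D).
Hypothesis B0 : 0 < B.
Hypothesis Xi_out : forall z : E, B < `|z| -> Xi z = 0 :> R.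
Hypothesis theta1 : forall L, cpt_in L Omega ->
  exists J : nat, forall j y, (J <= j)%N -> L y -> theta j y = 1 :> K.

(* Smooth in [e], and equal to [1] on any given compact subset of [Omega] once
   [e] is small, since only the [theta j] with [j] close to [1 / e] occur. *)
Definition cutN (N : nat) (e : R) : D := \sum_(j < N) rscal (wgt e j) *: theta j.

(** Enough terms to include all nonzero weights. This number jumps with [e], but by [cutN_indep]
    further terms do not change the sum, so near a given [e] a fixed number can be used. *)
Definition levels (e : R) : nat := (Num.bound e^-1 + 2)%N.

Lemma levels_ge e : 0 < e -> e^-1 + 2 <= (levels e)%:R.
Proof.
move=> e0; rewrite natrD lerD2r ltW//; apply: archi_boundP.
by rewrite invr_ge0 ltW.
Qed.

Lemma cutNE N e y : cutN N e y = \sum_(j < N) rscal (wgt e j) * theta j y :> K.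
Proof. by rewrite test_sum; apply: eq_bigr => j _; rewrite testZ. Qed.

Lemma cutN_indep e (N1 N2 : nat) y : e^-1 + 2 <= N1%:R -> (N1 <= N2)%N ->
  cutN N2 e y = cutN N1 e y :> K.
Proof.
move=> eN1 N12; rewrite !cutNE -!(big_mkord predT (fun j => rscal (wgt e j) * theta j y)).
rewrite (big_cat_nat (n := N1))//= [X in _ + X]big_nat_cond [X in _ + X]big1 ?addr0//.
move=> j /andP[/andP[N1j _] _]; rewrite wgt0 ?rscal0 ?mul0r//.
have h : N1%:R <= j%:R :> R by rewrite ler_nat.
by rewrite ler_normr; apply/orP; right; lra.
Qed.

Lemma cutN_one e (N J : nat) y : 0 < e -> e^-1 + 2 <= N%:R -> J%:R + 2 <= e^-1 ->
  (forall j, (J <= j)%N -> theta j y = 1 :> K) -> cutN N e y = 1 :> K.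
Proof.
move=> e0 eN Je tJ; rewrite cutNE.
transitivity (\sum_(j < N) rscal (wgt e j) : K).
  apply: eq_bigr => j _; have [Jj|jJ] := leqP J j; first by rewrite tJ// mulr1.
  rewrite wgt0 ?rscal0 ?mul0r//.
  have h : j%:R <= J%:R :> R by rewrite ler_nat ltnW.
  by rewrite ler_normr; apply/orP; left; lra.
have e10 : 0 <= e^-1 by rewrite invr_ge0 ltW.
by apply: scalar_eq; rewrite ?sre_sum ?sim_sum ?sre1 ?sim1;
  [rewrite -(wgt_sum e10 eN); apply: eq_bigr => j _; rewrite sre_rscal
  |apply: big1 => j _; rewrite sim_rscal].
Qed.

Definition kfactor (w : D) (e : R) (x y : E) : K :=
  (1 + w y - w x) * rscal (e ^- n * scl e Xi y x).

(* Multiplying a kernel by [1 + w y - w x] does not affect its moments to the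
   order considered: [w (T f) = T (w f)] up to the error of the mollification [T]. *)
Definition kern (w : D) (e : @I01 R) (x : Omega) : D :=
  mktest (fun y => kfactor w (val e) (val x) y * cutN (levels (val e)) (val e) y).

Lemma scl_out e x y : 0 < e -> e * B < `|y - x| -> scl e Xi y x = 0.
Proof.
move=> e0 yx; apply: Xi_out; rewrite normrZ normfV (gtr0_norm e0).
by rewrite ltr_pdivlMl.
Qed.

Lemma csm_kfactor w e x : csm dirE setT (kfactor w e x).
Proof.
have sx : rsm dirE setT (fun y : E => scl e Xi y x).
  apply: (csm_compE (k := RealScalars) (f := Xi) openT openT (test_csm Xi) (c := fun y => e^-1 *: (y - x))) => // i.
  apply: (rsm_ext openT (rsmM openT (rsm_cst dirE setT e^-1)
    (rsmB openT (rsm_coord i setT) (rsm_cst dirE setT (x 0 i))))) => y _.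
  by rewrite !mxE.
have s1 : csm dirE setT (fun y => rscal (e ^- n * scl e Xi y x) : K).
  exact: (rsm_csm (rsmM openT (rsm_cst dirE setT (e ^- n)) sx)).
have s2 : csm dirE setT (fun y => 1 + w y - w x : K).
  exact: (csmB openT (csmD openT (csm_cst dirE setT 1) (test_csm w)) (csm_cst dirE setT (w x : K))).
exact: (csmM openT s2 s1).
Qed.

Lemma kernE w e x y : kern w e x y =
  kfactor w (val e) (val x) y * cutN (levels (val e)) (val e) y :> K.
Proof.
rewrite /kern mktestE//; apply: (product_is_test Oo).
exact: (csm_sub (@subsetT _ _) (csm_kfactor w (val e) (val x))).
Qed.

Definition htail (z : E1) : E := \row_i z 0 (lift ord0 i).

Lemma htail_hrow t y : htail (hrow t y) = y.
Proof. by apply/rowP => i; rewrite mxE hrow_lift. Qed.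

Lemma cutoffs_support (N : nat) : exists L : set E, cpt_in L Omega /\
  forall j y, (j < N)%N -> ~ L y -> theta j y = 0 :> K.
Proof.
have OO : Omega `<=` Omega° by move: (Oo); rewrite openE.
elim: N => [|N [L [[cL LO] zL]]].
  by exists set0; split=> //; split; [exact: compact0|].
have [_ cs sO] := test_is_test (theta N).
exists (L `|` supp (theta N)); split.
  by split; [exact: compactU|move=> y [/LO//|/sO/OO]].
move=> j y; rewrite ltnS leq_eqVlt => /orP[/eqP -> nL|jN nL].
  by apply: supp_out => h; apply: nL; right.
by apply: zL => // h; apply: nL; left.
Qed.

Lemma kern_smooth w : smooth_kernel (kern w).
Proof.
move=> e c /smooth_curve_rsm se /smooth_curve_coord sc.
pose e' (t : R) : R := val (e t); have e'0 t : 0 < e' t := I01_gt0 (e t).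
pose F (N : R -> nat) (z : E1) : K :=
  kfactor w (e' (z 0 ord0)) (val (c (z 0 ord0))) (htail z) * cutN (N (z 0 ord0)) (e' (z 0 ord0)) (htail z).
have s0 : rsm dirE setT (fun z : E1 => z 0 ord0) := rsm_coord ord0 setT.
have sei : rsm dir1 setT (fun t => (e' t)^-1).
  exact: (rsm_comp1 openT rsm_inv se (fun t _ => e'0 t)).
have seiz : rsm dirE setT (fun z : E1 => (e' (z 0 ord0))^-1).
  exact: (rsm_comp1 openT sei s0 (fun _ _ => I)).
have scz i : rsm dirE setT (fun z : E1 => val (c (z 0 ord0)) 0 i).
  exact: (rsm_comp1 openT (sc i) s0 (fun _ _ => I)).
have stz i : rsm dirE setT (fun z : E1 => htail z 0 i).
  by apply: (rsm_ext openT (rsm_coord (lift ord0 i) setT)) => z _; rewrite mxE.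
have stest (psi : D) : csm dirE setT (fun z : E1 => psi (htail z) : K).
  exact: (csm_compE openT (c := htail) openT (test_csm psi) stz (fun _ _ => I)).
have swc : csm dirE setT (fun z : E1 => w (val (c (z 0 ord0))) : K).
  exact: (csm_compE openT (c := fun z : E1 => val (c (z 0 ord0))) openT (test_csm w) scz (fun _ _ => I)).
have sscl : rsm dirE setT (fun z : E1 => scl (e' (z 0 ord0)) Xi (htail z) (val (c (z 0 ord0)))).
  apply: (csm_compE (k := RealScalars) (f := Xi) openT openT (test_csm Xi)
    (c := fun z : E1 => (e' (z 0 ord0))^-1 *: (htail z - val (c (z 0 ord0))))) => // i.
  apply: (rsm_ext openT (rsmM openT seiz (rsmB openT (stz i) (scz i)))) => z _.
  by rewrite [RHS]mxE [X in _ = _ * X]mxE [X in _ = _ * (_ + X)]mxE.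
have sfac : csm dirE setT (fun z : E1 =>
    kfactor w (e' (z 0 ord0)) (val (c (z 0 ord0))) (htail z)).
  have s1 := rsm_csm (k := k) (rsmM openT (rsmX openT n seiz) sscl).
  apply: (csm_ext openT (csmM openT (csmB openT (csmD openT (csm_cst dirE setT 1) (stest w)) swc) s1)) => z _.
  by rewrite /kfactor /= exprVn.
have scut (M : nat) : csm dirE setT (fun z : E1 => cutN M (e' (z 0 ord0)) (htail z) : K).
  have sj (j : 'I_M) : csm dirE setT (fun z : E1 => rscal (wgt (e' (z 0 ord0)) j) * theta j (htail z) : K).
    have sw := rsmB openT seiz (rsm_cst dirE setT j%:R).
    have sw2 := rsm_comp1 openT (rsm_jump transition_step) sw (fun _ _ => I).
    exact: (csmM openT (rsm_csm (k := k) sw2) (stest (theta j))).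
  by apply: (csm_ext openT (csm_sum openT (index_enum 'I_M) sj)) => z _; rewrite cutNE.
(* Near [t0] the inverse of [e'] changes by at most 1, so one term more than at [t0] suffices on a
   neighbourhood. *)
have lvl (t0 : R) : exists2 r : R, 0 < r & forall s y, `|s - t0| < r ->
    cutN (levels (e' s)) (e' s) y = cutN (levels (e' t0)).+1 (e' s) y :> K.
  have [r r0 Hr] := (continuous_normP _ _).1 (rsm_cont sei (I : setT t0)) 1 ltr01.
  exists r => // s y st; have := Hr s st; rewrite ler_norml => /andP[h1 h2].
  have l1 := levels_ge (e'0 s); have l2 := levels_ge (e'0 t0).
  have l3 : (e' s)^-1 + 2 <= (levels (e' t0)).+1%:R by rewrite -natr1; lra.
  rewrite -(cutN_indep y l1 (leq_maxl _ (levels (e' t0)).+1)).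
  by rewrite -(cutN_indep y l3 (leq_maxr (levels (e' s)) _)).
apply: (smooth_test_curve_joint (H := F (fun t => levels (e' t)))) => [|t y|t].
- apply: csm_local => [|z _]; first exact: openT.
  have [r r0 Hr] := lvl (z 0 ord0).
  have Wo : open [set z' : E1 | `|z' 0 ord0 - z 0 ord0| < r].
    rewrite openE => y /= yz; apply/nbhs_ballP; exists (r - `|y 0 ord0 - z 0 ord0|) => /=.
      by rewrite subr_gt0.
    move=> v; rewrite -ball_normE /= => yv.
    rewrite -(subrKA (y 0 ord0)) (le_lt_trans (ler_normD _ _))// -ltrBrDr.
    by apply: le_lt_trans yv; rewrite distrC; have := coord_le_norm (y - v) ord0; rewrite !mxE.
  exists [set z' : E1 | `|z' 0 ord0 - z 0 ord0| < r]; split=> //.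
    by rewrite /= subrr normr0.
  apply: (csm_ext Wo (csm_sub (@subsetT _ _)
    (csmM openT sfac (scut (levels (e' (z 0 ord0))).+1)))) => z' /= zz.
  by rewrite /F Hr.
- by rewrite kernE /F hrow0 htail_hrow.
have [r r0 Hr] := lvl t; have [L [cL zL]] := cutoffs_support (levels (e' t)).+1.
exists r, L; split=> // s y st nLy.
rewrite /F hrow0 htail_hrow Hr// cutNE big1 ?mulr0// => j _.
by rewrite zL// mulr0.
Qed.

Lemma kern_LSK1 w : LSK1 (kern w).
Proof.
(* The threshold 2 exceeds every [e]. The factor [n] passes from the sup norm to the Euclidean norm,
   and the summand 1 makes the inequality strict. *)
move=> L cL; exists 2, (n%:R * B + 1); split=> //.
  by rewrite ltr_wpDl// mulr_ge0// ltW.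
move=> x e Lx _; have e0 := I01_gt0 e; have Be0 : 0 <= val e * B by rewrite mulr_ge0// ltW.
have cl : closed [set y : E | `|y - val x| <= val e * B].
  have cz : continuous (fun y : E => `|y - val x|).
    move=> y; have c1 : {for y, continuous (fun _ : E => val x)} by exact: cst_continuous.
    have c2 : {for y, continuous (fun y : E => y)} by exact: cvg_id.
    exact: (continuous_comp (continuousB c2 c1) (@norm_continuous _ _ _)).
  exact: (closed_comp (fun y _ => cz y) (@closed_le R (val e * B))).
apply: (@subset_trans _ [set y : E | `|y - val x| <= val e * B]).
  apply: (supp_sub cl) => y /= /negP; rewrite -ltNge => yx.
  by rewrite kernE /kfactor (scl_out e0 yx) mulr0 rscal0 mulr0 mul0r.
move=> y /= yx; rewrite /eball /=; apply: (@le_lt_trans _ _ (n%:R * (val e * B))).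
  by apply: le_trans (enorm_le_norm _) _; rewrite ler_wpM2l.
by rewrite mulrDl mul1r mulrA mulrAC ltrDl.
Qed.

(** Near [L] and for small [e] the cutoff is 1 wherever the profile does not vanish. The constant 1
    in [1 + w y - w x] is expressed by [th], since the factors of a [kterm] are test functions; [th]
    is 1 at all points concerned. *)
Lemma kern_local (w : D) (L : set E) : cpt_in L Omega -> exists (e0 : R) (U : set E) (th : D),
  [/\ 0 < e0, open U, L `<=` U, U `<=` Omega &
    (forall x, U x -> th x = 1 :> K) /\
    forall (e : @I01 R) x y, val e <= e0 -> U x ->
      slice (kern w) e x y = kernel_sum [:: ((th, th), (Xi, 0%N)); ((th, w), (Xi, 0%N));
        ((- w, th), (Xi, 0%N))] (val e) x y :> K].
Proof.
move=> cL; have [d d0 cf] := fat_cpt_in Oo cL; have [th th1] := cutoff (k := k) Oo cf.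
have [J HJ] := theta1 cf; have [_ fO] := cf.
have d20 : 0 < d / 2 by rewrite divr_gt0.
have ff y : fat (d / 2) L y -> fat d L y.
  by move=> [x Lx yx]; exists x => //; apply: le_trans yx _; rewrite ler_pdivrMr// ler_pMr// ler1n.
pose U : set E := (fat (d / 2) L)°.
have Uf y : U y -> fat (d / 2) L y by exact: interior_subset.
have J20 : 0 < (J%:R + 2)^-1 :> R by rewrite invr_gt0 ltr_wpDl.
(* [e * B <= d / 2] keeps [y] in the fattening where [th] is 1; [e <= 1 / (J + 2)] gives weight 0 to
   all [theta j] with [j < J], which need not be 1 there. *)
exists (Num.min (d / (2 * B)) (J%:R + 2)^-1), U, th; split.
- by rewrite lt_min J20 andbT divr_gt0// mulr_gt0.
- exact: open_interior.
- exact: fat_interior.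
- by move=> x /Uf/ff/fO/interior_subset.
split=> [x /Uf/ff/th1//|e x y]; rewrite le_min => /andP[ed eJ] Ux.
have fx : fat d L x := ff _ (Uf _ Ux).
have Ox : Omega x := interior_subset (fO _ fx).
have e0 := I01_gt0 e.
have [mw mwE mwx] : exists2 mw : D, mw = - w & mw x = - w x :> K.
  by exists (- w) => //; exact: testN.
rewrite -mwE /slice valL_inE kernE /= /kernel_sum !big_cons big_nil addr0 /kernel_term /= !addn0.
have [yx|yx] := leP `|y - x| (val e * B); last first.
  by rewrite /kfactor (scl_out e0 yx) mulr0 rscal0 !mulr0 mul0r !addr0.
have fy : fat d L y.
  have [v Lv xv] := Uf _ Ux; exists v => //; rewrite -(subrKA x) (le_trans (ler_normD _ _))//.
  rewrite (splitr d) lerD//; apply: le_trans yx _.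
  by move: ed; rewrite -ler_pdivlMr// invfM mulrA.
have eJ' : J%:R + 2 <= (val e)^-1.
  by rewrite -[leLHS]invrK lef_pV2 ?posrE ?invr_gt0 ?ltr_wpDl.
rewrite (cutN_one e0 (levels_ge e0) eJ' (fun j Jj => HJ j y Jj fy)) mulr1 (th1 _ fx) (th1 _ fy).
rewrite mwx.
by rewrite /kfactor; ring.
Qed.

Lemma kern_LSK2 w : LSK2 (kern w).
Proof.
apply: (LSK2_of_terms Oo) => L cL; have [e0 [U [th [e00 Uo LU UO [_ HU]]]]] := kern_local w cL.
exists e0, U, [:: ((th, th), (Xi, 0%N)); ((th, w), (Xi, 0%N)); ((- w, th), (Xi, 0%N))].
split=> // e x ee Ux; apply/funext => y; rewrite kernel_slice; last exact: UO.
exact: HU.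
Qed.

Section Moments.
Variables (X : R) (chi : R -> R) (q : nat).
Hypothesis X0 : 0 <= X.
Hypothesis chi_cont : continuous chi.
Hypothesis chi_out : forall t, B <= `|t| -> chi t = 0.
Hypothesis chi_le : forall t, `|chi t| <= X.
Hypothesis chi_moment : forall j, (j <= q)%N -> moment B chi j (j == 0%N)%:R.
Hypothesis XiE : Xi = (fun y : E => \prod_(i < n) chi (y 0 i)) :> (E -> R).

(** With [T] the mollification by [Xi], the kernel sends [f] to [T f + T (w f) - w (T f)]. As
    [w f - w f = 0], the error is [(T f - f) + (T (w f) - w f) - w (T f - f)]: three terms of an
    [error_sum], with [th] inserted to obtain test functions. *)
Lemma kern_LSK3 w : LSK3 q (kern w).
Proof.
apply: (LSK3_of_terms B0 X0 chi_cont chi_out chi_le chi_moment XiE Oo (kern_smooth w)).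
move=> L f cL sf; have [e0 [U [th [e00 Uo LU UO [th1 HU]]]]] := kern_local w cL.
have cf := smooth_fun_csm sf.
pose fD (psi : D) : D := mktest (fun y => 'valL_0 f y * psi y).
have fDE psi y : fD psi y = 'valL_0 f y * psi y :> K.
  by rewrite /fD mktestE//; exact: product_is_test.
exists e0, U, [:: (th, fD th); (th, fD w); (- w, fD th)]; split=> // e x ee Ux.
have e0' := I01_gt0 e.
have [mw mwE mwx] : exists2 mw : D, mw = - w & mw x = - w x :> K.
  by exists (- w) => //; exact: testN.
have [v v0E] : exists v : K, 'valL_0 f x = v by exists ('valL_0 f x).
rewrite -mwE v0E /error_sum !big_cons big_nil addr0 /= !fDE v0E th1// mwx.
pose ker (g : D) y : K := g y * rscal (val e ^- n * scl (val e) Xi y x).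
have [B1 B10 [kt kw]] : exists2 B1, 0 < B1 & kcc B1 (ker (fD th)) /\ kcc B1 (ker (fD w)).
  have [[_ c1 _] [_ c2 _]] := (test_is_test (fD th), test_is_test (fD w)).
  have [B1 B10 HB] := compact_cube (compactU c1 c2).
  have sk : csm dirE setT (fun y => rscal (val e ^- n * scl (val e) Xi y x) : K).
    apply: (csm_ext openT (csm_kfactor 0 (val e) x)) => y _.
    by rewrite /kfactor !test0 addr0 subr0 mul1r.
  exists B1 => //; split; apply: (kcc_cube HB (csmM openT (test_csm _) sk)) => y nL.
    by rewrite supp_out ?mul0r// => h; apply: nL; left.
  by rewrite supp_out ?mul0r// => h; apply: nL; right.
have -> : distr_of f (slice (kern w) e x) =
    th x * kmoll (val e) Xi (fD th) x + (th x * kmoll (val e) Xi (fD w) x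
      + (- w x) * kmoll (val e) Xi (fD th) x).
  have k0 : kcc B1 (fun _ : E => 0 : K) by split=> // y; exact: kcont_cst.
  have kz : kcc B1 (fun y => - w x * ker (fD th) y + 0).
    by have [c1 c2] := kt; split=> [y|y i yB];
      [apply: kcontD; [apply: kcontM; [exact: kcont_cst|exact: c1]|exact: kcont_cst]
      |rewrite (c2 y i)// mulr0 addr0].
  have kz2 : kcc B1 (fun y => th x * ker (fD w) y + (- w x * ker (fD th) y + 0)).
    have [c1 c2] := kw; have [c3 c4] := kz; split=> [y|y i yB].
      by apply: kcontD; [apply: kcontM; [exact: kcont_cst|exact: c1]|exact: c3].
    by rewrite (c2 y i)// mulr0 add0r; exact: c4 yB.
  have i0 : integral_Rn (fun _ : E => 0 : K) = 0.
    transitivity (-1 * integral_Rn (fun _ : E => 0 : K) + integral_Rn (fun _ : E => 0 : K)); last first.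
      by rewrite mulN1r addNr.
    rewrite -(integral_RnZD (-1) (ltW B10) k0 k0).
    by congr integral_Rn; apply/funext => y; rewrite mulr0 addr0.
  rewrite -[X in _ + (_ + X)]addr0 -i0.
  rewrite -(integral_RnZD _ (ltW B10) kt k0) -(integral_RnZD _ (ltW B10) kw kz).
  rewrite -(integral_RnZD _ (ltW B10) kt kz2); congr integral_Rn; apply/funext => y.
  rewrite HU// -mwE /ker !fDE; move: ('valL_0 f y) => z.
  rewrite /kernel_sum !big_cons big_nil addr0 /kernel_term /= !addn0 mwx.
  by ring.
by rewrite th1//; ring.
Qed.

Lemma kern_smoothing w : smoothing_kernels q (kern w).
Proof.
by split; [exact: kern_smooth|exact: kern_LSK1|exact: kern_LSK2|exact: kern_LSK3].
Qed.

End Moments.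
End Kernel.

(** * Uniqueness *)

Section Uniqueness.
Context {k : scalar_kind} {R : realType} {n : nat} {Omega : set 'rV[R]_n}.
Local Notation K := (scal k R).
Local Notation E := 'rV[R]_n.
Local Notation D := (testfun k Omega).
Local Notation T := (testfun RealScalars (setT : set E)).
Hypothesis Oo : open Omega.

Lemma unit_mesh (M : nat) : (0 < M)%N -> exists e : @I01 R, val e = M%:R^-1.
Proof.
move=> M0; have h : I01 (M%:R^-1 : R).
  by rewrite /I01 /= invr_gt0 ltr0n M0 invf_le1 ?ltr0n// ler1n.
by exists (SigSub (mem_set h)).
Qed.

(** Distributivity turns the sum over the grid into a product of one-dimensional telescoping
    sums. *)
Lemma grid_partition (A e : R) (H : R -> R) (Xi : T) (N : nat) (y : E) : 0 < e -> transition A H ->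
  Xi = (fun y : E => \prod_(i < n) jump H (y 0 i)) :> (E -> R) ->
  (forall i, `|e^-1 * y 0 i| <= N%:R - A) ->
  \sum_(f : {ffun 'I_n -> 'I_(N + N).+1}) scl e Xi y (\row_i (e * ((f i)%:R - N%:R))) = 1.
Proof.
move=> e0 tH XiE yN.
transitivity (\sum_(f : {ffun 'I_n -> 'I_(N + N).+1}) \prod_i jump H (e^-1 * y 0 i + N%:R - (f i)%:R)).
  apply: eq_bigr => f _; rewrite /scl XiE; apply: eq_bigr => i _; rewrite !mxE.
  by congr jump; field; rewrite gt_eqF.
rewrite -(bigA_distr_bigA (fun i (j : 'I_(N + N).+1) => jump H (e^-1 * y 0 i + N%:R - j%:R))).
by rewrite big1// => i _; exact: (jump_telescope tH (yN i)).
Qed.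

(* The kernels [kern psi] and [kern 0] combine into [psi y * e ^- n Xi ((y - x) / e)],
   on which [u] is [O(e)], and [psi] is exactly [e ^ n] times the sum of about
   [e ^- n] of these over a grid of mesh [e]. *)
Lemma negligible_eq0 (u : D -> K) : distributions k Omega u ->
  negligible_space k Omega (iota_emb u) -> forall psi, u psi = 0.
Proof.
move=> du [_ neg] psi; have [ud uz _] := du.
have [_ cpsi psiO] := test_is_test psi.
have OO : Omega `<=` Omega° by move: (Oo); rewrite openE.
have cL0 : cpt_in (supp psi) Omega by split=> // y /psiO/OO.
have [d d0 cL] := fat_cpt_in Oo cL0; have [_ LO] := cL.
(* Order 0 in [x] and one power of [e] are enough; the resulting [q] fixes the number of vanishing
   moments of the kernels. *)
have [q Hq] := neg _ cL (fun=> 0%N) 1%N.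
have [A [H [A0 tH mH]]] := @moment_kernel R q.
pose B := A + 1; have B0 : 0 < B by rewrite ltr_wpDl.
have chi_out t : B <= `|t| -> jump H t = 0 by exact: jump_out tH.
have chi_cont : continuous (jump H) by move=> t; exact: rsm_cont (rsm_jump tH) I.
have [X X0 chi_le] : exists2 X : R, 0 <= X & forall t, `|jump H t| <= X.
  have [X X0 HX] := @compact_continuous_bounded R R (jump H) `[- B, B]
    (@segment_compact _ _ _) (fun x _ => chi_cont x).
  exists X => // t; have [tB|tB] := leP `|t| B; last by rewrite chi_out ?normr0// ltW.
  by apply: HX; rewrite /= in_itv /= -ler_norml.
pose Xi : T := @mktest RealScalars R n setT (fun y : E => \prod_(i < n) jump H (y 0 i)).
have XiE : Xi = (fun y : E => \prod_(i < n) jump H (y 0 i)) :> (E -> R).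
  exact: (mktestE (profile_is_test B0 (rsm_jump tH) chi_out)).
have Xi_out (z : E) : B < `|z| -> Xi z = 0 :> R.
  move=> zB; case: (@norm_gt_coord R n z B (ltW B0) zB) => i zi.
  by rewrite XiE (bigD1 i)//= chi_out ?mul0r// ltW.
have [theta theta1] := @exhaustion k R n Omega Oo.
have sm w := kern_smoothing Oo B0 Xi_out theta1 X0 chi_cont chi_out chi_le mH XiE w.
have bound w : exists e0 C : R, [/\ 0 < e0, 0 < C & forall (e : @I01 R) (x : Omega),
    val e <= e0 -> fat d (supp psi) (val x) -> modulus (u (kern Xi theta w e x)) <= C * val e].
  have [e0 [C [e00 C0 HC]]] := Hq _ (sm w); exists e0, C; split=> // e x ee Lx.
  by have := HC e (val x) ee Lx; rewrite /test_derivative mpow0 valL_in expr1.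
have [e1 [C1 [e10 C10 HC1]]] := bound psi; have [e2 [C2 [e20 C20 HC2]]] := bound 0.
have [M M0 psiM] := test_bounded psi.
have [J HJ] := theta1 _ cL0.
(* [C2 + M * C2] accounts for the kernel with [w = 0], whose coefficient [1 - psi x] has modulus at
   most [1 + M]. *)
pose C := C1 + C2 + M * C2; have C0 : 0 <= C.
  by apply: addr_ge0; [apply: addr_ge0; exact: ltW|apply: mulr_ge0 => //; exact: ltW].
pose P e (x : E) : D := mktest (fun y => rscal (e ^- n * scl e Xi y x) * psi y).
have PE e x y : 0 < e -> P e x y = rscal (e ^- n * scl e Xi y x) * psi y :> K.
  move=> e0; rewrite /P mktestE//; apply: (product_is_test Oo).
  apply: (csm_sub (@subsetT _ _)); apply: (csm_ext openT (csm_kfactor Xi (0 : D) e x)) => z _.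
  by rewrite /kfactor !test0 addr0 subr0 mul1r.
have uP (e : @I01 R) (x : E) : val e <= e1 -> val e <= e2 -> val e * B <= d -> J%:R + 2 <= (val e)^-1 ->
    modulus (u (P (val e) x)) <= C * val e.
  move=> ee1 ee2 eB eJ; have e0 := I01_gt0 e.
  (* For centres farther than [d] from the support of [psi] the product is zero, because the profile
     has radius [e * B <= d]; so the bound holds for every [x]. *)
  have [Lx|nLx] := pselect (fat d (supp psi) x); last first.
    have -> : P (val e) x = 0; last by rewrite (distribution0 du) modulus0 mulr_ge0// ltW.
    apply: test_eq => y; rewrite PE// test0; have [sy|/supp_out ->] := pselect (supp psi y); last exact: mulr0.
    rewrite (scl_out Xi_out e0) ?mulr0 ?rscal0 ?mul0r//; apply: le_lt_trans eB _.
    by rewrite ltNge; apply/negP => yx; apply: nLx; exists y => //; rewrite distrC.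
  have Ox : Omega x := interior_subset (LO _ Lx).
  pose x' : Omega := SigSub (mem_set Ox).
  have Lx' : fat d (supp psi) (val x') by [].
  (* [(1 + psi y - psi x) - (1 - psi x) = psi y], and on the support of [psi] the cutoff is 1 by the
     lower bound on [1 / e]. *)
  have -> : P (val e) x = kern Xi theta psi e x' + (-1 * (1 - psi x)) *: kern Xi theta 0 e x'.
    apply: test_eq => y; rewrite PE// testD testZ !(kernE Oo) /kfactor !test0 /=.
    have [sy|/supp_out psiy] := pselect (supp psi y); last by rewrite psiy; ring.
    by rewrite (cutN_one e0 (levels_ge e0) eJ (fun j Jj => HJ j y Jj sy)); ring.
  rewrite ud uz; apply: le_trans (modulusD _ _) _; rewrite /C -addrA mulrDl; apply: lerD.
    exact: HC1.
  rewrite modulusM mulN1r modulusN [leRHS](_ : _ = (1 + M) * (C2 * val e)); last by ring.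
  apply: ler_pM.
  - exact: modulus_ge0.
  - exact: modulus_ge0.
  - apply: le_trans (modulusD _ _) _; rewrite modulusN modulus1 lerD2l; exact: psiM.
  - exact: HC2.
have [b0 b00 psib] := compact_cube cpsi.
pose b := Num.bound (b0 + A).
have bA : b0 + A <= b%:R by apply/ltW/archi_boundP; rewrite addr_ge0// ltW.
have key (m : nat) : (0 < m)%N -> e1^-1 <= m%:R -> e2^-1 <= m%:R -> B / d <= m%:R -> J%:R + 2 <= m%:R :> R ->
    modulus (u psi) <= (b%:R + b%:R + 1) ^+ n * C * m%:R^-1.
  move=> m0 me1 me2 md mJ; have [e eE] := unit_mesh m0.
  have mr : 0 < m%:R :> R by rewrite ltr0n.
  have m1 : 1 <= m%:R :> R by rewrite ler1n.
  have e0 : 0 < val e := I01_gt0 e.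
  (* As [m >= 1] and [b0 + A <= b], one has [m * b0 <= N - A]: the grid of mesh [1 / m] covers the
     support of [psi] with the margin [A] required for telescoping. *)
  pose N := (m * b)%N.
  pose xf (f : {ffun 'I_n -> 'I_(N + N).+1}) : E := \row_i (val e * ((f i)%:R - N%:R)).
  have psiE : psi = \sum_(f : {ffun 'I_n -> 'I_(N + N).+1}) rscal (val e ^+ n) *: P (val e) (xf f).
    apply: test_eq => y; rewrite test_sum.
    have [sy|/supp_out psiy] := pselect (supp psi y); last first.
      by rewrite psiy big1// => f _; rewrite testZ PE// psiy !mulr0.
    rewrite -[LHS]mul1r -[1]rscal1 -(@grid_partition A (val e) H Xi N y e0 tH XiE); last first.
      move=> i; rewrite eE invrK normrM (gtr0_norm mr) /N natrM.
      have := psib y i sy; move: bA m1 A0; nra.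
    rewrite -/(xf _) (big_morph rscal rscalD rscal0) mulr_suml; apply: eq_bigr => f _.
    rewrite testZ PE// mulrA -rscalM mulrA mulfV ?mul1r// expf_neq0// gt_eqF//.
  rewrite {1}psiE (distribution_sum _ _ du); apply: le_trans (modulus_sum _ _) _.
  apply: (@le_trans _ _ (\sum_(f : {ffun 'I_n -> 'I_(N + N).+1}) val e ^+ n * (C * val e))).
    apply: ler_sum => f _; rewrite uz modulusM modulus_rscal ger0_norm; last by rewrite exprn_ge0// ltW.
    apply: ler_wpM2l; first by rewrite exprn_ge0// ltW.
    apply: uP; rewrite eE ?invrK//.
    - by rewrite -[leRHS]invrK lef_pV2 ?posrE ?invr_gt0.
    - by rewrite -[leRHS]invrK lef_pV2 ?posrE ?invr_gt0.
    - by rewrite mulrC ler_pdivrMr// mulrC -ler_pdivrMr.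
  (* There are [(2 N + 1) ^ n] grid points, and [(2 N + 1) / m <= 2 b + 1], so the factor [e ^ n]
     balances their number. *)
  rewrite sumr_const card_ffun !card_ord -[leLHS]mulr_natl natrX mulrA -exprMn eE [leRHS]mulrAC -mulrA.
  rewrite [m%:R^-1 * C]mulrC.
  apply: ler_wpM2r; first by rewrite mulr_ge0// invr_ge0 ltW.
  apply: lerXn2r; rewrite ?nnegrE.
  - by rewrite mulr_ge0// invr_ge0 ltW.
  - by rewrite !addr_ge0.
  rewrite ler_pdivrMr// /N -natr1 natrD natrM; have := ler0n R b; move: m1; nra.
apply: modulus_eq0; apply/eqP; rewrite eq_le modulus_ge0 andbT leNgt; apply/negP => u0.
pose W := (b%:R + b%:R + 1) ^+ n * C; have W0 : 0 <= W by rewrite mulr_ge0// exprn_ge0// !addr_ge0.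
(* Beyond all thresholds for [1 / e] and beyond [W / modulus (u psi)], which contradicts [key]. *)
pose S := e1^-1 + e2^-1 + B / d + (J%:R + 2) + W / modulus (u psi) + 1.
have [s1 s2 s3 s4] : [/\ 0 < e1^-1, 0 < e2^-1, 0 < B / d & 0 <= J%:R :> R].
  by split; rewrite ?invr_gt0// divr_gt0.
have s5 : 0 <= W / modulus (u psi) by rewrite divr_ge0// ltW.
have S0 : 0 < S by rewrite /S; lra.
have := archi_boundP (ltW S0); set m := Num.bound S => Sm.
have mr : 0 < m%:R :> R by exact: lt_trans Sm.
have := key m; rewrite -(ltr0n R) mr => /(_ isT).
have l1 : e1^-1 <= m%:R by move: Sm; rewrite /S; lra.
have l2 : e2^-1 <= m%:R by move: Sm; rewrite /S; lra.
have l3 : B / d <= m%:R by move: Sm; rewrite /S; lra.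
have l4 : J%:R + 2 <= m%:R :> R by move: Sm; rewrite /S; lra.
move=> /(_ l1 l2 l3 l4); rewrite -/W ler_pdivlMr// leNgt => /negP; apply.
rewrite mulrC -ltr_pdivrMr//.
by move: Sm; rewrite /S; lra.
Qed.

Lemma distr_of0 : distr_of (fun _ : Omega => 0 : K) = fun=> 0.
Proof.
have v0 (y : E) : 'valL_0 (fun _ : Omega => 0 : K) y = 0 :> K.
  by rewrite /=; case: ('oinv_set_val y).
apply/funext => phi; rewrite /distr_of (_ : (fun y => _) = fun=> 0); last first.
  by apply/funext => y; rewrite v0; exact: (@mul0r K).
apply: scalar_eq; rewrite ?sre_integral ?sim_integral.
  rewrite (_ : sre \o _ = fun=> 0) ?rintegral_cst0 ?sre0//.
  by apply/funext => y /=; rewrite sre0.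
rewrite (_ : sim \o _ = fun=> 0) ?rintegral_cst0 ?sim0//.
by apply/funext => y /=; rewrite sim0.
Qed.

Lemma smooth_fun0 : smooth_fun k Omega (fun=> 0).
Proof.
apply: (csm_smooth_on Oo); apply: (csm_ext Oo (csm_cst dirE Omega 0)) => y Oy.
by rewrite valL_inE.
Qed.

(** That 0 is negligible is the case [f = 0] of the statement on the difference of the
    embeddings. *)
Lemma distributions_negligible :
  (iota_emb @` distributions k Omega) `&` negligible_space k Omega = [set 0].
Proof.
apply/seteqP; split=> [F [[u du <-] nu]|F ->] /=.
  by apply/funext => phi; apply/funext => x; rewrite /iota_emb (negligible_eq0 du nu).
have e0 : iota_emb (distr_of (fun _ : Omega => 0 : K)) = 0 :> (D -> Omega -> K).
  by rewrite distr_of0.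
split.
  by exists (distr_of (fun _ : Omega => 0 : K)); [exact (distr_of_distribution Oo smooth_fun0)|exact: e0].
have := embedding_difference_negligible Oo smooth_fun0; rewrite e0.
rewrite (_ : 0 - _ = 0)//; apply/funext => phi; apply/funext => x.
exact: subr0.
Qed.

End Uniqueness.

Theorem theorem11 (k : scalar_kind) (R : realType) (n : nat)
    (Omega : set 'rV[R]_n) (Omega_open : open Omega) :
  [/\ iota_emb @` distributions k Omega `<=` moderate_space k Omega,
      sigma_emb @` smooth_fun k Omega `<=` moderate_space k Omega,
      [set iota_emb (distr_of f) - sigma_emb f | f in smooth_fun k Omega]
        `<=` negligible_space k Omega &
      (iota_emb @` distributions k Omega) `&` negligible_space k Omega = [set 0]].
Proof.
split.
- by move=> F [u du <-]; exact: iota_moderate.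
- by move=> F [f sf <-]; exact: sigma_moderate.
- by move=> F [f sf <-]; exact: embedding_difference_negligible.
- exact: distributions_negligible.
Qed.
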